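(* Let $m\ge 2$. Every Ustilovsky sphere of dimension $4m+1$ contact open book embeds in $(S^{4m+3},\xi_{std})$.
   Context: All contact manifolds are closed and co-oriented. $\xi_{std}$ is the standard contact structure on the unit sphere $S^{4m+3}\subset\mathbb{R}^{4m+4}$. **Ustilovsky spheres.** For a positive integer $p\equiv\pm1 \pmod 8$, the Ustilovsky sphere of dimension $4m+1$ with parameter $p$ is the Brieskorn manifold $\{(z_0,\dots,z_{2m+1})\in\mathbb{C}^{2m+2}: z_0^p+z_1^2+\cdots+z_{2m+1}^2=0,\ |z|=1\}$ (diffeomorphic to $S^{4m+1}$) with the contact structure given by the kernel of the restriction of $\frac{i}{8}\sum_{j=0}^{2m+1}a_j(z_j\,d\bar z_j-\bar z_j\,dz_j)$, where $a_0=p$ and $a_j=2$ for $j\ge1$. **Contact open books.** Let $(V,\partial V,d\alpha)$ be a compact exact symplectic manifold with convex boundary: a collar of $\partial V$ is symplectomorphic to $((-1,0]\times\partial V,d(e^t\alpha|_{\partial V}))$, and the Liouville field $Y$, $i_Yd\alpha=\alpha$, equals $\partial_t$ there (outward pointing). Let $\phi$ be a symplectomorphism of $(V,d\alpha)$ equal to the identity near $\partial V$. After a symplectic isotopy that is the identity near $\partial V$ one may assume $\phi^*\alpha-\alpha=dh$ for a function $h$. The form $dt+\alpha$ on $\mathbb{R}\times V$ descends to a contact form on the mapping torus $\mathcal{MT}(V,\phi)$, the quotient of $\mathbb{R}\times V$ by $(t,x)\mapsto(t-h(x),\phi(x))$. It is extended over $\partial V\times D^2$ by a contact form $h_1(r)\alpha|_{\partial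 V}+h_2(r)\,dt$ (with $(r,t)$ polar coordinates on $D^2$) which equals $\alpha|_{\partial V}+r^2dt$ near $r=0$ and matches the form on the mapping torus near the boundary. The resulting contact manifold $\mathcal{MT}(V,\phi)\cup_{id}\partial V\times D^2$ is denoted $\mathcal{A}ob(V,d\alpha,\phi)$; it is called a contact open book with page $(V,d\alpha)$, monodromy $\phi$ and binding $(\partial V,\alpha|_{\partial V})$. A contact manifold $(M,\xi)$ is supported by $\mathcal{A}ob(V,d\alpha,\phi)$ if it is contactomorphic to it, i.e. $\xi$ has a contact form whose exterior derivative is symplectic on the pages and which induces the positive orientation on $M$ and the positive contact orientation on the binding. **Contact open book embedding.** $(M_1,\xi_1)$ contact open book embeds in $(M_2,\xi_2)$ if there exist supporting contact open books $\mathcal{A}ob(\Sigma_1,d\alpha_1,\phi_1)$ of $(M_1,\xi_1)$ and $\mathcal{A}ob(\Sigma_2,d\alpha_2,\phi_2)$ of $(M_2,\xi_2)$ and a proper symplectic embedding $g:(\Sigma_1,d\alpha_1)\to(\Sigma_2,d\alpha_2)$ (so $g^*d\alpha_2=d\alpha_1$) with $g\circ\phi_1=\phi_2\circ g$. *)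

(* Defs.v *)
From HB Require Import structures.
From mathcomp Require Import all_boot all_order all_algebra.
From mathcomp Require Import all_classical all_reals all_analysis.
From mathcomp Require Import complex.

Set Implicit Arguments.
Unset Strict Implicit.
Unset Printing Implicit Defensive.

Import Order.TTheory GRing.Theory Num.Theory.
Import numFieldNormedType.Exports.

Local Open Scope classical_set_scope.
Local Open Scope ring_scope.

(* Smooth manifolds are embedded in Euclidean spaces.  Maps and forms on a
   subset A are total functions on the ambient space, smooth on some open
   neighbourhood of A, so that the ambient directional derivatives 'D_v at
   points of A, along tangent vectors of A, depend only on the restriction
   to A; values far from A carry no information. *)

(* In finite dimension, f is C^(k+1) on the open set U iff every directional
   derivative of f exists and is C^k on U. *)
Fixpoint Ck (R : realType) (E F : normedModType R) (k : nat) (U : set E)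
    (f : E -> F) : Prop :=
  match k with
  | 0 => forall x, U x -> {for x, continuous f}
  | k'.+1 => forall v, (forall x, U x -> derivable f x v) /\
                       Ck k' U (fun x => 'D_v f x)
  end.

Definition smooth_on (R : realType) (E F : normedModType R) (U : set E)
    (f : E -> F) : Prop := forall k, Ck k U f.

Definition smooth_near (R : realType) (E F : normedModType R) (A : set E)
    (f : E -> F) : Prop :=
  exists U : set E, [/\ open U, A `<=` U & smooth_on U f].

(** Submanifolds with boundary *)

(* The closed half-space { y_0 >= 0 } of R^d (a point when d = 0). *)
Definition half_space (R : realType) (d : nat) : set 'rV[R]_d :=
  [set y | forall i : 'I_d, val i = 0%N -> 0 <= y ord0 i].

Record is_chart (R : realType) (E : normedModType R) (d : nat) (V : set E)
    (U : set E) (W : set 'rV[R]_d) (psi : 'rV[R]_d -> E) (chi : E -> 'rV[R]_d)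
    : Prop := IsChart {
  chart_openU : open U;
  chart_openW : open W;
  chart_smooth_psi : smooth_on W psi;
  chart_smooth_chi : smooth_on U chi;
  chart_to : forall y, V y -> U y ->
    [/\ W (chi y), half_space (chi y) & psi (chi y) = y];
  chart_from : forall w, W w -> half_space w ->
    [/\ V (psi w), U (psi w) & chi (psi w) = w] }.

Definition submanifold (R : realType) (E : normedModType R) (d : nat)
    (V : set E) : Prop :=
  forall x, V x -> exists U W psi chi, @is_chart R E d V U W psi chi /\ U x.

Definition boundary (R : realType) (E : normedModType R) (d : nat)
    (V : set E) : set E :=
  [set x | V x /\ exists U W psi chi,
    [/\ @is_chart R E d V U W psi chi, U x &
        exists2 i : 'I_d, val i = 0%N & chi x ord0 i = 0]].

(* The full d-dimensional tangent space, also at boundary points. *)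
Definition tangent (R : realType) (E : normedModType R) (d : nat)
    (V : set E) (x : E) : set E :=
  [set v | V x /\ exists U W psi chi,
    [/\ @is_chart R E d V U W psi chi, U x &
        exists w : 'rV[R]_d, v = 'D_w psi (chi x)]].

Definition bdtangent (R : realType) (E : normedModType R) (d : nat)
    (V : set E) (x : E) : set E := tangent d.-1 (boundary d V) x.

Definition diffeo (R : realType) (E : normedModType R) (V : set E)
    (f : E -> E) : Prop :=
  smooth_near V f /\ exists f' : E -> E, smooth_near V f' /\
    forall x, V x -> [/\ V (f x), V (f' x), f' (f x) = x & f (f' x) = x].

(** Differential forms: [a x v] is the value of the 1-form a at x on v *)

Definition one_form (R : realType) (E : normedModType R) (V : set E)
    (a : E -> E -> R) : Prop :=
  (forall x c u v, a x (c *: u + v) = c * a x u + a x v) /\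
  (forall v, smooth_near V (fun x => (a x v : R^o))).

(* Since u and v are extended to constant fields, they commute. *)
Definition dform (R : realType) (E : normedModType R) (a : E -> E -> R)
    (x u v : E) : R :=
  'D_u (fun y => (a y v : R^o)) x - 'D_v (fun y => (a y u : R^o)) x.

(** Exact symplectic manifolds with convex boundary *)

(* c is the collar ((-1,0] x bd V, d(e^t a|bd V)) of bd V.  The last field says
   that the image of d/dt is the Liouville field Y, i_Y da = a; it points
   outward since t <= 0. *)
Record is_collar (R : realType) (E : normedModType R) (d : nat) (V : set E)
    (a : E -> E -> R) (c : R^o * E -> E) : Prop := IsCollar {
  collar_smooth :
    smooth_near [set q : R^o * E | -1 < q.1 <= 0 /\ boundary d V q.2] c;
  collar_diffeo : exists (O : set E) (c' : E -> R^o * E),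
    [/\ open O, boundary d V `<=` O, smooth_near (V `&` O) c',
        (forall t x, -1 < t <= 0 -> boundary d V x ->
           [/\ V (c (t, x)), O (c (t, x)) & c' (c (t, x)) = (t, x)]) &
        (forall y, V y -> O y ->
           [/\ -1 < (c' y).1 <= 0, boundary d V (c' y).2 & c (c' y) = y])];
  collar0 : forall x, boundary d V x -> c (0, x) = x;
  collar_symplectic : forall t x (s1 s2 : R) u1 u2,
    -1 < t <= 0 -> boundary d V x ->
    bdtangent d V x u1 -> bdtangent d V x u2 ->
    dform a (c (t, x)) ('D_(s1, u1) c (t, x)) ('D_(s2, u2) c (t, x)) =
    expR t * (s1 * a x u2 - s2 * a x u1 + dform a x u1 u2);
  collar_liouville : forall t x u,
    -1 < t <= 0 -> boundary d V x -> tangent d V (c (t, x)) u ->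
    dform a (c (t, x)) ('D_(1, 0) c (t, x)) u = a (c (t, x)) u }.

Record exact_symplectic (R : realType) (E : normedModType R) (d : nat)
    (V : set E) (a : E -> E -> R) : Prop := ExactSymplectic {
  es_compact : compact V;
  es_manifold : submanifold d V;
  es_form : one_form V a;
  es_nondegenerate : forall x u, tangent d V x u -> u != 0 ->
    exists2 v, tangent d V x v & dform a x u v != 0;
  es_convex : exists c, is_collar d V a c }.

Definition symplectomorphism (R : realType) (E : normedModType R) (d : nat)
    (V : set E) (a : E -> E -> R) (phi : E -> E) : Prop :=
  diffeo V phi /\
  forall x u v, tangent d V x u -> tangent d V x v ->
    dform a (phi x) ('D_u phi x) ('D_v phi x) = dform a x u v.

Definition id_near_boundary (R : realType) (E : normedModType R) (d : nat)
    (V : set E) (phi : E -> E) : Prop :=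
  exists O : set E, [/\ open O, boundary d V `<=` O &
    forall x, V x -> O x -> phi x = x].

Definition symplectic_isotopy (R : realType) (E : normedModType R) (d : nat)
    (V : set E) (a : E -> E -> R) (phi phi' : E -> E) : Prop :=
  exists Phi : R^o * E -> E,
  [/\ smooth_near [set q : R^o * E | 0 <= q.1 <= 1 /\ V q.2] Phi,
      (forall s, 0 <= s <= 1 ->
         symplectomorphism d V a (fun x => Phi (s, x))),
      (exists O : set E, [/\ open O, boundary d V `<=` O &
         forall s x, 0 <= s <= 1 -> V x -> O x -> Phi (s, x) = x]) &
      (forall x, V x -> Phi (0, x) = phi x /\ Phi (1, x) = phi' x)].

(** Contact open books *)

(* phi^*a - a = dh on the page V. *)
Definition exact_monodromy (R : realType) (E : normedModType R) (d : nat)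
    (V : set E) (a : E -> E -> R) (phi : E -> E) (h : E -> R) : Prop :=
  smooth_near V (h : E -> R^o) /\
  forall x v, tangent d V x v ->
    a (phi x) ('D_v phi x) - a x v = 'D_v (h : E -> R^o) x.

Definition deck (R : realType) (E : normedModType R) (phi : E -> E)
    (h : E -> R) (q : R^o * E) : R^o * E := (q.1 - h q.2, phi q.2).

(* The point of R^2 with radius r and angle 2 pi t / T: on the disc glued to
   the boundary circle R/TZ of the mapping torus, (r,t) are the polar
   coordinates, t having period T. *)
Definition polar (R : realType) (T r t : R) : R^o * R^o :=
  (r * cos (2 * pi * t / T), r * sin (2 * pi * t / T)).

Definition radius (R : realType) (w : R^o * R^o) : R :=
  Num.sqrt (w.1 ^+ 2 + w.2 ^+ 2).

(* The 1-form dt = (T / 2 pi) d(angle) in Cartesian coordinates, away from 0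
   (at w = 0 this is the zero form). *)
Definition polar_dt (R : realType) (T : R) (w eta : R^o * R^o) : R :=
  T / (2 * pi) * ((w.1 * eta.2 - w.2 * eta.1) / radius w ^+ 2).

(* (P, Q) is a diffeomorphism MT(V, phi) \cup bd V x D^2 -> M, identifying the
   contact form of the open book with lam.
   - P is defined on R x V; its fibres are the orbits of the deck
     transformation (t,x) |-> (t - h x, phi x), where h is normalised to be
     positive, and P^*lam = dt + a.
   - Q is defined on bd V x { |w| < 1 + eps }.  On the unit disc it
     parametrises the part bd V x D^2, and 1 <= r < 1 + eps overlaps the collar
     of the boundary of the mapping torus, by t = t and e^(1-r) a + dt =
     e^s a + dt; this encodes both the gluing along the identity at r = 1 and
     its smooth structure.  Moreover Q^*lam = h1(r) a|bd V + h2(r) dt, and the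
     fact that this is a contact form follows from lam being one. *)
Record open_book_form (R : realType) (F E : normedModType R) (d : nat)
    (M : set F) (lam : F -> F -> R)
    (V : set E) (a : E -> E -> R) (phi : E -> E) (h : E -> R)
    (c : R^o * E -> E) (P : R^o * E -> F) (Q : E * (R^o * R^o) -> F)
    (eps : R) (h1 h2 : R -> R) : Prop := OpenBookForm {
  ob_eps : 0 < eps <= 1;
  ob_h_gt0 : forall x, V x -> 0 < h x;
  ob_P_smooth : smooth_near [set q : R^o * E | V q.2] P;
  ob_P_immersion : forall t x (s : R) u, tangent d V x u ->
    'D_(s, u) P (t, x) = 0 -> s = 0 /\ u = 0;
  ob_P_fibres : forall q q' : R^o * E, V q.2 -> V q'.2 ->
    (P q = P q' <->
     exists n, iter n (deck phi h) q = q' \/ iter n (deck phi h) q' = q);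
  ob_P_form : forall t x (s : R) u, tangent d V x u ->
    lam (P (t, x)) ('D_(s, u) P (t, x)) = s + a x u;
  ob_Q_smooth : smooth_near
    [set q : E * (R^o * R^o) | boundary d V q.1 /\ radius q.2 < 1 + eps] Q;
  ob_Q_immersion : forall x w u eta, radius w < 1 + eps ->
    bdtangent d V x u -> 'D_(u, eta) Q (x, w) = 0 -> u = 0 /\ eta = 0;
  ob_Q_inj : forall x x' w w', boundary d V x -> boundary d V x' ->
    radius w < 1 + eps -> radius w' < 1 + eps ->
    Q (x, w) = Q (x', w') -> x = x' /\ w = w';
  ob_Q_form : forall x w u eta, radius w < 1 + eps -> bdtangent d V x u ->
    lam (Q (x, w)) ('D_(u, eta) Q (x, w)) =
    h1 (radius w) * a x u + h2 (radius w) * polar_dt (h x) w eta;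
  ob_h12_smooth : smooth_near [set r : R^o | 0 <= r < 1 + eps]
                    (h1 : R^o -> R^o) /\
                  smooth_near [set r : R^o | 0 <= r < 1 + eps]
                    (h2 : R^o -> R^o);
  ob_h12_near0 : exists2 delta, 0 < delta & forall r, 0 <= r < delta ->
    h1 r = 1 /\ h2 r = r ^+ 2;
  ob_h12_match : forall r, 1 <= r < 1 + eps ->
    h1 r = expR (1 - r) /\ h2 r = 1;
  ob_glue : forall x r t, boundary d V x -> 1 <= r < 1 + eps ->
    Q (x, polar (h x) r t) = P (t, c (1 - r, x));
  ob_disjoint : forall (q : R^o * E) x w, V q.2 -> boundary d V x ->
    radius w < 1 -> P q <> Q (x, w);
  ob_cover : forall y, M y <->
    (exists2 q : R^o * E, V q.2 & y = P q) \/
    (exists x w, [/\ boundary d V x, radius w < 1 & y = Q (x, w)]) }.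

(* A co-oriented contact manifold is given by a pair (M, b), the contact
   structure being the kernel of the restriction of b to M; only b up to a
   positive factor matters.  (M, ker b) is co-orientedly contactomorphic to
   Aob(V, da, phi), after replacing phi by some phi' with phi'^*a - a = dh. *)
Definition supports (R : realType) (F E : normedModType R) (d : nat)
    (V : set E) (a : E -> E -> R) (phi : E -> E)
    (M : set F) (b : F -> F -> R) : Prop :=
  exists phi' h c, [/\ symplectomorphism d V a phi' /\
      symplectic_isotopy d V a phi phi',
    exact_monodromy d V a phi' h, is_collar d V a c &
    exists f : F -> R,
    [/\ smooth_near M (f : F -> R^o), forall y, M y -> 0 < f y &
        exists P Q eps h1 h2,
          open_book_form d M (fun y v => f y * b y v) V a phi' h c P Q
            eps h1 h2]].

Definition supporting_open_book (R : realType) (F E : normedModType R)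
    (d : nat) (M : set F) (b : F -> F -> R)
    (V : set E) (a : E -> E -> R) (phi : E -> E) : Prop :=
  [/\ exact_symplectic d V a, symplectomorphism d V a phi,
      id_near_boundary d V phi & supports d V a phi M b].

(* V1 is compact, so an injective immersion is an embedding; proper means
   that the boundary of V1 is the preimage of that of V2, to which V1 is
   transverse. *)
Record proper_symplectic_embedding (R : realType) (E1 E2 : normedModType R)
    (d1 d2 : nat) (V1 : set E1) (a1 : E1 -> E1 -> R)
    (V2 : set E2) (a2 : E2 -> E2 -> R) (g : E1 -> E2) : Prop :=
  ProperSymplecticEmbedding {
  pse_smooth : smooth_near V1 g;
  pse_maps : forall x, V1 x -> V2 (g x);
  pse_inj : forall x y, V1 x -> V1 y -> g x = g y -> x = y;
  pse_immersion : forall x u, tangent d1 V1 x u -> 'D_u g x = 0 -> u = 0;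
  pse_symplectic : forall x u v, tangent d1 V1 x u -> tangent d1 V1 x v ->
    dform a2 (g x) ('D_u g x) ('D_v g x) = dform a1 x u v;
  pse_boundary : forall x, V1 x ->
    (boundary d2 V2 (g x) <-> boundary d1 V1 x);
  pse_transverse : forall x w, boundary d1 V1 x -> tangent d2 V2 (g x) w ->
    exists u v, [/\ tangent d1 V1 x u, bdtangent d2 V2 (g x) v &
                    w = 'D_u g x + v] }.

(* The closed contact manifold (M_i, ker b_i) has dimension d_i + 1. *)
Definition contact_open_book_embeds (R : realType) (F1 F2 : normedModType R)
    (d1 : nat) (M1 : set F1) (b1 : F1 -> F1 -> R)
    (d2 : nat) (M2 : set F2) (b2 : F2 -> F2 -> R) : Prop :=
  exists (n1 n2 : nat)
    (V1 : set 'rV[R]_n1) (a1 : 'rV[R]_n1 -> 'rV[R]_n1 -> R)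
    (phi1 : 'rV[R]_n1 -> 'rV[R]_n1)
    (V2 : set 'rV[R]_n2) (a2 : 'rV[R]_n2 -> 'rV[R]_n2 -> R)
    (phi2 : 'rV[R]_n2 -> 'rV[R]_n2) (g : 'rV[R]_n1 -> 'rV[R]_n2),
  [/\ supporting_open_book d1 M1 b1 V1 a1 phi1,
      supporting_open_book d2 M2 b2 V2 a2 phi2,
      proper_symplectic_embedding d1 d2 V1 a1 V2 a2 g &
      forall x, V1 x -> g (phi1 x) = phi2 (g x)].

(** Brieskorn manifolds and the standard sphere *)

(* C^k as R^k x R^k, with z_j = x_j + i y_j. *)
Definition Cspace (R : realType) (k : nat) : normedModType R :=
  ('rV[R]_k * 'rV[R]_k)%type.

Definition coordz (R : realType) (k : nat) (z : Cspace R k) (j : 'I_k) : R[i] :=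
  Complex (z.1 ord0 j) (z.2 ord0 j).

Definition unit_sphere (R : realType) (k : nat) : set (Cspace R k) :=
  [set z | \sum_(j < k) `|coordz z j| ^+ 2 = 1].

Definition brieskorn (R : realType) (k : nat) (e : 'I_k -> nat)
    : set (Cspace R k) :=
  [set z | \sum_(j < k) coordz z j ^+ e j = 0] `&` @unit_sphere R k.

(* (i/8) \sum_j e_j (z_j d\bar z_j - \bar z_j dz_j), which is real. *)
Definition brieskorn_form (R : realType) (k : nat) (e : 'I_k -> nat)
    (z v : Cspace R k) : R :=
  complex.Re (Complex 0 1 / 8%:R * \sum_(j < k) (e j)%:R *
    (coordz z j * conjc (coordz v j) - conjc (coordz z j) * coordz v j)).

Definition ustilovsky_exponent (m p : nat) (j : 'I_(2 * m + 2)) : nat :=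
  if val j == 0%N then p else 2%N.

Definition ustilovsky_sphere (R : realType) (m p : nat)
    : set (Cspace R (2 * m + 2)) :=
  brieskorn (ustilovsky_exponent (m := m) p).

Definition ustilovsky_form (R : realType) (m p : nat)
    : Cspace R (2 * m + 2) -> Cspace R (2 * m + 2) -> R :=
  brieskorn_form (ustilovsky_exponent (m := m) p).

(* \sum_j (x_j dy_j - y_j dx_j), whose kernel on the unit sphere is the
   standard contact structure. *)
Definition std_form (R : realType) (k : nat) (z v : Cspace R k) : R :=
  \sum_(j < k) (z.1 ord0 j * v.2 ord0 j - z.2 ord0 j * v.1 ord0 j).

(* Main.v *)
Require Import Defs.
From HB Require Import structures.
From mathcomp Require Import all_boot all_order all_algebra.
From mathcomp Require Import all_classical all_reals all_analysis.
From mathcomp Require Import complex ring lra.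

(** Both open books are written down explicitly.  The page of the Ustilovsky sphere is the unit
    disc cotangent bundle of S^(2m), with points (q, xi), and the monodromy is the p-th power of
    a Dehn twist: the normalised geodesic flow through an angle that depends on s = |xi|^2 and
    decreases from p pi near the zero section to 0 near the boundary.  For a suitable positive
    function Y of s, the map (q, xi) |-> xi / Y + i Y q is a symplectic embedding into a ball of
    C^(2m+1); away from the zero section its image satisfies |z|^2 = 2 |xi|, and there it turns
    the geodesic flow into a rotation z |-> e^(i T(|z|^2)) z.  Near the zero section both maps
    are (-1)^p.  The rotation is isotopic to the identity among symplectomorphisms, so that the
    ball with this monodromy is an open book of the standard sphere.

    On the Ustilovsky sphere the open book is arg z_0.  Write rho = |z_0|^2 and let z be the
    vector of the other coordinates; then |z|^4 - |z.z|^2 = (1 - rho)^2 - rho^p decreases in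
    rho, which makes rho a smooth function of s once this quantity is prescribed as a function
    of s.  Real and imaginary part of z are multiples of the two vectors of the frame (q, xi),
    turned by the geodesic flow; the time is rescaled by the function h of the monodromy, so
    that a positive multiple of the contact form becomes dt + xi.dq. *)

Set Implicit Arguments.
Unset Strict Implicit.
Unset Printing Implicit Defensive.

Import Order.TTheory GRing.Theory Num.Theory.
Import numFieldNormedType.Exports.

Local Open Scope classical_set_scope.
Local Open Scope ring_scope.

(** * Smooth maps *)

(** An open book asks for dt plus the page form on the nose, with a fixed collar, so no stability
    theorem may absorb an error and every profile has to solve its equation in closed form. With r =
    |xi|, s = r^2 and c the cutoff, the key choice is [slope] = d(rc)/dr with twist angle p pi (1 -
    [slope]). The primitive h of the monodromy must satisfy dh = r d(angle), and integration by
    parts leaves no integral: h is p pi / 2 times K - 4 r^3 c'(s), the constant K making it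
    positive. On the Brieskorn side, with alpha = 2t / [height], a conformal factor F leaves (F / 2)
    dalpha - r d([slope] alpha) as time part; it is dt if F = [height] + 2 r [slope], which is K +
    2rc. This F dictates the value 4s / F^2 of [gram], and its monotonicity in s is again the
    positivity of [height]. The other obstacle is the zero section, where r is not smooth and the
    frame degenerates: c vanishes for s <= 1/16, which freezes all turning there. Near the binding
    both contact forms become multiples of a + nu dt for one function nu of the disc radius, equal
    to 1/r on the cotangent collar, so a single pair h1, h2 serves both open books. *)

Section SmoothMaps.
Context {R : realType}.
Implicit Types E F G : normedModType R.

(* [Ck] with continuity demanded at every order: unlike [Ck], it decreases with k by construction. *)
Fixpoint Sk E F (k : nat) (U : set E) (f : E -> F) : Prop :=
  (forall x, U x -> {for x, continuous f}) /\
  match k with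
  | 0 => True
  | k'.+1 => forall v, (forall x, U x -> derivable f x v) /\
                       Sk k' U (fun x => 'D_v f x)
  end.

(** [Ck] of positive order mentions derivatives only, so continuity of f itself is its order 0
    instance; once all orders are quantified the two scales agree. *)
Lemma Sk_smooth E F (U : set E) (f : E -> F) :
  smooth_on U f <-> forall k, Sk k U f.
Proof.
split=> [sf k|sf].
  elim: k f sf => [|k IH] f sf; first by split=> //; exact: (sf 0%N).
  split; first exact: (sf 0%N).
  move=> v; split; first by have [] := sf 1%N v.
  by apply: IH => j; have [] := sf j.+1 v.
move=> k; elim: k f sf => [|k IH] f sf; first by case: (sf 0%N).
move=> v; split; first by case: (sf 1%N) => _ /(_ v)[].
by apply: IH => j; case: (sf j.+1) => _ /(_ v)[].
Qed.

Lemma Sk_continuous E F k (U : set E) (f : E -> F) x :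
  Sk k U f -> U x -> {for x, continuous f}.
Proof. by case: k => [|k] [+ _]; exact. Qed.

Lemma Sk_derivable E F k (U : set E) (f : E -> F) x v :
  Sk k.+1 U f -> U x -> derivable f x v.
Proof. by move=> [_ /(_ v)[+ _]]; exact. Qed.

Lemma Sk_derive E F k (U : set E) (f : E -> F) v :
  Sk k.+1 U f -> Sk k U (fun x => 'D_v f x).
Proof. by move=> [_ /(_ v)[]]. Qed.

Lemma SkW E F k (U : set E) (f : E -> F) : Sk k.+1 U f -> Sk k U f.
Proof.
elim: k f => [|k IH] f [cf df]; first by split.
split=> // v; have [dfv sf] := df v; split=> //.
exact: IH.
Qed.

Lemma Sk_sub E F k (U U' : set E) (f : E -> F) :
  U' `<=` U -> Sk k U f -> Sk k U' f.
Proof.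
move=> sU; elim: k f => [|k IH] f [cf df]; split=> //.
- by move=> x /sU; exact: cf.
- by move=> x /sU; exact: cf.
move=> v; have [dfv sf] := df v; split; first by move=> x /sU; exact: dfv.
exact: IH.
Qed.

Lemma open_near E (U : set E) (P : E -> Prop) x : open U -> U x ->
  (forall y, U y -> P y) -> \forall y \near x, P y.
Proof. by move=> oU Ux UP; apply: filterS (open_nbhs_nbhs (conj oU Ux)). Qed.

Lemma Sk_ext E F k (U : set E) (f g : E -> F) : open U ->
  (forall x, U x -> f x = g x) -> Sk k U f -> Sk k U g.
Proof.
move=> oU; elim: k f g => [|k IH] f g fg.
  move=> [cf _]; split=> // x Ux.
  have nfg := open_near oU Ux fg.
  rewrite /prop_for /continuous_at -fg //; apply: cvg_trans (cf x Ux).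
  exact: near_eq_cvg nfg.
move=> sf; have [cf df] := sf; split.
  by move=> x Ux; exact: (Sk_continuous (IH f g fg (SkW sf)) Ux).
move=> v; have [dfv sfv] := df v; split.
  move=> x Ux; apply: near_eq_derivable (dfv x Ux); exact: open_near fg.
apply: IH sfv => x Ux; apply: near_eq_derive; exact: open_near fg.
Qed.

(** Every clause is pointwise, so it passes to unions; this glues germs into smoothness near a
    set. *)
Lemma Sk_bigcup E F k (I : Type) (U : I -> set E) (f : E -> F) :
  (forall i, Sk k (U i) f) -> Sk k [set x | exists i, U i x] f.
Proof.
elim: k f => [|k IH] f sf.
  by split=> // x [i Ux]; apply: (Sk_continuous (sf i)).
split; first by move=> x [i Ux]; apply: (Sk_continuous (sf i)).
move=> v; split; first by move=> x [i Ux]; apply: (Sk_derivable (sf i)).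
by apply: IH => i; apply: Sk_derive.
Qed.

Lemma Sk_cst E F k (U : set E) (c : F) : Sk k U (fun _ => c).
Proof.
elim: k c => [|k IH] c; first by split=> // x _; exact: cst_continuous.
split; first by move=> x _; exact: cst_continuous.
move=> v; split; first by move=> x _; exact: derivable_cst.
rewrite (_ : (fun x => 'D_v _ x) = fun _ => 0); first exact: IH.
by apply/funext => x; rewrite (derive_cst c).
Qed.

Lemma Sk_lin E F k (U : set E) (f : {linear E -> F}) : continuous f -> Sk k U f.
Proof.
move=> cf; have df x : differentiable f x by exact: linear_differentiable.
case: k => [|k]; first by split=> // x _; exact: cf.
split; first by move=> x _; exact: cf.
move=> v; split; first by move=> x _; exact: diff_derivable.
rewrite (_ : (fun x => 'D_v _ x) = fun _ => f v); first exact: Sk_cst.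
by apply/funext => x; rewrite deriveE // diff_lin.
Qed.

Lemma Sk_D E F k (U : set E) (f g : E -> F) : open U ->
  Sk k U f -> Sk k U g -> Sk k U (fun x => f x + g x).
Proof.
move=> oU; elim: k f g => [|k IH] f g sf sg.
  by split=> // x Ux; apply: cvgD; [apply: (Sk_continuous sf)|apply: (Sk_continuous sg)].
have df v x : U x -> derivable f x v by exact: Sk_derivable sf.
have dg v x : U x -> derivable g x v by exact: Sk_derivable sg.
split; first by move=> x Ux; exact: (Sk_continuous (IH _ _ (SkW sf) (SkW sg)) Ux).
move=> v; split; first by move=> x Ux; apply: derivableD; [exact: df|exact: dg].
apply: (@Sk_ext _ _ _ _ (fun x => 'D_v f x + 'D_v g x)) => //.
  by move=> x Ux; rewrite -deriveD //; [exact: df|exact: dg].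
by apply: IH; apply: Sk_derive.
Qed.

Lemma Sk_M E k (U : set E) (f g : E -> R^o) : open U ->
  Sk k U f -> Sk k U g -> Sk k U (fun x => f x * g x : R^o).
Proof.
move=> oU; elim: k f g => [|k IH] f g sf sg.
  by split=> // x Ux; apply: cvgM; [apply: (Sk_continuous sf)|apply: (Sk_continuous sg)].
have df v x : U x -> derivable f x v by exact: Sk_derivable sf.
have dg v x : U x -> derivable g x v by exact: Sk_derivable sg.
split; first by move=> x Ux; exact: (Sk_continuous (IH _ _ (SkW sf) (SkW sg)) Ux).
move=> v; split; first by move=> x Ux; apply: derivableM; [exact: df|exact: dg].
apply: (@Sk_ext _ _ _ _ (fun x => f x * 'D_v g x + g x * 'D_v f x)) => //.
  by move=> x Ux; rewrite [RHS]deriveM //; [exact: df|exact: dg].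
apply: Sk_D => //; apply: IH; try exact: SkW; exact: Sk_derive.
Qed.

(** Restriction to the line through x in direction v reduces this to the one-variable chain rule, so
    derivability of f in the single direction v suffices. *)
Lemma is_derive_comp1 E (f : E -> R^o) (phi : R^o -> R^o) (x v : E) (a b : R) :
  is_derive x v f a -> is_derive (f x) 1 phi b ->
  is_derive x v (fun y => phi (f y) : R^o) (b * a).
Proof.
move=> [df dfE] [dphi dphiE].
have lineE (g : E -> R^o) : 'D_v g x = (fun h : R => g (h *: v + x))^`()%classic 0.
  rewrite /derive1 /derive; set F1 := fun h : R => _; set F2 := fun h : R => _.
  suff -> : F1 = F2 by [].
  by apply/funext => h; rewrite /F1 /F2 /= addr0 scale0r add0r.
have df' := (derivable1P f x v).1 df.
have e0 : (0 : R) *: v + x = x by rewrite scale0r add0r.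
have dphi' : derivable phi (f ((0 : R) *: v + x)) 1 by rewrite e0; exact: dphi.
split.
  apply/derivable1P/derivable1_diffP.
  apply: (@differentiable_comp _ _ _ _ (fun h : R^o => f (h *: v + x)) phi).
    exact: (derivable1_diffP _ _).1 df'.
  exact: (derivable1_diffP _ _).1 dphi'.
rewrite lineE.
have := @derive1_comp R (fun h : R => f (h *: v + x)) phi 0 df' dphi'.
rewrite /comp => ->; rewrite -lineE dfE e0 derive1E dphiE //.
Qed.

Lemma Sk_comp1 E k (U : set E) (W : set R^o) (f : E -> R^o) (phi : R^o -> R^o) :
  open U -> open W -> (forall x, U x -> W (f x)) ->
  Sk k W phi -> Sk k U f -> Sk k U (fun x => phi (f x)).
Proof.
move=> oU oW UW; elim: k phi => [|k IH] phi sp sf.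
  split=> // x Ux; apply: continuous_comp; first exact: (Sk_continuous sf).
  by apply: (Sk_continuous sp); exact: UW.
have dcomp v x : U x -> is_derive x v (fun x => phi (f x)) ('D_1 phi (f x) * 'D_v f x).
  move=> Ux; apply: is_derive_comp1; apply: derivableP; first exact: (Sk_derivable sf).
  by apply: (Sk_derivable sp); exact: UW.
split; first by move=> x Ux; exact: (Sk_continuous (IH _ (SkW sp) (SkW sf)) Ux).
move=> v; split; first by move=> x Ux; have [] := dcomp v x Ux.
apply: (@Sk_ext _ _ _ _ (fun x => 'D_1 phi (f x) * 'D_v f x)) => //.
  by move=> x Ux; have [_ ->] := dcomp v x Ux.
apply: Sk_M => //; last exact: Sk_derive.
by apply: (IH (fun y => 'D_1 phi y)); [exact: Sk_derive|exact: SkW].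
Qed.

Lemma cvg_rV E n (f : E -> 'rV[R]_n) x :
  (forall j, {for x, continuous (fun y => f y ord0 j)}) -> {for x, continuous f}.
Proof.
move=> cf; apply/cvgrPdist_le => /= e e0; near=> y.
rewrite /Num.Def.normr/= mx_normrE (bigmax_le _ (ltW e0))//= => -[i j] _.
rewrite !mxE/= (ord1 i); move: j; near: y; apply: filter_forall => /= j.
exact: (cvgrPdist_le _ _).1 (cf j) _ e0.
Unshelve. all: by end_near. Qed.

Lemma rV_coord_continuous n (j : 'I_n) : continuous (fun y : 'rV[R]_n => y ord0 j).
Proof. by move=> x; exact: coord_continuous. Qed.

Lemma is_derive_rV E n (f : E -> 'rV[R]_n) x v df :
  is_derive x v f df <-> forall j, is_derive x v (fun y => f y ord0 j : R^o) (df ord0 j).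
Proof.
split=> [[dfx <-] j|dfj].
  have /derivable_mxP dfj := dfx.
  by split; [exact: dfj|rewrite derive_mx // mxE].
have dfx : derivable f x v.
  by apply/derivable_mxP => i j; rewrite (ord1 i); case: (dfj j).
split=> //; rewrite derive_mx //; apply/rowP => j; rewrite mxE.
by case: (dfj j).
Qed.

Lemma Sk_rV E n k (U : set E) (f : E -> 'rV[R]_n) : open U ->
  (forall j, Sk k U (fun x => f x ord0 j : R^o)) -> Sk k U f.
Proof.
move=> oU; elim: k f => [|k IH] f sf.
  by split=> // x Ux; apply: cvg_rV => j; exact: (Sk_continuous (sf j)).
have df v x : U x -> is_derive x v f (\row_j 'D_v (fun x => f x ord0 j : R^o) x).
  move=> Ux; apply/is_derive_rV => j; rewrite mxE; apply: derivableP.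
  exact: (Sk_derivable (sf j)).
split; first by move=> x Ux; apply: cvg_rV => j; exact: (Sk_continuous (sf j)).
move=> v; split; first by move=> x Ux; have [] := df v x Ux.
apply: (@Sk_ext _ _ _ _ (fun x => \row_j 'D_v (fun x => f x ord0 j : R^o) x)) => //.
  by move=> x Ux; have [_ ->] := df v x Ux.
apply: IH => j; under eq_fun do rewrite mxE; exact: Sk_derive.
Qed.

Lemma Sk_coord E n k (U : set E) (f : E -> 'rV[R]_n) j : open U ->
  Sk k U f -> Sk k U (fun x => f x ord0 j : R^o).
Proof.
move=> oU; elim: k f => [|k IH] f sf.
  split=> // x Ux; apply: (@continuous_comp _ _ _ f (fun y => y ord0 j)); first exact: (Sk_continuous sf).
  exact: rV_coord_continuous.
have df v x : U x -> is_derive x v (fun y => f y ord0 j : R^o) ('D_v f x ord0 j).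
  by move=> Ux; apply: (is_derive_rV _ _ _ _).1; apply: derivableP; exact: (Sk_derivable sf).
split.
  move=> x Ux; apply: (@continuous_comp _ _ _ f (fun y => y ord0 j)); first exact: (Sk_continuous sf).
  exact: rV_coord_continuous.
move=> v; split; first by move=> x Ux; have [] := df v x Ux.
apply: (@Sk_ext _ _ _ _ (fun x => 'D_v f x ord0 j)) => //.
  by move=> x Ux; have [_ ->] := df v x Ux.
by apply: IH; exact: Sk_derive.
Qed.

Lemma is_derive_pair E F G (f : E -> F) (g : E -> G) x v df dg :
  is_derive x v f df -> is_derive x v g dg ->
  is_derive x v (fun y => (f y, g y)) (df, dg).
Proof.
move=> [df1 <-] [dg1 <-].
have cv : (fun h : R => h^-1 *: (((fun y => (f y, g y)) \o shift x) (h *: v) - (f x, g x))) @ 0^'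
     --> ('D_v f x, 'D_v g x).
  by apply: cvg_pair; [exact: df1|exact: dg1].
by split; [apply/cvg_ex; eexists; exact: cv|exact: cvg_lim cv].
Qed.

Lemma Sk_pair E F G k (U : set E) (f : E -> F) (g : E -> G) : open U ->
  Sk k U f -> Sk k U g -> Sk k U (fun x => (f x, g x)).
Proof.
move=> oU; elim: k f g => [|k IH] f g sf sg.
  by split=> // x Ux; apply: cvg_pair; [apply: (Sk_continuous sf)|apply: (Sk_continuous sg)].
have dfg v x : U x -> is_derive x v (fun y => (f y, g y)) ('D_v f x, 'D_v g x).
  by move=> Ux; apply: is_derive_pair; apply: derivableP;
    [exact: (Sk_derivable sf)|exact: (Sk_derivable sg)].
split; first by move=> x Ux; exact: (Sk_continuous (IH _ _ (SkW sf) (SkW sg)) Ux).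
move=> v; split; first by move=> x Ux; have [] := dfg v x Ux.
apply: (@Sk_ext _ _ _ _ (fun x => ('D_v f x, 'D_v g x))) => //.
  by move=> x Ux; have [_ ->] := dfg v x Ux.
by apply: IH; exact: Sk_derive.
Qed.

End SmoothMaps.

(** * Elementary functions and the smooth step *)

Section ElementaryFunctions.
Context {R : realType}.
Implicit Types E F G : normedModType R.

Lemma is_derive_dir1 (phi : R^o -> R^o) (x v b : R) :
  is_derive (x : R^o) 1 phi b -> is_derive (x : R^o) (v : R^o) phi (v * b).
Proof.
move=> d; rewrite mulrC.
by apply: (@is_derive_comp1 _ _ (id : R^o -> R^o) phi x v v b).
Qed.

Lemma is_derive_add E F (f g : E -> F) (x v : E) df dg :
  is_derive x v f df -> is_derive x v g dg ->
  is_derive x v (fun y => f y + g y) (df + dg).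
Proof. exact: is_deriveD. Qed.

Lemma is_derive_mul E (f g : E -> R^o) (x v : E) (df dg : R) :
  is_derive x v f df -> is_derive x v g dg ->
  is_derive x v (fun y => f y * g y : R^o) (f x * dg + g x * df).
Proof. exact: is_deriveM. Qed.

Lemma is_derive_pow E (f : E -> R^o) n (x v : E) (df : R) : is_derive x v f df ->
  is_derive x v (fun y => f y ^+ n : R^o) (n%:R * f x ^+ n.-1 * df).
Proof.
move=> d; elim: n => [|n IH].
  rewrite !mul0r; exact: (is_derive_cst (1 : R^o)).
rewrite (_ : (fun y => _) = fun y => f y * f y ^+ n : R^o); last first.
  by apply/funext => y; rewrite exprS.
apply: is_derive_eq (is_derive_mul d IH) _.
by case: n {IH} => [|n]; rewrite ?mul0r ?mulr0 /= ?exprS -?[n.+2%:R]natr1; ring.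
Qed.

Lemma is_derive_inv (x : R^o) : x != 0 ->
  is_derive x 1 (fun y : R^o => y^-1 : R^o) (- (x^-1 * x^-1)).
Proof.
move=> x0; have h := @is_deriveV _ (id : R -> R) x 1 1 x0 (is_derive_id x 1).
by apply: is_derive_eq h _; rewrite /GRing.scale /= mulr1 expr2 invfM.
Qed.

(** Bootstrapping: order k for phi gives order k for its derivative F, hence order k + 1 for phi. It
    covers the reciprocal, exponential, square root, logarithm and one-variable inverses. *)
Lemma Sk_ode (W : set R^o) (phi F : R^o -> R^o) : open W ->
  (forall x, W x -> is_derive x 1 phi (F x)) ->
  (forall k, Sk k W phi -> Sk k W F) -> forall k, Sk k W phi.
Proof.
move=> oW dphi sF; elim=> [|k IH].
  split=> // x /dphi[dx _]; apply: differentiable_continuous.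
  exact/derivable1_diffP.
have dv v x : W x -> is_derive x v phi (v * F x).
  by move=> /dphi dx; exact: is_derive_dir1.
split; first by move=> x Wx; exact: (Sk_continuous IH).
move=> v; split; first by move=> x /(dv v)[].
apply: (@Sk_ext _ _ _ _ _ (fun x => v * F x)) => //.
  by move=> x /(dv v)[_ ->].
by apply: Sk_M => //; [exact: Sk_cst|exact: sF].
Qed.

Lemma open_neq0 : open [set x : R^o | x != 0].
Proof. exact: open_neq. Qed.

Lemma Sk_inv k : Sk k [set x : R^o | x != 0] (fun x : R^o => x^-1 : R^o).
Proof.
apply: (@Sk_ode _ _ (fun x => - 1 * (x^-1 * x^-1))); first exact: open_neq0.
  by move=> x /= x0; rewrite mulN1r; exact: is_derive_inv.
move=> j sj; apply: Sk_M; first exact: open_neq0; first exact: Sk_cst.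
by apply: Sk_M; first exact: open_neq0.
Qed.

Lemma Sk_expR k : Sk k setT (fun x : R^o => expR x : R^o).
Proof.
by apply: (@Sk_ode _ _ (fun x => expR x)); first exact: openT.
Qed.

Lemma Sk_cos_sin k : Sk k setT (fun x : R^o => cos x : R^o) /\
  Sk k setT (fun x : R^o => sin x : R^o).
Proof.
elim: k => [|k [IHc IHs]].
  by split; split=> // x _; [exact: continuous_cos|exact: continuous_sin].
have dc v (x : R^o) : is_derive x v (fun x => cos x : R^o) (v * - sin x).
  by apply: is_derive_dir1; exact: is_derive_cos.
have ds v (x : R^o) : is_derive x v (fun x => sin x : R^o) (v * cos x).
  by apply: is_derive_dir1; exact: is_derive_sin.
split; (split; first by [move=> x _; exact: continuous_cos|move=> x _; exact: continuous_sin]).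
  move=> v; split; first by move=> x _; case: (dc v x).
  apply: (@Sk_ext _ _ _ _ _ (fun x => (v * -1) * sin x)); first exact: openT.
    by move=> x _; case: (dc v x) => _ ->; rewrite -mulrA mulN1r.
  by apply: Sk_M => //; [exact: openT|exact: Sk_cst].
move=> v; split; first by move=> x _; case: (ds v x).
apply: (@Sk_ext _ _ _ _ _ (fun x => v * cos x)); first exact: openT.
  by move=> x _; case: (ds v x) => _ ->.
by apply: Sk_M => //; [exact: openT|exact: Sk_cst].
Qed.

Lemma Sk_sqrt k : Sk k [set x : R^o | 0 < x] (fun x : R^o => Num.sqrt x : R^o).
Proof.
have oW : open [set x : R^o | 0 < x] by exact: open_gt.
apply: (@Sk_ode _ _ (fun x => (2 * Num.sqrt x)^-1)) => //.
move=> j sj; apply: (@Sk_comp1 _ _ _ _ _ _ (fun x => x^-1)) => //; [exact: open_neq0| | |].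
- by move=> x /= x0; rewrite mulf_neq0 // gt_eqF // sqrtr_gt0.
- exact: Sk_inv.
- by apply: Sk_M => //; exact: Sk_cst.
Qed.

(** The powers of 1/x are included because the family is then closed, up to linear combinations,
    under differentiation. *)
Definition flat (n : nat) (x : R^o) : R^o :=
  if x <= 0 then 0 else (x^-1) ^+ n * expR (- x^-1).

(** With y = 1/x, exp(y) is the (n+2)-nd power of exp(y/(n+2)) >= y/(n+2); n of the factors absorb
    x^(-n) and two remain. The quadratic bound makes the difference quotient at 0 vanish. *)
Lemma flat_bound n : exists C : R, forall x, `|flat n x| <= C * x ^+ 2.
Proof.
exists (n.+2%:R ^+ n.+2) => x; rewrite /flat; case: ifPn => [_|].
  by rewrite normr0 mulr_ge0 // ?sqr_ge0 // exprn_ge0.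
rewrite -ltNge => x0.
have y0 : 0 < x^-1 by rewrite invr_gt0.
have le1 : (x^-1 / n.+2%:R) ^+ n.+2 <= expR (x^-1).
  rewrite [leRHS](_ : _ = expR (x^-1 / n.+2%:R) ^+ n.+2); last first.
    by rewrite -expRM_natl mulrC divfK.
  apply: lerXn2r; rewrite ?nnegrE ?expR_ge0 ?divr_ge0 ?(ltW y0) //.
  by apply: le_trans (expR_ge1Dx _); rewrite lerDr.
rewrite ger0_norm ?mulr_ge0 ?exprn_ge0 ?expR_ge0 ?(ltW y0) //.
rewrite expRN ler_pdivrMr ?expR_gt0 //.
apply: le_trans (ler_wpM2l _ le1); last by rewrite mulr_ge0 ?sqr_ge0 ?exprn_ge0.
rewrite expr_div_n mulrACA mulrA.
rewrite [_ * x ^+ 2]mulrC -mulrA [X in _ * X]mulrAC divff ?mul1r ?expf_neq0 //.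
by rewrite -(addn2 n) exprD mulrCA -exprMn divff ?expr1n ?mulr1 // lt0r_neq0.
Qed.

Lemma is_derive_flat n (x : R^o) :
  is_derive x 1 (flat n) (flat n.+2 x - n%:R * flat n.+1 x).
Proof.
have [x0|x0|->] := ltgtP x 0.
- rewrite {2 3}/flat ltW // mulr0 subr0.
  apply: near_eq_is_derive (is_derive_cst (0 : R^o) x 1).
  by near=> y; rewrite /flat ifT // ltW //; near: y; exact: lt_nbhsl.
- rewrite {2 3}/flat leNgt x0 /=.
  have : is_derive x 1 (fun y : R^o => (y^-1) ^+ n * expR (- y^-1) : R^o)
     (x^-1 ^+ n.+2 * expR (- x^-1) - n%:R * (x^-1 ^+ n.+1 * expR (- x^-1))).
    have di := is_derive_inv (lt0r_neq0 x0 : (x : R^o) != 0).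
    have de : is_derive x 1 (fun y : R^o => expR (- y^-1) : R^o)
        (expR (- x^-1) * (x^-1 * x^-1)).
      have dN := is_deriveN di; rewrite opprK in dN.
      exact: (@is_derive_comp1 _ _ _ (fun y => expR y) _ _ _ _ dN (is_derive_expR _)).
    have dn := is_derive_pow n di.
    apply: is_derive_eq (is_derive_mul dn de) _.
    by case: n {dn} => [|n]; rewrite /= !exprS -?[n.+1%:R]natr1; ring.
  apply: near_eq_is_derive.
  near=> y; rewrite /flat ifF //; apply/negbTE; rewrite -ltNge.
  by near: y; exact: lt_nbhsr.
have -> : flat n.+2 0 - n%:R * flat n.+1 0 = 0 by rewrite /flat lexx mulr0 subrr.
have [C hC] := flat_bound n.
have f0 : flat n 0 = 0 by rewrite /flat lexx.
have cv : (fun h : R => h^-1 *: ((flat n \o shift 0) (h *: 1) - flat n 0)) @ 0^' --> (0 : R^o).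
  apply/cvgr0Pnorm_le => e e0; near=> h.
  have h0 : h != 0 by near: h; exact: nbhs_dnbhs_neq.
  rewrite /= addr0 [_%:A]mulr1 f0 subr0 normrM normfV.
  rewrite mulrC ler_pdivrMr ?normr_gt0 //.
  apply: le_trans (hC h) _; rewrite -[h ^+ 2]ger0_norm ?sqr_ge0 // normrX expr2 mulrA.
  apply: ler_wpM2r => //.
  have C1 : 0 < `|C| + 1 by rewrite ltr_wpDl.
  apply: (@le_trans _ _ ((`|C| + 1) * `|h|)).
    by apply: ler_wpM2r => //; apply: le_trans (ler_norm _) _; rewrite lerDl.
  rewrite mulrC -ler_pdivlMr //; near: h; apply: dnbhs0_le; exact: divr_gt0.
by split; [apply/cvg_ex; eexists; exact: cv|exact: cvg_lim cv].
Unshelve. all: by end_near. Qed.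

Lemma Sk_flat k n : Sk k setT (flat n).
Proof.
elim: k n => [|k IH] n.
  split=> // x _; apply: differentiable_continuous.
  by apply/derivable1_diffP; case: (is_derive_flat n x).
have dv v x : is_derive x v (flat n) (v * (flat n.+2 x + (- n%:R) * flat n.+1 x)).
  by apply: is_derive_dir1; rewrite mulNr; exact: is_derive_flat.
split; first by move=> x Ux; exact: (Sk_continuous (IH n)).
move=> v; split; first by move=> x _; case: (dv v x).
apply: (@Sk_ext _ _ _ _ _ (fun x => v * (flat n.+2 x + (- n%:R) * flat n.+1 x))).
- exact: openT.
- by move=> x _; case: (dv v x) => _ ->.
apply: Sk_M; [exact: openT|exact: Sk_cst|apply: Sk_D; [exact: openT|exact: IH|]].
by apply: Sk_M; [exact: openT|exact: Sk_cst|exact: IH].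
Qed.

Lemma flat_ge0 n x : 0 <= flat n x.
Proof.
rewrite /flat; case: ifPn => // /negP/negP; rewrite -ltNge => x0.
by rewrite mulr_ge0 ?expR_ge0 // exprn_ge0 // invr_ge0 ltW.
Qed.

Lemma flat_gt0 n x : 0 < x -> 0 < flat n x.
Proof.
by move=> x0; rewrite /flat leNgt x0 /= mulr_gt0 ?expR_gt0 // exprn_gt0 // invr_gt0.
Qed.

Lemma flat_eq0 n x : x <= 0 -> flat n x = 0.
Proof. by rewrite /flat => ->. Qed.

Definition step (x : R^o) : R^o := flat 0 x / (flat 0 x + flat 0 (1 - x)).

Lemma step_den_gt0 x : 0 < flat 0 x + flat 0 (1 - x).
Proof.
have [x0|x0] := ltP 0 x; first by rewrite ltr_pwDl ?flat_gt0 ?flat_ge0.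
by rewrite ltr_wpDl ?flat_ge0 // flat_gt0 // subr_gt0 (le_lt_trans x0).
Qed.

Lemma step_ge0 x : 0 <= step x.
Proof. by rewrite divr_ge0 ?flat_ge0 // ltW ?step_den_gt0. Qed.

Lemma step_le1 x : step x <= 1.
Proof. by rewrite ler_pdivrMr ?step_den_gt0 // mul1r lerDl flat_ge0. Qed.

Lemma step_eq0 x : x <= 0 -> step x = 0.
Proof. by move=> x0; rewrite /step flat_eq0 // mul0r. Qed.

Lemma step_eq1 x : 1 <= x -> step x = 1.
Proof.
move=> x1; rewrite /step [X in _ + X]flat_eq0 ?subr_le0 // addr0 divff //.
by rewrite gt_eqF // flat_gt0 // (lt_le_trans _ x1).
Qed.

Lemma Sk_step k : Sk k setT step.
Proof.
have oT : open [set: R^o] by exact: openT.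
have s1 : Sk k setT (fun x : R^o => flat 0 (1 - x)).
  apply: (@Sk_comp1 _ _ _ _ setT (fun x : R^o => 1 - x)) => //; first exact: Sk_flat.
  apply: (@Sk_ext _ _ _ _ _ (fun x : R^o => 1 + (-1) * x : R^o)) => //.
    by move=> x _; rewrite mulN1r.
  apply: Sk_D => //; first exact: Sk_cst.
  apply: Sk_M => //; first exact: Sk_cst.
  apply: (@Sk_lin _ _ _ _ _ idfun); exact: (fun x => cvg_id).
apply: Sk_M => //; first exact: Sk_flat.
apply: (@Sk_comp1 _ _ _ _ _ _ (fun x => x^-1)) => //; first exact: open_neq0.
- by move=> x _; rewrite /= gt_eqF // step_den_gt0.
- exact: Sk_inv.
by apply: Sk_D => //; exact: Sk_flat.
Qed.

(** In the quotient rule the terms with a product of the same function and its derivative cancel,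
    and the remaining numerator is a sum of products of values of [flat]. *)
Lemma derive_step_ge0 (x : R^o) : 0 <= 'D_1 step x.
Proof.
have df y : is_derive (y : R^o) 1 (flat 0) (flat 2 y).
  by apply: is_derive_eq (is_derive_flat 0 y) _; rewrite mul0r subr0.
have dg : is_derive x 1 (fun y : R^o => flat 0 (1 - y)) (flat 2 (1 - x) * -1).
  have dN := is_deriveB (is_derive_cst (1 : R^o) x 1) (is_derive_id x 1).
  rewrite sub0r in dN; exact: (@is_derive_comp1 _ _ _ (flat 0) _ _ _ _ dN (df _)).
have dd := is_deriveD (df x) dg.
have d0 := step_den_gt0 x.
have dV := @is_derive_comp1 _ _ _ (fun y => y^-1) _ _ _ _ dd
  (is_derive_inv (lt0r_neq0 d0 : (_ : R^o) != 0)).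
have [_ ->] := is_derive_mul (df x) dV.
rewrite /= !fctE.
set a := flat 0 x in d0 *; set b := flat 0 (1 - x) in d0 *.
set a' := flat 2 x; set b' := flat 2 (1 - x).
have -> : a * (- ((a + b)^-1 / (a + b)) * (a' + b' * -1)) + (a + b)^-1 * a'
  = (a' * b + a * b') / (a + b) ^+ 2 by field; exact: lt0r_neq0.
by rewrite divr_ge0 ?sqr_ge0 // addr_ge0 // mulr_ge0 // flat_ge0.
Qed.

End ElementaryFunctions.

(** * Total differentiability and the chain rule in several variables *)

Section Chain.
Context {R : realType}.
Implicit Types E F G : normedModType R.

Lemma Sk_sum E F k (U : set E) (I : Type) (r : seq I) (P : pred I) (f : I -> E -> F) :
  open U -> (forall i, P i -> Sk k U (f i)) ->
  Sk k U (fun x => \sum_(i <- r | P i) f i x).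
Proof.
move=> oU sf; elim: r => [|i r IH].
  by under eq_fun do rewrite big_nil; exact: Sk_cst.
under eq_fun do rewrite big_cons; case Pi: (P i) => //.
by apply: Sk_D => //; exact: sf.
Qed.

Lemma is_derive_line E F (f : E -> F) (x v : E) (t : R) a :
  is_derive (x + t *: v) v f a <->
  is_derive (t : R^o) 1 (fun s : R^o => f (x + s *: v)) a.
Proof.
have e : (fun h : R => h^-1 *: ((f \o shift (x + t *: v)) (h *: v) - f (x + t *: v)))
  = (fun h : R => h^-1 *: (((fun s : R^o => f (x + s *: v)) \o shift (t : R^o)) (h *: 1)
       - f (x + t *: v))).
  apply/funext => h /=; congr (_ *: (f _ - _)).
  by rewrite [_%:A]mulr1 scalerDl addrCA.
split=> [[d1 d2]|[d1 d2]]; split.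
- by move: d1; rewrite /derivable e.
- by move: d2; rewrite /derive e.
- by move: d1; rewrite /derivable -e.
- by move: d2; rewrite /derive -e.
Qed.

(** The inner map is only derivable in the direction v; total differentiability of the outer map
    makes up for it, after restriction to the line through x. *)
Lemma is_derive_chain E F G (f : F -> G) (g : E -> F) (x v : E) dg :
  differentiable f (g x) -> is_derive x v g dg ->
  is_derive x v (fun y => f (g y)) ('D_dg f (g x)).
Proof.
move=> df dgx.
have e0 : x = x + (0 : R) *: v by rewrite scale0r addr0.
pose c := fun s : R^o => g (x + s *: v).
have c0 : c 0 = g x by rewrite /c -e0.
have dc : is_derive (0 : R^o) 1 c dg.
  by apply: (is_derive_line g x v 0 dg).1; rewrite -e0.
have [dc1 dcE] := dc.
have dc2 : differentiable c (0 : R^o) by exact: (derivable1_diffP _ _).1 dc1.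
have df2 : differentiable f (c 0) by rewrite c0.
have dfc := differentiable_comp dc2 df2.
rewrite [X in is_derive X]e0; apply: (is_derive_line (f \o g) x v 0 _).2.
split; first exact: (@diff_derivable _ _ _ (f \o c) 0 1 dfc).
rewrite (@deriveE _ _ _ (f \o c) 0 1 dfc) (diff_comp dc2 df2) /=.
by rewrite -(@deriveE _ _ _ c 0 1 dc2) dcE c0 -deriveE.
Qed.

Lemma is_derive_scale E (f : E -> R^o) (x v : E) (c a : R) :
  is_derive x v f a -> is_derive x (c *: v) f (c * a).
Proof.
move=> d; have e0 w : x = x + (0 : R) *: w by rewrite scale0r addr0.
rewrite (e0 v) in d; have {}d := (is_derive_line f x v 0 a).1 d.
rewrite (e0 (c *: v)); apply: (is_derive_line f x (c *: v) 0 _).2.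
rewrite (_ : (fun s : R^o => _) = (fun s : R^o => (fun s : R^o => f (x + s *: v)) (c * s))).
  have dm := is_derive_mul (is_derive_cst (c : R^o) (0 : R^o) 1) (is_derive_id (0 : R^o) 1).
  rewrite /= mulr1 mul0r addr0 in dm.
  have d' : is_derive (c * 0 : R^o) 1 (fun s : R^o => f (x + s *: v)) a by rewrite mulr0.
  by rewrite mulrC; exact: (is_derive_comp1 dm d').
by apply/funext => s /=; rewrite scalerA mulrC.
Qed.

Lemma MVT_line E (f : E -> R^o) (x v : E) :
  (forall t : R, 0 <= t <= 1 -> derivable f (x + t *: v) v) ->
  exists2 t : R, 0 <= t <= 1 & f (x + v) - f x = 'D_v f (x + t *: v).
Proof.
move=> df; pose phi := fun s : R^o => f (x + s *: v).
have dphi t : 0 <= t <= 1 -> is_derive (t : R^o) 1 phi ('D_v f (x + t *: v)).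
  by move=> t01; apply: (is_derive_line f x v t _).1; apply: derivableP; exact: df.
have [||t t01 E0] := @MVT_segment R phi (fun t => 'D_v f (x + t *: v)) 0 1 ler01.
- by move=> t; rewrite in_itv /= => /andP[t0 t1]; apply: dphi; rewrite !ltW.
- apply: derivable_within_continuous => t; rewrite in_itv /= => t01.
  by case: (dphi t t01).
exists t; first by move: t01; rewrite in_itv.
by move: E0; rewrite /phi scale1r scale0r addr0 subr0 mulr1.
Qed.

Lemma rV_normP n (x : 'rV[R]_n) (e : R) : 0 <= e ->
  `|x| <= e <-> forall i, `|x ord0 i| <= e.
Proof.
move=> e0; split=> [xe i|xe].
  apply: le_trans xe; rewrite [leRHS]/Num.Def.normr /= mx_normrE.
  exact: (le_bigmax _ _ (ord0, i)).
rewrite [leLHS]/Num.Def.normr /= mx_normrE; apply: bigmax_le => // -[i j] _ /=.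
by rewrite (ord1 i).
Qed.

Lemma rV_coord_norm n (x : 'rV[R]_n) i : `|x ord0 i| <= `|x|.
Proof. by have /(_ i) := (@rV_normP _ x `|x| (normr_ge0 _)).1 (lexx _). Qed.

Definition head_row n (h : 'rV[R]_n) k : 'rV[R]_n :=
  \row_i if (i < k)%N then h ord0 i else 0.

(** The increment f(x + h) - f(x) is telescoped along the coordinate path given by [head_row]; each
    step is a mean value in one basis direction, controlled by continuity of the partial
    derivatives. *)
Lemma smooth_differentiable n (f : 'rV[R]_n -> R^o) (U : set 'rV[R]_n) x :
  open U -> U x -> Sk 1 U f -> differentiable f x.
Proof.
move=> oU Ux sf.
pose e_ i : 'rV[R]_n := delta_mx ord0 i.
pose L (h : 'rV[R]_n) : R^o := \sum_i h ord0 i * 'D_(e_ i) f x.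
have linL : linear L.
  move=> a u v; rewrite /L scaler_sumr -big_split; apply: eq_bigr => i _ /=.
  by rewrite !mxE mulrDl -mulrA.
pose Llin : {linear 'rV[R]_n -> R^o} := HB.pack L (GRing.isLinear.Build _ _ _ _ _ linL).
have cL : continuous Llin.
  have sL : Sk 0 setT L.
    apply: Sk_sum; first exact: openT.
    move=> i _; apply: Sk_M; [exact: openT| |exact: Sk_cst].
    by split=> // z _; exact: rV_coord_continuous.
  by move=> y; exact: (Sk_continuous sL).
have dL := @diff_unique R 'rV[R]_n R^o f Llin x cL.
(* The little-o statement to be proved is the premise of [dL]; its type is read off rather than
   written out. *)
have dfL : ltac:(match type of dL with ?A -> _ => exact A end).
  apply/eqaddoP => e e0.
  have n0 : 0 < n.+1%:R :> R by rewrite ltr0n.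
  (* There are n coordinate steps, each with error at most d |h|; dividing by n + 1 also covers n =
     0. *)
  pose d := e / n.+1%:R.
  have d0 : 0 < d by rewrite divr_gt0.
  have nD : \forall y \near x, U y /\ forall i, `|'D_(e_ i) f y - 'D_(e_ i) f x| <= d.
    near=> y; split.
      by near: y; exact: open_nbhs_nbhs.
    near: y; apply: filter_forall => i.
    have := Sk_continuous (Sk_derive (e_ i) sf) Ux.
    move=> /cvgrPdist_le/(_ _ d0); apply: filterS => y; by rewrite distrC.
  have [r /= r0 hr] := (nbhs_ballP _ _).1 nD.
  have nr : \forall h \near nbhs (0 : 'rV[R]_n), `|h| < r.
    by apply/nbhs_ballP; exists r => // h; rewrite -ball_normE /= sub0r normrN.
  apply: filterS nr => h hr'.
  have stepk k : (k <= n)%N ->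
    `|f (x + head_row h k) - f x - \sum_(i < n | (i < k)%N) h ord0 i * 'D_(e_ i) f x|
      <= k%:R * (d * `|h|).
    elim: k => [|k IH] kn.
      rewrite (_ : head_row h 0 = 0) ?addr0; last by apply/rowP => i; rewrite !mxE.
      by rewrite big_pred0 // !subrr normr0 mul0r.
    pose i0 := Ordinal kn.
    have hS : head_row h k.+1 = head_row h k + h ord0 i0 *: e_ i0.
      apply/rowP => i; rewrite !mxE /= ltnS.
      have [->|ni] := eqVneq i i0; first by rewrite /= leqnn ltnn add0r mulr1.
      rewrite mulr0 addr0 leq_eqVlt (_ : (i == k :> nat) = false) //.
      by apply/negbTE; apply: contra ni => /eqP ik; apply/eqP/val_inj.
    have inb (t : R) : 0 <= t <= 1 -> ball x r (x + head_row h k + t *: (h ord0 i0 *: e_ i0)).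
      move=> /andP[t0 t1]; rewrite -ball_normE /= -addrA opprD addNKr normrN.
      apply: le_lt_trans hr'; apply/rV_normP => // i; rewrite !mxE /=.
      have [->|ni] := eqVneq i i0.
        rewrite /= ltnn add0r mulr1 normrM (ger0_norm t0).
        by apply: le_trans (rV_coord_norm h i0); rewrite ler_piMl.
      rewrite mulr0 mulr0 addr0; case: ifP => _; last by rewrite normr0.
      exact: rV_coord_norm.
    have [|t t01 Et] := @MVT_line _ f (x + head_row h k) (h ord0 i0 *: e_ i0).
      move=> t t01; have [Uy _] := hr _ (inb t t01).
      by have [] := is_derive_scale (h ord0 i0) (derivableP (Sk_derivable (v := e_ i0) sf Uy)).
    have [Uy Dy] := hr _ (inb t t01).
    have [_ Ds] := is_derive_scale (h ord0 i0) (derivableP (Sk_derivable (v := e_ i0) sf Uy)).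
    rewrite Ds in Et.
    rewrite (bigD1 i0) //= hS addrA.
    rewrite (eq_bigl (fun i : 'I_n => (i < k)%N)); last first.
      move=> i; rewrite ltnS leq_eqVlt.
      have [->|ni] := eqVneq i i0; first by rewrite /= ltnn andbF.
      rewrite andbT (_ : (i == k :> nat) = false) //.
      by apply/negbTE; apply: contra ni => /eqP ik; apply/eqP/val_inj.
    have -> : f (x + head_row h k + h ord0 i0 *: e_ i0) - f x
       - (h ord0 i0 * 'D_(e_ i0) f x + \sum_(i < n | (i < k)%N) h ord0 i * 'D_(e_ i) f x)
      = (f (x + head_row h k) - f x - \sum_(i < n | (i < k)%N) h ord0 i * 'D_(e_ i) f x)
       + h ord0 i0 * ('D_(e_ i0) f (x + head_row h k + t *: (h ord0 i0 *: e_ i0)) - 'D_(e_ i0) f x).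
      by move: Et; rewrite mulrBr => <-; ring.
    apply: le_trans (ler_normD _ _) _.
    rewrite -natr1 mulrDl mul1r; apply: lerD; first by apply: IH; exact: ltnW.
    rewrite normrM mulrC; apply: ler_pM => //; exact: rV_coord_norm.
  have := stepk n (leqnn n).
  rewrite (_ : head_row h n = h); last by apply/rowP => i; rewrite !mxE ltn_ord.
  rewrite (eq_bigl xpredT); last by move=> i; rewrite ltn_ord.
  move=> H; have -> : (f \o shift x - (cst (f x) + Llin)) h
      = f (x + h) - f x - \sum_i h ord0 i * 'D_(e_ i) f x.
    by rewrite !fctE /= opprD addrA [h + x]addrC.
  apply: le_trans H _.
  rewrite mulrA; apply: ler_wpM2r => //; rewrite /d mulrCA ler_piMr ?ltW //.
  by rewrite ltr_pdivrMr // mul1r ltr_nat.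
have dE := dL dfL.
by apply/diff_locallyP; rewrite dE.
Unshelve. all: by end_near. Qed.

Lemma derive_sum_coord n (f : 'rV[R]_n -> R^o) x v : differentiable f x ->
  'D_v f x = \sum_i v ord0 i * 'D_(delta_mx ord0 i) f x.
Proof.
move=> df; rewrite deriveE // {1}(row_sum_delta v) linear_sum.
by apply: eq_bigr => i _; rewrite linearZ /= -deriveE.
Qed.

(** All orders are assumed for f, so that the induction on k can pass to its partial derivatives
    without losing an order; the middle space is finite-dimensional because the chain rule uses
    total differentiability. *)
Lemma Sk_comp E n k (U : set E) (W : set 'rV[R]_n) (f : 'rV[R]_n -> R^o)
    (g : E -> 'rV[R]_n) : open U -> open W -> (forall x, U x -> W (g x)) ->
  (forall k, Sk k W f) -> Sk k U g -> Sk k U (fun x => f (g x)).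
Proof.
move=> oU oW UW; elim: k f => [|k IH] f sf sg.
  split=> // x Ux; apply: continuous_comp; first exact: (Sk_continuous sg).
  by apply: (Sk_continuous (sf 0%N)); exact: UW.
have df x : U x -> differentiable f (g x).
  by move=> Ux; exact: (smooth_differentiable oW (UW x Ux) (sf 1%N)).
have dcomp v x : U x -> is_derive x v (fun x => f (g x))
    (\sum_i 'D_v g x ord0 i * 'D_(delta_mx ord0 i) f (g x)).
  move=> Ux; rewrite -derive_sum_coord; last exact: df.
  apply: is_derive_chain; first exact: df.
  by apply: derivableP; exact: (Sk_derivable sg).
split; first by move=> x Ux; exact: (Sk_continuous (IH f sf (SkW sg)) Ux).
move=> v; split; first by move=> x Ux; case: (dcomp v x Ux).
apply: (@Sk_ext _ _ _ _ _
  (fun x => \sum_i 'D_v g x ord0 i * 'D_(delta_mx ord0 i) f (g x))) => //.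
  by move=> x Ux; case: (dcomp v x Ux) => _ ->.
apply: Sk_sum => // i _; apply: Sk_M => //.
  by apply: Sk_coord => //; exact: Sk_derive.
by apply: (IH (fun y => 'D_(delta_mx ord0 i) f y)); [move=> j; exact: Sk_derive|exact: SkW].
Qed.

End Chain.

(** * Germs of smooth maps *)

Section Germs.
Context {R : realType}.
Implicit Types E F G : normedModType R.

(** Smoothness is handled germ by germ, because the profiles below have different formulas on
    different ranges. *)
Definition smooth_at E F (x : E) (f : E -> F) :=
  exists U : set E, [/\ open U, U x & forall k, Sk k U f].

(** The neighbourhood is the union of all open sets on which f is smooth, so no set has to be chosen
    for each point. *)
Lemma smooth_near_at E F (A : set E) (f : E -> F) :
  (forall x, A x -> smooth_at x f) -> smooth_near A f.
Proof.
move=> sf; pose D := {U : set E | open U /\ forall k, Sk k U f}.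
exists [set x | exists i : D, (sval i) x]; split.
- rewrite (_ : [set x | _] = \bigcup_(i : D) sval i); last first.
    by apply/seteqP; split=> [x [i hi]|x [i _ hi]]; exists i.
  by apply: bigcup_open => -[U []].
- by move=> x /sf[U [oU Ux sU]]; exists (exist _ U (conj oU sU)).
- apply/Sk_smooth => k; apply: Sk_bigcup => -[U [oU sU]] /=; exact: sU.
Qed.

Lemma smooth_near_atP E F (A : set E) (f : E -> F) x :
  smooth_near A f -> A x -> smooth_at x f.
Proof. by move=> [U [oU sU /Sk_smooth sf]] Ax; exists U; split=> //; exact: sU. Qed.

Lemma smooth_on_atP E F (U : set E) (f : E -> F) x : open U -> smooth_on U f -> U x ->
  smooth_at x f.
Proof. by move=> oU /Sk_smooth sf Ux; exists U. Qed.

Lemma smooth_on_at E F (U : set E) (f : E -> F) :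
  (forall x, U x -> smooth_at x f) -> smooth_on U f.
Proof.
move=> /smooth_near_at[W [oW sUW sf]].
by apply/Sk_smooth => k; apply: Sk_sub sUW _; move/Sk_smooth : sf.
Qed.

Lemma smooth_at_near E F (x : E) (f : E -> F) : smooth_at x f ->
  \forall y \near x, smooth_at y f.
Proof.
by move=> [U [oU Ux sf]]; apply: (open_near oU Ux) => y Uy; exists U.
Qed.

Lemma smooth_at_ext E F (x : E) (f g : E -> F) :
  (\forall y \near x, f y = g y) -> smooth_at x f -> smooth_at x g.
Proof.
move=> fg [U [oU Ux sf]].
have : nbhs x [set y | f y = g y] by [].
rewrite nbhsE => -[W [oW Wx] sW].
exists (U `&` W); split; [exact: openI|by split|move=> k].
apply: (@Sk_ext _ _ _ _ _ f); first exact: openI.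
  by move=> y [_ /sW].
by apply: Sk_sub (sf k) => y [].
Qed.

Lemma smooth_at_derivable E F (x v : E) (f : E -> F) : smooth_at x f -> derivable f x v.
Proof. by move=> [U [oU Ux sf]]; exact: (Sk_derivable (sf 1%N)). Qed.

Lemma smooth_at_continuous E F (x : E) (f : E -> F) : smooth_at x f -> {for x, continuous f}.
Proof. by move=> [U [oU Ux sf]]; exact: (Sk_continuous (sf 1%N)). Qed.

Lemma smooth_at_derive E F (x v : E) (f : E -> F) :
  smooth_at x f -> smooth_at x (fun y => 'D_v f y).
Proof. by move=> [U [oU Ux sf]]; exists U; split=> // k; exact: Sk_derive. Qed.

Lemma smooth_at_differentiable n (x : 'rV[R]_n) (f : 'rV[R]_n -> R^o) :
  smooth_at x f -> differentiable f x.
Proof. by move=> [U [oU Ux sf]]; exact: (smooth_differentiable oU Ux). Qed.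

Lemma smooth_at_cst E F (x : E) (c : F) : smooth_at x (fun _ => c).
Proof. by exists setT; split=> [||k]; [exact: openT| |exact: Sk_cst]. Qed.

Lemma smooth_at_lin E F (x : E) (f : {linear E -> F}) : continuous f -> smooth_at x f.
Proof. by exists setT; split=> [||k]; [exact: openT| |exact: Sk_lin]. Qed.

Lemma smooth_at_id E (x : E) : smooth_at x id.
Proof. by apply: (@smooth_at_lin _ _ _ idfun) => y; exact: cvg_id. Qed.

Lemma smooth_atD E F (x : E) (f g : E -> F) : smooth_at x f -> smooth_at x g ->
  smooth_at x (fun y => f y + g y).
Proof.
move=> [U [oU Ux sf]] [W [oW Wx sg]]; exists (U `&` W); split=> [||k]; first exact: openI.
  by [].
apply: Sk_D; first exact: openI.
  by apply: Sk_sub (sf k) => y [].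
by apply: Sk_sub (sg k) => y [].
Qed.

Lemma smooth_atM E (x : E) (f g : E -> R^o) : smooth_at x f -> smooth_at x g ->
  smooth_at x (fun y => f y * g y : R^o).
Proof.
move=> [U [oU Ux sf]] [W [oW Wx sg]]; exists (U `&` W); split=> [||k]; first exact: openI.
  by [].
apply: Sk_M; first exact: openI.
  by apply: Sk_sub (sf k) => y [].
by apply: Sk_sub (sg k) => y [].
Qed.

Lemma smooth_at_pair E F G (x : E) (f : E -> F) (g : E -> G) :
  smooth_at x f -> smooth_at x g -> smooth_at x (fun y => (f y, g y)).
Proof.
move=> [U [oU Ux sf]] [W [oW Wx sg]]; exists (U `&` W); split=> [||k]; first exact: openI.
  by [].
apply: Sk_pair; first exact: openI.
  by apply: Sk_sub (sf k) => y [].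
by apply: Sk_sub (sg k) => y [].
Qed.

Lemma smooth_at_preimage_open E F (x : E) (f : E -> F) (W : set F) : smooth_at x f ->
  open W -> W (f x) -> exists U, [/\ open U, U x, forall k, Sk k U f &
    forall y, U y -> W (f y)].
Proof.
move=> [U [oU Ux sf]] oW Wfx.
exists (U `&` f @^-1` W); split=> //; last by move=> y [].
  rewrite openE => y [Uy Wy]; rewrite /interior.
  apply: filterI; first exact: open_nbhs_nbhs.
  apply: (Sk_continuous (sf 0%N) Uy); exact: open_nbhs_nbhs.
by move=> k; apply: Sk_sub (sf k) => y [].
Qed.

Lemma smooth_at_comp1 E (x : E) (f : E -> R^o) (phi : R^o -> R^o) :
  smooth_at (f x) phi -> smooth_at x f -> smooth_at x (fun y => phi (f y)).
Proof.
move=> [W [oW Wx sp]] sf.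
have [U [oU Ux sU UW]] := smooth_at_preimage_open sf oW Wx.
by exists U; split=> // k; apply: (Sk_comp1 oU oW UW).
Qed.

Lemma smooth_at_comp E n (x : E) (g : E -> 'rV[R]_n) (f : 'rV[R]_n -> R^o) :
  smooth_at (g x) f -> smooth_at x g -> smooth_at x (fun y => f (g y)).
Proof.
move=> [W [oW Wx sf]] sg.
have [U [oU Ux sU UW]] := smooth_at_preimage_open sg oW Wx.
by exists U; split=> // k; apply: (Sk_comp oU oW UW).
Qed.

Lemma smooth_at_rV E n (x : E) (f : E -> 'rV[R]_n) :
  smooth_at x f <-> forall j, smooth_at x (fun y => f y ord0 j : R^o).
Proof.
split=> [[U [oU Ux sf]] j|sf].
  by exists U; split=> // k; exact: Sk_coord.
have /choice[U hU] : forall j, exists U : set E,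
  [/\ open U, U x & forall k, Sk k U (fun y => f y ord0 j : R^o)] by exact: sf.
pose W := \bigcap_(j in [set: 'I_n]) U j.
have oW : open W.
  rewrite openE => y Wy; rewrite /interior.
  have : \forall z \near y, forall j, U j z.
    by apply: filter_forall => j; have [oU _ _] := hU j; apply: open_nbhs_nbhs; split=> //; exact: Wy.
  by apply: filterS => z Uz j _; exact: Uz.
exists W; split=> //; first by move=> j _; have [] := hU j.
move=> k; apply: Sk_rV => // j; have [_ _ s] := hU j.
by apply: Sk_sub (s k) => y; exact.
Qed.

End Germs.

(** * Rules for germs and the inverse of a monotone function *)

Section SmoothOperations.
Context {R : realType}.
Implicit Types E F G : normedModType R.

Lemma is_derive_fst E F G (f : E -> F * G) (x v : E) df :
  is_derive x v f df -> is_derive x v (fun y => (f y).1) df.1.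
Proof.
move=> d; have dfst : differentiable (@fst F G) (f x).
  by apply: (@linear_differentiable _ _ _ (@fst F G)) => z; exact: cvg_fst.
have := is_derive_chain dfst d.
by rewrite deriveE // (@diff_lin _ _ _ (@fst F G)) // => z; exact: cvg_fst.
Qed.

Lemma is_derive_snd E F G (f : E -> F * G) (x v : E) df :
  is_derive x v f df -> is_derive x v (fun y => (f y).2) df.2.
Proof.
move=> d; have dsnd : differentiable (@snd F G) (f x).
  by apply: (@linear_differentiable _ _ _ (@snd F G)) => z; exact: cvg_snd.
have := is_derive_chain dsnd d.
by rewrite deriveE // (@diff_lin _ _ _ (@snd F G)) // => z; exact: cvg_snd.
Qed.

Lemma smooth_at_fst E F G (x : E) (f : E -> F * G) :
  smooth_at x f -> smooth_at x (fun y => (f y).1).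
Proof.
move=> [U [oU Ux sf]]; exists U; split=> // k.
have {sf} := sf k; elim: k f => [|k IH] f sf.
  split=> // y Uy; apply: (@continuous_comp _ _ _ f fst); first exact: (Sk_continuous sf).
  exact: cvg_fst.
have d v y : U y -> is_derive y v (fun y => (f y).1) ('D_v f y).1.
  by move=> Uy; apply: is_derive_fst; apply: derivableP; exact: (Sk_derivable sf).
split; first by move=> y Uy; exact: (Sk_continuous (IH f (SkW sf)) Uy).
move=> v; split; first by move=> y Uy; case: (d v y Uy).
apply: (@Sk_ext _ _ _ _ _ (fun y => ('D_v f y).1)) => //.
  by move=> y Uy; case: (d v y Uy) => _ ->.
by apply: IH; exact: Sk_derive.
Qed.

Lemma smooth_at_snd E F G (x : E) (f : E -> F * G) :
  smooth_at x f -> smooth_at x (fun y => (f y).2).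
Proof.
move=> [U [oU Ux sf]]; exists U; split=> // k.
have {sf} := sf k; elim: k f => [|k IH] f sf.
  split=> // y Uy; apply: (@continuous_comp _ _ _ f snd); first exact: (Sk_continuous sf).
  exact: cvg_snd.
have d v y : U y -> is_derive y v (fun y => (f y).2) ('D_v f y).2.
  by move=> Uy; apply: is_derive_snd; apply: derivableP; exact: (Sk_derivable sf).
split; first by move=> y Uy; exact: (Sk_continuous (IH f (SkW sf)) Uy).
move=> v; split; first by move=> y Uy; case: (d v y Uy).
apply: (@Sk_ext _ _ _ _ _ (fun y => ('D_v f y).2)) => //.
  by move=> y Uy; case: (d v y Uy) => _ ->.
by apply: IH; exact: Sk_derive.
Qed.

Lemma smooth_atN E (x : E) (f : E -> R^o) : smooth_at x f -> smooth_at x (fun y => - f y : R^o).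
Proof.
move=> sf; rewrite (_ : (fun y => _) = fun y => (-1) * f y : R^o).
  by apply: smooth_atM => //; exact: smooth_at_cst.
by apply/funext => y; rewrite mulN1r.
Qed.

Lemma smooth_atB E (x : E) (f g : E -> R^o) : smooth_at x f -> smooth_at x g ->
  smooth_at x (fun y => f y - g y : R^o).
Proof. by move=> sf sg; apply: smooth_atD => //; exact: smooth_atN. Qed.

Lemma smooth_atV E (x : E) (f : E -> R^o) : f x != 0 -> smooth_at x f ->
  smooth_at x (fun y => (f y)^-1 : R^o).
Proof.
move=> f0; apply: (@smooth_at_comp1 _ _ _ _ (fun y : R^o => y^-1 : R^o)).
by exists [set y : R^o | y != 0]; split=> [||k]; [exact: open_neq0|exact: f0|exact: Sk_inv].
Qed.

Lemma smooth_at_sqrt E (x : E) (f : E -> R^o) : 0 < f x -> smooth_at x f ->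
  smooth_at x (fun y => Num.sqrt (f y) : R^o).
Proof.
move=> f0; apply: (@smooth_at_comp1 _ _ _ _ (fun y : R^o => Num.sqrt y : R^o)).
by exists [set y : R^o | 0 < y]; split=> [||k]; [exact: open_gt|exact: f0|exact: Sk_sqrt].
Qed.

Lemma smooth_at_expR E (x : E) (f : E -> R^o) : smooth_at x f ->
  smooth_at x (fun y => expR (f y) : R^o).
Proof.
apply: (@smooth_at_comp1 _ _ _ _ (fun y : R^o => expR y : R^o)).
by exists setT; split=> [||k]; [exact: openT|by []|exact: Sk_expR].
Qed.

Lemma smooth_at_cos E (x : E) (f : E -> R^o) : smooth_at x f ->
  smooth_at x (fun y => cos (f y) : R^o).
Proof.
apply: (@smooth_at_comp1 _ _ _ _ (fun y : R^o => cos y : R^o)).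
by exists setT; split=> [||k]; [exact: openT|by []|case: (@Sk_cos_sin R k)].
Qed.

Lemma smooth_at_sin E (x : E) (f : E -> R^o) : smooth_at x f ->
  smooth_at x (fun y => sin (f y) : R^o).
Proof.
apply: (@smooth_at_comp1 _ _ _ _ (fun y : R^o => sin y : R^o)).
by exists setT; split=> [||k]; [exact: openT|by []|case: (@Sk_cos_sin R k)].
Qed.

Lemma smooth_at_step E (x : E) (f : E -> R^o) : smooth_at x f ->
  smooth_at x (fun y => step (f y) : R^o).
Proof.
apply: (@smooth_at_comp1 _ _ _ _ step).
by exists setT; split=> [||k]; [exact: openT|by []|exact: Sk_step].
Qed.

Lemma smooth_at_ln E (x : E) (f : E -> R^o) : 0 < f x -> smooth_at x f ->
  smooth_at x (fun y => ln (f y) : R^o).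
Proof.
move=> f0; apply: (@smooth_at_comp1 _ _ _ _ (fun y : R^o => ln y : R^o)).
exists [set y : R^o | 0 < y]; split=> [||]; [exact: open_gt|exact: f0|].
apply: (@Sk_ode _ _ _ (fun y => y^-1)); first exact: open_gt.
move=> k _; apply: (@Sk_sub _ _ _ _ [set y : R^o | y != 0]); last exact: Sk_inv.
by move=> y /= y0; rewrite gt_eqF.
Qed.

Lemma smooth_atX E (x : E) (f : E -> R^o) n : smooth_at x f ->
  smooth_at x (fun y => f y ^+ n : R^o).
Proof.
move=> sf; elim: n => [|n IH].
  by under eq_fun do rewrite expr0; exact: smooth_at_cst.
by under eq_fun do rewrite exprS; exact: smooth_atM.
Qed.

Lemma smooth_at_sum E F (x : E) (I : Type) (r : seq I) (P : pred I) (f : I -> E -> F) :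
  (forall i, P i -> smooth_at x (f i)) ->
  smooth_at x (fun y => \sum_(i <- r | P i) f i y).
Proof.
move=> sf; elim: r => [|i r IH].
  by under eq_fun do rewrite big_nil; exact: smooth_at_cst.
under eq_fun do rewrite big_cons; case Pi: (P i) => //.
by apply: smooth_atD => //; exact: sf.
Qed.

Lemma smooth_atZ E n (x : E) (c : E -> R^o) (f : E -> 'rV[R]_n) :
  smooth_at x c -> smooth_at x f -> smooth_at x (fun y => c y *: f y).
Proof.
move=> sc /smooth_at_rV sf; apply/smooth_at_rV => j.
by under eq_fun do rewrite mxE; exact: smooth_atM.
Qed.

Definition dot n (u v : 'rV[R]_n) : R := \sum_j u ord0 j * v ord0 j.

Lemma dotC n (u v : 'rV[R]_n) : dot u v = dot v u.
Proof. by apply: eq_bigr => j _; rewrite mulrC. Qed.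

Lemma dotDl n (u v w : 'rV[R]_n) : dot (u + v) w = dot u w + dot v w.
Proof. by rewrite -big_split; apply: eq_bigr => j _; rewrite mxE mulrDl. Qed.

Lemma dotZl n c (u w : 'rV[R]_n) : dot (c *: u) w = c * dot u w.
Proof. by rewrite mulr_sumr; apply: eq_bigr => j _; rewrite mxE mulrA. Qed.

Lemma dotDr n (u v w : 'rV[R]_n) : dot w (u + v) = dot w u + dot w v.
Proof. by rewrite dotC dotDl !(dotC w). Qed.

Lemma dotZr n c (u w : 'rV[R]_n) : dot w (c *: u) = c * dot w u.
Proof. by rewrite dotC dotZl dotC. Qed.

Lemma dotNl n (u v : 'rV[R]_n) : dot (- u) v = - dot u v.
Proof. by rewrite -scaleN1r dotZl mulN1r. Qed.

Lemma dotNr n (u v : 'rV[R]_n) : dot u (- v) = - dot u v.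
Proof. by rewrite dotC dotNl dotC. Qed.

Lemma dot0l n (u : 'rV[R]_n) : dot 0 u = 0.
Proof. by rewrite -(scale0r u) dotZl mul0r. Qed.

Lemma dot0r n (u : 'rV[R]_n) : dot u 0 = 0.
Proof. by rewrite dotC dot0l. Qed.

Lemma dot_ge0 n (u : 'rV[R]_n) : 0 <= dot u u.
Proof. by apply: sumr_ge0 => j _; rewrite -expr2 sqr_ge0. Qed.

Lemma dot_eq0 n (u : 'rV[R]_n) : (dot u u == 0) = (u == 0).
Proof.
apply/eqP/eqP => [|->]; last by rewrite dot0l.
move/eqP; rewrite psumr_eq0; last by move=> j _; rewrite -expr2 sqr_ge0.
by move=> /allP h; apply/rowP => j; rewrite mxE;
  apply/eqP; have := h j (mem_index_enum _); rewrite /= -expr2 sqrf_eq0.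
Qed.

Lemma dot_gt0 n (u : 'rV[R]_n) : (0 < dot u u) = (u != 0).
Proof. by rewrite lt_neqAle dot_ge0 andbT eq_sym dot_eq0. Qed.

Definition dotE := (dotDl, dotDr, dotZl, dotZr, dotNl, dotNr, dot0l, dot0r).

Lemma smooth_at_dot E n (x : E) (f g : E -> 'rV[R]_n) :
  smooth_at x f -> smooth_at x g -> smooth_at x (fun y => dot (f y) (g y) : R^o).
Proof.
move=> /smooth_at_rV sf /smooth_at_rV sg; apply: smooth_at_sum => j _.
exact: smooth_atM.
Qed.

Lemma is_derive_bigsum E F (x v : E) (I : Type) (r : seq I) (P : pred I)
    (f : I -> E -> F) (df : I -> F) :
  (forall i, P i -> is_derive x v (f i) (df i)) ->
  is_derive x v (fun y => \sum_(i <- r | P i) f i y) (\sum_(i <- r | P i) df i).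
Proof.
move=> d; elim: r => [|i r IH].
  rewrite (_ : (fun y => _) = cst 0); first by rewrite big_nil; exact: is_derive_cst.
  by apply/funext => y; rewrite big_nil.
rewrite big_cons (_ : (fun y => _) = fun y =>
    if P i then f i y + \sum_(j <- r | P j) f j y else \sum_(j <- r | P j) f j y).
  by case Pi: (P i) => //; apply: is_derive_add => //; exact: d.
by apply/funext => y; rewrite big_cons.
Qed.

Lemma is_derive_dot E n (x v : E) (f g : E -> 'rV[R]_n) df dg :
  is_derive x v f df -> is_derive x v g dg ->
  is_derive x v (fun y => dot (f y) (g y) : R^o) (dot df (g x) + dot (f x) dg).
Proof.
move=> /is_derive_rV d1 /is_derive_rV d2.
apply: is_derive_eq (is_derive_bigsum _ (fun j _ => is_derive_mul (d1 j) (d2 j))) _.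
by rewrite big_split addrC; congr (_ + _); apply: eq_bigr => j _; rewrite mulrC.
Qed.

Lemma is_deriveZ_fun E n (x v : E) (c : E -> R^o) (f : E -> 'rV[R]_n) (dc : R) df :
  is_derive x v c dc -> is_derive x v f df ->
  is_derive x v (fun y => c y *: f y) (dc *: f x + c x *: df).
Proof.
move=> d1 /is_derive_rV d2; apply: (is_derive_rV _ _ _ _).2 => j; rewrite !mxE.
have -> : (fun y => (c y *: f y) ord0 j) = (fun y => c y * f y ord0 j).
  by apply/funext => y; rewrite mxE.
by apply: is_derive_eq (is_derive_mul d1 (d2 j)) _; rewrite addrC [dc * _]mulrC.
Qed.

Lemma is_derive_lsub E n1 n2 (x v : E) (f : E -> 'rV[R]_(n1 + n2)) df :
  is_derive x v f df -> is_derive x v (fun y => lsubmx (f y)) (lsubmx df).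
Proof.
move=> /is_derive_rV d; apply: (is_derive_rV _ _ _ _).2 => j; rewrite mxE.
by under eq_fun do rewrite mxE; exact: d.
Qed.

Lemma is_derive_rsub E n1 n2 (x v : E) (f : E -> 'rV[R]_(n1 + n2)) df :
  is_derive x v f df -> is_derive x v (fun y => rsubmx (f y)) (rsubmx df).
Proof.
move=> /is_derive_rV d; apply: (is_derive_rV _ _ _ _).2 => j; rewrite mxE.
by under eq_fun do rewrite mxE; exact: d.
Qed.

Lemma is_derive_row_mx E n1 n2 (x v : E) (f : E -> 'rV[R]_n1) (g : E -> 'rV[R]_n2) df dg :
  is_derive x v f df -> is_derive x v g dg ->
  is_derive x v (fun y => row_mx (f y) (g y)) (row_mx df dg).
Proof.
move=> /is_derive_rV d1 /is_derive_rV d2; apply: (is_derive_rV _ _ _ _).2 => j.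
rewrite mxE; under eq_fun do rewrite mxE; case: (fintype.split j) => k; [exact: d1|exact: d2].
Qed.

Lemma smooth_at_lsub E n1 n2 (x : E) (f : E -> 'rV[R]_(n1 + n2)) :
  smooth_at x f -> smooth_at x (fun y => lsubmx (f y)).
Proof.
move=> /smooth_at_rV d; apply/smooth_at_rV => j.
by under eq_fun do rewrite mxE; exact: d.
Qed.

Lemma smooth_at_rsub E n1 n2 (x : E) (f : E -> 'rV[R]_(n1 + n2)) :
  smooth_at x f -> smooth_at x (fun y => rsubmx (f y)).
Proof.
move=> /smooth_at_rV d; apply/smooth_at_rV => j.
by under eq_fun do rewrite mxE; exact: d.
Qed.

Lemma smooth_at_row_mx E n1 n2 (x : E) (f : E -> 'rV[R]_n1) (g : E -> 'rV[R]_n2) :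
  smooth_at x f -> smooth_at x g -> smooth_at x (fun y => row_mx (f y) (g y)).
Proof.
move=> /smooth_at_rV sf /smooth_at_rV sg; apply/smooth_at_rV => j.
by under eq_fun do rewrite mxE; case: (fintype.split j) => k; [exact: sf|exact: sg].
Qed.

Lemma smooth_at_coord E n (x : E) (f : E -> 'rV[R]_n) j :
  smooth_at x f -> smooth_at x (fun y => f y ord0 j : R^o).
Proof. by move=> /smooth_at_rV. Qed.

Lemma is_derive_coord E n (x v : E) (f : E -> 'rV[R]_n) j df :
  is_derive x v f df -> is_derive x v (fun y => f y ord0 j : R^o) (df ord0 j).
Proof. by move=> /is_derive_rV. Qed.

Lemma is_derive_mulmxr E n m (A : 'M[R]_(n, m)) (x v : E) (f : E -> 'rV[R]_n) df :
  is_derive x v f df -> is_derive x v (fun y => f y *m A) (df *m A).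
Proof.
move=> /is_derive_rV d; apply: (is_derive_rV _ _ _ _).2 => j; rewrite mxE.
under eq_fun do rewrite mxE.
apply: is_derive_bigsum => i _.
apply: is_derive_eq (is_derive_mul (d i) (is_derive_cst (A i j : R^o) x v)) _.
by rewrite mulr0 add0r mulrC.
Qed.

Lemma smooth_at_mulmxr E n m (A : 'M[R]_(n, m)) (x : E) (f : E -> 'rV[R]_n) :
  smooth_at x f -> smooth_at x (fun y => f y *m A).
Proof.
move=> /smooth_at_rV s; apply/smooth_at_rV => j.
under eq_fun do rewrite mxE.
by apply: smooth_at_sum => i _; apply: smooth_atM => //; exact: smooth_at_cst.
Qed.

(** A positive derivative makes G strictly increasing, so [xget] picks a true inverse on the image
    of the interval. That image is open, the inverse has derivative 1/G'(g), and [Sk_ode] upgrades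
    this to smoothness. *)
Lemma smooth_at_inverse (G : R^o -> R^o) (a b : R) :
  (forall x : R, a < x < b -> smooth_at (x : R^o) G /\ 0 < 'D_1 G x) ->
  exists g : R^o -> R^o, forall x : R, a < x < b ->
    g (G x) = x /\ smooth_at (G x : R^o) g.
Proof.
move=> hG.
have dG x : a < x < b -> is_derive (x : R^o) 1 G ('D_1 G x).
  by move=> /hG[sG _]; apply: derivableP; exact: smooth_at_derivable.
have mono x y : a < x < b -> a < y < b -> x < y -> G x < G y.
  move=> /andP[ax xb] /andP[ay yb] xy.
  have [||c c1 e] := @MVT R G (fun z => 'D_1 G z) x y xy.
  - move=> z; rewrite in_itv /= => /andP[xz zy].
    by apply: dG; rewrite (lt_trans ax xz) (lt_trans zy yb).
  - apply: derivable_within_continuous => z; rewrite in_itv /= => /andP[xz zy].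
    by case: (dG z _) => //; rewrite (lt_le_trans ax xz) (le_lt_trans zy yb).
  rewrite -subr_gt0 e mulr_gt0 ?subr_gt0 //.
  move: c1; rewrite in_itv /= => /andP[xc cy].
  by have [|] := hG c; rewrite ?(lt_trans ax xc) ?(lt_trans cy yb).
have inj x y : a < x < b -> a < y < b -> G x = G y -> x = y.
  move=> hx hy e; have [xy|yx|//] := ltgtP x y.
    by have := mono _ _ hx hy xy; rewrite e ltxx.
  by have := mono _ _ hy hx yx; rewrite e ltxx.
pose g y : R^o := xget 0 [set x : R^o | a < x < b /\ G x = y].
have gK x : a < x < b -> g (G x) = x.
  move=> hx; rewrite /g; case: xgetP => [z _ [hz e]|/(_ x)[]] //.
  exact: inj.
exists g => x0 hx0; split; first exact: gK.
have nI x : a < x < b -> \forall z \near x, a < z < b.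
  move=> /andP[ax xb]; near=> z; apply/andP; split.
    by near: z; exact: lt_nbhsr.
  by near: z; exact: lt_nbhsl.
have nK x : a < x < b -> {near x, cancel G g}.
  by move=> /nI; apply: filterS => z; exact: gK.
have nC x : a < x < b -> {near x, continuous G}.
  by move=> /nI; apply: filterS => z /hG[sG _]; exact: smooth_at_continuous.
have gC x (hx : a < x < b) := near_can_continuousAcan_sym (nK x hx) (nC x hx).
pose W := [set y : R^o | exists2 x : R, a < x < b & G x = y].
have oW : open W.
  rewrite openE => _ [x hx <-]; rewrite /interior.
  have [gc gs] := gC x hx.
  have ngx : \forall y \near G x, a < g y < b.
    have := nbhs_singleton gc; rewrite /= /continuous_at (gK x hx) => c.
    exact: (c _ (nI x hx)).
  near=> y; exists (g y); first by near: y.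
  by near: y; exact: gs.
have dg y : W y -> is_derive (y : R^o) 1 g ('D_1 G (g y))^-1.
  move=> [x hx <-]; rewrite gK //.
  apply: (is_derive_inverse (nK x hx) (nC x hx) (dG x hx)).
  by rewrite gt_eqF //; case: (hG x hx).
exists W; split=> //; first by exists x0.
apply: (Sk_ode oW dg) => k sg.
have [U [oU sU sG]] : smooth_near [set x : R^o | a < x < b] (fun x => 'D_1 G x).
  by apply: smooth_near_at => x /hG[+ _]; exact: smooth_at_derive.
apply: (@Sk_comp1 _ _ _ _ [set y : R^o | y != 0] _ (fun y : R^o => y^-1 : R^o)) => //.
- by move=> y [x hx <-] /=; rewrite gK // gt_eqF //; case: (hG x hx).
- exact: Sk_inv.
apply: (@Sk_comp1 _ _ _ _ U _ (fun y => 'D_1 G y)) sg => //.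
- by move=> y [x hx <-] /=; rewrite gK //; exact: sU.
- by move/Sk_smooth : sG.
Unshelve. all: by end_near. Qed.

End SmoothOperations.

(** Hypotheses of the form [forall s, smooth_at s f] are tried before the structural rules: the
    smoothness of a named profile is put into the context and used without unfolding the profile. *)
Ltac smooth1 := first
  [ exact: smooth_at_cst | exact: smooth_at_id | assumption
  | lazymatch goal with
    | |- smooth_at _ (fun y => ?f (@?g y)) => match goal with H : forall s, smooth_at s ?f' |- _ =>
        constr_eq f f'; apply: (@smooth_at_comp1 _ _ _ g f (H _)) end
    | |- smooth_at _ ?f => match goal with H : forall s, smooth_at s ?f' |- _ =>
        constr_eq f f'; exact: H end end
  | lazymatch goal with
    | |- smooth_at _ (fun y => expR (@?f y)) => apply: smooth_at_expR
    | |- smooth_at _ (fun y => cos (@?f y)) => apply: smooth_at_cos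
    | |- smooth_at _ (fun y => sin (@?f y)) => apply: smooth_at_sin
    | |- smooth_at _ (fun y => step (@?f y)) => apply: smooth_at_step
    | |- smooth_at _ (fun y => Num.sqrt (@?f y)) => apply: smooth_at_sqrt
    | |- smooth_at _ (fun y => ln (@?f y)) => apply: smooth_at_ln end
  | apply: smooth_at_row_mx | apply: smooth_at_pair
  | apply: smooth_atB | apply: smooth_atN | apply: smooth_atD
  | apply: smooth_atM | apply: smooth_atX | apply: smooth_atZ
  | apply: smooth_at_dot | apply: smooth_atV
  | apply: smooth_at_lsub | apply: smooth_at_rsub | apply: smooth_at_coord
  | apply: smooth_at_fst | apply: smooth_at_snd
  | apply: smooth_at_sqrt | apply: smooth_at_expR | apply: smooth_at_cos | apply: smooth_at_sin
  | (apply: smooth_at_sum; move=> ? _) ].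
Ltac smooth := repeat smooth1.

(** * The inverse function theorem *)

(** Joins completeness to the normed structure of matrices, as the Banach fixed point theorem below
    demands. *)
HB.instance Definition _ (R : realType) (m n : nat) :=
  Complete.copy 'M[R]_(m, n) 'M[R]_(m, n).

Section InverseFunction.
Context {R : realType}.
Implicit Types E F G : normedModType R.

Lemma Sk_prod E k (U : set E) (I : Type) (r : seq I) (P : pred I) (f : I -> E -> R^o) :
  open U -> (forall i, P i -> Sk k U (f i)) ->
  Sk k U (fun x => \prod_(i <- r | P i) f i x : R^o).
Proof.
move=> oU sf; elim: r => [|i r IH].
  by under eq_fun do rewrite big_nil; exact: Sk_cst.
under eq_fun do rewrite big_cons; case Pi: (P i) => //.
by apply: Sk_M => //; exact: sf.
Qed.

Lemma Sk_det E n k (U : set E) (A : E -> 'M[R]_n) : open U ->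
  (forall i j, Sk k U (fun x => A x i j : R^o)) -> Sk k U (fun x => \det (A x) : R^o).
Proof.
move=> oU sA; rewrite /determinant; apply: Sk_sum => // s _.
by apply: Sk_M => //; [exact: Sk_cst|exact: Sk_prod].
Qed.

Lemma Sk_invmx E n k (U : set E) (A : E -> 'M[R]_n) : open U ->
  (forall x, U x -> A x \in unitmx) ->
  (forall i j, Sk k U (fun x => A x i j : R^o)) ->
  forall i j, Sk k U (fun x => invmx (A x) i j : R^o).
Proof.
move=> oU uA sA i j.
apply: (@Sk_ext _ _ _ _ _ (fun x => (\det (A x))^-1 * \adj (A x) i j : R^o)) => //.
  by move=> x Ux; rewrite /invmx uA // !mxE.
apply: Sk_M => //.
  apply: (@Sk_comp1 _ _ _ _ [set y : R^o | y != 0] _ (fun y : R^o => y^-1 : R^o)) => //.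
  - by move=> x Ux /=; have := uA x Ux; rewrite unitmxE unitfE.
  - exact: Sk_inv.
  - exact: Sk_det.
under eq_fun do rewrite mxE /cofactor.
apply: Sk_M => //; first exact: Sk_cst.
by apply: Sk_det => // i' j'; under eq_fun do rewrite !mxE; exact: sA.
Qed.

Lemma mulmx_bounded n m (B : 'M[R]_(n, m)) :
  exists2 K : R, 0 < K & forall v : 'rV_n, `|v *m B| <= K * `|v|.
Proof.
pose K := 1 + \sum_i \sum_j `|B i j|.
have K0 : 0 < K by rewrite ltr_pwDl // sumr_ge0 // => i _; rewrite sumr_ge0.
exists K => // v; apply/rV_normP; first by rewrite mulr_ge0 // ltW.
move=> j; rewrite mxE; apply: le_trans (ler_norm_sum _ _ _) _.
apply: (@le_trans _ _ (\sum_i `|v| * `|B i j|)).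
  by apply: ler_sum => i _; rewrite normrM ler_wpM2r // rV_coord_norm.
rewrite -mulr_sumr mulrC ler_wpM2r // /K; apply: le_trans (_ : \sum_i \sum_j `|B i j| <= _).
  apply: ler_sum => i _; rewrite (bigD1 j) //= lerDl sumr_ge0 //.
by rewrite lerDr.
Qed.

Lemma differentiable_approx n (f : 'rV[R]_n -> R^o) p (e : R) : differentiable f p -> 0 < e ->
  \forall x \near p, `|f x - f p - 'D_(x - p) f p| <= e * `|x - p|.
Proof.
move=> df e0.
have [_ E0] := (diff_locallyP p f).1 df.
have /eqaddoP /(_ e e0) := E0.
move=> /nbhs_ballP[r /= r0 hr]; apply/nbhs_ballP; exists r => //= x xr.
have h : `|p - x| < r by move: xr; rewrite -ball_normE.
have := hr (x - p); rewrite -ball_normE /= sub0r normrN distrC => /(_ h).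
by rewrite !fctE /= subrK opprD addrA deriveE.
Qed.

(** Contraction argument: composed with the inverse Jacobian at x0, the map becomes the identity
    plus a perturbation H of Lipschitz constant 1/2 near x0. *)
Lemma inverse_function n (Phi : 'rV[R]_n -> 'rV[R]_n) (x0 : 'rV[R]_n) (U0 : set 'rV[R]_n) :
  smooth_at x0 Phi -> (forall v, 'D_v Phi x0 = 0 -> v = 0) -> nbhs x0 U0 ->
  exists (U W : set 'rV[R]_n) (Psi : 'rV[R]_n -> 'rV[R]_n),
  [/\ open U /\ U x0, U `<=` U0, open W /\ smooth_on W Psi,
      forall x, U x -> [/\ smooth_at x Phi, W (Phi x) & Psi (Phi x) = x] &
      forall w, W w -> U (Psi w) /\ Phi (Psi w) = w].
Proof.
move=> [D0 [oO Ox0 sO]] injD nU0.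
pose e_ i : 'rV[R]_n := delta_mx ord0 i.
pose M x : 'M[R]_n := \matrix_(i, j) 'D_(e_ i) (fun y => Phi y ord0 j : R^o) x.
have sPhi j : forall k, Sk k D0 (fun y => Phi y ord0 j : R^o).
  by move=> k; apply: Sk_coord.
have dPhi j x : D0 x -> differentiable (fun y => Phi y ord0 j : R^o) x.
  by move=> Ox; apply: (smooth_differentiable oO Ox).
have vM (v x : 'rV[R]_n) j : D0 x -> (v *m M x) ord0 j = 'D_v (fun y => Phi y ord0 j : R^o) x.
  move=> Ox; rewrite mxE derive_sum_coord; last exact: dPhi.
  by apply: eq_bigr => i _; rewrite mxE.
have DPhi (v x : 'rV[R]_n) : D0 x -> is_derive x v Phi (v *m M x).
  move=> Ox; apply: (is_derive_rV _ _ _ _).2 => j; rewrite vM //.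
  by apply: derivableP; exact: (Sk_derivable (sPhi j 1%N)).
have uM : M x0 \in unitmx.
  rewrite -row_free_unit -kermx_eq0; apply/eqP/row_matrixP => i; rewrite row0.
  apply: injD; case: (DPhi (row i (kermx (M x0))) x0 Ox0) => _ ->.
  by rewrite -row_mul mulmx_ker row0.
pose A := invmx (M x0).
have uA : A \in unitmx by rewrite unitmx_inv.
pose F x := Phi x *m A.
pose H x := F x - x.
have dH (v x : 'rV[R]_n) : D0 x -> is_derive x v H (v *m M x *m A - v).
  move=> Ox; have dF := is_derive_mulmxr A (DPhi v x Ox).
  exact: (is_deriveB dF (is_derive_id x v)).
have sH j k : Sk k D0 (fun y => H y ord0 j : R^o).
  apply: (@Sk_ext _ _ _ _ _ (fun y => \sum_i Phi y ord0 i * A i j + (-1) * y ord0 j : R^o)) => //.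
    by move=> y _; rewrite !mxE mulN1r.
  apply: Sk_D => //.
    by apply: Sk_sum => // i _; apply: Sk_M => //; exact: Sk_cst.
  apply: Sk_M => //; first exact: Sk_cst.
  apply: (@Sk_coord _ _ _ _ _ id) => //.
  by apply: (@Sk_lin _ _ _ _ _ idfun) => z; exact: cvg_id.
(* In the sup norm, n partial derivatives bounded by d add up to at most 1/2. *)
pose d : R := (2 * n.+1%:R)^-1.
have d0 : 0 < d by rewrite invr_gt0 mulr_gt0 // ltr0n.
have nD : \forall y \near x0, (D0 y /\ U0 y) /\
    forall i j, `|'D_(e_ i) (fun y => H y ord0 j : R^o) y| <= d.
  near=> y; split.
    by split; near: y; [exact: open_nbhs_nbhs|exact: nU0].
  near: y; apply: filter_forall => i; apply: filter_forall => j.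
  have Dx0 : 'D_(e_ i) (fun y => H y ord0 j : R^o) x0 = 0.
    have [_ ->] := is_derive_coord j (dH (e_ i) x0 Ox0).
    by rewrite mulmxK // subrr mxE.
  have := Sk_continuous (Sk_derive (e_ i) (sH j 1%N)) Ox0.
  move=> /cvgrPdist_le/(_ _ d0); apply: filterS => y.
  by rewrite Dx0 sub0r normrN.
have [r /= r0 hr] := (nbhs_ballP _ _).1 nD.
have inB (x : 'rV[R]_n) : `|x0 - x| < r -> (D0 x /\ U0 x) /\
    forall i j, `|'D_(e_ i) (fun y => H y ord0 j : R^o) x| <= d.
  by move=> xr; apply: hr; rewrite -ball_normE.
have DH (v x : 'rV[R]_n) : `|x0 - x| < r -> `|v *m M x *m A - v| <= `|v| / 2.
  move=> /inB[[Ox _] hD]; apply/rV_normP; first by rewrite divr_ge0.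
  move=> j; have [_ <-] := is_derive_coord j (dH v x Ox).
  rewrite derive_sum_coord; last exact: (smooth_differentiable oO Ox).
  apply: le_trans (ler_norm_sum _ _ _) _.
  apply: (@le_trans _ _ (\sum_(i < n) `|v| * d)).
    by apply: ler_sum => i _; rewrite normrM ler_pM // ?rV_coord_norm.
  rewrite sumr_const card_ord -[X in X <= _]mulr_natr -[X in X <= _]mulrA ler_wpM2l //.
  rewrite /d invfM -mulrA ler_piMr ?invr_ge0 // mulrC ler_pdivrMr ?ltr0n //.
  by rewrite mul1r ler_nat.
have HL (x y : 'rV[R]_n) : `|x0 - x| < r -> `|x0 - y| < r -> `|H y - H x| <= `|y - x| / 2.
  move=> xr yr; apply/rV_normP; first by rewrite divr_ge0.
  move=> j; rewrite mxE [X in _ + X]mxE.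
  have seg (t : R) : 0 <= t <= 1 -> `|x0 - (x + t *: (y - x))| < r.
    move=> /andP[t0 t1].
    have -> : x0 - (x + t *: (y - x)) = (1 - t) *: (x0 - x) + t *: (x0 - y).
      by apply/rowP => i; rewrite !mxE; ring.
    apply: le_lt_trans (ler_normD _ _) _; rewrite !normrZ !ger0_norm ?subr_ge0 //.
    have [->|t0'] := eqVneq t 0; first by rewrite subr0 mul1r mul0r addr0.
    have tp : 0 < t by rewrite lt_neqAle eq_sym t0'.
    have -> : r = (1 - t) * r + t * r by ring.
    by apply: ler_ltD; [apply: ler_wpM2l; rewrite ?subr_ge0 // ltW|rewrite ltr_pM2l].
  have [|t t01] := @MVT_line R _ (fun y => H y ord0 j : R^o) x (y - x).
    move=> t /seg/inB[[Ox _] _]; exact: (Sk_derivable (sH j 1%N)).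
  rewrite [x + _]addrC subrK => E0; have [[Oc _] _] := inB _ (seg _ t01).
  rewrite E0; have [_ ->] := is_derive_coord j (dH (y - x) _ Oc).
  exact: le_trans (rV_coord_norm _ _) (DH _ _ (seg _ t01)).
have FL (x y : 'rV[R]_n) : `|x0 - x| < r -> `|x0 - y| < r -> `|y - x| <= 2 * `|F y - F x|.
  move=> xr yr; have e : y - x = (F y - F x) - (H y - H x).
    by rewrite /H; apply/rowP => i; rewrite !mxE; ring.
  have := HL x y xr yr; have := ler_normB (F y - F x) (H y - H x); rewrite -e.
  set a := `|y - x|; set b := `|F y - F x|; set c := `|H y - H x|; lra.
have Finj (x y : 'rV[R]_n) : `|x0 - x| < r -> `|x0 - y| < r -> Phi x = Phi y -> x = y.
  move=> xr yr e; have := FL x y xr yr; rewrite /F e subrr normr0 mulr0 normr_le0 subr_eq0.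
  by move/eqP.
(* y is reached at the fixed point of x |-> y - H x. This map preserves the closed ball of radius
   r/2, because r/4 + (r/2)/2 = r/2. *)
have Fsurj (y : 'rV[R]_n) : `|y - F x0| < r / 4 -> exists2 p, `|x0 - p| <= r / 2 & F p = y.
  move=> yr; pose B := [set x : 'rV[R]_n | `|x0 - x| <= r / 2].
  have r2 : r / 2 < r by rewrite ltr_pdivrMr // ltr_pMr // ltr1n.
  have Bx0 : B x0 by rewrite /B /= subrr normr0 divr_ge0 // ltW.
  pose T x := y - H x.
  have TB : {homo T : x / B x >-> B x}.
    move=> x Bx; rewrite /B /= /T.
    have xr : `|x0 - x| < r by exact: le_lt_trans Bx r2.
    have x0r : `|x0 - x0| < r by rewrite subrr normr0.
    have -> : x0 - (y - H x) = - (y - F x0) + (H x - H x0).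
      by rewrite /H; apply/rowP => i; rewrite !mxE; ring.
    apply: le_trans (ler_normD _ _) _; rewrite normrN.
    have := HL x0 x x0r xr; rewrite (distrC x x0).
    move: Bx; rewrite /B /=; move: yr.
    set a := `|y - F x0|; set b := `|x0 - x|; set c := `|H x - H x0|; lra.
  pose Tf : {fun B >-> B} := HB.pack T (isFun.Build _ _ _ _ T TB).
  have cB : closed B.
    have -> : B = [set x : 'rV[R]_n | `|x - x0| <= r / 2].
      by apply/seteqP; split=> x; rewrite /B /= distrC.
    apply: (@preimage_closed _ _ (fun x : 'rV[R]_n => `|x - x0|) [set t : R | t <= r / 2]).
      move=> x _; apply: (@continuous_comp _ _ _ (fun x => x - x0) (fun x => `|x|)).
        by apply: smooth_at_continuous; apply: smooth_atD; [exact: smooth_at_id|exact: smooth_at_cst].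
      exact: norm_continuous.
    exact: closed_le.
  have [|||p Bp pT] := @banach_fixed_point R 'rV[R]_n B Tf.
  - exists (2^-1)%:nng; split; first by rewrite /= invf_lt1 // ltr1n.
    move=> [x z] /= [Bx Bz]; rewrite /T.
    have -> : y - H x - (y - H z) = H z - H x by apply/rowP => i; rewrite !mxE; ring.
    have xr : `|x0 - x| < r by exact: le_lt_trans Bx r2.
    have zr : `|x0 - z| < r by exact: le_lt_trans Bz r2.
    by have := HL x z xr zr; rewrite mulrC (distrC x z).
  - by [].
  - by exists x0.
  exists p => //; move: pT; rewrite /= /T /H => /eqP.
  by rewrite eq_sym subr_eq addrC subrK => /eqP.
pose W := [set w : 'rV[R]_n | `|w *m A - F x0| < r / 4].
pose U := [set x : 'rV[R]_n | `|x0 - x| < r /\ `|F x - F x0| < r / 4].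
pose Psi w := xget 0 [set x : 'rV[R]_n | `|x0 - x| < r /\ Phi x = w].
have PsiK w : W w -> U (Psi w) /\ Phi (Psi w) = w.
  move=> Ww; have [p pr Fp] := Fsurj _ Ww.
  have Pp : Phi p = w by have := congr1 (mulmxr (invmx A)) Fp; rewrite /= !mulmxK.
  have pr' : `|x0 - p| < r by apply: le_lt_trans pr _; rewrite ltr_pdivrMr // ltr_pMr // ltr1n.
  rewrite /Psi; case: xgetP => [x _ [xr Px]|/(_ p)[]] //.
  by split=> //; split=> //; rewrite /F Px.
have PhiK x : U x -> Psi (Phi x) = x.
  move=> [xr Fx]; have [[pr _] Pp] := PsiK _ (Fx : W (Phi x)).
  exact: Finj.
have oW : open W.
  have c : continuous (fun w : 'rV[R]_n => `|w *m A - F x0|).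
    move=> w; apply: (@continuous_comp _ _ _ (fun w : 'rV[R]_n => w *m A - F x0 : 'rV[R]_n) (fun x : 'rV[R]_n => `|x|)).
      apply: smooth_at_continuous; apply: smooth_atD; last exact: smooth_at_cst.
      by apply: smooth_at_mulmxr; exact: smooth_at_id.
    exact: norm_continuous.
  exact: (open_comp (fun w _ => c w) (@open_lt R (r / 4))).
have oB : open [set x : 'rV[R]_n | `|x0 - x| < r].
  have -> : [set x : 'rV[R]_n | `|x0 - x| < r] = ball x0 r by rewrite -ball_normE.
  exact: ball_open.
have cPhi x : D0 x -> {for x, continuous Phi}.
  by move=> Ox; apply: smooth_at_continuous; exists D0.
have oU : open U.
  rewrite openE => x [xr Fx]; rewrite /interior.
  apply: filterI; first exact: (open_nbhs_nbhs (conj oB xr)).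
  have [[Ox _] _] := inB x xr.
  exact: (cPhi x Ox _ (open_nbhs_nbhs (conj oW (Fx : W (Phi x))))).
have [KA KA0 hKA] := mulmx_bounded A.
have PsiL w w' : W w -> W w' -> `|Psi w' - Psi w| <= 2 * (KA * `|w' - w|).
  move=> Ww Ww'; have [[pr _] Pp] := PsiK _ Ww; have [[pr' _] Pp'] := PsiK _ Ww'.
  apply: le_trans (FL _ _ pr pr') _; rewrite ler_pM2l // /F Pp Pp' -mulmxBl.
  exact: hKA.
have uMx x : U x -> M x \in unitmx.
  move=> [xr _]; rewrite -row_free_unit -kermx_eq0; apply/eqP/row_matrixP => i; rewrite row0.
  have := DH (row i (kermx (M x))) x xr.
  rewrite -row_mul mulmx_ker row0 mul0mx sub0r normrN => h.
  by apply/eqP; rewrite -normr_le0; move: h; set a := `|_|; lra.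
(* The first-order error of Phi at p is o(|ph - p|), and the Lipschitz bound [PsiL] turns it into
   o(|h|). The summand 1 in [C0] keeps that constant positive when v = 0. *)
have dPsi v w : W w -> is_derive w v Psi (v *m invmx (M (Psi w))).
  move=> Ww; set p := Psi w; set B := invmx (M p).
  have [Up Pp] := PsiK _ Ww; have [pr Fp] := Up; have [[Op _] _] := inB _ pr.
  have [KB KB0 hKB] := mulmx_bounded B.
  pose C0 := 2 * (KA * `|v|) + 1.
  have C00 : 0 < C0 by rewrite ltr_wpDl // mulr_ge0 // mulr_ge0 // ltW.
  suff cv : (fun h : R => h^-1 *: ((Psi \o shift w) (h *: v) - Psi w)) @ 0^' --> v *m B.
    by split; [apply/cvg_ex; eexists; exact: cv|exact: cvg_lim cv].
  apply/cvgrPdist_le => e e0.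
  pose e' := e / (KB * C0).
  have e'0 : 0 < e' by rewrite divr_gt0 // mulr_gt0.
  have nap : \forall x \near p, forall j,
      `|Phi x ord0 j - Phi p ord0 j - 'D_(x - p) (fun y => Phi y ord0 j : R^o) p| <= e' * `|x - p|.
    have := filter_forall (nbhs_filter p) (fun j =>
      @differentiable_approx _ (fun y => Phi y ord0 j) p e' (dPhi j p Op) e'0).
    exact.
  have [s /= s0 hs] := (nbhs_ballP _ _).1 nap.
  have [s' /= s'0 hs'] := (nbhs_ballP _ _).1 (open_nbhs_nbhs (conj oW Ww)).
  have v1 : 0 < `|v| + 1 by rewrite ltr_wpDl.
  near=> h.
  have h0 : h != 0 by near: h; exact: nbhs_dnbhs_neq.
  have hv : `|h| * `|v| < s'.
    have : `|h| < s' / (`|v| + 1) by near: h; apply: dnbhs0_lt; exact: divr_gt0.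
    rewrite ltr_pdivlMr // mulrDr mulr1; apply: le_lt_trans.
    by rewrite lerDl.
  have hC : `|h| * C0 < s.
    have : `|h| < s / C0 by near: h; apply: dnbhs0_lt; exact: divr_gt0.
    by rewrite ltr_pdivlMr.
  have Wh : W (h *: v + w).
    by apply: hs'; rewrite -ball_normE /= opprD addrCA subrr addr0 normrN normrZ.
  have [[ph_r _] Pph] := PsiK _ Wh; set ph := Psi (h *: v + w) in ph_r Pph.
  have qL : `|ph - p| <= C0 * `|h|.
    apply: le_trans (PsiL _ _ Ww Wh) _.
    rewrite addrK normrZ /C0; set x := `|h|; set y := `|v|.
    have x_ge0 : 0 <= x by exact: normr_ge0.
    by rewrite -subr_ge0 (_ : _ - _ = x) //; ring.
  have qM : `|h *: v - (ph - p) *m M p| <= e' * `|ph - p|.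
    apply/rV_normP; first by rewrite mulr_ge0 // ltW.
    move=> j; have := hs ph; rewrite -ball_normE /= distrC => /(_ _)/wrap[|/(_ j)].
      by apply: le_lt_trans qL _; rewrite mulrC.
    by rewrite Pph Pp -vM // !mxE addrK.
  have -> : v *m B - h^-1 *: ((Psi \o shift w) (h *: v) - Psi w)
      = h^-1 *: ((h *: v - (ph - p) *m M p) *m B).
    have -> : (h *: v - (ph - p) *m M p) *m B = h *: (v *m B) - (ph - p).
      by rewrite mulmxBl (mulmxK (uMx p Up)) -scalemxAl.
    rewrite [RHS]scalerBr; congr (_ - _).
    by apply/rowP => j; rewrite !mxE mulrA mulVf // mul1r.
  rewrite normrZ normfV ler_pdivrMl ?normr_gt0 //.
  apply: le_trans (hKB _) _.
  apply: (@le_trans _ _ (KB * (e' * (C0 * `|h|)))).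
    by rewrite ler_pM2l //; apply: le_trans qM _; rewrite ler_pM2l.
  set x := `|h|; rewrite (_ : KB * (e' * (C0 * x)) = x * e) //.
  by rewrite /e'; field; rewrite !gt_eqF.
exists U, W, Psi; split.
- by split=> //; split; rewrite subrr normr0 // divr_gt0.
- by move=> x [xr _]; have [[_ U0x] _] := inB x xr.
(* Bootstrapping again: the derivative of Psi is the inverse Jacobian at Psi, and its entries are
   smooth by the cofactor formula. *)
- split=> //; apply/Sk_smooth => k; elim: k => [|k IH].
    split=> // w Ww; apply/(@cvgrPdist_le _ _ _ (nbhs w) (nbhs_filter w)) => e e0.
    have K2 : 0 < 2 * KA by rewrite mulr_gt0.
    have n2 : nbhs w [set w' | `|w - w'| <= e / (2 * KA)].
      apply/nbhs_ballP; exists (e / (2 * KA)); first by rewrite /= divr_gt0.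
      by move=> w'; rewrite -ball_normE /= => /ltW.
    have n1 : nbhs w W := open_nbhs_nbhs (conj oW Ww).
    apply: (@filterS2 _ (nbhs w) (nbhs_filter w) _ _ _ _ n1 n2) => w' Ww' /= hw'.
    rewrite distrC; apply: le_trans (PsiL w w' Ww Ww') _.
    by rewrite mulrA mulrC -ler_pdivlMr // distrC.
  split; first by move=> w Ww; exact: (Sk_continuous IH).
  move=> v; split; first by move=> w Ww; case: (dPsi v w Ww).
  apply: (@Sk_ext _ _ _ _ _ (fun w => v *m invmx (M (Psi w)))) => //.
    by move=> w Ww; case: (dPsi v w Ww) => _ ->.
  apply: Sk_rV => // j; under eq_fun do rewrite mxE.
  apply: Sk_sum => // i _; apply: Sk_M => //; first exact: Sk_cst.
  apply: Sk_invmx => //; first by move=> w /PsiK[/uMx].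
  move=> i' j'; under eq_fun do rewrite mxE.
  apply: (@Sk_comp _ _ _ _ _ D0 (fun x => 'D_(e_ i') (fun y => Phi y ord0 j' : R^o) x)) => //.
    by move=> w /PsiK[[xr _] _]; have [[]] := inB _ xr.
  by move=> l; apply: Sk_derive.
- move=> x Ux; have [xr Fx] := Ux; split; [|exact: Fx|exact: PhiK].
  by exists D0; split=> //; have [[]] := inB x xr.
- exact: PsiK.
Unshelve. all: by end_near. Qed.
End InverseFunction.

(** * Regular level sets as submanifolds *)

Section LevelSets.
Context {R : realType}.
Implicit Types E F G : normedModType R.

Definition jac n m (f : 'rV[R]_n -> 'rV[R]_m) x : 'M[R]_(n, m) :=
  \matrix_(i, j) 'D_(delta_mx ord0 i) (fun y => f y ord0 j : R^o) x.

Lemma is_derive_jac n m (f : 'rV[R]_n -> 'rV[R]_m) (x v : 'rV[R]_n) :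
  smooth_at x f -> is_derive x v f (v *m jac f x).
Proof.
move=> /smooth_at_rV sf; apply: (is_derive_rV _ _ _ _).2 => j; rewrite mxE.
have -> : \sum_i v ord0 i * jac f x i j = 'D_v (fun y => f y ord0 j : R^o) x.
  rewrite derive_sum_coord; last exact: smooth_at_differentiable.
  by apply: eq_bigr => i _; rewrite mxE.
by apply: derivableP; exact: smooth_at_derivable.
Qed.

Lemma derive_jac n m (f : 'rV[R]_n -> 'rV[R]_m) (x v : 'rV[R]_n) :
  smooth_at x f -> 'D_v f x = v *m jac f x.
Proof. by move=> /(is_derive_jac v)[]. Qed.

Lemma is_derive_comp_jac E n m (f : 'rV[R]_n -> 'rV[R]_m) (g : E -> 'rV[R]_n) (x v : E) dg :
  smooth_at (g x) f -> is_derive x v g dg ->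
  is_derive x v (fun y => f (g y)) (dg *m jac f (g x)).
Proof.
move=> /smooth_at_rV sf d; apply: (is_derive_rV _ _ _ _).2 => j; rewrite mxE.
have df := smooth_at_differentiable (sf j).
apply: is_derive_eq (is_derive_chain df d) _.
by rewrite (derive_sum_coord _ df); apply: eq_bigr => i _; rewrite mxE.
Qed.

Lemma is_derive_comp_smooth E n (f : 'rV[R]_n -> R^o) (g : E -> 'rV[R]_n) (x v : E) dg :
  smooth_at (g x) f -> is_derive x v g dg ->
  is_derive x v (fun y => f (g y)) ('D_dg f (g x)).
Proof. by move=> sf; apply: is_derive_chain; exact: smooth_at_differentiable. Qed.

Lemma smooth_at_comp_rV E n m (x : E) (f : 'rV[R]_n -> 'rV[R]_m) (g : E -> 'rV[R]_n) :
  smooth_at (g x) f -> smooth_at x g -> smooth_at x (fun y => f (g y)).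
Proof.
move=> /smooth_at_rV sf sg; apply/smooth_at_rV => j.
by apply: (smooth_at_comp (sf j)).
Qed.

Lemma near_line E (U : set E) (x v : E) : nbhs x U ->
  \forall h \near (0 : R), U (x + h *: v).
Proof.
move=> /nbhs_ballP[r /= r0 hr]; have v1 : 0 < `|v| + 1 by rewrite ltr_wpDl.
have nh : \forall h \near (0 : R), `|h| < r / (`|v| + 1).
  apply/nbhs_ballP; exists (r / (`|v| + 1)); first by rewrite /= divr_gt0.
  by move=> h; rewrite -ball_normE /= sub0r normrN.
apply: filterS nh => h; rewrite ltr_pdivlMr // mulrDr mulr1 => hh.
apply: hr; rewrite -ball_normE /= opprD addrA subrr sub0r normrN normrZ.
by apply: le_lt_trans hh; rewrite lerDl.
Qed.

Lemma derive_right E (f g : E -> R^o) x v : derivable f x v -> derivable g x v ->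
  f x = g x -> (\forall h \near (0 : R)^'+, f (x + h *: v) = g (x + h *: v)) ->
  'D_v f x = 'D_v g x.
Proof.
move=> df dg fgx fgh.
rewrite /derive (cvg_at_rightE _ _ df) (cvg_at_rightE _ _ dg).
have e : \forall h \near (0 : R)^'+, (fun h : R => h^-1 *: ((f \o shift x) (h *: v) - f x)) h
     = (fun h : R => h^-1 *: ((g \o shift x) (h *: v) - g x)) h.
  by apply: filterS fgh => h /= e; rewrite ![_ + x]addrC e fgx.
congr (lim _); apply/seteqP; split; apply: near_eq_cvg => //.
by apply: filterS e => h ->.
Qed.

(** Inward directions are settled by one-sided limits, and an outward direction is the opposite of
    an inward one. Hence derivatives at boundary points do not depend on the extension across the
    boundary. *)
Lemma half_space_derive d (W : set 'rV[R]_d) (f g : 'rV[R]_d -> R^o) (y w : 'rV[R]_d) :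
  open W -> W y -> half_space y ->
  (forall v, derivable f y v) -> (forall v, derivable g y v) ->
  (forall z, W z -> half_space z -> f z = g z) -> 'D_w f y = 'D_w g y.
Proof.
move=> oW Wy hy df dg fg.
have in_ (u : 'rV[R]_d) : (forall i : 'I_d, val i = 0%N -> 0 <= u ord0 i) ->
    'D_u f y = 'D_u g y.
  move=> hu; apply: derive_right => //; first exact: fg.
  have nW := @near_line _ W y u (open_nbhs_nbhs (conj oW Wy)).
  near=> h; have h0 : 0 < h by near: h; exact: nbhs_right_gt.
  apply: fg; first by near: h; apply: cvg_within; exact: nW.
  by move=> i i0; rewrite !mxE addr_ge0 ?hy // mulr_ge0 ?hu // ltW.
have [hw|] := pselect (forall i : 'I_d, val i = 0%N -> 0 <= w ord0 i); first exact: in_.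
move=> /existsNP[i /not_implyP[i0 /negP]]; rewrite -ltNge => wi.
have hN : 'D_(- w) f y = 'D_(- w) g y.
  apply: in_ => j j0; have -> : j = i by apply: val_inj; rewrite j0 i0.
  by rewrite mxE oppr_ge0 ltW.
have neg (k : 'rV[R]_d -> R^o) : (forall v, derivable k y v) -> 'D_w k y = - 'D_(- w) k y.
  move=> dk; have := is_derive_scale (-1) (derivableP (dk w)).
  by rewrite scaleN1r => -[_ ->]; rewrite mulN1r opprK.
by rewrite !neg // hN.
Unshelve. all: by end_near. Qed.

Section Charts.
Context {n d : nat}.
Implicit Types (V U : set 'rV[R]_n) (psi : 'rV[R]_d -> 'rV[R]_n) (chi : 'rV[R]_n -> 'rV[R]_d).

Lemma chart_smooth_psi_at V U W psi chi y : is_chart V U W psi chi -> W y -> smooth_at y psi.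
Proof. by move=> [oU oW sp _ _ _] Wy; exact: smooth_on_atP oW sp Wy. Qed.

Lemma chart_smooth_chi_at V U W psi chi x : is_chart V U W psi chi -> U x -> smooth_at x chi.
Proof. by move=> [oU oW _ sc _ _] Ux; exact: smooth_on_atP oU sc Ux. Qed.

Lemma tangent_level V (f : 'rV[R]_n -> R^o) x v c : smooth_at x f ->
  (forall y, V y -> f y = c) -> tangent d V x v -> 'D_v f x = 0.
Proof.
move=> sf f0 [Vx [U [W [psi [chi [ch Ux [w ->]]]]]]].
have [Wy hy py] := chart_to ch Vx Ux.
have sp := chart_smooth_psi_at ch Wy.
have sf' : smooth_at (psi (chi x)) f by rewrite py.
have dfp u := is_derive_comp_smooth sf' (is_derive_jac u sp).
have [_ E0] := dfp w; rewrite derive_jac // -{1}py -E0.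
rewrite (@half_space_derive _ W _ (cst c)) //; first by rewrite derive_cst.
- exact: chart_openW ch.
- by move=> z Wz hz; have [Vz _ _] := chart_from ch Wz hz; rewrite f0.
Qed.

(** In a chart placing x on the boundary, the distinguished coordinate of the transition map would
    have its minimum 0 at an interior point, so its differential would vanish; but the Jacobian of
    the transition is invertible by the chain rule. *)
Lemma interior_chart_not_boundary V U W psi chi x : is_chart V U W psi chi -> V x -> U x ->
  (forall i : 'I_d, val i = 0%N -> 0 < chi x ord0 i) -> ~ boundary d V x.
Proof.
move=> ch Vx Ux pos [_ [U' [W' [psi' [chi' [ch' Ux' [i0 i00 ci0]]]]]]].
have [Wy hy py] := chart_to ch Vx Ux; have [Wy' hy' py'] := chart_to ch' Vx Ux'.
set y := chi x in Wy hy py pos; set y' := chi' x in Wy' hy' py' ci0.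
have sp := chart_smooth_psi_at ch Wy; have sp' := chart_smooth_psi_at ch' Wy'.
have sc : smooth_at (psi' y') chi by rewrite py'; exact: chart_smooth_chi_at ch Ux.
have sc' : smooth_at (psi y) chi' by rewrite py; exact: chart_smooth_chi_at ch' Ux'.
pose tau z := chi' (psi z); pose sig z := chi (psi' z).
have ty : tau y = y' by rewrite /tau py.
have stau : smooth_at y tau by exact: smooth_at_comp_rV.
have ssig : smooth_at (tau y) sig by rewrite ty; exact: smooth_at_comp_rV.
have nV : \forall z \near y, V (psi z) /\ U' (psi z) /\ W z /\ half_space z.
  have nW : nbhs y W := open_nbhs_nbhs (conj (chart_openW ch) Wy).
  have nU : nbhs y (psi @^-1` U').
    apply: (smooth_at_continuous sp); rewrite py.
    exact: open_nbhs_nbhs (conj (chart_openU ch') Ux').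
  have nh : nbhs y [set z | half_space z].
    have h : \forall z \near nbhs (y : 'rV[R]_d), forall i : 'I_d, val i = 0%N -> 0 <= (z : 'rV[R]_d) ord0 i.
      apply: (filter_forall (nbhs_filter y)) => i.
      have [i1|/eqP ni] := eqVneq (val i) 0%N; last by apply: filterE => z /ni.
      have := @rV_coord_continuous R d i y => /cvgr_gt/(_ _ (pos i i1)).
      by apply: filterS => z /ltW.
    exact: h.
  apply: (@filterS3 _ (nbhs y) (nbhs_filter y) _ _ _ _ _ nW nU nh) => z Wz Uz hz.
  by have [? _ _] := chart_from ch Wz hz.
have sigtau : \forall z \near y, sig (tau z) = z.
  apply: filterS nV => z [Vz [Uz [Wz hz]]].
  rewrite /sig /tau; have [_ _ ->] := chart_to ch' Vz Uz.
  by have [_ _ ->] := chart_from ch Wz hz.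
have injtau (u : 'rV[R]_d) : u *m jac tau y *m jac sig (tau y) = u.
  have [_ E0] := is_derive_comp_jac ssig (is_derive_jac u stau).
  by rewrite -E0 (near_eq_derive u sigtau) derive_id.
have : jac tau y *m jac sig (tau y) = 1%:M.
  by apply/row_matrixP => i; rewrite row_mul rowE injtau rowE mulmx1.
move=> /mulmx1C JJ.
have col0 (u : 'rV[R]_d) : (u *m jac tau y) ord0 i0 = 0.
  have dt := is_derive_coord i0 (is_derive_jac u stau).
  pose phi := fun h : R => tau (y + h *: u) ord0 i0.
  have dphi : is_derive (0 : R) 1 phi ((u *m jac tau y) ord0 i0).
    apply: (is_derive_line (fun z => tau z ord0 i0 : R^o) y u 0 _).1.
    by rewrite scale0r addr0.
  have [_ <-] := dphi; rewrite -derive1E.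
  have nphi : \forall h \near (0 : R), 0 <= phi h /\ derivable phi h 1.
    have nl := near_line u (@filterI _ _ (nbhs_filter y) _ _ nV (smooth_at_near stau)).
    apply: (@filterS _ (nbhs (0 : R)) (nbhs_filter _) _ _ _ nl) => h [[Vz [Uz _]] sz].
    split; first by have [_ hh _] := chart_to ch' Vz Uz; exact: hh.
    have dh := is_derive_coord i0 (is_derive_jac u sz).
    by have [] := (is_derive_line (fun z => tau z ord0 i0 : R^o) y u h _).1 dh.
  have [r /= r0 hr] := (nbhs_ballP _ _).1 nphi.
  have phi0 : phi 0 = 0 by rewrite /phi scale0r addr0 ty.
  have inr t : t \in `]- r, r[ -> 0 <= phi t /\ derivable phi t 1.
    rewrite in_itv /= => /andP[h1 h2]; apply: hr; rewrite -ball_normE /= sub0r normrN.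
    by rewrite ltr_norml h1.
  have [||||_ E0] := @derive1_at_min R phi (- r) r 0.
  - by rewrite ge0_cp // ltW.
  - by move=> t /inr[].
  - by rewrite in_itv /= oppr_lt0 r0.
  - by move=> t /inr[]; rewrite phi0.
  by rewrite derive1E.
have := congr1 (fun B : 'M[R]_d => ((delta_mx ord0 i0 : 'rV[R]_d) *m B) ord0 i0) JJ.
by rewrite mulmx1 mulmxA col0 mxE !eqxx /= => /eqP; rewrite eq_sym oner_eq0.
Qed.

End Charts.

(** The inverse function theorem for (F, L): L is the coordinate map, and the parametrisation is the
    local inverse restricted to F = 0. *)
Lemma level_chart n c d (V : set 'rV[R]_n) (F : 'rV[R]_n -> 'rV[R]_c)
    (L : 'rV[R]_n -> 'rV[R]_d) (x0 : 'rV[R]_n) : n = (c + d)%N ->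
  V x0 -> smooth_at x0 F -> smooth_at x0 L ->
  (forall v, 'D_v F x0 = 0 -> 'D_v L x0 = 0 -> v = 0) ->
  (\forall x \near x0, V x <-> F x = 0 /\ half_space (L x)) ->
  exists U W psi, [/\ is_chart V U W psi L, U x0 &
    forall v, 'D_v F x0 = 0 -> exists w, v = 'D_w psi (L x0)].
Proof.
move=> en; subst n => Vx0 sF sL inj nV.
pose Phi x := row_mx (F x) (L x).
have sPhi : smooth_at x0 Phi by exact: smooth_at_row_mx.
have dPhi v : is_derive x0 v Phi (row_mx ('D_v F x0) ('D_v L x0)).
  by apply: is_derive_row_mx; apply: derivableP; exact: smooth_at_derivable.
have injP v : 'D_v Phi x0 = 0 -> v = 0.
  have [_ ->] := dPhi v => e.
  have /eq_row_mx[] : row_mx ('D_v F x0) ('D_v L x0) = row_mx 0 0 by rewrite e row_mx0.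
  exact: inj.
have nsV : nbhs x0 [set x | (V x <-> F x = 0 /\ half_space (L x)) /\ smooth_at x L].
  exact: filterI nV (smooth_at_near sL).
have [U [W' [Psi [[oU Ux0] sU [oW' sPsi] hU hW']]]] := inverse_function sPhi injP nsV.
pose W := [set y : 'rV[R]_d | W' (row_mx 0 y)].
have srow (y : 'rV[R]_d) : smooth_at y (fun y : 'rV[R]_d => row_mx (0 : 'rV[R]_c) y).
  by apply: smooth_at_row_mx; [exact: smooth_at_cst|exact: smooth_at_id].
have oW : open W.
  rewrite openE => y Wy; rewrite /interior.
  exact: (smooth_at_continuous (srow y) (open_nbhs_nbhs (conj oW' Wy))).
pose psi y := Psi (row_mx 0 y).
have spsi y : W y -> smooth_at y psi.
  move=> Wy; apply: smooth_at_comp_rV; last exact: srow.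
  exact: smooth_on_atP oW' sPsi Wy.
have rowPhi x : V x -> U x -> row_mx 0 (L x) = Phi x.
  by move=> Vx Ux; have [/= [/(_ Vx)[F0 _] _] _] := sU x Ux; rewrite /Phi F0.
have PhiPsi w : W w -> Phi (psi w) = row_mx 0 w by move=> Ww; have [] := hW' _ Ww.
exists U, W, psi; split=> //.
- split=> //.
  + exact: smooth_on_at.
  + by apply: smooth_on_at => x /sU[].
  + move=> y Vy Uy; have [_ WP PK] := hU y Uy.
    by rewrite /W /= /psi rowPhi //; split=> //; have [/= [/(_ Vy)[]]] := sU y Uy.
  + move=> w Ww hw; have [Uw _] := hW' _ Ww.
    have /eq_row_mx[F0 Lw] := PhiPsi w Ww.
    have [/= [_ VF] _] := sU _ Uw.
    by split=> //; apply: VF; rewrite F0 /= Lw.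
(* The vectors v and ['D_w psi] have the same image under the injective differential of (F, L). *)
move=> v F0; pose w := 'D_v L x0; exists w.
have Wy : W (L x0) by rewrite /W /= rowPhi //; have [] := hU _ Ux0.
have px0 : psi (L x0) = x0 by rewrite /psi rowPhi //; have [] := hU _ Ux0.
have sPhi' : smooth_at (psi (L x0)) Phi by rewrite px0.
have dc := is_derive_comp_jac sPhi' (derivableP (smooth_at_derivable (v := w) (spsi _ Wy))).
have dr : is_derive (L x0) w (fun y : 'rV[R]_d => Phi (psi y)) (row_mx 0 w).
  apply: near_eq_is_derive (is_derive_row_mx (is_derive_cst 0 (L x0) w) (is_derive_id (L x0) w)).
  by apply: (open_near oW Wy) => y Wy'; rewrite PhiPsi.
have : ('D_w psi (L x0) - v) *m jac Phi x0 = 0.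
  have [_ e1] := dc; have [_ e2] := dr; rewrite e1 px0 in e2.
  rewrite mulmxBl e2 -derive_jac //; have [_ ->] := dPhi v.
  by rewrite F0 subrr.
rewrite -derive_jac // => /injP/eqP; rewrite subr_eq0 => /eqP->//.
Qed.

(** The rows of B are a basis of the kernel of J, and the pseudo-inverse Q reads off coordinates in
    it. *)
Lemma kernel_complement n c d (J : 'M[R]_(n, c)) : n = (c + d)%N ->
  (forall a : 'rV[R]_c, exists v, v *m J = a) ->
  exists (B : 'M[R]_(d, n)) (Q : 'M[R]_(n, d)), [/\ B *m Q = 1%:M, B *m J = 0 &
    forall v : 'rV_n, v *m J = 0 -> v *m Q = 0 -> v = 0].
Proof.
move=> en surj.
have rJ : \rank J = c.
  apply/eqP/row_fullP; have /choice[K hK] : forall i : 'I_c, exists v : 'rV_n, v *m J = delta_mx ord0 i.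
    by move=> i; exact: surj.
  by exists (\matrix_i K i); apply/row_matrixP => i; rewrite row_mul rowK hK rowE mulmx1.
have rk : \rank (kermx J) = d by rewrite mxrank_ker rJ en addKn.
have [B [fB [BJ kB]]] : exists B : 'M[R]_(d, n), row_free B /\ (B *m J = 0 /\
    forall v : 'rV_n, v *m J = 0 -> (v <= B)%MS).
  rewrite -rk; exists (row_base (kermx J)); split; first exact: row_base_free.
  split; first by apply/sub_kermxP; rewrite eq_row_base.
  by move=> v /sub_kermxP; rewrite eq_row_base.
have BV := mulmxVp fB.
exists B, (pinvmx B); split=> // v vJ vQ.
have /submxP[w vw] := kB v vJ.
by move: vQ; rewrite vw -mulmxA BV mulmx1 => ->; rewrite mul0mx.
Qed.

(* The half-space coordinate of the chart is f itself. *)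
Lemma level_chart_boundary n c d (V : set 'rV[R]_n) (F : 'rV[R]_n -> 'rV[R]_c)
    (f : 'rV[R]_n -> R^o) (x0 : 'rV[R]_n) : n = (c + d.+1)%N ->
  V x0 -> smooth_at x0 F -> smooth_at x0 f ->
  (forall a b, exists v, 'D_v F x0 = a /\ 'D_v f x0 = b) ->
  (\forall x \near x0, V x <-> F x = 0 /\ 0 <= f x) ->
  exists U W psi chi, [/\ is_chart V U W psi chi, U x0,
    forall i : 'I_d.+1, val i = 0%N -> chi x0 ord0 i = f x0 &
    forall v, 'D_v F x0 = 0 -> exists w, v = 'D_w psi (chi x0)].
Proof.
move=> en Vx0 sF sf surj nV.
pose fr x : 'rV[R]_1 := \row_(i < 1) f x.
have sfr : smooth_at x0 fr by apply/smooth_at_rV => j; under eq_fun do rewrite mxE.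
pose Ff x := row_mx (F x) (fr x).
have sFf : smooth_at x0 Ff by exact: smooth_at_row_mx.
have dfr v : is_derive x0 v fr (\row_(i < 1) 'D_v f x0).
  apply: (is_derive_rV _ _ _ _).2 => j; rewrite mxE; under eq_fun do rewrite mxE.
  by apply: derivableP; exact: smooth_at_derivable.
have dFf v : is_derive x0 v Ff (row_mx ('D_v F x0) (\row_(i < 1) 'D_v f x0)).
  apply: is_derive_row_mx => //; apply: derivableP; exact: smooth_at_derivable.
have [||B [Q [BQ BJ injQ]]] := @kernel_complement n (c + 1) d (jac Ff x0).
- by rewrite en -addnA add1n.
- move=> a; have [v [e1 e2]] := surj (lsubmx a) (rsubmx a ord0 ord0); exists v.
  rewrite -derive_jac //; have [_ ->] := dFf v; rewrite e1 -[RHS]hsubmxK; congr row_mx.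
  by apply/rowP => i; rewrite mxE e2 (ord1 i).
pose L x : 'rV[R]_d.+1 := row_mx (fr x) (x *m Q).
have sL : smooth_at x0 L.
  by apply: smooth_at_row_mx => //; apply: smooth_at_mulmxr; exact: smooth_at_id.
have dL v : is_derive x0 v L (row_mx (\row_(i < 1) 'D_v f x0) (v *m Q)).
  apply: (is_derive_row_mx (dfr v)); apply: is_derive_mulmxr; exact: is_derive_id.
have L0 x (i : 'I_d.+1) : val i = 0%N -> L x ord0 i = f x.
  move=> i0; have -> : i = lshift d (ord0 : 'I_1) by apply: val_inj.
  transitivity (fr x ord0 ord0); [exact: row_mxEl|by rewrite mxE].
have [||U [W [psi [ch Ux0 tg]]]] := @level_chart n c d.+1 V F L x0 en Vx0 sF sL.
- move=> v F0; have [_ ->] := dL v => e.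
  have /eq_row_mx[f0 vQ] : row_mx (\row_(i < 1) 'D_v f x0) (v *m Q) = row_mx 0 0.
    by rewrite e row_mx0.
  apply: injQ => //; rewrite -derive_jac //; have [_ ->] := dFf v.
  by rewrite F0 f0 row_mx0.
- apply: filterS nV => x [V1 V2]; split=> [/V1[F0 f0]|[F0 hs]].
    by split=> // i i0; rewrite L0.
  by apply: V2; split=> //; rewrite -(L0 x ord0) //; exact: hs.
by exists U, W, psi, L; split=> // i; exact: L0.
Qed.

(** The boundary version is applied with an artificial defining function: one coordinate along the
    kernel, shifted to take the value 1 at x0. Its positivity nearby makes the chart an interior
    one. *)
Lemma level_chart_interior n c d (V : set 'rV[R]_n) (F : 'rV[R]_n -> 'rV[R]_c)
    (x0 : 'rV[R]_n) : n = (c + d.+1)%N ->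
  V x0 -> smooth_at x0 F ->
  (forall a, exists v, 'D_v F x0 = a) ->
  (\forall x \near x0, V x <-> F x = 0) ->
  exists U W psi chi, [/\ is_chart V U W psi chi, U x0,
    forall i : 'I_d.+1, val i = 0%N -> 0 < chi x0 ord0 i &
    forall v, 'D_v F x0 = 0 -> exists w, v = 'D_w psi (chi x0)].
Proof.
move=> en Vx0 sF surj nV.
have [|B [Q [BQ BJ injQ]]] := @kernel_complement n c d.+1 (jac F x0) en.
  by move=> a; have [v <-] := surj a; exists v; rewrite derive_jac.
pose f x : R^o := 1 + ((x - x0) *m Q) ord0 ord0.
have sf : smooth_at x0 f.
  apply: smooth_atD; first exact: smooth_at_cst.
  apply: smooth_at_coord; apply: smooth_at_mulmxr; apply: smooth_atD.
    exact: smooth_at_id.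
  exact: smooth_at_cst.
have df v : is_derive x0 v f ((v *m Q) ord0 ord0).
  have d1 := is_derive_coord ord0 (is_derive_mulmxr Q
    (is_derive_add (is_derive_id x0 v) (is_derive_cst (- x0) x0 v))).
  have := is_derive_add (is_derive_cst (1 : R^o) x0 v) d1.
  by rewrite add0r addr0.
have f0 : f x0 = 1 by rewrite /f subrr mul0mx mxE addr0.
have [||U [W [psi [chi [ch Ux0 c0 tg]]]]] := @level_chart_boundary n c d V F f x0 en Vx0 sF sf.
- move=> a b; have [v0 v0a] := surj a.
  pose v := v0 + (b - (v0 *m Q) ord0 ord0) *: (delta_mx ord0 ord0 *m B).
  exists v; split.
    rewrite derive_jac // mulmxDl -scalemxAl -mulmxA BJ mulmx0 scaler0 addr0.
    by rewrite -derive_jac.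
  have [_ ->] := df v; rewrite mulmxDl -scalemxAl -mulmxA BQ mulmx1 !mxE !eqxx /=.
  by rewrite mulr1 addrC subrK.
- have nf : \forall x \near x0, 0 < f x.
    have := smooth_at_continuous sf => /cvgr_gt; apply.
    by rewrite f0.
  apply: filterS2 nV nf => x [V1 V2] fx; split=> [/V1|[/V2]] //.
  by split=> //; exact: ltW.
by exists U, W, psi, chi; split=> // i /c0 ->; rewrite f0.
Qed.

Section LevelSetManifold.
Context {n c d : nat} (V : set 'rV[R]_n) (F : 'rV[R]_n -> 'rV[R]_c) (f : 'rV[R]_n -> R^o).
Hypothesis en : n = (c + d.+1)%N.
Hypothesis VE : forall x, V x <-> F x = 0 /\ 0 <= f x.
Hypothesis sF : forall x, V x -> smooth_at x F.
Hypothesis sf : forall x, V x -> smooth_at x f.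
Hypothesis surjF : forall x a, V x -> exists v, 'D_v F x = a.
Hypothesis surjFf : forall x a b, V x -> f x = 0 ->
  exists v, 'D_v F x = a /\ 'D_v f x = b.

Lemma level_charts x : V x ->
  exists U W psi chi, [/\ @is_chart R _ d.+1 V U W psi chi, U x,
    forall i : 'I_d.+1, val i = 0%N -> 0 <= chi x ord0 i /\ (chi x ord0 i = 0 <-> f x = 0) &
    forall v, 'D_v F x = 0 -> exists w, v = 'D_w psi (chi x)].
Proof.
move=> Vx; have [fx0|fx0] := eqVneq (f x) 0.
  have [||U [W [psi [chi [ch Ux c0 tg]]]]] := @level_chart_boundary n c d V F f x en Vx (sF Vx) (sf Vx).
  - by move=> a b; exact: surjFf.
  - exact: filterE VE.
  by exists U, W, psi, chi; split=> // i /c0 ->; rewrite fx0.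
have fx : 0 < f x by rewrite lt_neqAle eq_sym fx0; case/VE: Vx.
have [||U [W [psi [chi [ch Ux c0 tg]]]]] := @level_chart_interior n c d V F x en Vx (sF Vx).
- by move=> a; exact: surjF.
- have nf : \forall z \near x, 0 < f z.
    by have := smooth_at_continuous (sf Vx) => /cvgr_gt; apply.
  apply: filterS nf => z /ltW fz; split=> [/VE[]|F0] //.
  by apply/VE.
exists U, W, psi, chi; split=> // i /c0 ci; split; first exact: ltW.
split=> e; first by move: ci; rewrite e ltxx.
by rewrite e eqxx in fx0.
Qed.

Lemma level_submanifold : submanifold d.+1 V.
Proof.
by move=> x /level_charts[U [W [psi [chi [ch Ux _ _]]]]]; exists U, W, psi, chi.
Qed.

(** The definition allows any chart to certify a boundary point; [interior_chart_not_boundary] rules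
    this out where f > 0. *)
Lemma level_boundary : boundary d.+1 V = [set x | V x /\ f x = 0].
Proof.
apply/seteqP; split=> x.
  move=> bx; have Vx : V x by case: bx.
  have [U [W [psi [chi [ch Ux c0 _]]]]] := level_charts Vx.
  split=> //; apply: contrapT => fx.
  apply: (interior_chart_not_boundary ch Vx Ux _ bx) => i /c0[ge0 e].
  by rewrite lt_neqAle ge0 andbT eq_sym; apply/eqP => /e.
move=> [Vx fx]; have [U [W [psi [chi [ch Ux c0 _]]]]] := level_charts Vx.
split=> //; exists U, W, psi, chi; split=> //; exists ord0 => //.
by apply/(c0 ord0 _).2.
Qed.

Lemma level_tangent x v : tangent d.+1 V x v <-> V x /\ 'D_v F x = 0.
Proof.
split=> [tv|[Vx F0]].
  have Vx : V x by case: tv.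
  split=> //; have dF := derivableP (smooth_at_derivable (v := v) (sF Vx)).
  apply/rowP => j; have [_ e] := is_derive_coord j dF; rewrite mxE -e.
  apply: (@tangent_level _ d.+1 V _ x v 0) => //.
    by apply: smooth_at_coord; exact: sF.
  by move=> y /VE[-> _]; rewrite mxE.
have [U [W [psi [chi [ch Ux _ tg]]]]] := level_charts Vx.
by split=> //; exists U, W, psi, chi; split=> //; exact: tg.
Qed.

End LevelSetManifold.
End LevelSets.

Section DerivativeRules.
Context {R : realType}.
Implicit Types E F : normedModType R.

Lemma is_derive_opp E F (f : E -> F) (x v : E) df :
  is_derive x v f df -> is_derive x v (fun y => - f y) (- df).
Proof. exact: is_deriveN. Qed.

Lemma is_derive_sub E F (f g : E -> F) (x v : E) df dg :
  is_derive x v f df -> is_derive x v g dg -> is_derive x v (fun y => f y - g y) (df - dg).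
Proof. exact: is_deriveB. Qed.

Lemma is_derive_exp_comp E (f : E -> R^o) (x v : E) (df : R) :
  is_derive x v f df -> is_derive x v (fun y => expR (f y) : R^o) (expR (f x) * df).
Proof. by move=> d; apply: is_derive_comp1 d (is_derive_expR _). Qed.

Lemma is_derive_cos_comp E (f : E -> R^o) (x v : E) (df : R) :
  is_derive x v f df -> is_derive x v (fun y => cos (f y) : R^o) (- sin (f x) * df).
Proof. by move=> d; apply: is_derive_comp1 d (is_derive_cos _). Qed.

Lemma is_derive_sin_comp E (f : E -> R^o) (x v : E) (df : R) :
  is_derive x v f df -> is_derive x v (fun y => sin (f y) : R^o) (cos (f x) * df).
Proof. by move=> d; apply: is_derive_comp1 d (is_derive_sin _). Qed.

Lemma is_derive_sqrt_comp E (f : E -> R^o) (x v : E) (df : R) : 0 < f x ->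
  is_derive x v f df ->
  is_derive x v (fun y => Num.sqrt (f y) : R^o) ((2 * Num.sqrt (f x))^-1 * df).
Proof. by move=> f0 d; apply: is_derive_comp1 d (is_derive1_sqrt f0). Qed.

Lemma is_derive_inv_comp E (f : E -> R^o) (x v : E) (df : R) : f x != 0 ->
  is_derive x v f df ->
  is_derive x v (fun y => (f y)^-1 : R^o) (- ((f x)^-1 * (f x)^-1) * df).
Proof. by move=> f0 d; apply: is_derive_comp1 d (is_derive_inv f0). Qed.

End DerivativeRules.

(* Class resolution is switched off: it would instantiate the unknown derivative arbitrarily. *)
Ltac der1 := lazymatch goal with |- is_derive _ _ _ _ => first
  [ match goal with H : is_derive _ _ _ _ |- _ => notypeclasses refine H end
  | notypeclasses refine (is_derive_cst _ _ _)
  | notypeclasses refine (is_derive_id _ _)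
  | simple notypeclasses refine (is_derive_row_mx _ _)
  | simple notypeclasses refine (is_derive_pair _ _)
  | simple notypeclasses refine (is_derive_sub _ _)
  | simple notypeclasses refine (is_derive_add _ _)
  | simple notypeclasses refine (is_derive_opp _)
  | simple notypeclasses refine (is_derive_mul _ _)
  | simple notypeclasses refine (is_derive_pow _ _)
  | simple notypeclasses refine (is_deriveZ_fun _ _)
  | simple notypeclasses refine (is_derive_dot _ _)
  | simple notypeclasses refine (is_derive_exp_comp _)
  | simple notypeclasses refine (is_derive_cos_comp _)
  | simple notypeclasses refine (is_derive_sin_comp _)
  | simple notypeclasses refine (is_derive_sqrt_comp _ _)
  | simple notypeclasses refine (is_derive_inv_comp _ _)
  | simple notypeclasses refine (is_derive_lsub _)
  | simple notypeclasses refine (is_derive_rsub _)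
  | simple notypeclasses refine (is_derive_coord _ _)
  | simple notypeclasses refine (is_derive_fst _)
  | simple notypeclasses refine (is_derive_snd _) ] end.
Ltac der := repeat der1.
Ltac der_vec := simple notypeclasses refine (is_derive_eq _ _); [ | der | ].
Ltac der_eq := simple notypeclasses refine (is_derive_eq _ _); [ | der | rewrite /GRing.scale /= ].

(** * The Liouville forms and the disc cotangent bundle *)

Section Pages.
Context {R : realType} {N : nat}.
Local Notation E := 'rV[R]_(N + N).
Local Notation l := lsubmx.
Local Notation r := rsubmx.

Lemma dot_row_mx (a b c d : 'rV[R]_N) : dot (row_mx a b) (row_mx c d) = dot a c + dot b d.
Proof.
rewrite /dot big_split_ord; congr (_ + _); apply: eq_bigr => i _;
  by rewrite ?row_mxEl ?row_mxEr.
Qed.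

Lemma dot_lr (x y : E) : dot x y = dot (l x) (l y) + dot (r x) (r y).
Proof. by rewrite -dot_row_mx !hsubmxK. Qed.

(* In coordinates x = (q, xi), this is xi.dq. *)
Definition canonical_form (x u : E) : R := dot (r x) (l u).

(* In coordinates x = (Re z, Im z), this is (1/2) (x.dy - y.dx). *)
Definition radial_form (x u : E) : R := (dot (l x) (r u) - dot (r x) (l u)) / 2.

Lemma dform_canonical (x u v : E) :
  dform canonical_form x u v = dot (r u) (l v) - dot (r v) (l u).
Proof.
have d (w w' : E) : is_derive x w (fun y : E => (dot (r y) (l w') : R^o)) (dot (r w) (l w')).
  apply: is_derive_eq; first by der.
  by rewrite dot0r addr0.
by rewrite /dform /canonical_form; have [_ ->] := d u v; have [_ ->] := d v u.
Qed.

Lemma dform_radial (x u v : E) :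
  dform radial_form x u v = dot (l u) (r v) - dot (r u) (l v).
Proof.
have d (w w' : E) : is_derive x w (fun y : E => ((dot (l y) (r w') - dot (r y) (l w')) / 2 : R^o))
    ((dot (l w) (r w') - dot (r w) (l w')) / 2).
  apply: is_derive_eq; first by der.
  by rewrite !dot0r; ring.
rewrite /dform /radial_form; have [_ ->] := d u v; have [_ ->] := d v u.
by rewrite (dotC (l v)) (dotC (r v)); field.
Qed.

Lemma one_form_canonical (V : set E) : one_form V canonical_form.
Proof.
split=> [x c u v|v]; first by rewrite /canonical_form linearP /= dotDr dotZr.
apply: smooth_near_at => x _; rewrite /canonical_form; smooth.
Qed.

Lemma one_form_radial (V : set E) : one_form V radial_form.
Proof.
split=> [x c u v|v].
  by rewrite /radial_form !linearP /= !dotDr !dotZr; field.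
apply: smooth_near_at => x _; rewrite /radial_form; smooth.
Qed.

(* The unit disc cotangent bundle of the sphere S^(N-1), x = (q, xi). *)
Definition disc_cotangent : set E :=
  [set x | [/\ dot (l x) (l x) = 1, dot (l x) (r x) = 0 & dot (r x) (r x) <= 1]].

Definition disc_cotangent_eqs (x : E) : 'rV[R]_(1 + 1) :=
  row_mx (\row_(i < 1) (dot (l x) (l x) - 1)) (\row_(i < 1) dot (l x) (r x)).

Definition cosphere_eq (x : E) : R^o := 1 - dot (r x) (r x).

Lemma smooth_at_const_row (F : normedModType R) (x : F) (f : F -> R^o) :
  smooth_at x f -> smooth_at x (fun y => \row_(i < 1) f y).
Proof. by move=> sf; apply/smooth_at_rV => j; under eq_fun do rewrite mxE. Qed.

Lemma is_derive_const_row (F : normedModType R) (x v : F) (f : F -> R^o) df :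
  is_derive x v f df -> is_derive x v (fun y => \row_(i < 1) f y) (\row_(i < 1) df).
Proof.
move=> sf; apply: (is_derive_rV _ _ _ _).2 => j; rewrite mxE.
by under eq_fun do rewrite mxE.
Qed.

Lemma is_derive_disc_cotangent_eqs (x v : E) : is_derive x v disc_cotangent_eqs
  (row_mx (\row_(i < 1) (2 * dot (l x) (l v)))
          (\row_(i < 1) (dot (l v) (r x) + dot (l x) (r v)))).
Proof.
apply: is_derive_row_mx; apply: is_derive_const_row; apply: is_derive_eq; try by der.
by rewrite (dotC (l v)); ring.
Qed.

Lemma is_derive_cosphere_eq (x v : E) :
  is_derive x v cosphere_eq (- (2 * dot (r x) (r v))).
Proof. by apply: is_derive_eq; [der|rewrite (dotC (r v)); ring]. Qed.

Lemma row_mx_eq0 n1 n2 (a : 'rV[R]_n1) (b : 'rV[R]_n2) : row_mx a b = 0 <-> a = 0 /\ b = 0.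
Proof.
by split=> [e|[-> ->]]; [apply: eq_row_mx; rewrite e row_mx0|rewrite row_mx0].
Qed.

Lemma const_row_eq0 (a : R) : (\row_(i < 1) a : 'rV[R]_1) = 0 <-> a = 0.
Proof.
split=> [/rowP/(_ ord0)|->]; first by rewrite !mxE.
by apply/rowP => i; rewrite !mxE.
Qed.

Lemma disc_cotangentE x : disc_cotangent x <-> disc_cotangent_eqs x = 0 /\ 0 <= cosphere_eq x.
Proof.
rewrite /disc_cotangent_eqs /cosphere_eq subr_ge0; split=> [[e1 e2 e3]|[]].
  by split=> //; apply/row_mx_eq0; split; apply/const_row_eq0; rewrite ?e1 ?subrr.
by move=> /row_mx_eq0[/const_row_eq0/eqP + /const_row_eq0 ?]; rewrite subr_eq0 => /eqP.
Qed.

(** Moving q along q changes |q|^2, moving xi along q changes q.xi, and moving xi along xi changes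
    |xi|^2; the last works on the boundary, where |xi| = 1. *)
Lemma disc_cotangent_surj x (a : 'rV[R]_(1 + 1)) (b : R) : disc_cotangent x -> exists v : E,
  'D_v disc_cotangent_eqs x = a /\ (cosphere_eq x = 0 -> 'D_v cosphere_eq x = b).
Proof.
move=> [qq qx xx].
pose v : E := row_mx ((lsubmx a ord0 ord0 / 2) *: l x)
  (rsubmx a ord0 ord0 *: l x + (- b / 2) *: r x).
exists v; have [_ ->] := is_derive_disc_cotangent_eqs x v.
have [_ ->] := is_derive_cosphere_eq x v.
rewrite /v row_mxKl row_mxKr !(dotDr, dotZr, dotNr, dotZl) (dotC (r x) (l x)) qq qx.
split; last first.
  by rewrite /cosphere_eq => /eqP; rewrite subr_eq0 => /eqP <-; field.
rewrite -[RHS]hsubmxK; congr row_mx; apply/rowP => i; rewrite mxE (ord1 i).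
  by field.
by rewrite !(mulr0, mulr1, addr0, add0r).
Qed.

Lemma smooth_at_disc_cotangent_eqs x : smooth_at x disc_cotangent_eqs.
Proof. by apply: smooth_at_row_mx; apply: smooth_at_const_row; smooth. Qed.

Lemma smooth_at_cosphere_eq x : smooth_at x cosphere_eq.
Proof. by rewrite /cosphere_eq; smooth. Qed.

Section DiscCotangent.
Context {d : nat} (en : (N + N = 1 + 1 + d.+1)%N).

Lemma disc_cotangent_submanifold : submanifold d.+1 disc_cotangent.
Proof.
apply: (level_submanifold en disc_cotangentE).
- by move=> x _; exact: smooth_at_disc_cotangent_eqs.
- by move=> x _; exact: smooth_at_cosphere_eq.
- by move=> x a Vx; have [v [e _]] := disc_cotangent_surj a 0 Vx; exists v.
- by move=> x a b Vx x0; have [v [e1 e2]] := disc_cotangent_surj a b Vx; exists v; split=> //; exact: e2.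
Qed.

Lemma boundary_disc_cotangent : boundary d.+1 disc_cotangent =
  [set x | [/\ dot (l x) (l x) = 1, dot (l x) (r x) = 0 & dot (r x) (r x) = 1]].
Proof.
rewrite (level_boundary en disc_cotangentE); first last.
- by move=> x a b Vx x0; have [v [e1 e2]] := disc_cotangent_surj a b Vx; exists v; split=> //; exact: e2.
- by move=> x a Vx; have [v [e _]] := disc_cotangent_surj a 0 Vx; exists v.
- by move=> x _; exact: smooth_at_cosphere_eq.
- by move=> x _; exact: smooth_at_disc_cotangent_eqs.
apply/seteqP; split=> x.
  by move=> [[e1 e2 _] /eqP]; rewrite subr_eq0 => /eqP.
by move=> [e1 e2 e3]; rewrite /= /cosphere_eq e3 subrr; split=> //; split=> //; rewrite e3.
Qed.

Lemma tangent_disc_cotangent x v : tangent d.+1 disc_cotangent x v <->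
  [/\ disc_cotangent x, dot (l x) (l v) = 0 & dot (l v) (r x) + dot (l x) (r v) = 0].
Proof.
rewrite (level_tangent en disc_cotangentE); first last.
- by move=> y a b Vx x0; have [w [e1 e2]] := disc_cotangent_surj a b Vx; exists w; split=> //; exact: e2.
- by move=> y a Vx; have [w [e _]] := disc_cotangent_surj a 0 Vx; exists w.
- by move=> y _; exact: smooth_at_cosphere_eq.
- by move=> y _; exact: smooth_at_disc_cotangent_eqs.
have [_ ->] := is_derive_disc_cotangent_eqs x v.
rewrite row_mx_eq0 !const_row_eq0; split=> [[Vx [e1 e2]]|[Vx e1 e2]]; last by rewrite e1 mulr0.
by split=> //; move/eqP: e1; rewrite mulf_eq0 pnatr_eq0 /= => /eqP.
Qed.

(** Only necessary conditions are recorded. They come from [tangent_level] for three functions that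
    are constant on the boundary, without charts of the boundary. *)
Lemma bdtangent_disc_cotangent x v : bdtangent d.+1 disc_cotangent x v ->
  [/\ boundary d.+1 disc_cotangent x, dot (l x) (l v) = 0, dot (l v) (r x) + dot (l x) (r v) = 0
    & dot (r x) (r v) = 0].
Proof.
move=> tv; have bx : boundary d.+1 disc_cotangent x by case: tv.
have t1 (f : E -> R^o) (c : R) : smooth_at x f -> (forall y, boundary d.+1 disc_cotangent y -> f y = c) -> 'D_v f x = 0.
  by move=> sf fc; exact: tangent_level sf fc tv.
rewrite boundary_disc_cotangent in t1; split=> //.
- have : 'D_v (fun y : E => dot (l y) (l y) : R^o) x = 0.
    by apply: (t1 _ 1); [smooth|move=> y []].
  have d1 : is_derive x v (fun y : E => dot (l y) (l y) : R^o) (2 * dot (l x) (l v)).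
    by apply: is_derive_eq; [der|rewrite (dotC (l v)); ring].
  by have [_ ->] := d1 => /eqP; rewrite mulf_eq0 pnatr_eq0 /= => /eqP.
- have : 'D_v (fun y : E => dot (l y) (r y) : R^o) x = 0.
    by apply: (t1 _ 0); [smooth|move=> y []].
  have d1 : is_derive x v (fun y : E => dot (l y) (r y) : R^o) (dot (l v) (r x) + dot (l x) (r v)).
    by apply: is_derive_eq; [der|].
  by have [_ ->] := d1.
- have : 'D_v (fun y : E => dot (r y) (r y) : R^o) x = 0.
    by apply: (t1 _ 1); [smooth|move=> y []].
  have d1 : is_derive x v (fun y : E => dot (r y) (r y) : R^o) (2 * dot (r x) (r v)).
    by apply: is_derive_eq; [der|rewrite (dotC (r v)); ring].
  by have [_ ->] := d1 => /eqP; rewrite mulf_eq0 pnatr_eq0 /= => /eqP.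
Qed.

(** The flow of the Liouville field, which is radial in xi. *)
Definition disc_cotangent_collar (p : R^o * E) : E := row_mx (l p.2) (expR p.1 *: r p.2).

Lemma is_derive_disc_cotangent_collar (t : R) (x : E) (s : R) (u : E) :
  is_derive ((t, x) : R^o * E) (s, u) disc_cotangent_collar
    (row_mx (l u) ((expR t * s) *: r x + expR t *: r u)).
Proof. by rewrite /disc_cotangent_collar; apply: is_derive_eq; [der|]. Qed.

End DiscCotangent.
End Pages.

(** * The two pages *)

Section ExactPages.
Context {R : realType} {N : nat}.
Local Notation E := 'rV[R]_(N + N).
Local Notation l := lsubmx.
Local Notation r := rsubmx.
Local Notation DT := (@disc_cotangent R N).

Lemma lsubmxD (a b : E) : l (a + b) = l a + l b. Proof. exact: linearD. Qed.
Lemma rsubmxD (a b : E) : r (a + b) = r a + r b. Proof. exact: linearD. Qed.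
Lemma lsubmxN (a : E) : l (- a) = - l a. Proof. exact: linearN. Qed.
Lemma rsubmxN (a : E) : r (- a) = - r a. Proof. exact: linearN. Qed.
Lemma lsubmxZ c (a : E) : l (c *: a) = c *: l a. Proof. exact: linearZ. Qed.
Lemma rsubmxZ c (a : E) : r (c *: a) = c *: r a. Proof. exact: linearZ. Qed.
Lemma lsubmx0 : l (0 : E) = 0. Proof. exact: linear0. Qed.
Lemma rsubmx0 : r (0 : E) = 0. Proof. exact: linear0. Qed.

Definition lrE := ((@row_mxKl R 1 N N), (@row_mxKr R 1 N N), lsubmxD, rsubmxD, lsubmxN, rsubmxN,
  lsubmxZ, rsubmxZ, lsubmx0, rsubmx0).

Lemma continuous_smooth n (f : 'rV[R]_n -> R^o) : (forall x, smooth_at x f) -> continuous f.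
Proof. by move=> sf x; exact: smooth_at_continuous. Qed.

Lemma bounded_dot n (A : set 'rV[R]_n) (C : R) : (forall x, A x -> dot x x <= C) -> bounded_set A.
Proof.
move=> AC; exists (1 + C); split; first exact: num_real.
move=> M hM x Ax; apply: le_trans (ltW hM); have xC := AC x Ax.
have C0 : 0 <= C by apply: le_trans (dot_ge0 x) xC.
apply/rV_normP; first by rewrite addr_ge0.
move=> i; have xi : x ord0 i ^+ 2 <= C.
  apply: le_trans xC; rewrite /dot (bigD1 i) //= -expr2 lerDl sumr_ge0 // => j _.
  by rewrite -expr2 sqr_ge0.
rewrite -(@ler_pXn2r _ 2) ?nnegrE ?addr_ge0 // -normrX ger0_norm ?sqr_ge0 //.
apply: le_trans xi _; nra.
Qed.

Lemma compact_disc_cotangent : compact DT.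
Proof.
apply: bounded_closed_compact.
  apply: (@bounded_dot _ _ 2) => x [qq _ xx]; rewrite dot_lr qq; lra.
have c1 : continuous (fun x : E => dot (l x) (l x) : R^o).
  by apply: continuous_smooth => x; smooth.
have c2 : continuous (fun x : E => dot (l x) (r x) : R^o).
  by apply: continuous_smooth => x; smooth.
have c3 : continuous (fun x : E => dot (r x) (r x) : R^o).
  by apply: continuous_smooth => x; smooth.
have -> : DT = [set x : E | dot (l x) (l x) = 1] `&` [set x : E | dot (l x) (r x) = 0]
   `&` [set x : E | dot (r x) (r x) <= 1].
  by apply/seteqP; split=> x; [move=> []|move=> [[? ?] ?]].
apply: closedI; first apply: closedI.
- exact: (preimage_closed (fun x _ => c1 x) (@closed_eq R 1)).
- exact: (preimage_closed (fun x _ => c2 x) (@closed_eq R 0)).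
- exact: (preimage_closed (fun x _ => c3 x) (@closed_le R 1)).
Qed.

Section Disc.
Context {d : nat} (en : (N + N = 1 + 1 + d.+1)%N).

(** A vertical u is paired with the horizontal vector [r u], corrected to be tangent; any other u is
    paired with the vertical vector [l u]. The value is plus or minus a squared length. *)
Lemma disc_cotangent_nondegenerate (x u : E) : tangent d.+1 DT x u -> u != 0 ->
  exists2 v, tangent d.+1 DT x v & dform canonical_form x u v != 0.
Proof.
move=> /(tangent_disc_cotangent en)[Vx e1 e2] u0; have [qq qx xx] := Vx.
have [lu|lu] := eqVneq (l u) 0.
  have ru : r u != 0.
    by apply: contra u0 => /eqP ru; rewrite -[u]hsubmxK lu ru row_mx0.
  have e3 : dot (l x) (r u) = 0 by rewrite lu dot0l add0r in e2.
  exists (row_mx (r u) (- dot (r u) (r x) *: l x)).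
    apply/(tangent_disc_cotangent en); rewrite row_mxKl row_mxKr dotZr qq mulr1 subrr.
    by split.
  rewrite dform_canonical row_mxKl row_mxKr lu dot0r subr0.
  by rewrite dot_eq0.
exists (row_mx 0 (l u)).
  apply/(tangent_disc_cotangent en); rewrite row_mxKl row_mxKr dot0r dot0l add0r.
  by split.
by rewrite dform_canonical row_mxKl row_mxKr dot0r sub0r oppr_eq0 dot_eq0.
Qed.

Lemma smooth_at_disc_cotangent_collar p : smooth_at p (@disc_cotangent_collar R N).
Proof. by rewrite /disc_cotangent_collar; smooth. Qed.

Lemma disc_cotangent_is_collar : is_collar d.+1 DT canonical_form disc_cotangent_collar.
Proof.
have bE := @boundary_disc_cotangent R N d en.
split.
- by apply: smooth_near_at => p _; exact: smooth_at_disc_cotangent_collar.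
(* The set |xi| > 1/e is what the collar of length 1 covers. *)
- pose O := [set y : E | expR (- 1) < Num.sqrt (dot (r y) (r y))].
  have O0 y : O y -> 0 < dot (r y) (r y).
    by move=> /(lt_trans (expR_gt0 _)); rewrite sqrtr_gt0.
  exists O, (fun y => (ln (Num.sqrt (dot (r y) (r y))) : R^o,
     row_mx (l y) ((Num.sqrt (dot (r y) (r y)))^-1 *: r y))); split.
  + have c : continuous (fun y : E => Num.sqrt (dot (r y) (r y))).
      move=> y; apply: (@continuous_comp _ _ _ (fun y : E => dot (r y) (r y) : R^o) Num.sqrt).
        by apply: smooth_at_continuous; smooth.
      exact: sqrt_continuous.
    exact: (open_comp (fun x _ => c x) (@open_gt R (expR (- 1)))).
  + move=> x; rewrite bE => -[_ _ xx]; rewrite /O /= xx sqrtr1.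
    by rewrite -[X in _ < X](@expR0 R) ltr_expR ltrN10.
  + apply: smooth_near_at => y [_ /O0 y0].
    by smooth; rewrite ?gt_eqF ?sqrtr_gt0.
  + move=> t x /andP[t1 t0]; rewrite bE => -[qq qx xx].
    have xt : dot (expR t *: r x) (expR t *: r x) = expR t ^+ 2.
      by rewrite dotZl dotZr xx; ring.
    have sE : Num.sqrt (expR t ^+ 2) = expR t by rewrite sqrtr_sqr ger0_norm ?expR_ge0.
    rewrite /O /disc_cotangent_collar /= row_mxKl row_mxKr xt sE; split.
    * split; rewrite ?row_mxKl ?row_mxKr ?xt //; first by rewrite dotZr qx mulr0.
      by rewrite expr_le1 ?expR_ge0 // -(@expR0 R) ler_expR.
    * by rewrite ltr_expR.
    * by rewrite expRK scalerA mulVf ?gt_eqF ?expR_gt0 // scale1r hsubmxK.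
  + move=> y Vy Oy; have [qq qx xx] := Vy; have y0 := O0 y Oy.
    have s0 : 0 < Num.sqrt (dot (r y) (r y)) by rewrite sqrtr_gt0.
    rewrite bE /disc_cotangent_collar /= row_mxKl row_mxKr lnK ?posrE //.
    rewrite scalerA divff ?gt_eqF // scale1r hsubmxK; split=> //.
      rewrite -[X in X < _](@expRK R) ltr_ln ?posrE ?expR_gt0 // Oy /=.
      rewrite ln_le0 // -sqrtr1 ler_wsqrtr //.
    split=> //; first by rewrite dotZr qx mulr0.
    rewrite dotZl dotZr mulrA -invfM -expr2 sqr_sqrtr ?dot_ge0 // mulVf // gt_eqF //.
- by move=> x _; rewrite /disc_cotangent_collar /= expR0 scale1r hsubmxK.
- move=> t x s1 s2 u1 u2 _ bx /(bdtangent_disc_cotangent en)[_ a1 a2 a3].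
  move=> /(bdtangent_disc_cotangent en)[_ b1 b2 b3].
  rewrite bE in bx; case: bx => qq qx xx.
  have [_ ->] := is_derive_disc_cotangent_collar t x s1 u1.
  have [_ ->] := is_derive_disc_cotangent_collar t x s2 u2.
  rewrite !dform_canonical /canonical_form !row_mxKl !row_mxKr !dotE.
  by ring.
- move=> t x u _ bx /(tangent_disc_cotangent en)[_ e1 e2].
  have [_ ->] := is_derive_disc_cotangent_collar t x 1 0.
  rewrite dform_canonical /canonical_form /disc_cotangent_collar /= !row_mxKl !row_mxKr.
  by rewrite !linear0 !dotE; ring.
Qed.

Lemma disc_cotangent_exact : exact_symplectic d.+1 DT canonical_form.
Proof.
split; [exact: compact_disc_cotangent|exact: disc_cotangent_submanifold|
  exact: one_form_canonical|exact: disc_cotangent_nondegenerate|].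
by exists disc_cotangent_collar; exact: disc_cotangent_is_collar.
Qed.

End Disc.

(** The squared radius is 2 because the page embedding has |z|^2 = 2 |xi| near the boundary |xi| =
    1. *)
Definition ball2 : set E := [set x | dot x x <= 2].

Definition sphere_eq (x : E) : R^o := 2 - dot x x.

Lemma compact_ball2 : compact ball2.
Proof.
apply: bounded_closed_compact; first by apply: (@bounded_dot _ _ 2) => x.
have c : continuous (fun x : E => dot x x : R^o).
  by apply: continuous_smooth => x; smooth.
exact: (preimage_closed (fun x _ => c x) (@closed_le R 2)).
Qed.

Lemma is_derive_sphere_eq (x v : E) : is_derive x v sphere_eq (- (2 * dot x v)).
Proof. by apply: is_derive_eq; [der|rewrite (dotC v); ring]. Qed.

Lemma smooth_at_sphere_eq x : smooth_at x sphere_eq.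
Proof. by rewrite /sphere_eq; smooth. Qed.

Lemma sphere_eq_surj x b : sphere_eq x = 0 -> exists v : E, 'D_v sphere_eq x = b.
Proof.
move=> /eqP; rewrite subr_eq0 => /eqP xx; exists ((- b / 4) *: x).
by have [_ ->] := is_derive_sphere_eq x ((- b / 4) *: x); rewrite dotZr -xx; field.
Qed.

Lemma rV0E (a b : 'rV[R]_0) : a = b.
Proof. by apply/rowP => -[]. Qed.

Lemma ball2E x : ball2 x <-> (cst 0 x : 'rV[R]_0) = 0 /\ 0 <= sphere_eq x.
Proof. by rewrite /sphere_eq subr_ge0; split=> [|[]]. Qed.

Section Ball.
Context {d : nat} (en : (N + N = 0 + d.+2)%N).

Let s1 x : ball2 x -> smooth_at x (cst 0 : E -> 'rV[R]_0).
Proof. by move=> _; exact: smooth_at_cst. Qed.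

Let s2 x : ball2 x -> smooth_at x sphere_eq.
Proof. by move=> _; exact: smooth_at_sphere_eq. Qed.

Let s3 x (a : 'rV[R]_0) : ball2 x -> exists v, 'D_v (cst 0 : E -> 'rV[R]_0) x = a.
Proof. by move=> _; exists 0; exact: rV0E. Qed.

Let s4 x (a : 'rV[R]_0) b : ball2 x -> sphere_eq x = 0 -> exists v,
  'D_v (cst 0 : E -> 'rV[R]_0) x = a /\ 'D_v sphere_eq x = b.
Proof. by move=> _ /(sphere_eq_surj b)[v e]; exists v; split=> //; exact: rV0E. Qed.

Lemma ball2_submanifold : submanifold d.+2 ball2.
Proof. exact: (level_submanifold en ball2E s1 s2 s3 s4). Qed.

Lemma boundary_ball2 : boundary d.+2 ball2 = [set x | dot x x = 2].
Proof.
rewrite (level_boundary en ball2E s1 s2 s3 s4); apply/seteqP; split=> x.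
  by move=> [_ /eqP]; rewrite subr_eq0 => /eqP.
by move=> e; rewrite /= /ball2 /sphere_eq /= e subrr.
Qed.

Lemma tangent_ball2 x v : tangent d.+2 ball2 x v <-> ball2 x.
Proof.
rewrite (level_tangent en ball2E s1 s2 s3 s4); split=> [[]|] //.
by move=> bx; split=> //; exact: rV0E.
Qed.

(** Both directions are required, since transversality of the page embedding has to exhibit boundary
    tangent vectors. The sphere is a level set without boundary, hence the constant 1 as defining
    function. *)
Lemma bdtangent_ball2 x v : bdtangent d.+2 ball2 x v <-> dot x x = 2 /\ dot x v = 0.
Proof.
have en' : (N + N = 1 + d.+1)%N by rewrite en.
pose F x : 'rV[R]_1 := \row_(i < 1) sphere_eq x.
have dF y w : is_derive y w F (\row_(i < 1) - (2 * dot y w)).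
  by apply: is_derive_const_row; exact: is_derive_sphere_eq.
have VE y : boundary d.+2 ball2 y <-> F y = 0 /\ 0 <= (cst 1 : E -> R^o) y.
  rewrite boundary_ball2 /F const_row_eq0 /sphere_eq /=; split=> [->|[/eqP + _]].
    by rewrite subrr; split=> //; exact: ler01.
  by rewrite subr_eq0 => /eqP.
rewrite /bdtangent /= (level_tangent en' VE).
- have [_ ->] := dF x v; rewrite const_row_eq0 boundary_ball2 /=.
  split=> -[-> e]; split=> //; last by rewrite e mulr0 oppr0.
  by move/eqP: e; rewrite oppr_eq0 mulf_eq0 pnatr_eq0 /= => /eqP.
- by move=> y _; apply: smooth_at_const_row; exact: smooth_at_sphere_eq.
- by move=> y _; exact: smooth_at_cst.
- move=> y a; rewrite boundary_ball2 /= => yy.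
  have [|w e] := @sphere_eq_surj y (a ord0 ord0); first by rewrite /sphere_eq yy subrr.
  exists w; have [_ ->] := dF y w; have [_ e'] := is_derive_sphere_eq y w.
  by apply/rowP => i; rewrite mxE -e' e (ord1 i).
- by move=> y a b _ /= /eqP; rewrite oner_eq0.
Qed.

(** The flow of z/2, the Liouville field of the radial form. *)
Definition ball2_collar (p : R^o * E) : E := expR (p.1 / 2) *: p.2.

Lemma smooth_at_ball2_collar p : smooth_at p ball2_collar.
Proof. by rewrite /ball2_collar; smooth. Qed.

Lemma is_derive_ball2_collar (t : R) (x : E) (s : R) (u : E) :
  is_derive ((t, x) : R^o * E) (s, u) ball2_collar (expR (t / 2) *: ((s / 2) *: x + u)).
Proof.
rewrite /ball2_collar; apply: is_derive_eq; first by der.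
by rewrite /= mulr0 add0r scalerDr scalerA [2^-1 * s]mulrC.
Qed.

Lemma half_itv (t : R) : -1 < t <= 0 -> - 1 / 2 < t / 2 <= 0.
Proof. lra. Qed.

Lemma double_itv (t : R) : - 1 / 2 < t <= 0 -> -1 < t * 2 <= 0.
Proof. lra. Qed.

Lemma ball2_is_collar : is_collar d.+2 ball2 radial_form ball2_collar.
Proof.
have bE := boundary_ball2.
split.
- by apply: smooth_near_at => p _; exact: smooth_at_ball2_collar.
- pose O := [set y : E | expR (- 1 / 2) < Num.sqrt (dot y y / 2)].
  have O0 y : O y -> 0 < dot y y / 2.
    by move=> /(lt_trans (expR_gt0 _)); rewrite sqrtr_gt0.
  exists O, (fun y => (2 * ln (Num.sqrt (dot y y / 2)) : R^o,
     (Num.sqrt (dot y y / 2))^-1 *: y)); split.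
  + have c : continuous (fun y : E => Num.sqrt (dot y y / 2)).
      move=> y; apply: (@continuous_comp _ _ _ (fun y : E => dot y y / 2 : R^o) Num.sqrt).
        by apply: smooth_at_continuous; smooth.
      exact: sqrt_continuous.
    exact: (open_comp (fun x _ => c x) (@open_gt R (expR (- 1 / 2)))).
  + move=> x; rewrite bE /= => xx; rewrite /O /= xx divff // sqrtr1.
    by rewrite -[X in _ < X](@expR0 R) ltr_expR; lra.
  + apply: smooth_near_at => y [_ /O0 y0].
    by smooth; rewrite ?gt_eqF ?sqrtr_gt0.
  + move=> t x /half_itv/andP[t1 t0]; rewrite bE /= => xx.
    have xt : dot (expR (t / 2) *: x) (expR (t / 2) *: x) / 2 = expR (t / 2) ^+ 2.
      by rewrite dotZl dotZr xx; field.
    have sE : Num.sqrt (expR (t / 2) ^+ 2) = expR (t / 2) by rewrite sqrtr_sqr ger0_norm ?expR_ge0.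
    rewrite /O /ball2_collar /= xt sE; split.
    * rewrite /ball2 /=; have : expR (t / 2) ^+ 2 <= 1.
        by apply: exprn_ile1; rewrite ?expR_ge0 // -[X in _ <= X](@expR0 R) ler_expR.
      by rewrite -xt; lra.
    * by rewrite ltr_expR.
    * by rewrite expRK scalerA mulVf ?gt_eqF ?expR_gt0 // scale1r mulrC divfK.
  + move=> y Vy Oy; have y0 := O0 y Oy; rewrite /ball2 /= in Vy.
    have s0 : 0 < Num.sqrt (dot y y / 2) by rewrite sqrtr_gt0.
    rewrite bE /ball2_collar /= [2 * _]mulrC mulfK // lnK ?posrE //.
    rewrite scalerA divff ?gt_eqF // scale1r; split=> //.
      have h1 : - 1 / 2 < ln (Num.sqrt (dot y y / 2)).
        by rewrite -[X in X < _](@expRK R) ltr_ln ?posrE ?expR_gt0.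
      have h2 : ln (Num.sqrt (dot y y / 2)) <= 0.
        by rewrite ln_le0 // -[X in _ <= X](@sqrtr1 R) ler_wsqrtr // ler_pdivrMr // mul1r.
      by apply: double_itv; rewrite h1.
    rewrite dotZl dotZr mulrA -invfM -expr2 sqr_sqrtr ?ltW //.
    by field; rewrite gt_eqF //; lra.
- by move=> x _; rewrite /ball2_collar /= mul0r expR0 scale1r.
- move=> t x s1' s2' u1 u2 _ bx /bdtangent_ball2[_ a1] /bdtangent_ball2[_ b1].
  rewrite bE /= in bx; move: bx a1 b1; rewrite !dot_lr => bx a1 b1.
  have [_ ->] := is_derive_ball2_collar t x s1' u1.
  have [_ ->] := is_derive_ball2_collar t x s2' u2.
  have -> : expR t = expR (t / 2) * expR (t / 2).
    by rewrite -expRD -splitr.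
  rewrite !dform_radial /radial_form !lrE !dotE.
  rewrite (dotC (r x) (l x)) (dotC (l u1) (r x)) (dotC (r u1) (l x)).
  by field.
- move=> t x u _ bx _.
  have [_ ->] := is_derive_ball2_collar t x 1 0.
  rewrite dform_radial /radial_form /ball2_collar /= !lrE !dotE.
  by field.
Qed.

Lemma ball2_nondegenerate (x u : E) : tangent d.+2 ball2 x u -> u != 0 ->
  exists2 v, tangent d.+2 ball2 x v & dform radial_form x u v != 0.
Proof.
move=> /tangent_ball2 bx u0; exists (row_mx (- r u) (l u)); first exact/tangent_ball2.
rewrite dform_radial row_mxKl row_mxKr dotNr opprK -dot_lr dot_eq0.
by [].
Qed.

Lemma ball2_exact : exact_symplectic d.+2 ball2 radial_form.
Proof.
split; [exact: compact_ball2|exact: ball2_submanifold|exact: one_form_radial|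
  exact: ball2_nondegenerate|].
by exists ball2_collar; exact: ball2_is_collar.
Qed.

End Ball.
End ExactPages.

(** * Twists, rotations and the page embedding *)

Section PageMaps.
Context {R : realType} {N : nat}.
Local Notation E := 'rV[R]_(N + N).
Local Notation l := lsubmx.
Local Notation r := rsubmx.
Local Notation DT := (@disc_cotangent R N).
Local Notation sq x := (dot (r x) (r x)).

(** The device for proving identities modulo relations such as cos^2 + sin^2 = 1: the difference of
    the two sides is written as an explicit combination of the relations, which [ring] or [field]
    then checks. *)
Lemma eq_of_sub (a b c : R) : c = 0 -> a - b = c -> a = b.
Proof. by move=> -> /eqP; rewrite subr_eq0 => /eqP. Qed.

Lemma smooth_at_is_derive (F G : normedModType R) (f : F -> G) x v :
  smooth_at x f -> is_derive x v f ('D_v f x).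
Proof. by move=> sf; split=> //; exact: smooth_at_derivable. Qed.

Lemma is_derive_of_sq (f : R^o -> R^o) (x u : E) : smooth_at (sq x : R^o) f ->
  is_derive x u (fun y : E => f (sq y) : R^o) ('D_1 f (sq x) * (2 * dot (r x) (r u))).
Proof.
move=> sf; have d : is_derive x u (fun y : E => sq y : R^o) (2 * dot (r x) (r u)).
  by apply: is_derive_eq; [der|rewrite (dotC (r u)); ring].
by apply: is_derive_comp1 d _; exact: smooth_at_is_derive.
Qed.

Lemma smooth_at_of_sq (F : normedModType R) (g : F -> E) (f : R^o -> R^o) (x : F) :
  smooth_at (sq (g x) : R^o) f -> smooth_at x g -> smooth_at x (fun y => f (sq (g y)) : R^o).
Proof.
by move=> sf sg; apply: (@smooth_at_comp1 _ _ _ (fun y => sq (g y) : R^o)) => //; smooth.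
Qed.

Lemma disc_sq01 (x : E) : DT x -> 0 <= sq x <= 1.
Proof. by move=> [_ _ ->]; rewrite dot_ge0. Qed.

Section Twist.
Variables (A B : R^o -> R^o).
Hypothesis sA : forall s, smooth_at s A.
Hypothesis sB : forall s, smooth_at s B.
Hypothesis AB : forall s : R, A s ^+ 2 + s * B s ^+ 2 = 1.

(* With A = cos th and B = (sin th) / |xi|, this is the geodesic flow at time th for the
   covector normalised to length 1. *)
Definition twist (x : E) : E :=
  row_mx (A (sq x) *: l x + B (sq x) *: r x) (A (sq x) *: r x - (sq x * B (sq x)) *: l x).

Lemma smooth_at_twist x : smooth_at x twist.
Proof.
have s1 : smooth_at x (fun y : E => A (sq y) : R^o) by apply: smooth_at_of_sq; smooth.
have s2 : smooth_at x (fun y : E => B (sq y) : R^o) by apply: smooth_at_of_sq; smooth.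
rewrite /twist (_ : (fun y : E => _) = fun y : E => row_mx
  (A (sq y) *: l y + B (sq y) *: r y) (A (sq y) *: r y + (- (sq y * B (sq y))) *: l y)).
  by smooth.
by apply/funext => y; rewrite scaleNr.
Qed.

Lemma is_derive_twist (x u : E) : is_derive x u twist
  (row_mx (A (sq x) *: l u + B (sq x) *: r u + (2 * dot (r x) (r u)) *:
             ('D_1 A (sq x) *: l x + 'D_1 B (sq x) *: r x))
          (A (sq x) *: r u - (sq x * B (sq x)) *: l u + (2 * dot (r x) (r u)) *:
             ('D_1 A (sq x) *: r x - (B (sq x) + sq x * 'D_1 B (sq x)) *: l x))).
Proof.
have dA := is_derive_of_sq u (sA (sq x)); have dB := is_derive_of_sq u (sB (sq x)).
rewrite /twist; apply: is_derive_eq; first by der.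
congr row_mx; apply/rowP => i; rewrite !mxE /=; first by ring.
by rewrite (dotC (r u) (r x)); ring.
Qed.

Lemma twist_sq x : DT x -> sq (twist x) = sq x.
Proof.
move=> [qq qx _]; rewrite /twist !lrE !dotE (dotC (r x) (l x)) qq qx.
by apply: (@eq_of_sub _ _ (sq x * (A (sq x) ^+ 2 + sq x * B (sq x) ^+ 2 - 1))); [rewrite AB subrr mulr0|ring].
Qed.

Lemma twist_disc x : DT x -> DT (twist x).
Proof.
move=> Vx; have [qq qx xx] := Vx; split; last by rewrite twist_sq.
  rewrite /twist !lrE !dotE (dotC (r x) (l x)) qq qx.
  by apply: (@eq_of_sub _ _ (A (sq x) ^+ 2 + sq x * B (sq x) ^+ 2 - 1)); [rewrite AB subrr|ring].
by rewrite /twist !lrE !dotE (dotC (r x) (l x)) qq qx; ring.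
Qed.

(** Obtained by differentiating [AB]; these two relations are all that [twist_symplectic] uses about
    the coefficients. *)
Lemma derive_twist_coef s : 2 * A s * 'D_1 A s + B s ^+ 2 + 2 * s * B s * 'D_1 B s = 0.
Proof.
have dA := smooth_at_is_derive (1 : R^o) (sA s); have dB := smooth_at_is_derive (1 : R^o) (sB s).
have d : is_derive (s : R^o) 1 (fun s : R^o => A s * A s + s * (B s * B s) : R^o)
   (2 * A s * 'D_1 A s + B s ^+ 2 + 2 * s * B s * 'D_1 B s).
  by apply: is_derive_eq; rewrite /GRing.scale /=; ring.
have [_ <-] := d; under eq_fun => y do rewrite -!expr2 AB.
exact: derive_cst.
Qed.

Context {d : nat} (en : (N + N = 1 + 1 + d.+1)%N).

Lemma twist_symplectic x u v : tangent d.+1 DT x u -> tangent d.+1 DT x v ->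
  dform canonical_form (twist x) ('D_u twist x) ('D_v twist x) = dform canonical_form x u v.
Proof.
move=> /(tangent_disc_cotangent en)[[qq qx _] u1 u2] /(tangent_disc_cotangent en)[_ v1 v2].
have [_ ->] := is_derive_twist x u; have [_ ->] := is_derive_twist x v.
rewrite !dform_canonical !lrE !dotE.
have eu : dot (l x) (r u) = - dot (r x) (l u) by rewrite (dotC (r x)); lra.
have ev : dot (l x) (r v) = - dot (r x) (l v) by rewrite (dotC (r x)); lra.
rewrite !(dotC _ (l x)) !(dotC _ (r x)) (dotC (r x) (l x)) u1 v1 qq qx eu ev.
rewrite (dotC (l v) (r u)) (dotC (r v) (l u)) (dotC (l v) (l u)) (dotC (r v) (r u)).
rewrite (dotC (l u) (r v)) ?(dotC (l u) (r v)).
have e1 := AB (sq x); have e2 := derive_twist_coef (sq x).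
set s := sq x in e1 e2 *.
apply: (@eq_of_sub _ _ ((A s ^+ 2 + s * B s ^+ 2 - 1) * (dot (r u) (l v) - dot (r v) (l u)) +
  (2 * A s * 'D_1 A s + B s ^+ 2 + 2 * s * B s * 'D_1 B s) * 2 *
  (dot (r x) (l v) * dot (r x) (r u) - dot (r x) (l u) * dot (r x) (r v)))).
  by rewrite e1 e2 subrr !mul0r add0r.
by ring.
Qed.

(** For A = cos th and B = sin th / sqrt(s) the coefficient is 2 sqrt(s) th'(s), by
    [cos_sinc_primitive]; this is the differential that h has to integrate. *)
Lemma twist_primitive x u : tangent d.+1 DT x u ->
  canonical_form (twist x) ('D_u twist x) - canonical_form x u =
  (2 * sq x * (A (sq x) * 'D_1 B (sq x) - B (sq x) * 'D_1 A (sq x)) + A (sq x) * B (sq x)) *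
  dot (r x) (r u).
Proof.
move=> /(tangent_disc_cotangent en)[[qq qx _] u1 u2].
have [_ ->] := is_derive_twist x u.
rewrite /canonical_form !lrE !dotE.
have eu : dot (l x) (r u) = - dot (r x) (l u) by rewrite (dotC (r x)); lra.
rewrite (dotC (r x) (l x)) u1 qq qx eu.
have e1 := AB (sq x); set s := sq x in e1 *.
apply: (@eq_of_sub _ _ ((A s ^+ 2 + s * B s ^+ 2 - 1) * dot (r x) (l u))).
  by rewrite e1 subrr mul0r.
by ring.
Qed.

End Twist.

(** Changing the sign of B reverses the flow, and |xi|^2 is invariant, so both maps use the
    coefficients at the same s. *)
Lemma twistK (A B B' : R^o -> R^o) x : (forall s : R, A s ^+ 2 + s * B s ^+ 2 = 1) ->
  (forall s : R, B' s = - B s) -> DT x -> twist A B' (twist A B x) = x.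
Proof.
move=> AB BB Vx; rewrite {1}/twist twist_sq // BB /twist !lrE.
have e := AB (sq x); rewrite -[RHS]hsubmxK; congr row_mx; apply/rowP => i; rewrite !mxE;
  set a := x _ _; set b := x _ _.
  apply: (@eq_of_sub _ _ ((A (sq x) ^+ 2 + sq x * B (sq x) ^+ 2 - 1) * a)); last by ring.
  by rewrite e subrr mul0r.
apply: (@eq_of_sub _ _ ((A (sq x) ^+ 2 + sq x * B (sq x) ^+ 2 - 1) * a)); last by ring.
by rewrite e subrr mul0r.
Qed.

Lemma twist_symplectomorphism (A B : R^o -> R^o) d (en : (N + N = 1 + 1 + d.+1)%N) :
  (forall s, smooth_at s A) -> (forall s, smooth_at s B) ->
  (forall s : R, A s ^+ 2 + s * B s ^+ 2 = 1) ->
  symplectomorphism d.+1 DT canonical_form (twist A B).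
Proof.
move=> sA sB AB; split; last by move=> x u v; exact: twist_symplectic.
have AB' s : A s ^+ 2 + s * (- B s) ^+ 2 = 1 by rewrite sqrrN AB.
have sB' s : smooth_at s (fun s => - B s : R^o) by smooth.
split; first by apply: smooth_near_at => x _; exact: smooth_at_twist.
exists (twist A (fun s => - B s)); split.
  by apply: smooth_near_at => x _; apply: smooth_at_twist.
move=> x Vx; split; [exact: twist_disc|exact: twist_disc|exact: twistK|].
by apply: twistK => // s; rewrite opprK.
Qed.

Section Rotation.
Variables (T : R^o -> R^o).
Hypothesis sT : forall s, smooth_at s T.

(* z |-> e^(i T(|z|^2)) z *)
Definition rotation (x : E) : E :=
  row_mx (cos (T (dot x x)) *: l x - sin (T (dot x x)) *: r x)
         (sin (T (dot x x)) *: l x + cos (T (dot x x)) *: r x).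

Lemma is_derive_rotation x u : is_derive x u rotation
  (row_mx (cos (T (dot x x)) *: l u - sin (T (dot x x)) *: r u +
      ('D_1 T (dot x x) * (2 * dot x u)) *: (- sin (T (dot x x)) *: l x - cos (T (dot x x)) *: r x))
    (sin (T (dot x x)) *: l u + cos (T (dot x x)) *: r u +
      ('D_1 T (dot x x) * (2 * dot x u)) *: (cos (T (dot x x)) *: l x - sin (T (dot x x)) *: r x))).
Proof.
have dT : is_derive x u (fun y : E => T (dot y y) : R^o) ('D_1 T (dot x x) * (2 * dot x u)).
  have d : is_derive x u (fun y : E => dot y y : R^o) (2 * dot x u).
    by apply: is_derive_eq; first (by der); rewrite (dotC u); ring.
  by apply: is_derive_comp1 d _; exact: smooth_at_is_derive.
rewrite /rotation; apply: is_derive_eq; first by der.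
by congr row_mx; apply/rowP => i; rewrite !mxE /=; ring.
Qed.

Lemma rotation_dot x : dot (rotation x) (rotation x) = dot x x.
Proof.
rewrite [LHS]dot_lr [RHS]dot_lr /rotation !lrE !dotE (dotC (r x) (l x)).
have e := cos2Dsin2 (T (dot x x)); set c := cos _ in e *; set s := sin _ in e *.
apply: (@eq_of_sub _ _ ((c ^+ 2 + s ^+ 2 - 1) * (dot (l x) (l x) + dot (r x) (r x)))).
  by rewrite e subrr mul0r.
by ring.
Qed.

(** The function |z|^2 generates the rotations, and the angle depends on it alone, so the extra
    terms are multiples of d|z|^2 wedge d|z|^2. *)
Lemma rotation_symplectic x u v :
  dform radial_form (rotation x) ('D_u rotation x) ('D_v rotation x) = dform radial_form x u v.
Proof.
have [_ ->] := is_derive_rotation x u; have [_ ->] := is_derive_rotation x v.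
have e := cos2Dsin2 (T (dot x x)); set c := cos _ in e *; set s := sin _ in e *.
set t := 'D_1 T _.
rewrite !dform_radial !lrE !dotE.
rewrite (dot_lr x u) (dot_lr x v) !(dotC _ (l x)) !(dotC _ (r x)) (dotC (r x) (l x)).
apply: (@eq_of_sub _ _ ((c ^+ 2 + s ^+ 2 - 1) * (dot (l u) (r v) - dot (r u) (l v)))).
  by rewrite e subrr mul0r.
by ring.
Qed.

End Rotation.

Lemma rotationK (T T' : R^o -> R^o) x : (forall s, T' s = - T s) ->
  rotation T' (rotation T x) = x.
Proof.
move=> TT; rewrite {1}/rotation rotation_dot TT cosN sinN /rotation !lrE.
have e := cos2Dsin2 (T (dot x x)); set c := cos _ in e *; set s := sin _ in e *.
rewrite -[RHS]hsubmxK; congr row_mx; apply/rowP => i; rewrite !mxE;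
  set a := x _ _; set b := x _ _.
  by apply: (@eq_of_sub _ _ ((c ^+ 2 + s ^+ 2 - 1) * a)); [rewrite e subrr mul0r|ring].
by apply: (@eq_of_sub _ _ ((c ^+ 2 + s ^+ 2 - 1) * b)); [rewrite e subrr mul0r|ring].
Qed.

Lemma smooth_at_rotation (F : normedModType R) (T : F -> R^o -> R^o) (g : F -> E) (x : F) :
  smooth_at x (fun y => T y (dot (g y) (g y)) : R^o) -> smooth_at x g ->
  smooth_at x (fun y => rotation (T y) (g y)).
Proof.
move=> sT sg; rewrite /rotation (_ : (fun y : F => _) = fun y : F => row_mx
  (cos (T y (dot (g y) (g y))) *: l (g y) + (- sin (T y (dot (g y) (g y)))) *: r (g y))
  (sin (T y (dot (g y) (g y))) *: l (g y) + cos (T y (dot (g y) (g y))) *: r (g y))).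
  by smooth.
by apply/funext => y; rewrite scaleNr.
Qed.

Lemma rotation_symplectomorphism (T : R^o -> R^o) d : (N + N = 0 + d.+2)%N ->
  (forall s, smooth_at s T) -> symplectomorphism d.+2 (@ball2 R N) radial_form (rotation T).
Proof.
move=> en sT; split; last by move=> x u v _ _; exact: rotation_symplectic.
have sr (T' : R^o -> R^o) : (forall s, smooth_at s T') -> smooth_near (@ball2 R N) (rotation T').
  move=> sT'; apply: smooth_near_at => x _; apply: (@smooth_at_rotation _ (fun _ => T') id).
    by apply: (@smooth_at_comp1 _ _ _ (fun y => dot y y : R^o)) => //; smooth.
  exact: smooth_at_id.
split; first exact: sr.
exists (rotation (fun s => - T s : R^o)); split; first by apply: sr => s; smooth.
move=> x Vx; split; rewrite /ball2 /= ?rotation_dot //; first by apply: rotationK.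
by apply: rotationK => s; rewrite opprK.
Qed.

Section PageEmbedding.
Variables (Y : R^o -> R^o).
Hypothesis sY : forall s : R, 0 <= s -> smooth_at s Y.
Hypothesis Y0 : forall s : R, 0 <= s -> 0 < Y s.

(* (q, xi) |-> xi / Y + i Y q *)
Definition page_embedding (x : E) : E := row_mx ((Y (sq x))^-1 *: r x) (Y (sq x) *: l x).

Lemma smooth_at_page_embedding x : smooth_at x page_embedding.
Proof.
have s1 : smooth_at x (fun y : E => Y (sq y) : R^o).
  by apply: smooth_at_of_sq; [apply: sY; exact: dot_ge0|smooth].
by rewrite /page_embedding; smooth; rewrite gt_eqF // Y0 // dot_ge0.
Qed.

Lemma is_derive_page_embedding (x u : E) : is_derive x u page_embedding
  (row_mx ((Y (sq x))^-1 *: r u - ('D_1 Y (sq x) * (2 * dot (r x) (r u)) / Y (sq x) ^+ 2) *: r x)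
    (Y (sq x) *: l u + ('D_1 Y (sq x) * (2 * dot (r x) (r u))) *: l x)).
Proof.
have y0 : Y (sq x) != 0 by rewrite gt_eqF // Y0 // dot_ge0.
have dY := is_derive_of_sq u (sY (dot_ge0 (r x))).
rewrite /page_embedding; apply: is_derive_eq; first by der.
by congr row_mx; apply/rowP => i; rewrite !mxE /=; field.
Qed.

Lemma page_embedding_dot x : DT x ->
  dot (page_embedding x) (page_embedding x) = sq x / Y (sq x) ^+ 2 + Y (sq x) ^+ 2.
Proof.
move=> [qq _ _]; have y0 : Y (sq x) != 0 by rewrite gt_eqF // Y0 // dot_ge0.
by rewrite dot_lr /page_embedding !lrE !dotE qq; field.
Qed.

Lemma page_embedding_inj x y : DT x -> DT y -> page_embedding x = page_embedding y -> x = y.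
Proof.
move=> [qx _ _] [qy _ _] /eq_row_mx[e1 e2].
have x0 := Y0 (dot_ge0 (r x)); have y0 := Y0 (dot_ge0 (r y)).
have e3 : Y (sq x) = Y (sq y).
  have : Y (sq x) ^+ 2 = Y (sq y) ^+ 2.
    have := congr1 (fun a => dot a a) e2; rewrite !dotE qx qy !mulr1 => e.
    by rewrite !expr2.
  by move/eqP; rewrite eqrXn2 ?ltW // => /eqP.
rewrite -[x]hsubmxK -[y]hsubmxK; congr row_mx.
  by move: e2; rewrite -e3; apply: scalerI; rewrite gt_eqF.
by move: e1; rewrite -e3; apply: scalerI; rewrite invr_eq0 gt_eqF.
Qed.

Context {d : nat} (en : (N + N = 1 + 1 + d.+1)%N).

Lemma page_embedding_immersion x u : tangent d.+1 DT x u -> 'D_u page_embedding x = 0 -> u = 0.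
Proof.
move=> /(tangent_disc_cotangent en)[[qq qx _] u1 u2].
have y0 : Y (sq x) != 0 by rewrite gt_eqF // Y0 // dot_ge0.
have [_ ->] := is_derive_page_embedding x u; set c := 'D_1 Y _ * _.
move=> /row_mx_eq0[e1 e2].
have c0 : c = 0.
  by have := congr1 (dot (l x)) e2; rewrite !dotE u1 qq mulr0 add0r mulr1.
rewrite c0 mul0r !scale0r subr0 addr0 in e1 e2.
move: e1 e2 => /eqP + /eqP; rewrite !scaler_eq0 invr_eq0 (negbTE y0) /= => /eqP e1 /eqP e2.
by rewrite -[u]hsubmxK e1 e2 row_mx0.
Qed.

(** The terms containing dY cancel for every Y: they pair dY with q.dxi + xi.dq = d(q.xi), which
    vanishes on the cotangent bundle. *)
Lemma page_embedding_symplectic x u v : tangent d.+1 DT x u -> tangent d.+1 DT x v ->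
  dform radial_form (page_embedding x) ('D_u page_embedding x) ('D_v page_embedding x) =
  dform canonical_form x u v.
Proof.
move=> /(tangent_disc_cotangent en)[[qq qx _] u1 u2] /(tangent_disc_cotangent en)[_ v1 v2].
have y0 : Y (sq x) != 0 by rewrite gt_eqF // Y0 // dot_ge0.
have [_ ->] := is_derive_page_embedding x u; have [_ ->] := is_derive_page_embedding x v.
rewrite dform_radial dform_canonical !lrE !dotE.
have eu : dot (l x) (r u) = - dot (r x) (l u) by rewrite (dotC (r x)); lra.
have ev : dot (l x) (r v) = - dot (r x) (l v) by rewrite (dotC (r x)); lra.
rewrite (dotC (r u) (l x)) (dotC (l u) (r x)) (dotC (r x) (l x)) qx eu ev (dotC (l u) (r v)).
by field.
Qed.

End PageEmbedding.
End PageMaps.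

(** * The twist angle *)

Section Profiles.
Context {R : realType}.

(** It rises between s = 1/16 and s = 1/4, that is between |xi| = 1/4 and |xi| = 1/2. Below, the
    terms singular at the zero section are switched off; above, the formulas needed on the collar
    hold exactly. *)
Definition cutoff (s : R^o) : R^o := step ((16 * s - 1) / 3).

Lemma cutoff_eq0 (s : R) : s <= 1 / 16 -> cutoff s = 0.
Proof. by move=> s0; rewrite /cutoff step_eq0 //; lra. Qed.

Lemma cutoff_eq1 (s : R) : 1 / 4 <= s -> cutoff s = 1.
Proof. by move=> s0; rewrite /cutoff step_eq1 //; lra. Qed.

Lemma cutoff_ge0 s : 0 <= cutoff s. Proof. exact: step_ge0. Qed.
Lemma cutoff_le1 s : cutoff s <= 1. Proof. exact: step_le1. Qed.

Lemma smooth_cutoff s : smooth_at s cutoff.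
Proof. by rewrite /cutoff; smooth. Qed.

Definition dcutoff (s : R^o) : R^o := 'D_1 cutoff s.

Lemma smooth_dcutoff s : smooth_at s dcutoff.
Proof. by apply: smooth_at_derive; exact: smooth_cutoff. Qed.

Lemma is_derive_cutoff (s : R^o) : is_derive s 1 cutoff (dcutoff s).
Proof. by apply: smooth_at_is_derive; exact: smooth_cutoff. Qed.

Lemma near_lt (a s : R) : s < a -> \forall y \near (s : R^o), y < a.
Proof. by move=> sa; exact: (open_near (@open_lt R a)). Qed.

Lemma near_gt (a s : R) : a < s -> \forall y \near (s : R^o), a < y.
Proof. by move=> sa; exact: (open_near (@open_gt R a)). Qed.

Lemma derive_near_cst (f : R^o -> R^o) (s c : R) : (\forall y \near (s : R^o), f y = c) ->
  'D_1 f (s : R^o) = 0.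
Proof.
move=> h; rewrite (@near_eq_derive _ _ _ f (cst c)) ?derive_cst //.
Qed.

Lemma dcutoff_eq0 (s : R) : s < 1 / 16 -> dcutoff s = 0.
Proof.
move=> /near_lt s0; apply: (@derive_near_cst _ _ 0).
by apply: filterS s0 => y /ltW /cutoff_eq0.
Qed.

Lemma dcutoff_eq0r (s : R) : 1 / 4 < s -> dcutoff s = 0.
Proof.
move=> /near_gt s0; apply: (@derive_near_cst _ _ 1).
by apply: filterS s0 => y /ltW /cutoff_eq1.
Qed.

Lemma dcutoff_ge0 s : 0 <= dcutoff s.
Proof.
have d : is_derive s 1 cutoff ('D_1 step ((16 * s - 1) / 3) * (16 / 3)).
  apply: (@is_derive_comp1 _ _ (fun s : R^o => (16 * s - 1) / 3 : R^o) step).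
    by der_eq; field.
  apply: smooth_at_is_derive; exact: (@smooth_at_step _ _ _ id (smooth_at_id _)).
rewrite /dcutoff; have [_ ->] := d; rewrite mulr_ge0 ?derive_step_ge0 //; lra.
Qed.

(** The square root is smooth only for s > 0; a profile that is constant below 1/16 is nevertheless
    smooth on the whole line. *)
Lemma smooth_at_flat (f : R^o -> R^o) (s c : R) : (forall s : R, 0 < s -> smooth_at (s : R^o) f) ->
  (forall s : R, s < 1 / 16 -> f s = c) -> smooth_at (s : R^o) f.
Proof.
move=> s1 s2; have [s0|s0] := ltP 0 s; first exact: s1.
apply: (@smooth_at_ext _ _ _ _ (fun=> c)); last exact: smooth_at_cst.
have s3 : s < 1 / 16 by apply: le_lt_trans s0 _; lra.
by apply: filterS (near_lt s3) => y /s2.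
Qed.

(* The derivative of sqrt * cutoff, multiplied by 2 sqrt. *)
Definition slope (s : R^o) : R^o := cutoff s + 2 * s * dcutoff s.

(** Twice the integral of sqrt(s) d([slope]). By parts that integral is sqrt(s) [slope] - sqrt(s)
    [cutoff], since [slope] is the derivative of sqrt(s) [cutoff] with respect to sqrt(s). *)
Definition height_drop (s : R^o) : R^o := 4 * s * Num.sqrt s * dcutoff s.

Definition smooth_sqrt (s : R^o) : R^o := Num.sqrt s * cutoff s.

Lemma slope_eq0 (s : R) : s < 1 / 16 -> slope s = 0.
Proof. by move=> s0; rewrite /slope cutoff_eq0 ?ltW // dcutoff_eq0 // mulr0 addr0. Qed.

Lemma slope_eq1 (s : R) : 1 / 4 < s -> slope s = 1.
Proof. by move=> s0; rewrite /slope cutoff_eq1 ?ltW // dcutoff_eq0r // mulr0 addr0. Qed.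

Lemma height_drop_eq0 (s : R) : s < 1 / 16 -> height_drop s = 0.
Proof. by move=> s0; rewrite /height_drop dcutoff_eq0 // mulr0. Qed.

Lemma height_drop_eq0r (s : R) : 1 / 4 < s -> height_drop s = 0.
Proof. by move=> s0; rewrite /height_drop dcutoff_eq0r // mulr0. Qed.

Lemma smooth_sqrt_eq0 (s : R) : s < 1 / 16 -> smooth_sqrt s = 0.
Proof. by move=> s0; rewrite /smooth_sqrt cutoff_eq0 ?ltW // mulr0. Qed.

Lemma smooth_sqrt_eq (s : R) : 1 / 4 <= s -> smooth_sqrt s = Num.sqrt s.
Proof. by move=> s0; rewrite /smooth_sqrt cutoff_eq1 // mulr1. Qed.

Lemma smooth_sqrt_ge0 s : 0 <= smooth_sqrt s.
Proof. by rewrite mulr_ge0 ?sqrtr_ge0 ?cutoff_ge0. Qed.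

Lemma smooth_at_slope s : smooth_at s slope.
Proof. have h1 := smooth_cutoff; have h2 := smooth_dcutoff; by rewrite /slope; smooth. Qed.

Lemma smooth_at_height_drop s : smooth_at s height_drop.
Proof.
apply: (@smooth_at_flat _ _ 0) => [{}s s0|]; last exact: height_drop_eq0.
have h2 := smooth_dcutoff; by rewrite /height_drop; smooth.
Qed.

Lemma smooth_at_smooth_sqrt s : smooth_at s smooth_sqrt.
Proof.
apply: (@smooth_at_flat _ _ 0) => [{}s s0|]; last exact: smooth_sqrt_eq0.
have h2 := smooth_cutoff; by rewrite /smooth_sqrt; smooth.
Qed.

Lemma is_derive_smooth_sqrt (s : R^o) : 0 < s ->
  is_derive s 1 smooth_sqrt (slope s / (2 * Num.sqrt s)).
Proof.
move=> s0; have q0 : Num.sqrt s != 0 by rewrite gt_eqF // sqrtr_gt0.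
have d := is_derive_cutoff s; have e := sqr_sqrtr (ltW s0).
rewrite /smooth_sqrt; der_eq; first by [].
rewrite /slope; set q := Num.sqrt s in q0 e *; rewrite -e.
by field.
Qed.

Lemma is_derive_slope (s : R^o) :
  is_derive s 1 slope (3 * dcutoff s + 2 * s * 'D_1 dcutoff s).
Proof.
have d := is_derive_cutoff s; have d2 := smooth_at_is_derive (1 : R^o) (smooth_dcutoff s).
rewrite /slope; der_eq; by ring.
Qed.

Lemma is_derive_height_drop (s : R^o) : 0 < s ->
  is_derive s 1 height_drop (2 * Num.sqrt s * 'D_1 slope s).
Proof.
move=> s0; have q0 : Num.sqrt s != 0 by rewrite gt_eqF // sqrtr_gt0.
have d := is_derive_cutoff s; have d2 := smooth_at_is_derive (1 : R^o) (smooth_dcutoff s).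
have [_ ->] := is_derive_slope s; have e := sqr_sqrtr (ltW s0).
rewrite /height_drop; der_eq; first by [].
set q := Num.sqrt s in q0 e *; rewrite -e.
by field.
Qed.

(** K is the free additive constant in the primitive of the monodromy; a large one makes the return
    time positive. *)
Lemma height_drop_bounded : exists2 K : R, 2 < K & forall s : R, 0 <= s <= 1 -> height_drop s < K.
Proof.
have c : {within `[0, 1], continuous (height_drop : R -> R)}.
  apply: continuous_subspaceT => s; exact: smooth_at_continuous (smooth_at_height_drop s).
have [m _ h] := EVT_max ler01 c.
exists (3 + `|height_drop m|); first by have := normr_ge0 (height_drop m); lra.
move=> s s01; have := h s; rewrite in_itv /= => /(_ s01) sm.
apply: le_lt_trans sm _; have := ler_norm (height_drop m : R) => /le_lt_trans -> //; rewrite ltrDr; lra.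
Qed.

Lemma cosDpin (x : R) p : cos (x + p%:R * pi) = (-1) ^+ p * cos x.
Proof.
elim: p => [|p IH]; first by rewrite mul0r addr0 mul1r.
by rewrite -natr1 mulrDl mul1r addrA cosDpi IH exprS; ring.
Qed.

Lemma sinDpin (x : R) p : sin (x + p%:R * pi) = (-1) ^+ p * sin x.
Proof.
elim: p => [|p IH]; first by rewrite mul0r addr0 mul1r.
by rewrite -natr1 mulrDl mul1r addrA sinDpi IH exprS; ring.
Qed.

Lemma sin_pin p : sin (p%:R * pi : R) = 0.
Proof. by have := sinDpin 0 p; rewrite add0r sin0 mulr0. Qed.

Lemma cos_pin p : cos (p%:R * pi : R) = (-1) ^+ p.
Proof. by have := cosDpin 0 p; rewrite add0r cos0 mulr1. Qed.

Section Angle.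
Variable p : nat.

Definition angle (s : R^o) : R^o := p%:R * pi * (1 - slope s).

Lemma angle_core (s : R) : s < 1 / 16 -> angle s = p%:R * pi.
Proof. by move=> s0; rewrite /angle slope_eq0 // subr0 mulr1. Qed.

Lemma angle_end (s : R) : 1 / 4 < s -> angle s = 0.
Proof. by move=> s0; rewrite /angle slope_eq1 // subrr mulr0. Qed.

Lemma smooth_at_angle s : smooth_at s angle.
Proof. have h := smooth_at_slope; by rewrite /angle; smooth. Qed.

Lemma is_derive_angle (s : R^o) : is_derive s 1 angle (- (p%:R * pi * 'D_1 slope s)).
Proof.
have d := smooth_at_is_derive (1 : R^o) (smooth_at_slope s).
rewrite /angle; der_eq; by ring.
Qed.

Definition cos_angle (s : R^o) : R^o := cos (angle s).
Definition sinc_angle (s : R^o) : R^o := sin (angle s) / Num.sqrt s.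

Lemma smooth_at_cos_angle s : smooth_at s cos_angle.
Proof. have h := smooth_at_angle; by rewrite /cos_angle; smooth. Qed.

Lemma sinc_angle_core (s : R) : s < 1 / 16 -> sinc_angle s = 0.
Proof. by move=> s0; rewrite /sinc_angle angle_core // sin_pin mul0r. Qed.

Lemma smooth_at_sinc_angle s : smooth_at s sinc_angle.
Proof.
apply: (@smooth_at_flat _ _ 0) => [{}s s0|]; last exact: sinc_angle_core.
have h := smooth_at_angle; rewrite /sinc_angle; smooth.
by rewrite gt_eqF // sqrtr_gt0.
Qed.

Lemma cos_sinc_angle (s : R) : cos_angle s ^+ 2 + s * sinc_angle s ^+ 2 = 1.
Proof.
rewrite -[RHS](cos2Dsin2 (angle s)); congr (_ + _).
have [s0|s0] := ltP 0 s.
  rewrite /sinc_angle expr_div_n sqr_sqrtr ?ltW // mulrC divfK ?gt_eqF //.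
rewrite sinc_angle_core ?angle_core ?sin_pin ?expr0n ?mulr0 //; apply: le_lt_trans s0 _; lra.
Qed.

Lemma cos_sinc_primitive (s : R) : 0 < s ->
  2 * s * (cos_angle s * 'D_1 sinc_angle s - sinc_angle s * 'D_1 cos_angle s) +
  cos_angle s * sinc_angle s = 2 * Num.sqrt s * 'D_1 angle s.
Proof.
move=> s0; have q0 : Num.sqrt s != 0 by rewrite gt_eqF // sqrtr_gt0.
have q1 : 0 < Num.sqrt s by rewrite sqrtr_gt0.
have d := smooth_at_is_derive (1 : R^o) (smooth_at_angle s).
have [_ ->] : is_derive (s : R^o) 1 cos_angle (- sin (angle s) * 'D_1 angle s).
  by rewrite /cos_angle; apply: is_derive_eq; first by der.
have [_ ->] : is_derive (s : R^o) 1 sinc_angle (cos (angle s) * 'D_1 angle s / Num.sqrt s -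
   sin (angle s) / (2 * Num.sqrt s ^+ 3)).
  by rewrite /sinc_angle; der_eq => //; field.
have e := sqr_sqrtr (ltW s0); have cs := cos2Dsin2 (angle s).
rewrite /cos_angle /sinc_angle -[in 2 * s]e.
set q := Num.sqrt s in q0 *; set a := cos _ in cs *; set b := sin _ in cs *; set t : R := 'D_1 angle _.
apply: (@eq_of_sub _ _ _ (2 * q * t * (a ^+ 2 + b ^+ 2 - 1))); first by rewrite cs subrr mulr0.
by field.
Qed.

End Angle.

(** The fourth root of s from s = 1/64 on, and kept away from 0 below. The correction ends well
    before 1/16, where the twist is still (-1)^p, so the monodromy does not see that |z|^2 = 2 |xi|
    fails there. *)
Definition quarter_root (s : R^o) : R^o := Num.sqrt (Num.sqrt (s + (1 - step (64 * s)) / 64)).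

Lemma quarter_root_arg (s : R) : 0 <= s -> 0 < s + (1 - step (64 * s)) / 64.
Proof.
move=> s0; have [s1|s1] := leP (1 / 64) s.
  by have := step_le1 (64 * s); lra.
have [->|s2] := eqVneq s 0; first by rewrite mulr0 step_eq0 //; lra.
have : 0 < s by rewrite lt_neqAle eq_sym s2.
by have := step_le1 (64 * s); lra.
Qed.

Lemma quarter_root_gt0 (s : R) : 0 <= s -> 0 < quarter_root s.
Proof. by move=> s0; rewrite !sqrtr_gt0 quarter_root_arg. Qed.

Lemma smooth_at_quarter_root (s : R) : 0 <= s -> smooth_at (s : R^o) quarter_root.
Proof.
move=> s0; rewrite /quarter_root; smooth; rewrite ?sqrtr_gt0 quarter_root_arg //.
Qed.

Lemma quarter_root_sqr (s : R) : 1 / 64 <= s -> quarter_root s ^+ 2 = Num.sqrt s.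
Proof.
move=> s0; rewrite /quarter_root sqr_sqrtr ?sqrtr_ge0 // step_eq1; last lra.
by rewrite subrr mul0r addr0.
Qed.

Definition page_radius (s : R) : R := s / quarter_root s ^+ 2 + quarter_root s ^+ 2.

(** The bound 1/2 puts the argument |z|^4 / 4 of the ball angle below 1/16, so that the rotation,
    like the twist, is by p pi. *)
Lemma page_radius_small (s : R) : 0 <= s < 1 / 64 -> page_radius s < 1 / 2.
Proof.
move=> /andP[s0 s1]; have y0 := quarter_root_gt0 s0.
have Y0 : 0 < quarter_root s ^+ 2 by rewrite exprn_gt0.
have Y4 : (quarter_root s ^+ 2) ^+ 2 = s + (1 - step (64 * s)) / 64.
  by rewrite /quarter_root !sqr_sqrtr ?sqrtr_ge0 // ltW // quarter_root_arg.
have st0 := step_ge0 (64 * s); have st1 := step_le1 (64 * s).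
rewrite /page_radius; set z := quarter_root s ^+ 2 in Y0 Y4 *.
(* Here z^2 is at most 1/64 + 1/64 = 1/32, which is below 1/25. *)
have z1 : z <= 1 / 5.
  by rewrite -(@ler_pXn2r _ 2) ?nnegrE ?ltW //; rewrite Y4; lra.
have : s / z <= z by rewrite ler_pdivrMr // -expr2 Y4; lra.
lra.
Qed.

Lemma page_radius_large (s : R) : 1 / 64 <= s -> page_radius s = 2 * Num.sqrt s.
Proof.
move=> s0; rewrite /page_radius quarter_root_sqr // -{1}[s]sqr_sqrtr; last lra.
by rewrite expr2 mulfK ?gt_eqF ?sqrtr_gt0 //; lra.
Qed.
End Profiles.

(** * The two monodromies and their intertwining *)

Section Monodromy.
Context {R : realType} {N : nat}.
Local Notation E := 'rV[R]_(N + N).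
Local Notation l := lsubmx.
Local Notation r := rsubmx.
Local Notation DT := (@disc_cotangent R N).
Local Notation sq x := (dot (r x) (r x)).
Variable p : nat.

Definition page_twist : E -> E := twist (cos_angle p) (sinc_angle p).

(* On the image of the page embedding |z|^2 = 2 |xi| away from the zero section. *)
Definition ball_angle (c : R) (m : R^o) : R^o := c * angle p (m ^+ 2 / 4).

Definition ball_twist : E -> E := rotation (ball_angle 1).

Lemma smooth_at_ball_angle c m : smooth_at m (ball_angle c).
Proof. have h := @smooth_at_angle R p; by rewrite /ball_angle; smooth. Qed.

Local Notation emb := (@page_embedding R N quarter_root).

Lemma page_embedding_radius x : DT x -> dot (emb x) (emb x) = page_radius (sq x).
Proof. by move=> Vx; rewrite page_embedding_dot //; move=> s s0; exact: quarter_root_gt0. Qed.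

(** For s >= 1/64 the embedding is sqrt|xi| (xi/|xi| + iq), on which the geodesic flow at time th
    acts as multiplication by e^(i th). For smaller s both sides are multiplied by (-1)^p. *)
Lemma page_embedding_twist x : DT x -> emb (page_twist x) = ball_twist (emb x).
Proof.
move=> Vx; have s0 := dot_ge0 (r x); have y0 := quarter_root_gt0 s0.
rewrite /ball_twist /rotation page_embedding_radius // {1}/page_embedding twist_sq //; last first.
  exact: cos_sinc_angle.
rewrite /page_twist /twist /page_embedding !lrE /ball_angle !mul1r.
set s := sq x in s0 y0 *.
have [s1|s1] := ltP s (1 / 64).
  have pr := page_radius_small (introT andP (conj s0 s1)).
  have p0 : 0 <= page_radius s.
    by rewrite /page_radius addr_ge0 ?divr_ge0 ?exprn_ge0 ?(ltW y0).
  rewrite sinc_angle_core; last lra.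
  rewrite /cos_angle !angle_core; last 2 first.
  - nra.
  - lra.
  by rewrite sin_pin !mulr0 !scale0r !subr0 !addr0 add0r !scalerA [_^-1 * _]mulrC [_ s * _]mulrC.
rewrite page_radius_large // exprMn sqr_sqrtr //.
have -> : 2 ^+ 2 * s / 4 = s by field.
have q0 : 0 < Num.sqrt s by rewrite sqrtr_gt0; lra.
have y2 := quarter_root_sqr s1; have qs := sqr_sqrtr s0.
rewrite /sinc_angle /cos_angle; set c := cos _; set b := sin _.
set y := quarter_root s in y0 y2 *.
have y1 : y != 0 by rewrite gt_eqF.
have e1 : s * (b / Num.sqrt s) = b * y ^+ 2.
  by rewrite y2 -{1}qs; field; rewrite gt_eqF.
rewrite e1 -y2.
by congr row_mx; apply/rowP => i; rewrite !mxE; field.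
Qed.

Context {d d2 : nat} (en : (N + N = 1 + 1 + d.+1)%N) (en2 : (N + N = 0 + d2.+2)%N).

Lemma page_twist_symplectomorphism : symplectomorphism d.+1 DT canonical_form page_twist.
Proof.
apply: (twist_symplectomorphism en); [exact: smooth_at_cos_angle|exact: smooth_at_sinc_angle|].
exact: cos_sinc_angle.
Qed.

Lemma ball_twist_symplectomorphism c :
  symplectomorphism d2.+2 (@ball2 R N) radial_form (rotation (ball_angle c)).
Proof. by apply: (rotation_symplectomorphism en2); exact: smooth_at_ball_angle. Qed.

Lemma page_twist_id_near_boundary : id_near_boundary d.+1 DT page_twist.
Proof.
exists [set x : E | 1 / 4 < sq x]; split.
- have c : continuous (fun x : E => sq x : R^o) by apply: continuous_smooth => x; smooth.
  exact: (open_comp (fun x _ => c x) (@open_gt R (1 / 4))).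
- by rewrite (boundary_disc_cotangent en) => x [_ _ e] /=; rewrite e; lra.
- move=> x Vx /= x1; rewrite /page_twist /twist /cos_angle /sinc_angle angle_end // cos0 sin0.
  by rewrite mul0r mulr0 !scale0r !scale1r addr0 subr0 hsubmxK.
Qed.

Lemma ball_twist_id c (x : E) : 1 < dot x x -> rotation (ball_angle c) x = x.
Proof.
move=> x1; rewrite /rotation /ball_angle angle_end ?mulr0.
  by rewrite cos0 sin0 !scale0r !scale1r subr0 add0r hsubmxK.
have : 1 < dot x x ^+ 2 by rewrite exprn_egt1.
lra.
Qed.

Lemma open_dot_gt1 : open [set x : E | 1 < dot x x].
Proof.
have c : continuous (fun x : E => dot x x : R^o) by apply: continuous_smooth => x; smooth.
exact: (open_comp (fun x _ => c x) (@open_gt R 1)).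
Qed.

Lemma boundary_ball2_gt1 : boundary d2.+2 (@ball2 R N) `<=` [set x : E | 1 < dot x x].
Proof. by rewrite (boundary_ball2 en2) => x /= ->; lra. Qed.

Lemma ball_twist_id_near_boundary : id_near_boundary d2.+2 (@ball2 R N) ball_twist.
Proof.
exists [set x : E | 1 < dot x x]; split; [exact: open_dot_gt1|exact: boundary_ball2_gt1|].
by move=> x _; exact: ball_twist_id.
Qed.

(** The angle is scaled down to 0; every intermediate rotation is supported in |z|^2 <= 1. *)
Lemma ball_twist_isotopy : symplectic_isotopy d2.+2 (@ball2 R N) radial_form ball_twist id.
Proof.
exists (fun q : R^o * E => rotation (ball_angle (1 - q.1)) q.2); split.
- apply: smooth_near_at => q _.
  apply: (@smooth_at_rotation _ _ _ (fun q : R^o * E => ball_angle (1 - q.1)) snd).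
    by have h := @smooth_at_angle R p; rewrite /ball_angle; smooth.
  by smooth.
- by move=> s _; exact: (ball_twist_symplectomorphism (1 - s)).
- exists [set x : E | 1 < dot x x]; split; [exact: open_dot_gt1|exact: boundary_ball2_gt1|].
  by move=> s x _ _; exact: ball_twist_id.
- move=> x _; rewrite /= subr0 subrr; split=> //.
  rewrite /rotation /ball_angle mul0r cos0 sin0.
  by rewrite !scale0r !scale1r subr0 add0r hsubmxK.
Qed.

Lemma constant_isotopy n k (V : set 'rV[R]_n) a f : symplectomorphism k V a f ->
  id_near_boundary k V f -> symplectic_isotopy k V a f f.
Proof.
move=> sf [U [oU bU fU]]; exists (fun q => f q.2); split=> //.
- case: sf => -[sf _] _; apply: smooth_near_at => q [_ Vq].
  by apply: smooth_at_comp_rV; [exact: smooth_near_atP sf Vq|smooth].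
- by exists U; split=> // s x _; exact: fU.
Qed.

Lemma page_embedding_proper : proper_symplectic_embedding d.+1 d2.+2 DT canonical_form
  (@ball2 R N) radial_form emb.
Proof.
have Y0 := @quarter_root_gt0 R; have sY := @smooth_at_quarter_root R.
have b1 := boundary_disc_cotangent en; have b2 := boundary_ball2 en2.
split.
- by apply: smooth_near_at => x _; exact: smooth_at_page_embedding.
- move=> x Vx; rewrite /ball2 /= page_embedding_radius //.
  have /andP[s0 s1] := disc_sq01 Vx.
  have [s2|s2] := ltP (sq x) (1 / 64).
    by have := page_radius_small (introT andP (conj s0 s2)); lra.
  rewrite page_radius_large // -[X in _ <= X]mulr1 ler_pM2l // -sqrtr1.
  by rewrite ler_wsqrtr.
- by move=> x y; exact: page_embedding_inj.
- by move=> x u; exact: page_embedding_immersion.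
- by move=> x u v; exact: page_embedding_symplectic.
- move=> x Vx; rewrite b1 b2 /= page_embedding_radius //.
  have /andP[s0 s1] := disc_sq01 Vx; have [qq qx _] := Vx.
  split=> [e|[_ _ ->]]; last by rewrite page_radius_large ?sqrtr1; lra.
  split=> //; have [s2|s2] := ltP (sq x) (1 / 64).
    by have := page_radius_small (introT andP (conj s0 s2)); rewrite e; lra.
  move: e; rewrite page_radius_large // => e.
  by rewrite -[LHS](sqr_sqrtr s0) (_ : Num.sqrt _ = 1) ?expr1n //; lra.
- move=> x w bx _; rewrite b1 in bx; have [qq qx xx] := bx.
  have Vx : DT x by split=> //; rewrite xx.
  (* Since |z|^2 = 2 |xi| at the boundary, moving xi radially at rate c gives the image a radial
     component c, the same as that of w; the difference is tangent to the sphere. *)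
  pose c : R := dot (emb x) w; pose u : E := row_mx 0 (c *: r x); exists u, (w - 'D_u emb x).
  have tu : tangent d.+1 DT x u.
    by apply/(tangent_disc_cotangent en); rewrite /u !lrE dot0r dot0l dotZr qx mulr0 addr0.
  split=> //; last by rewrite addrC subrK.
  apply/(bdtangent_ball2 en2); rewrite page_embedding_radius // xx page_radius_large; last lra.
  rewrite sqrtr1 mulr1; split=> //; have [_ ->] := is_derive_page_embedding sY Y0 x u.
  have y1 : quarter_root (1 : R) = 1.
    by rewrite /quarter_root step_eq1 ?subrr ?mul0r ?addr0 ?sqrtr1 //; lra.
  rewrite dotDr dotNr -/c [X in _ - X]dot_lr /page_embedding /u !lrE !dotE xx y1 qq.
  by field.
Qed.

End Monodromy.

(** * The normal form near the binding *)

Section DiscProfile.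
Context {R : realType}.

Lemma derive_gt0_lt (f : R^o -> R^o) (a b : R) : a < b ->
  (forall s : R, a <= s <= b -> smooth_at (s : R^o) f) ->
  (forall s : R, a < s < b -> 0 < 'D_1 f (s : R^o)) -> f a < f b.
Proof.
move=> ab sf f0; have [||c c1 e] := @MVT R f (fun z => 'D_1 f (z : R^o)) a b ab.
- move=> z; rewrite in_itv /= => /andP[az zb].
  by apply: smooth_at_is_derive; apply: sf; rewrite !ltW.
- apply: derivable_within_continuous => z; rewrite in_itv /= => ab'.
  exact: smooth_at_derivable (sf z ab').
by rewrite -subr_gt0 e mulr_gt0 ?subr_gt0 //; apply: f0; rewrite in_itv in c1.
Qed.

Lemma smooth_IVT (f : R^o -> R^o) (a b v : R) : a <= b ->
  (forall s : R, a <= s <= b -> smooth_at (s : R^o) f) ->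
  f a <= v <= f b -> exists2 c : R, a <= c <= b & f c = v.
Proof.
move=> ab sf /andP[av vb].
have [||c] := @IVT R f a b v ab; last by rewrite in_itv /= => c1 c2; exists c.
  apply: derivable_within_continuous => z; rewrite in_itv /= => ab'.
  exact: smooth_at_derivable (sf z ab').
by rewrite (min_idPl (le_trans av vb)) (max_idPr (le_trans av vb)) av.
Qed.

(** The quotient of the profile by v is defined first, because its square root scales the disc
    coordinates and must be smooth and positive at the centre. *)
Definition disc_ratio (v : R^o) : R^o := 1 - cutoff v + cutoff v * (expR (Num.sqrt v - 1) / v).

(* Equals v near 0 and exp(sqrt v - 1) for large v: the square of the modulus in the disc,
   reparametrised to match the collar of the page. *)
Definition disc_profile (v : R^o) : R^o := v * disc_ratio v.

Lemma smooth_at_disc_ratio v : smooth_at v disc_ratio.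
Proof.
apply: (@smooth_at_flat _ _ _ 1) => [{}v v0|{}v v0].
  by have h := @smooth_cutoff R; rewrite /disc_ratio; smooth; rewrite gt_eqF.
by rewrite /disc_ratio cutoff_eq0 ?ltW // mul0r subr0 addr0.
Qed.

Lemma smooth_at_disc_profile v : smooth_at v disc_profile.
Proof. by have h := smooth_at_disc_ratio; rewrite /disc_profile; smooth. Qed.

Lemma disc_ratio_gt0 (v : R) : 0 <= v -> 0 < disc_ratio v.
Proof.
move=> v0; rewrite /disc_ratio; have [v1|v1] := ltP v (1 / 16).
  by rewrite cutoff_eq0 ?ltW // mul0r subr0 addr0 ltr01.
have e : 0 < expR (Num.sqrt v - 1) / v by rewrite divr_gt0 ?expR_gt0 //; lra.
have c0 := cutoff_ge0 v; have c1 := cutoff_le1 v.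
have [c2|c2] := eqVneq (cutoff v) 0; first by rewrite c2; lra.
have : 0 < cutoff v by rewrite lt_neqAle eq_sym c2.
by move=> c3; have := mulr_gt0 c3 e; lra.
Qed.

Lemma disc_profile_small (v : R) : v <= 1 / 16 -> disc_profile v = v.
Proof. by move=> v0; rewrite /disc_profile /disc_ratio cutoff_eq0 // mul0r subr0 addr0 mulr1. Qed.

Lemma disc_profile_large (v : R) : 1 / 4 <= v -> disc_profile v = expR (Num.sqrt v - 1).
Proof.
move=> v0; rewrite /disc_profile /disc_ratio cutoff_eq1 // subrr add0r mul1r mulrC divfK //.
by rewrite gt_eqF //; lra.
Qed.

Lemma disc_profile0 : disc_profile 0 = 0. Proof. by rewrite /disc_profile mul0r. Qed.

Lemma disc_profile1 : disc_profile 1 = 1.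
Proof. by rewrite disc_profile_large ?sqrtr1 ?subrr ?expR0 //; lra. Qed.

Lemma disc_profile_ge0 (v : R) : 0 <= v -> 0 <= disc_profile v.
Proof. by move=> v0; rewrite mulr_ge0 // ltW // disc_ratio_gt0. Qed.

Lemma derive_disc_profile_gt0 (v : R) : 0 < v -> 0 < 'D_1 disc_profile (v : R^o).
Proof.
move=> v0; have [v1|v1] := ltP v (1 / 16).
  rewrite (@near_eq_derive _ _ _ disc_profile id) ?derive_id //.
  by apply: filterS (near_lt v1) => y /ltW /disc_profile_small.
have q0 : 0 < Num.sqrt v by rewrite sqrtr_gt0.
have [_ ->] : is_derive (v : R^o) 1 disc_profile ((1 - cutoff v) +
    cutoff v * (expR (Num.sqrt v - 1) / (2 * Num.sqrt v)) +
    dcutoff v * (expR (Num.sqrt v - 1) - v)).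
  have d := is_derive_cutoff (v : R^o); rewrite /disc_profile /disc_ratio.
  der_eq => //=; first by rewrite gt_eqF.
  by field; rewrite !gt_eqF.
have c0 := cutoff_ge0 v; have c1 := cutoff_le1 v; have d0 := dcutoff_ge0 v.
have e : 0 < expR (Num.sqrt v - 1) / (2 * Num.sqrt v) by rewrite divr_gt0 ?expR_gt0 ?mulr_gt0.
(* With q = sqrt(v) <= 1, wherever the cutoff varies, exp(q - 1) >= q >= q^2 = v. *)
have h : 0 <= dcutoff v * (expR (Num.sqrt v - 1) - v).
  have [v2|v2] := ltP (1 / 4) v; first by rewrite dcutoff_eq0r // mul0r.
  have e2 := expR_ge1Dx (Num.sqrt v - 1).
  have e3 := sqr_sqrtr (ltW v0).
  rewrite mulr_ge0 //; set q := Num.sqrt v in q0 e2 e3 *.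
  have q1 : q <= 1 by rewrite -(@ler_pXn2r _ 2) ?nnegrE ?ltW // expr1n e3; lra.
  have : q ^+ 2 <= q by rewrite expr2 ler_piMr // ltW.
  by move: e2; set w := expR _; lra.
have [c2|c2] := eqVneq (cutoff v) 0; first by rewrite c2; lra.
have : 0 < cutoff v by rewrite lt_neqAle eq_sym c2.
by move=> c3; have := mulr_gt0 c3 e; lra.
Qed.

Lemma disc_profile_lt (v w : R) : 0 <= v -> v < w -> disc_profile v < disc_profile w.
Proof.
move=> v0 vw; apply: derive_gt0_lt => // s; first by move=> _; exact: smooth_at_disc_profile.
by move=> /andP[vs _]; apply: derive_disc_profile_gt0; exact: le_lt_trans vs.
Qed.

Lemma disc_profile_inj (v w : R) : 0 <= v -> 0 <= w -> disc_profile v = disc_profile w -> v = w.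
Proof.
move=> v0 w0 e; have [vw|wv|//] := ltgtP v w.
  by have := disc_profile_lt v0 vw; rewrite e ltxx.
by have := disc_profile_lt w0 wv; rewrite e ltxx.
Qed.

Lemma disc_profile_surj (nu : R) : 0 <= nu < 1 -> exists2 v : R, 0 <= v < 1 & disc_profile v = nu.
Proof.
move=> /andP[n0 n1]; have [|||v /andP[v0 v1] e] := @smooth_IVT disc_profile 0 1 nu.
- exact: ler01.
- by move=> s _; exact: smooth_at_disc_profile.
- by rewrite disc_profile0 disc_profile1 n0 ltW.
exists v => //; rewrite v0 /= lt_neqAle v1 andbT; apply: contraTneq n1 => v1'.
by rewrite -e v1' disc_profile1 ltxx.
Qed.

(** The normal form is written h1 (a + nu dt), with nu the disc profile and h1 this factor: 1 near
    the binding, and 1/nu where the collar asks for e^(1-r) a + dt. The argument nu / (1 + nu) is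
    |z_0|^2 on the standard sphere, which makes the interpolation agree with [sphere_factor]. *)
Definition binding_factor (nu : R^o) : R^o :=
  1 - cutoff (nu / (1 + nu)) + cutoff (nu / (1 + nu)) / nu.

Lemma binding_factor_small (nu : R) : 0 <= nu <= 1 / 16 -> binding_factor nu = 1.
Proof.
move=> /andP[n0 n1]; rewrite /binding_factor cutoff_eq0 ?mul0r ?subr0 ?addr0 //.
by rewrite ler_pdivrMr; nra.
Qed.

Lemma binding_factor_large (nu : R) : 1 <= nu -> binding_factor nu = nu^-1.
Proof.
move=> n1; rewrite /binding_factor cutoff_eq1; first by rewrite subrr add0r mul1r.
by rewrite ler_pdivlMr; lra.
Qed.

Lemma binding_factor_gt0 (nu : R) : 0 <= nu -> 0 < binding_factor nu.
Proof.
move=> n0; have c0 := cutoff_ge0 (nu / (1 + nu)); have c1 := cutoff_le1 (nu / (1 + nu)).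
have [n1|n1] := ltP nu (1 / 16); first by rewrite binding_factor_small ?n0 ?ltW.
rewrite /binding_factor; set c := cutoff _ in c0 c1 *.
have e : 0 < nu^-1 by rewrite invr_gt0; lra.
have [c2|c2] := eqVneq c 0; first by rewrite c2; lra.
have : 0 < c by rewrite lt_neqAle eq_sym c2.
by move=> c3; have := mulr_gt0 c3 e; lra.
Qed.

Lemma smooth_at_binding_factor (nu : R) : 0 <= nu -> smooth_at (nu : R^o) binding_factor.
Proof.
move=> n0; have h := @smooth_cutoff R; have [n1|n1] := ltP 0 nu.
  by rewrite /binding_factor; smooth; rewrite gt_eqF //; lra.
apply: (@smooth_at_ext R R^o R^o nu (fun=> 1)); last exact: smooth_at_cst.
have a : nu < 1 / 16 by lra.
have b : - 1 / 2 < nu by lra.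
apply: filterS2 (near_lt a) (near_gt b) => y y1 y2.
rewrite /binding_factor cutoff_eq0 ?mul0r ?subr0 ?addr0 //.
by rewrite ler_pdivrMr; lra.
Qed.

Definition binding_h1 (s : R) : R := binding_factor (disc_profile (s ^+ 2)).
Definition binding_h2 (s : R) : R := disc_profile (s ^+ 2) * binding_h1 s.

Lemma binding_h_smooth (eps : R) :
  smooth_near [set s : R^o | 0 <= s < 1 + eps] (binding_h1 : R^o -> R^o) /\
  smooth_near [set s : R^o | 0 <= s < 1 + eps] (binding_h2 : R^o -> R^o).
Proof.
have h := smooth_at_disc_profile.
have s1 (s : R^o) : smooth_at s (binding_h1 : R^o -> R^o).
  apply: (@smooth_at_comp1 _ _ _ (fun s : R^o => disc_profile (s ^+ 2))); last by smooth.
  by apply: smooth_at_binding_factor; rewrite disc_profile_ge0 // sqr_ge0.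
split; apply: smooth_near_at => s _; first exact: s1.
by rewrite /binding_h2; smooth; exact: s1.
Qed.

Lemma binding_h_near0 : exists2 delta : R, 0 < delta & forall s : R, 0 <= s < delta ->
  binding_h1 s = 1 /\ binding_h2 s = s ^+ 2.
Proof.
exists (1 / 4); first lra; move=> s /andP[s0 s1].
have s2 : s ^+ 2 <= 1 / 16 by rewrite expr2; nra.
by rewrite /binding_h2 /binding_h1 disc_profile_small // binding_factor_small ?sqr_ge0 ?mulr1.
Qed.

Lemma disc_profile_end (s : R) : 1 <= s -> disc_profile (s ^+ 2) = expR (s - 1).
Proof.
move=> s1; have s0 : 0 <= s by lra.
rewrite disc_profile_large ?sqrtr_sqr ?ger0_norm //.
have : 1 <= s ^+ 2 by rewrite exprn_ege1.
lra.
Qed.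

Lemma binding_h_match (s : R) : 1 <= s -> binding_h1 s = expR (1 - s) /\ binding_h2 s = 1.
Proof.
move=> s1; rewrite /binding_h2 /binding_h1 disc_profile_end //.
have e1 : 1 <= expR (s - 1) :> R by rewrite -[X in X <= _](@expR0 R) ler_expR subr_ge0.
rewrite binding_factor_large // -expRN opprB; split=> //.
by rewrite -expRD addrC subrKA subrr expR0.
Qed.

End DiscProfile.

Local Notation radius := Defs.radius.

(** * Angles and polar coordinates *)

Section Angles.
Context {R : realType}.

Lemma cos_eq1 (x : R) : 0 <= x < 2 * pi -> cos x = 1 -> x = 0.
Proof.
move=> /andP[x0 x1] cx; apply/eqP; rewrite eq_le x0 andbT leNgt; apply/negP => x2.
have s0 : 0 < sin (x / 2) by apply: sin_gt0_pi; lra.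
have := cosD (x / 2) (x / 2); rewrite -splitr cx => e.
have := cos2Dsin2 (x / 2) => e2.
have : sin (x / 2) ^+ 2 = 0 by rewrite !expr2 in e2 *; lra.
by move/eqP; rewrite sqrf_eq0 gt_eqF.
Qed.

Lemma cosDn2pi (x : R) n : cos (x + n%:R * (2 * pi)) = cos x.
Proof. by rewrite mulrA -natrM cosDpin mulnC exprM sqrrN !expr1n mul1r. Qed.

Lemma sinDn2pi (x : R) n : sin (x + n%:R * (2 * pi)) = sin x.
Proof. by rewrite mulrA -natrM sinDpin mulnC exprM sqrrN !expr1n mul1r. Qed.

Lemma cos_eq1_mul (x : R) : 0 <= x -> cos x = 1 -> exists n : nat, x = n%:R * (2 * pi).
Proof.
move=> x0 cx; have p0 : 0 < 2 * pi :> R by rewrite mulr_gt0 ?pi_gt0.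
have q0 : 0 <= x / (2 * pi) by rewrite divr_ge0 // ltW.
have /andP[n1 n2] := truncn_itv q0; set n := Num.truncn _ in n1 n2.
exists n; have := @cos_eq1 (x - n%:R * (2 * pi)).
rewrite -[in cos _](cosDn2pi _ n) subrK => h; apply/eqP; rewrite -subr_eq0; apply/eqP; apply: h => //.
rewrite ler_pdivlMr // in n1; rewrite ltr_pdivrMr // -natr1 mulrDl mul1r in n2.
by rewrite subr_ge0 n1 /= ltrBlDl.
Qed.

Lemma cos_sin_eq (x y : R) : cos x = cos y -> sin x = sin y ->
  exists n : nat, x - y = n%:R * (2 * pi) \/ y - x = n%:R * (2 * pi).
Proof.
move=> c s; have e : cos (x - y) = 1 by rewrite cosB c s -!expr2 cos2Dsin2.
have [xy|/ltW xy] := leP 0 (x - y).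
  by have [n h] := cos_eq1_mul xy e; exists n; left.
have [||n h] := @cos_eq1_mul (y - x); first lra.
  by rewrite -opprB cosN.
by exists n; right.
Qed.

Lemma exists_angle (a b : R) : a ^+ 2 + b ^+ 2 = 1 -> exists t : R, a = cos t /\ b = sin t.
Proof.
move=> e; have a1 : -1 <= a <= 1 by have := sqr_ge0 b; nra.
have ca := acosK a1; have sb : sin (acos a) ^+ 2 = b ^+ 2.
  by have := cos2Dsin2 (acos a); rewrite ca; lra.
have s0 : 0 <= sin (acos a) by rewrite sin_ge0_pi // acos_ge0 // acos_lepi.
have [b0|/ltW b0] := leP 0 b.
  by exists (acos a); rewrite ca; split=> //; apply/eqP; rewrite -(@eqrXn2 _ 2) // sb.
exists (- acos a); rewrite cosN sinN ca; split=> //; apply/eqP; rewrite -eqr_oppLR.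
by rewrite -(@eqrXn2 _ 2) ?oppr_ge0 // sqrrN sb.
Qed.

Lemma radius_sqr (w : R^o * R^o) : radius w ^+ 2 = w.1 ^+ 2 + w.2 ^+ 2.
Proof. by rewrite sqr_sqrtr // addr_ge0 ?sqr_ge0. Qed.

Lemma radius_ge0 (w : R^o * R^o) : 0 <= radius w.
Proof. exact: sqrtr_ge0. Qed.

Lemma radius_polar (T r t : R) : 0 <= r -> radius (polar T r t) = r.
Proof.
move=> r0; rewrite /radius /= !exprMn -mulrDr cos2Dsin2 mulr1 sqrtr_sqr ger0_norm //.
Qed.

End Angles.

(** * Fibres of the map from the covering of the mapping torus *)

Section DeckFibres.
Context {R : realType} {E F : normedModType R}.
Variables (V : set E) (phi : E -> E) (h : E -> R) (P : R^o * E -> F).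
Hypothesis h0 : forall x, V x -> 0 < h x.
Hypothesis Vphi : forall x, V x -> V (phi x).
Hypothesis hphi : forall x, V x -> h (phi x) = h x.
Hypothesis Pdeck : forall q, V q.2 -> P (deck phi h q) = P q.
Hypothesis Psep : forall q q', V q.2 -> V q'.2 -> P q = P q' -> h q.2 = h q'.2 /\
  exists n : nat, q.1 - q'.1 = n%:R * h q.2 \/ q'.1 - q.1 = n%:R * h q.2.
Hypothesis Pinj : forall (t : R) x x', V x -> V x' -> P (t, x) = P (t, x') -> x = x'.

Lemma iter_deck n q : V q.2 -> [/\ V (iter n (deck phi h) q).2,
  (iter n (deck phi h) q).1 = q.1 - n%:R * h q.2, h (iter n (deck phi h) q).2 = h q.2 &
  P (iter n (deck phi h) q) = P q].
Proof.
move=> Vq; elim: n => [|n [V1 e1 h1 P1]]; first by rewrite mul0r subr0.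
rewrite iterS Pdeck // P1 /= hphi // h1 e1; split=> //; first exact: Vphi.
by rewrite -natr1 mulrDl mul1r opprD addrA.
Qed.

(** As h is invariant under phi, n deck steps shift the time by n h. [Psep] supplies the n that
    equalises the times, and [Pinj] then identifies the points of the page. *)
Lemma deck_fibres q q' : V q.2 -> V q'.2 -> (P q = P q' <->
  exists n, iter n (deck phi h) q = q' \/ iter n (deck phi h) q' = q).
Proof.
have key n y y' : V y.2 -> V y'.2 -> P y = P y' -> y.1 - y'.1 = n%:R * h y.2 ->
    iter n (deck phi h) y = y'.
  move=> Vy Vy' e d; have [V1 e1 _ P1] := iter_deck n Vy.
  have t1 : (iter n (deck phi h) y).1 = y'.1 by rewrite e1 -d opprB addrC subrK.
  move: V1 t1 P1; case: (iter _ _ _) => t x /= V1 -> P1.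
  rewrite [RHS]surjective_pairing; congr (_, _); apply: (Pinj (t := y'.1)) => //.
  by rewrite P1 e; case: (y').
move=> Vq Vq'; split=> [e|[n [<-|<-]]].
- have [eh [n [d|d]]] := Psep Vq Vq' e; exists n; [left|right]; first exact: key.
  by apply: key => //; rewrite -eh.
- by have [_ _ _ ->] := iter_deck n Vq.
- by have [_ _ _ ->] := iter_deck n Vq'.
Qed.

End DeckFibres.

(** * The open book of the standard sphere *)

Section ComplexPoints.
Context {R : realType} {N : nat}.
Local Notation E := 'rV[R]_(N + N).
Local Notation l := lsubmx.
Local Notation r := rsubmx.
Local Notation C := (Cspace R (1 + N)).

(* The point (a + ib, X + iW) of C x C^N. *)
Definition zpt (a b : R) (X W : 'rV[R]_N) : C :=
  (row_mx (\row_(i < 1) a) X, row_mx (\row_(i < 1) b) W).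

Lemma zpt_surj (z : C) :
  z = zpt (l z.1 ord0 ord0) (l z.2 ord0 ord0) (r z.1) (r z.2).
Proof.
case: z => x y; rewrite /zpt /=; congr (_, _).
  rewrite -[LHS](@hsubmxK R 1 1 N); congr row_mx; apply/rowP => i.
  by rewrite (ord1 i) [RHS]mxE.
rewrite -[LHS](@hsubmxK R 1 1 N); congr row_mx; apply/rowP => i.
by rewrite (ord1 i) [RHS]mxE.
Qed.

Lemma zpt_inj a b X W a' b' X' W' : zpt a b X W = zpt a' b' X' W' ->
  [/\ a = a', b = b', X = X' & W = W'].
Proof.
move=> [/eq_row_mx[e1 e2] /eq_row_mx[e3 e4]]; split=> //.
  by have := congr1 (fun M : 'rV_1 => M ord0 ord0) e1; rewrite !mxE.
by have := congr1 (fun M : 'rV_1 => M ord0 ord0) e3; rewrite !mxE.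
Qed.

Lemma zpt_eq0 a b X W : zpt a b X W = 0 -> [/\ a = 0, b = 0, X = 0 & W = 0].
Proof.
move=> e; apply: zpt_inj; rewrite e; congr (_, _);
  by rewrite -[LHS](@hsubmxK R 1 1 N); congr row_mx; apply/rowP => i; rewrite !mxE.
Qed.

Lemma smooth_at_zpt (F : normedModType R) (x : F) (a b : F -> R^o) (X W : F -> 'rV[R]_N) :
  smooth_at x a -> smooth_at x b -> smooth_at x X -> smooth_at x W ->
  smooth_at x (fun y => zpt (a y) (b y) (X y) (W y)).
Proof.
by move=> sa sb sX sW; apply: smooth_at_pair; apply: smooth_at_row_mx => //;
  exact: smooth_at_const_row.
Qed.

Lemma is_derive_zpt (F : normedModType R) (x v : F) (a b : F -> R^o) (X W : F -> 'rV[R]_N)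
    (da db : R) (dX dW : 'rV[R]_N) :
  is_derive x v a da -> is_derive x v b db -> is_derive x v X dX -> is_derive x v W dW ->
  is_derive x v (fun y => zpt (a y) (b y) (X y) (W y)) (zpt da db dX dW).
Proof.
by move=> sa sb sX sW; apply: is_derive_pair; apply: is_derive_row_mx => //;
  exact: is_derive_const_row.
Qed.

Definition modulus0 (z : C) : R^o := z.1 ord0 ord0 ^+ 2 + z.2 ord0 ord0 ^+ 2.

Lemma zpt00 a b X W : (zpt a b X W).1 ord0 ord0 = a /\ (zpt a b X W).2 ord0 ord0 = b.
Proof.
have e : ord0 = lshift N ord0 :> 'I_(1 + N) by exact: val_inj.
by rewrite /zpt /= e !row_mxEl !mxE.
Qed.

Lemma modulus0_zpt a b X W : modulus0 (zpt a b X W) = a ^+ 2 + b ^+ 2.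
Proof. by rewrite /modulus0; have [-> ->] := zpt00 a b X W. Qed.

Lemma smooth_at_modulus0 z : smooth_at z modulus0.
Proof.
rewrite /modulus0; apply: smooth_atD; apply: smooth_atX; apply: smooth_at_coord.
  exact: (smooth_at_fst (smooth_at_id _)).
exact: (smooth_at_snd (smooth_at_id _)).
Qed.

Lemma sqr_norm_complex (x y : R) : `|Complex x y| ^+ 2 = (x ^+ 2 + y ^+ 2)%:C%C.
Proof.
by rewrite /Num.norm /= -rmorphXn /= sqr_sqrtr // addr_ge0 ?sqr_ge0.
Qed.

Lemma unit_sphere_zpt a b X W : unit_sphere (zpt a b X W) <->
  a ^+ 2 + b ^+ 2 + dot X X + dot W W = 1.
Proof.
have e : \sum_(j < 1 + N) `|coordz (zpt a b X W) j| ^+ 2 =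
    (a ^+ 2 + b ^+ 2 + dot X X + dot W W)%:C%C.
  under eq_bigr => j _ do rewrite /coordz sqr_norm_complex.
  rewrite -(rmorph_sum (real_complex R)) /=; congr (_%:C)%C.
  rewrite big_split_ord /= big_ord_recl big_ord0 addr0 /zpt /= !row_mxEl !mxE.
  rewrite -!addrA; congr (_ + (_ + _)); rewrite /dot -big_split.
  by apply: eq_bigr => i _; rewrite !row_mxEr -!expr2.
rewrite /unit_sphere /= e; split=> [[]|->] //.
Qed.

Lemma std_form_zpt a b X W a' b' X' W' : std_form (zpt a b X W) (zpt a' b' X' W') =
  a * b' - b * a' + (dot X W' - dot W X').
Proof.
rewrite /std_form big_split_ord /= big_ord_recl big_ord0 addr0 /zpt /= !row_mxEl !mxE.
by congr (_ + _); rewrite /dot -sumrB; apply: eq_bigr => i _; rewrite !row_mxEr.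
Qed.

End ComplexPoints.

Section SphereOpenBook.
Context {R : realType} {N d : nat} (en : (N + N = 0 + d.+2)%N).
Local Notation E := 'rV[R]_(N + N).
Local Notation l := lsubmx.
Local Notation r := rsubmx.
Local Notation B := (@ball2 R N).

(** It normalises (e^(it), x / sqrt 2) to the unit sphere. The division by sqrt 2 accounts for the
    factor 1/2 in the radial form: the standard form pulls back to scale^2 times dt + radial
    form. *)
Definition sphere_scale (x : E) : R^o := (Num.sqrt (1 + dot x x / 2))^-1.

Definition sphere_P (q : R^o * E) : Cspace R (1 + N) :=
  zpt (sphere_scale q.2 * cos q.1) (sphere_scale q.2 * sin q.1)
    ((sphere_scale q.2 / Num.sqrt 2) *: l q.2) ((sphere_scale q.2 / Num.sqrt 2) *: r q.2).

Lemma sphere_arg_gt0 (x : E) : 0 < 1 + dot x x / 2.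
Proof. by have := dot_ge0 x; lra. Qed.

Lemma sphere_scale_gt0 x : 0 < sphere_scale x.
Proof. by rewrite invr_gt0 sqrtr_gt0 sphere_arg_gt0. Qed.

Lemma sphere_scale_sqr x : sphere_scale x ^+ 2 = (1 + dot x x / 2)^-1.
Proof. by rewrite exprVn sqr_sqrtr // ltW // sphere_arg_gt0. Qed.

Lemma smooth_at_sphere_scale x : smooth_at x sphere_scale.
Proof.
rewrite /sphere_scale; smooth; last exact: sphere_arg_gt0.
by rewrite gt_eqF // sqrtr_gt0 sphere_arg_gt0.
Qed.

Lemma smooth_at_scale2 (q : R^o * E) : smooth_at q (fun q : R^o * E => sphere_scale q.2 : R^o).
Proof.
by apply: (@smooth_at_comp _ _ _ _ snd); [exact: smooth_at_sphere_scale|smooth].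
Qed.

Lemma smooth_at_sphere_P q : smooth_at q sphere_P.
Proof. by have h := smooth_at_scale2 q; apply: smooth_at_zpt; smooth. Qed.

(** The derivative dd of the scale stays unspecified: the standard form annihilates radial
    directions, and the immersion argument eliminates dd from the equations. *)
Lemma is_derive_sphere_P t x (s : R) u : exists dd : R,
  is_derive ((t, x) : R^o * E) (s, u) sphere_P
   (zpt (dd * cos t - sphere_scale x * sin t * s) (dd * sin t + sphere_scale x * cos t * s)
     ((dd / Num.sqrt 2) *: l x + (sphere_scale x / Num.sqrt 2) *: l u)
     ((dd / Num.sqrt 2) *: r x + (sphere_scale x / Num.sqrt 2) *: r u)).
Proof.
have h := smooth_at_is_derive ((s, u) : R^o * E) (smooth_at_scale2 ((t, x) : R^o * E)).
exists ('D_((s, u) : R^o * E) (fun q : R^o * E => sphere_scale q.2 : R^o) (t, x)).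
apply: is_derive_zpt; der_eq.
- by ring.
- by ring.
- by congr (_ *: _ + _); ring.
- by congr (_ *: _ + _); ring.
Qed.

(** With rho = |z_0|^2 it is 1/rho on the page part, and (1 + nu) times the binding factor for nu =
    rho / (1 - rho) on the disc part; one formula in rho covers both. *)
Definition sphere_factor (rho : R^o) : R^o := (1 - cutoff rho) / (1 - rho) + cutoff rho / rho.

Lemma sphere_factor_large (rho : R) : 1 / 4 <= rho -> sphere_factor rho = rho^-1.
Proof. by move=> h; rewrite /sphere_factor cutoff_eq1 // subrr mul0r add0r mul1r. Qed.

Lemma sphere_factor_binding (nu : R) : 0 <= nu ->
  sphere_factor (nu / (1 + nu)) = (1 + nu) * binding_factor nu.
Proof.
move=> n0; rewrite /sphere_factor /binding_factor; have [->|n1] := eqVneq nu 0.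
  by rewrite !mul0r cutoff_eq0 ?subr0 ?mul0r ?addr0 ?invr1 //; lra.
have e : 1 + nu != 0 by rewrite gt_eqF //; lra.
field; rewrite n1 e /=.
by rewrite addrK oner_neq0.
Qed.

Lemma smooth_at_sphere_factor (rho : R) : 0 <= rho <= 1 -> smooth_at (rho : R^o) sphere_factor.
Proof.
move=> /andP[r0 r1]; have h := @smooth_cutoff R; have [r2|r2] := ltP rho (1 / 16).
  apply: (@smooth_at_ext R R^o R^o rho (fun rho => (1 - rho)^-1 : R^o)).
    apply: filterS (near_lt r2) => y y0.
    by rewrite /sphere_factor cutoff_eq0 ?ltW // subr0 mul0r addr0 mul1r.
  by smooth; rewrite gt_eqF //; lra.
have [r3|r3] := ltP (1 / 4) rho.
  apply: (@smooth_at_ext R R^o R^o rho (fun rho => rho^-1 : R^o)).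
    by apply: filterS (near_gt r3) => y /ltW y0; rewrite sphere_factor_large.
  by smooth; rewrite gt_eqF //; lra.
by rewrite /sphere_factor; smooth; rewrite gt_eqF //; lra.
Qed.

Lemma sphere_factor_gt0 (rho : R) : 0 <= rho <= 1 -> 0 < sphere_factor rho.
Proof.
move=> /andP[r0 r1]; have [r2|r2] := ltP rho 1; last first.
  have -> : rho = 1 by lra.
  by rewrite sphere_factor_large ?invr1; lra.
have -> : rho = (rho / (1 - rho)) / (1 + rho / (1 - rho)) by field; rewrite !gt_eqF; lra.
have n0 : 0 <= rho / (1 - rho) by rewrite divr_ge0; lra.
by rewrite sphere_factor_binding // mulr_gt0 ?binding_factor_gt0 //; lra.
Qed.

Local Notation vw w := (w.1 ^+ 2 + w.2 ^+ 2).

(** Over the disc |z_0|^2 = nu / (1 + nu) and the other coordinates have squared norm 1 / (1 + nu);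
    the factor 2 in the second scale comes from |x|^2 = 2 on the binding. *)
Definition sphere_disc_scale (v : R^o) : R^o := Num.sqrt (disc_ratio v / (1 + disc_profile v)).
Definition sphere_binding_scale (v : R^o) : R^o := (Num.sqrt (2 * (1 + disc_profile v)))^-1.

Definition sphere_Q (q : E * (R^o * R^o)) : Cspace R (1 + N) :=
  zpt (q.2.1 * sphere_disc_scale (vw q.2)) (q.2.2 * sphere_disc_scale (vw q.2))
    (sphere_binding_scale (vw q.2) *: l q.1) (sphere_binding_scale (vw q.2) *: r q.1).

Lemma vw_ge0 (w : R^o * R^o) : 0 <= vw w.
Proof. by rewrite addr_ge0 ?sqr_ge0. Qed.

Lemma onep_disc_profile_gt0 (v : R) : 0 <= v -> 0 < 1 + disc_profile v.
Proof. by move=> v0; have := disc_profile_ge0 v0; lra. Qed.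

Lemma sphere_disc_scale_gt0 (v : R) : 0 <= v -> 0 < sphere_disc_scale v.
Proof. by move=> v0; rewrite sqrtr_gt0 divr_gt0 ?disc_ratio_gt0 ?onep_disc_profile_gt0. Qed.

Lemma sphere_disc_scale_sqr (v : R) : 0 <= v ->
  sphere_disc_scale v ^+ 2 = disc_ratio v / (1 + disc_profile v).
Proof.
by move=> v0; rewrite sqr_sqrtr // ltW // divr_gt0 ?disc_ratio_gt0 ?onep_disc_profile_gt0.
Qed.

Lemma sphere_binding_scale_gt0 (v : R) : 0 <= v -> 0 < sphere_binding_scale v.
Proof. by move=> v0; rewrite invr_gt0 sqrtr_gt0 mulr_gt0 ?onep_disc_profile_gt0. Qed.

Lemma sphere_binding_scale_sqr (v : R) : 0 <= v ->
  sphere_binding_scale v ^+ 2 = (2 * (1 + disc_profile v))^-1.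
Proof. by move=> v0; rewrite exprVn sqr_sqrtr // ltW // mulr_gt0 ?onep_disc_profile_gt0. Qed.

Lemma smooth_at_sphere_disc_scale (v : R) : 0 <= v -> smooth_at (v : R^o) sphere_disc_scale.
Proof.
move=> v0; have h1 := @smooth_at_disc_profile R; have h2 := @smooth_at_disc_ratio R.
have g := onep_disc_profile_gt0 v0.
rewrite /sphere_disc_scale; smooth; last by rewrite gt_eqF.
by rewrite divr_gt0 ?disc_ratio_gt0.
Qed.

Lemma smooth_at_sphere_binding_scale (v : R) : 0 <= v -> smooth_at (v : R^o) sphere_binding_scale.
Proof.
move=> v0; have h1 := @smooth_at_disc_profile R; have g := onep_disc_profile_gt0 v0.
have g2 : 0 < 2 * (1 + disc_profile v) by rewrite mulr_gt0.
by rewrite /sphere_binding_scale; smooth; rewrite ?gt_eqF ?sqrtr_gt0.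
Qed.

Lemma smooth_at_of_vw (f : R^o -> R^o) (q : E * (R^o * R^o)) :
  smooth_at (vw q.2 : R^o) f -> smooth_at q (fun q : E * (R^o * R^o) => f (vw q.2) : R^o).
Proof.
by move=> sf; apply: (@smooth_at_comp1 _ _ _ (fun q : E * (R^o * R^o) => vw q.2 : R^o)) => //; smooth.
Qed.

Lemma smooth_at_sphere_Q q : smooth_at q sphere_Q.
Proof.
have h1 := smooth_at_of_vw (smooth_at_sphere_disc_scale (vw_ge0 q.2)).
have h2 := smooth_at_of_vw (smooth_at_sphere_binding_scale (vw_ge0 q.2)).
by apply: smooth_at_zpt; smooth.
Qed.

Lemma is_derive_of_vw (f : R^o -> R^o) (x u : E) (w eta : R^o * R^o) :
  smooth_at (vw w : R^o) f ->
  is_derive (x, w) (u, eta) (fun q : E * (R^o * R^o) => f (vw q.2) : R^o)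
    ('D_1 f (vw w : R^o) * (2 * (w.1 * eta.1 + w.2 * eta.2))).
Proof.
move=> sf; apply: (@is_derive_comp1 _ _ (fun q : E * (R^o * R^o) => vw q.2 : R^o) f);
  last exact: smooth_at_is_derive.
by der_eq; ring.
Qed.

Lemma is_derive_sphere_Q x w u eta : let v : R := vw w in
  let c : R := 2 * (w.1 * eta.1 + w.2 * eta.2) in
  is_derive ((x, w) : E * (R^o * R^o)) (u, eta) sphere_Q
  (zpt (eta.1 * sphere_disc_scale v + w.1 * ('D_1 sphere_disc_scale (v : R^o) * c))
       (eta.2 * sphere_disc_scale v + w.2 * ('D_1 sphere_disc_scale (v : R^o) * c))
    (('D_1 sphere_binding_scale (v : R^o) * c) *: l x + sphere_binding_scale v *: l u)
    (('D_1 sphere_binding_scale (v : R^o) * c) *: r x + sphere_binding_scale v *: r u)).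
Proof.
move=> v c.
have h1 := is_derive_of_vw x u eta (smooth_at_sphere_disc_scale (vw_ge0 w)).
have h2 := is_derive_of_vw x u eta (smooth_at_sphere_binding_scale (vw_ge0 w)).
by rewrite -/v -/c in h1 h2; apply: is_derive_zpt; der_eq => //; rewrite ?[_ * eta.1]mulrC ?[_ * eta.2]mulrC addrC.
Qed.

Lemma sphere_P_modulus t x : modulus0 (sphere_P (t, x)) = (1 + dot x x / 2)^-1.
Proof.
by rewrite modulus0_zpt !exprMn -mulrDr cos2Dsin2 mulr1 sphere_scale_sqr.
Qed.

Lemma sphere_Q_modulus x w : modulus0 (sphere_Q (x, w)) =
  disc_profile (vw w) / (1 + disc_profile (vw w)).
Proof.
have v0 := vw_ge0 w.
by rewrite modulus0_zpt !exprMn -mulrDl sphere_disc_scale_sqr // mulrA.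
Qed.

Lemma sphere_P_sphere q : unit_sphere (sphere_P q).
Proof.
apply/unit_sphere_zpt; rewrite !dotE !exprMn -mulrDr cos2Dsin2 mulr1.
have -> : forall c : R, c / Num.sqrt 2 * (c / Num.sqrt 2 * dot (l q.2) (l q.2)) =
    c ^+ 2 / Num.sqrt 2 ^+ 2 * dot (l q.2) (l q.2).
  by move=> c; field.
have -> : forall c : R, c / Num.sqrt 2 * (c / Num.sqrt 2 * dot (r q.2) (r q.2)) =
    c ^+ 2 / Num.sqrt 2 ^+ 2 * dot (r q.2) (r q.2).
  by move=> c; field.
rewrite sqr_sqrtr // sphere_scale_sqr; rewrite (dot_lr q.2).
have := dot_ge0 (l q.2); have := dot_ge0 (r q.2); set A := dot _ _; set A' := dot _ _ => g g'.
by field; rewrite gt_eqF //; lra.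
Qed.

Lemma sphere_Q_sphere x w : dot x x = 2 -> unit_sphere (sphere_Q (x, w)).
Proof.
move=> xx; have v0 := vw_ge0 w; have g := onep_disc_profile_gt0 v0.
apply/unit_sphere_zpt; rewrite /= !dotE !exprMn -mulrDl -addrA -!mulrDr -dot_lr xx mulrA -expr2.
rewrite sphere_disc_scale_sqr // sphere_binding_scale_sqr //= mulrA -/(disc_profile (vw w)).
by field; rewrite gt_eqF.
Qed.

Definition sphere_f (y : Cspace R (1 + N)) : R := sphere_factor (modulus0 y).

Lemma sphere_modulus_le1 (y : Cspace R (1 + N)) : unit_sphere y -> 0 <= modulus0 y <= 1.
Proof.
rewrite (zpt_surj y) => /unit_sphere_zpt e; rewrite modulus0_zpt.
have := dot_ge0 (r y.1); have := dot_ge0 (r y.2).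
by rewrite addr_ge0 ?sqr_ge0 //=; lra.
Qed.

Lemma ball_collar_dot (s : R) (x : E) : dot x x = 2 -> dot (ball2_collar (s, x)) (ball2_collar (s, x)) = 2 * expR s.
Proof.
move=> xx; rewrite /ball2_collar /= dotZl dotZr xx mulrA -expRD -splitr mulrC //.
Qed.

Lemma sphere_open_book : open_book_form d.+2 (@unit_sphere R (1 + N))
  (fun y v => sphere_f y * std_form y v) B radial_form id (fun=> 2 * pi)
  (@ball2_collar R N) sphere_P sphere_Q (1 / 4) binding_h1 binding_h2.
Proof.
have bE := boundary_ball2 en.
have p0 : 0 < 2 * pi :> R by rewrite mulr_gt0 ?pi_gt0.
have r2 : Num.sqrt 2 != 0 :> R by rewrite gt_eqF // sqrtr_gt0.
have r22 : Num.sqrt 2 ^+ 2 = 2 :> R by rewrite sqr_sqrtr.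
split.
- by lra.
- by [].
- by apply: smooth_near_at => q _; exact: smooth_at_sphere_P.
- move=> t x s u _; have [dd [_ ->]] := is_derive_sphere_P t x s u.
  move=> /zpt_eq0[e1 e2 e3 e4]; have d0 := sphere_scale_gt0 x.
  have cs := cos2Dsin2 t.
  (* Pairing the derivative of z_0 with e^(it) isolates dd, and pairing it with i e^(it) isolates
     s. *)
  have dd0 : dd = 0.
    apply: (@eq_of_sub _ _ _ (cos t * (dd * cos t - sphere_scale x * sin t * s) +
      sin t * (dd * sin t + sphere_scale x * cos t * s) - dd * (cos t ^+ 2 + sin t ^+ 2 - 1))).
      by rewrite e1 e2 cs subrr !mulr0 addr0 subr0.
    by ring.
  have s0 : sphere_scale x * s = 0.
    apply: (@eq_of_sub _ _ _ (cos t * (dd * sin t + sphere_scale x * cos t * s) -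
      sin t * (dd * cos t - sphere_scale x * sin t * s) -
      sphere_scale x * s * (cos t ^+ 2 + sin t ^+ 2 - 1))).
      by rewrite e1 e2 cs subrr !mulr0 !subr0.
    by ring.
  rewrite dd0 mul0r !scale0r !add0r in e3 e4.
  move/eqP: s0; rewrite mulf_eq0 gt_eqF //= => /eqP ->.
  have dz : sphere_scale x / Num.sqrt 2 != 0 by rewrite gt_eqF // divr_gt0 // sqrtr_gt0.
  move/eqP: e3; rewrite scaler_eq0 (negbTE dz) /= => /eqP e3.
  move/eqP: e4; rewrite scaler_eq0 (negbTE dz) /= => /eqP e4.
  by rewrite -[u]hsubmxK e3 e4 row_mx0.
- apply: deck_fibres => //.
  + move=> [t x] _; rewrite /deck /sphere_P /=; congr zpt; congr (_ * _).
      by have := @cosDn2pi R (t - 2 * pi) 1; rewrite mul1r subrK => ->.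
    by have := @sinDn2pi R (t - 2 * pi) 1; rewrite mul1r subrK => ->.
  + move=> [t x] [t' x'] _ _ e /=; split=> //.
    have := congr1 modulus0 e; rewrite !sphere_P_modulus => e0.
    have es : sphere_scale x = sphere_scale x'.
      apply/eqP; rewrite -(@eqrXn2 _ 2) ?ltW ?sphere_scale_gt0 //; apply/eqP.
      by rewrite !sphere_scale_sqr.
    move: e => /zpt_inj[/=]; rewrite -es => /(mulfI _) e1 /(mulfI _) e2 _ _.
    have sn : sphere_scale x != 0 by rewrite gt_eqF // sphere_scale_gt0.
    exact: cos_sin_eq (e1 sn) (e2 sn).
  + move=> t x x' _ _ e; have := congr1 modulus0 e; rewrite !sphere_P_modulus => e0.
    have es : sphere_scale x = sphere_scale x'.
      apply/eqP; rewrite -(@eqrXn2 _ 2) ?ltW ?sphere_scale_gt0 //; apply/eqP.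
      by rewrite !sphere_scale_sqr.
    move: e => /zpt_inj[_ _ /=]; rewrite -es => /scalerI e1 /scalerI e2.
    have dz : sphere_scale x / Num.sqrt 2 != 0.
      by rewrite gt_eqF // divr_gt0 ?sphere_scale_gt0 // sqrtr_gt0.
    by rewrite -[x]hsubmxK -[x']hsubmxK e1 // e2.
- move=> t x s u /(tangent_ball2 en) bx; have [dd [_ ->]] := is_derive_sphere_P t x s u.
  rewrite /sphere_f sphere_P_modulus sphere_factor_large; last first.
    by rewrite -[X in _ <= X]mul1r ler_pdivlMr ?sphere_arg_gt0 //; rewrite /ball2 /= in bx; lra.
  rewrite invrK /sphere_P std_form_zpt !dotE /radial_form (dotC (r x) (l x)) /=.
  have cs := cos2Dsin2 t; have ss := sphere_scale_sqr x; have g := sphere_arg_gt0 x.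
  set k := 1 + _ in ss g *; set a := sphere_scale x in ss *.
  have e : k * a ^+ 2 = 1 by rewrite ss divff // gt_eqF.
  apply: (@eq_of_sub _ _ _ ((k * a ^+ 2 * (cos t ^+ 2 + sin t ^+ 2) - 1) * s +
    (k * a ^+ 2 / Num.sqrt 2 ^+ 2 - 2^-1) * (dot (l x) (r u) - dot (r x) (l u)))).
    by rewrite e r22 cs !mul1r !subrr !mul0r addr0.
  by field.
- by apply: smooth_near_at => q _; exact: smooth_at_sphere_Q.
- move=> x w u eta _ /(bdtangent_ball2 en)[xx xu].
  have [_ ->] := is_derive_sphere_Q x w u eta.
  set v := vw w; set c := 2 * _; move=> /zpt_eq0[e1 e2 e3 e4].
  have v0 : 0 <= v := vw_ge0 w; have b0 := sphere_binding_scale_gt0 v0.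
  have a0 := sphere_disc_scale_gt0 v0.
  (* The inner product with x removes u, which is orthogonal to x on the boundary sphere. *)
  have db : 'D_1 sphere_binding_scale (v : R^o) * c = 0.
    have := congr2 +%R (congr1 (dot (l x)) e3) (congr1 (dot (r x)) e4).
    rewrite !dotE !addr0 addrACA -mulrDr -mulrDr -!dot_lr xx xu mulr0 addr0.
    by move/eqP; rewrite mulf_eq0 pnatr_eq0 orbF => /eqP.
  rewrite db !scale0r !add0r in e3 e4.
  move/eqP: e3; rewrite scaler_eq0 gt_eqF //= => /eqP e3.
  move/eqP: e4; rewrite scaler_eq0 gt_eqF //= => /eqP e4.
  split; first by rewrite -[u]hsubmxK e3 e4 row_mx0.
  (* At v = 0 the vector w is 0; for v > 0 the binding scale has nonzero derivative because the disc
     profile has. *)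
  have c0 : c = 0.
    have [v1|v1] := ltP 0 v; last first.
      have : v = 0 by apply/eqP; rewrite eq_le v1.
      move/eqP; rewrite paddr_eq0 ?sqr_ge0 // !sqrf_eq0 => /andP[/eqP w1 /eqP w2].
      by rewrite /c w1 w2 !mul0r addr0 mulr0.
    move/eqP: db; rewrite mulf_eq0 => /orP[/eqP db|/eqP //]; exfalso.
    have d1 := smooth_at_is_derive (1 : R^o) (@smooth_at_disc_profile R v).
    have g := onep_disc_profile_gt0 v0.
    have g2 : 0 < Num.sqrt (2 * (1 + disc_profile v)) by rewrite sqrtr_gt0 mulr_gt0.
    have [_] : is_derive (v : R^o) 1 sphere_binding_scale
       (- (Num.sqrt (2 * (1 + disc_profile v)) ^- 3 * 'D_1 disc_profile (v : R^o))).
      rewrite /sphere_binding_scale; der_eq; [by rewrite gt_eqF|by rewrite mulr_gt0|].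
      by field; rewrite gt_eqF.
    rewrite db => /esym/eqP; rewrite oppr_eq0 mulf_eq0 invr_eq0 expf_eq0 /= gt_eqF //=.
    by rewrite gt_eqF // derive_disc_profile_gt0.
  rewrite c0 !mulr0 !addr0 in e1 e2.
  move/eqP: e1; rewrite mulf_eq0 (gt_eqF a0) orbF => /eqP e1.
  move/eqP: e2; rewrite mulf_eq0 (gt_eqF a0) orbF => /eqP e2.
  by rewrite [eta]surjective_pairing e1 e2.
- move=> x x' w w' bx bx' _ _ e; have := congr1 modulus0 e; rewrite !sphere_Q_modulus => e0.
  have v0 := vw_ge0 w; have v0' := vw_ge0 w'.
  have ev : vw w = vw w'.
    apply: disc_profile_inj => //.
    have g := onep_disc_profile_gt0 v0; have g' := onep_disc_profile_gt0 v0'.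
    move/eqP: e0; rewrite eqr_div ?(lt0r_neq0 g) ?(lt0r_neq0 g') // => /eqP e0.
    by rewrite !mulrDr !mulr1 [X in _ = _ + X]mulrC in e0; exact: addIr e0.
  have a0 := sphere_disc_scale_gt0 v0; have b0 := sphere_binding_scale_gt0 v0.
  move: e => /zpt_inj[/=]; rewrite -ev => /mulIf e1 /mulIf e2 /scalerI e3 /scalerI e4.
  rewrite -[x]hsubmxK -[x']hsubmxK e3 ?gt_eqF // e4 ?gt_eqF //; split=> //.
  by rewrite [w]surjective_pairing [w']surjective_pairing e1 ?gt_eqF // e2 ?gt_eqF.
- move=> x w u eta _ /(bdtangent_ball2 en)[xx xu].
  have [_ ->] := is_derive_sphere_Q x w u eta.
  rewrite /sphere_f sphere_Q_modulus /sphere_Q std_form_zpt !dotE /= /polar_dt radius_sqr.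
  rewrite /binding_h2 /binding_h1 radius_sqr /radial_form (dotC (r x) (l x)).
  have v0 := vw_ge0 w; have g := onep_disc_profile_gt0 v0.
  rewrite sphere_factor_binding ?disc_profile_ge0 //.
  have a2 := sphere_disc_scale_sqr v0; have b2 := sphere_binding_scale_sqr v0.
  set v := vw w in v0 g a2 b2 *.
  set a := sphere_disc_scale v in a2 *; set b := sphere_binding_scale v in b2 *.
  have pi0 : pi != 0 :> R by rewrite gt_eqF // pi_gt0.
  set F := binding_factor _; set dt := dot (l x) (r u) - dot (r x) (l u).
  transitivity ((1 + disc_profile v) * F * (a ^+ 2 * (w.1 * eta.2 - w.2 * eta.1) + b ^+ 2 * dt)).
    by rewrite /dt; ring.
  have -> : (1 + disc_profile v) * F * (a ^+ 2 * (w.1 * eta.2 - w.2 * eta.1) + b ^+ 2 * dt) =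
      F * (disc_ratio v * (w.1 * eta.2 - w.2 * eta.1) + dt / 2).
    by rewrite a2 b2; field; rewrite gt_eqF.
  (* At the centre the quotient in [polar_dt] is 0 by convention; w = 0 makes the other side
     agree. *)
  have [v1|v1] := eqVneq v 0.
    move/eqP: (v1); rewrite paddr_eq0 ?sqr_ge0 // !sqrf_eq0 => /andP[/eqP w1 /eqP w2].
    by rewrite w1 w2 !mul0r subr0 !mulr0 mul0r !mulr0 add0r addr0.
  have aux (f D Z y q t : R) : y != 0 -> q != 0 ->
    f * (D * Z + t / 2) = f * (t / 2) + y * D * f * (2 * q / (2 * q) * (Z / y)).
    by move=> y0 q0; field; rewrite y0.
  exact: aux.
- exact: binding_h_smooth.
- exact: binding_h_near0.
- by move=> s /andP[s1 _]; exact: binding_h_match.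
- move=> x s t; rewrite bE => xx /andP[s1 _]; have s0 : 0 <= s by lra.
  have vE : vw (polar (2 * pi) s t) = s ^+ 2.
    by rewrite -radius_sqr radius_polar.
  rewrite /sphere_Q /sphere_P /= -/(polar (2 * pi) s t) vE.
  have tE : 2 * pi * t / (2 * pi) = t by rewrite mulrC mulrA mulVf ?mul1r ?gt_eqF.
  rewrite tE; have e1 := disc_profile_end s1; have cd := ball_collar_dot (1 - s) xx.
  have ee : expR (s - 1) * expR (1 - s) = 1 :> R.
    by rewrite -expRD addrC subrKA subrr expR0.
  have E0 := expR_gt0 (1 - s); have E1 := expR_gt0 (s - 1).
  have aux (A A' : R) : 0 < A -> A' * A = 1 -> A' = A^-1.
    by move=> A0 e; rewrite -[A']mulr1 -(divff (lt0r_neq0 A0)) mulrA e mul1r.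
  have aux1 (A A' : R) : 0 < A -> 0 < A' -> A' * A = 1 -> A' / (1 + A') = (1 + 2 * A / 2)^-1.
    by move=> A0 _ /(aux _ _ A0) ->; field; rewrite !gt_eqF //; lra.
  have aux2 (A A' : R) : 0 < A -> 0 < A' -> A' * A = 1 ->
      (2 * (1 + A'))^-1 = (1 + 2 * A / 2)^-1 / 2 * A.
    by move=> A0 _ /(aux _ _ A0) ->; field; rewrite !gt_eqF //; lra.
  have h1 : s * sphere_disc_scale (s ^+ 2) = sphere_scale (ball2_collar (1 - s, x)).
    apply/eqP; rewrite -(@eqrXn2 _ 2) ?ltW ?sphere_scale_gt0 ?mulr_gt0 ?sphere_disc_scale_gt0 ?sqr_ge0 //; last lra.
    rewrite exprMn sphere_disc_scale_sqr ?sqr_ge0 // sphere_scale_sqr cd mulrA -/(disc_profile _) e1.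
    by apply/eqP; exact: (aux1 _ _ E0 E1 ee).
  have h2 : sphere_binding_scale (s ^+ 2) = sphere_scale (ball2_collar (1 - s, x)) / Num.sqrt 2 * expR ((1 - s) / 2).
    have q0 : 0 < Num.sqrt 2 :> R by rewrite sqrtr_gt0.
    apply/eqP; rewrite -(@eqrXn2 _ 2) ?ltW ?sphere_binding_scale_gt0 ?sqr_ge0 //; last first.
      by rewrite mulr_gt0 ?expR_gt0 // divr_gt0 ?sphere_scale_gt0.
    rewrite sphere_binding_scale_sqr ?sqr_ge0 // !exprMn sphere_scale_sqr exprVn r22 cd e1.
    have -> : expR ((1 - s) / 2) ^+ 2 = expR (1 - s) by rewrite expr2 -expRD -splitr.
    by apply/eqP; exact: (aux2 _ _ E0 E1 ee).
  congr zpt; first by rewrite -h1; ring.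
  + by rewrite -h1; ring.
  + by rewrite h2 /ball2_collar /= !lrE scalerA.
  + by rewrite h2 /ball2_collar /= !lrE scalerA.
- move=> [t x] x' w Bx _ w1 e; have := congr1 modulus0 e.
  rewrite sphere_P_modulus sphere_Q_modulus; have v0 := vw_ge0 w.
  have v1 : vw w < 1.
    by rewrite -radius_sqr -(expr1n R 2) ltr_pXn2r ?nnegrE ?radius_ge0.
  have := disc_profile_lt v0 v1; rewrite disc_profile1 => n1 => e0.
  have n0 := disc_profile_ge0 v0.
  have : (1 + dot x x / 2)^-1 >= 1 / 2.
    by rewrite -[X in _ <= X]mul1r ler_pdivlMr ?sphere_arg_gt0 //; rewrite /ball2 /= in Bx; lra.
  by rewrite e0 ler_pdivlMr; lra.
- move=> y; split; last first.
    case=> [[q _ ->]|[x [w [bx _ ->]]]]; first exact: sphere_P_sphere.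
    by apply: sphere_Q_sphere; rewrite bE in bx.
  move=> My; have /andP[m0 m1] := sphere_modulus_le1 My.
  rewrite (zpt_surj y) in My m0 m1 *.
  set a := l y.1 _ _ in My m0 m1 *; set b := l y.2 _ _ in My m0 m1 *.
  set X := r y.1 in My m0 m1 *; set W := r y.2 in My m0 m1 *.
  move/unit_sphere_zpt: My; rewrite modulus0_zpt in m0 m1.
  set rho := _ + b ^+ 2 in m0 m1 *; move=> My.
  (* The value 1/2 of rho is the boundary |x|^2 = 2 of the page, and equally nu = 1, the unit circle
     of the disc. *)
  have [h|h] := leP (1 / 2) rho.
    left; have h0 : 0 < rho by lra.
    have q0 : 0 < Num.sqrt rho by rewrite sqrtr_gt0.
    have q2 : Num.sqrt rho ^+ 2 = rho by rewrite sqr_sqrtr.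
    have [|t [ct st]] := @exists_angle _ (a / Num.sqrt rho) (b / Num.sqrt rho).
      by rewrite !expr_div_n -mulrDl q2 divff // gt_eqF.
    pose x : E := (Num.sqrt 2 / Num.sqrt rho) *: row_mx X W.
    have xx : dot x x = 2 * (1 - rho) / rho.
      rewrite /x dotZl dotZr dot_row_mx (_ : dot X X + dot W W = 1 - rho); last lra.
      by rewrite mulrA -expr2 expr_div_n r22 q2; field; rewrite gt_eqF.
    have sx : sphere_scale x = Num.sqrt rho.
      apply/eqP; rewrite -(@eqrXn2 _ 2) ?ltW ?sphere_scale_gt0 //; apply/eqP.
      by rewrite sphere_scale_sqr xx q2; field; rewrite gt_eqF //=; lra.
    exists (t, x); first by rewrite /ball2 /= xx ler_pdivrMr //; lra.
    rewrite /sphere_P /= sx -ct -st /x !lrE !scalerA.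
    have -> : Num.sqrt rho / Num.sqrt 2 * (Num.sqrt 2 / Num.sqrt rho) = 1.
      by field; rewrite r2 gt_eqF.
    by rewrite !scale1r; congr zpt; field; rewrite gt_eqF.
  right; have nu01 : 0 <= rho / (1 - rho) < 1.
    by rewrite divr_ge0 ?ltr_pdivrMr /=; lra.
  have [v /andP[v0 v1] ev] := disc_profile_surj nu01.
  have a0 := sphere_disc_scale_gt0 v0; have b0 := sphere_binding_scale_gt0 v0.
  have b2 := sphere_binding_scale_sqr v0; have a2 := sphere_disc_scale_sqr v0.
  rewrite ev in b2.
  pose w : R^o * R^o := (a / sphere_disc_scale v, b / sphere_disc_scale v).
  have vE : vw w = v.
    rewrite /w /= !expr_div_n -mulrDl -/rho a2; have [v2|v2] := eqVneq v 0.
      have : rho / (1 - rho) = 0 by rewrite -ev v2 disc_profile0.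
      move/eqP; rewrite mulf_eq0 invr_eq0 => /orP[/eqP ->|]; first by rewrite mul0r v2.
      by rewrite gt_eqF //; lra.
    have -> : disc_ratio v = rho / (1 - rho) / v by rewrite -ev /disc_profile mulrC mulKf.
    rewrite ev; have rho0 : rho != 0.
      apply: contra v2 => /eqP rr; move: ev; rewrite rr mul0r => /eqP.
      by rewrite mulf_eq0 (gt_eqF (disc_ratio_gt0 v0)) orbF.
    by field; rewrite v2 rho0 /= !gt_eqF //; lra.
  pose x : E := (sphere_binding_scale v)^-1 *: row_mx X W.
  exists x, w; split.
  + rewrite bE /= /x dotZl dotZr dot_row_mx (_ : dot X X + dot W W = 1 - rho); last lra.
    by rewrite mulrA -expr2 exprVn b2; field; rewrite gt_eqF //=; lra.
  + by rewrite -(@ltr_pXn2r _ 2) ?nnegrE ?radius_ge0 // radius_sqr vE expr1n.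
  + rewrite /sphere_Q /= vE /x !lrE !scalerA divff ?gt_eqF // !scale1r.
    by rewrite /w /= !divfK ?gt_eqF.
Qed.

(** The open book is the one of the identity, to which phi is isotopic; its primitive may be any
    constant, and 2 pi makes t the ordinary angle of z_0. *)
Lemma sphere_supports (phi : E -> E) : symplectomorphism d.+2 B radial_form phi ->
  symplectic_isotopy d.+2 B radial_form phi id ->
  supports d.+2 B radial_form phi (@unit_sphere R (1 + N)) (@std_form R (1 + N)).
Proof.
move=> sp iso; exists id, (fun=> 2 * pi), (@ball2_collar R N); split.
- have di (u x : E) : 'D_u (id : E -> E) x = u by exact: derive_id.
  split; last exact: iso.
  split; last by move=> x u v _ _; rewrite !di.
  have s : smooth_near B id by apply: smooth_near_at => x _; exact: smooth_at_id.
  by split=> //; exists id.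
- split; first by apply: smooth_near_at => x _; exact: smooth_at_cst.
  by move=> x v _; rewrite derive_id subrr derive_cst.
- exact: ball2_is_collar.
- exists sphere_f; split.
  + apply: smooth_near_at => y My; apply: (@smooth_at_comp1 _ _ _ modulus0 sphere_factor).
      exact/smooth_at_sphere_factor/sphere_modulus_le1.
    exact: smooth_at_modulus0.
  + by move=> y My; exact/sphere_factor_gt0/sphere_modulus_le1.
  + exists sphere_P, sphere_Q, (1 / 4), binding_h1, binding_h2.
    exact: sphere_open_book.
Qed.

End SphereOpenBook.

(** * The open book of the Ustilovsky sphere *)

Section ComplexPower.
Context {R : realType} {N : nat}.

(** Complex powers as pairs of real polynomials, to which the real derivative rules apply. *)
Fixpoint zpow (p : nat) (a b : R^o) : R^o * R^o :=
  if p is p'.+1 then (a * (zpow p' a b).1 - b * (zpow p' a b).2,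
                      a * (zpow p' a b).2 + b * (zpow p' a b).1) else (1, 0).

Lemma zpowE p (a b : R) : Complex a b ^+ p = Complex (zpow p a b).1 (zpow p a b).2.
Proof. by elim: p => [|p IH]; rewrite ?expr0 // exprS IH. Qed.

Lemma zpow_norm p (a b : R) : (zpow p a b).1 ^+ 2 + (zpow p a b).2 ^+ 2 = (a ^+ 2 + b ^+ 2) ^+ p.
Proof.
elim: p => [|p IH]; first by rewrite /= expr1n expr0n addr0.
by rewrite [RHS]exprS -IH /=; ring.
Qed.

Lemma zpow_polar p (s t : R) : zpow p (s * cos t) (s * sin t) =
  (s ^+ p * cos (p%:R * t), s ^+ p * sin (p%:R * t)).
Proof.
elim: p => [|p IH]; first by rewrite /= mul0r cos0 sin0 expr0 mulr1 mulr0.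
rewrite /= IH /= -natr1 mulrDl mul1r cosD sinD exprS.
by congr (_, _); ring.
Qed.

Lemma smooth_at_zpow (F : normedModType R) (x : F) p (a b : F -> R^o) :
  smooth_at x a -> smooth_at x b ->
  smooth_at x (fun y => (zpow p (a y) (b y)).1 : R^o) /\
  smooth_at x (fun y => (zpow p (a y) (b y)).2 : R^o).
Proof.
move=> sa sb; elim: p => [|p [IH1 IH2]]; first by split; exact: smooth_at_cst.
by split=> /=; smooth.
Qed.

Lemma is_derive_zpow (F : normedModType R) (x v : F) p (a b : F -> R^o) (da db : R) :
  is_derive x v a da -> is_derive x v b db ->
  is_derive x v (fun y => (zpow p (a y) (b y)).1 : R^o)
   (p%:R * ((zpow p.-1 (a x) (b x)).1 * da - (zpow p.-1 (a x) (b x)).2 * db)) /\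
  is_derive x v (fun y => (zpow p (a y) (b y)).2 : R^o)
   (p%:R * ((zpow p.-1 (a x) (b x)).1 * db + (zpow p.-1 (a x) (b x)).2 * da)).
Proof.
move=> sa sb; elim: p => [|p [IH1 IH2]].
  by rewrite !mul0r; split; exact: is_derive_cst.
split=> /=; der_eq; case: p {IH1 IH2} => [|p] /=; rewrite -?natr1; ring.
Qed.

Local Notation l := lsubmx.
Local Notation r := rsubmx.

Definition brieskorn_exponent (p : nat) (j : 'I_(1 + N)) : nat := if val j == 0%N then p else 2%N.

Lemma brieskorn_exponent_l p : brieskorn_exponent p (lshift N ord0) = p.
Proof. by []. Qed.

Lemma brieskorn_exponent_r p i : brieskorn_exponent p (rshift 1 i) = 2%N.
Proof. by []. Qed.

Lemma coordz_zptl a b (X W : 'rV[R]_N) : coordz (zpt a b X W) (lshift N ord0) = Complex a b.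
Proof. by rewrite /coordz /zpt /= !row_mxEl !mxE. Qed.

Lemma coordz_zptr a b (X W : 'rV[R]_N) i :
  coordz (zpt a b X W) (rshift 1 i) = Complex (X ord0 i) (W ord0 i).
Proof. by rewrite /coordz /zpt /= !row_mxEr. Qed.

Lemma brieskorn_zpt p a b (X W : 'rV[R]_N) : brieskorn (brieskorn_exponent p) (zpt a b X W) <->
  [/\ (zpow p a b).1 + (dot X X - dot W W) = 0, (zpow p a b).2 + 2 * dot X W = 0 &
      a ^+ 2 + b ^+ 2 + dot X X + dot W W = 1].
Proof.
rewrite /brieskorn /setI /= unit_sphere_zpt.
have -> : \sum_(j < 1 + N) coordz (zpt a b X W) j ^+ brieskorn_exponent p j =
    Complex ((zpow p a b).1 + (dot X X - dot W W)) ((zpow p a b).2 + 2 * dot X W).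
  rewrite big_split_ord /= big_ord_recl big_ord0 addr0.
  have -> : coordz (zpt a b X W) (lshift N ord0) = Complex a b.
    by rewrite /coordz /zpt /= !row_mxEl !mxE.
  rewrite /brieskorn_exponent /= zpowE.
  have -> : \sum_(i < N) coordz (zpt a b X W) (rshift 1 i) ^+ 2 =
      Complex (dot X X - dot W W) (2 * dot X W).
    rewrite /dot -sumrB mulr_sumr.
    have -> : forall f g : 'I_N -> R, Complex (\sum_i f i) (\sum_i g i) =
        \sum_i Complex (f i) (g i).
      move=> f g; apply: (big_ind3 (fun (u v : R) (w : R[i]) => Complex u v = w)) => //.
      by move=> x1 x2 x3 y1 y2 y3 <- <-.
    apply: eq_bigr => i _; rewrite /coordz /zpt /= !row_mxEr expr2.
    by congr Complex; ring.
  by [].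
by split=> [[[-> ->] ->]|[-> -> ->]].
Qed.

Lemma brieskorn_form_zpt p a b (X W : 'rV[R]_N) a' b' X' W' :
  brieskorn_form (brieskorn_exponent p) (zpt a b X W) (zpt a' b' X' W') =
  p%:R / 4 * (a * b' - b * a') + (dot X W' - dot W X') / 2.
Proof.
have key (n : nat) (x y x' y' : R) : n%:R * (Complex x y * conjc (Complex x' y') -
    conjc (Complex x y) * Complex x' y') = Complex 0 (n%:R * (2 * (y * x' - x * y'))).
  have -> : n%:R = Complex n%:R 0 :> R[i] by rewrite -(rmorph_nat (real_complex R)).
  rewrite /conjc; congr Complex; rewrite /=; ring.
rewrite /brieskorn_form.
have -> : \sum_(j < 1 + N) (brieskorn_exponent p j)%:R *
    (coordz (zpt a b X W) j * conjc (coordz (zpt a' b' X' W') j) -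
     conjc (coordz (zpt a b X W) j) * coordz (zpt a' b' X' W') j) =
    Complex 0 (p%:R * (2 * (b * a' - a * b')) + 2 * (2 * (dot W X' - dot X W'))).
  rewrite big_split_ord big_ord1 (ord1 (ord0 : 'I_1)) brieskorn_exponent_l !coordz_zptl key.
  under eq_bigr => i _ do rewrite brieskorn_exponent_r !coordz_zptr key.
  have e (f : 'I_N -> R) : \sum_i Complex 0 (f i) = Complex 0 (\sum_i f i).
    apply: esym; apply: (big_ind2 (fun (u : R) (w : R[i]) => Complex 0 u = w)) => //.
    by move=> x1 x2 y1 y2 <- <-; congr Complex; rewrite addr0.
  rewrite e -!mulr_sumr sumrB -/(dot _ _) -/(dot _ _) /=.
  by congr Complex; rewrite addr0.
have -> : Complex 0 1 / 8%:R = Complex 0 (1 / 8) :> R[i].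
  have -> : 8%:R = Complex 8 0 :> R[i] by rewrite -(rmorph_nat (real_complex R)).
  have e8 : Complex 8 0 != 0 :> R[i] by rewrite eq_complex /= pnatr_eq0.
  apply: (mulIf e8); rewrite divfK // -[RHS]/(Complex (0 * 8 - 1 / 8 * 0) (0 * 0 + 1 / 8 * 8)).
  by congr Complex; field.
by rewrite /=; field.
Qed.

End ComplexPower.

(** * The modulus of the first coordinate *)

Section Modulus.
Context {R : realType}.
Variable p : nat.
Hypothesis p_odd : odd p.

(* On the Brieskorn manifold this function of rho = |z_0|^2 equals |z|^4 - |z . z|^2 for the
   remaining coordinates z. *)
Definition gram (rho : R^o) : R^o := (1 - rho) ^+ 2 - rho ^+ p.

Lemma is_derive_gram (rho : R^o) :
  is_derive rho 1 gram (- (2 * (1 - rho) + p%:R * rho ^+ p.-1)).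
Proof. by rewrite /gram; der_eq; ring. Qed.

Lemma smooth_at_gram rho : smooth_at rho gram.
Proof. by rewrite /gram; smooth. Qed.

(** As p is odd, p - 1 is even and the power is nonnegative for negative rho as well. So [gram] is
    monotone on both sides of rho = 0, and its inverse is smooth at the binding. *)
Lemma derive_gram_neg (rho : R) : -1 < rho < 1 -> 0 < 2 * (1 - rho) + p%:R * rho ^+ p.-1.
Proof.
move=> /andP[r0 r1]; rewrite ltr_pwDl //; first lra.
by rewrite mulr_ge0 // exprn_even_ge0 // -oddS prednK // odd_gt0.
Qed.

Lemma gram0 : gram 0 = 1.
Proof. by rewrite /gram subr0 expr1n expr0n gtn_eqF ?odd_gt0 // subr0. Qed.

Lemma gram1 : gram 1 = -1.
Proof. by rewrite /gram subrr expr0n expr1n sub0r. Qed.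

Lemma gram_inverse : exists g : R^o -> R^o, forall rho : R, -1 < rho < 1 ->
  g (gram rho) = rho /\ smooth_at (gram rho : R^o) g.
Proof.
have [|g hg] := @smooth_at_inverse R (fun rho => - gram rho) (-1) 1.
  move=> rho rho1; have s := smooth_at_gram rho; split; first by smooth.
  have d := is_derive_opp (is_derive_gram rho); have [_ ->] := d.
  by rewrite opprK; exact: derive_gram_neg.
exists (fun t => g (- t)) => rho rho1; have [e s] := hg rho rho1; split=> //.
apply: (@smooth_at_comp1 _ _ _ (fun t : R^o => - t : R^o)); last by smooth.
exact: s.
Qed.

Lemma gram_surj (t : R) : -1 < t <= 1 -> exists2 rho : R, 0 <= rho < 1 & gram rho = t.
Proof.
move=> /andP[t0 t1]; have [|||c /andP[c0 c1] e] := @smooth_IVT R (fun rho => - gram rho) 0 1 (- t).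
- exact: ler01.
- by move=> s _; have h := smooth_at_gram; smooth.
- by rewrite gram0 gram1; lra.
have e' : gram c = t by apply: oppr_inj.
exists c => //; rewrite c0 lt_neqAle c1 andbT /=; apply: contraTneq t0 => c2.
by rewrite -e' c2 gram1 ltxx.
Qed.

Lemma gram_lt1 (rho : R) : -1 < rho < 1 -> gram rho < 1 -> 0 < rho.
Proof.
move=> /andP[r0 r1]; rewrite ltNge; apply: contraLR; rewrite -!leNgt => r2.
have : rho ^+ p <= 0 by rewrite exprn_odd_le0.
rewrite negbK /gram; set x := rho ^+ p => x0; have := sqr_ge0 rho; lra.
Qed.

End Modulus.

(** * The return time and the conformal factor *)

Section PageHeight.
Context {R : realType}.
Variable K : R.
Hypothesis K2 : 2 < K.
Hypothesis hK : forall s : R, 0 <= s <= 1 -> height_drop s < K.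

(** The return time of the mapping torus is p pi / 2 times this function. *)
Definition height (s : R^o) : R^o := K - height_drop s.

Lemma height_gt0 s : 0 < height s.
Proof.
have k2 := K2; rewrite subr_gt0; have [s0|s0] := ltP s (1 / 16); first by rewrite height_drop_eq0 //; lra.
have [s1|s1] := ltP (1 / 4) s; first by rewrite height_drop_eq0r //; lra.
by apply: hK; lra.
Qed.

Lemma smooth_at_height s : smooth_at s height.
Proof. by have h := @smooth_at_height_drop R; rewrite /height; smooth. Qed.

(** For s >= 0 this is [height] + 2 sqrt(s) [slope], the conformal factor that normalises the
    dt-component in [page_time]. *)
Definition factor_page (s : R^o) : R^o := K + 2 * smooth_sqrt s.

Lemma factor_page_geK s : K <= factor_page s.
Proof. by rewrite lerDl mulr_ge0 // smooth_sqrt_ge0. Qed.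

Lemma factor_page_gt0 s : 0 < factor_page s.
Proof.
have k2 := K2; by apply: lt_le_trans (factor_page_geK s); lra. Qed.

Lemma smooth_at_factor_page s : smooth_at s factor_page.
Proof. by have h := @smooth_at_smooth_sqrt R; rewrite /factor_page; smooth. Qed.

(** The frame vectors are orthogonal of squared lengths s and 1, so scaling them by a and b gives 4
    s (ab)^2 for the Gram quantity; the contact form demands ab = 1 / [factor_page]. *)
Definition gram_page (s : R^o) : R^o := 4 * s / factor_page s ^+ 2.

Lemma smooth_at_gram_page s : smooth_at s gram_page.
Proof.
have h := smooth_at_factor_page; rewrite /gram_page; smooth.
by rewrite gt_eqF // exprn_gt0 // factor_page_gt0.
Qed.

(** With F the factor, F - 2 s F' = F - 2 sqrt(s) [slope] is the height again, so a positive return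
    time amounts to an increasing [gram_page]. *)
Lemma derive_gram_page (s : R^o) : 'D_1 gram_page s = 4 * height s / factor_page s ^+ 3.
Proof.
have k2 := K2; have [s0|s0] := ltP 0 s; last first.
  have s1 : s < 1 / 16 by apply: le_lt_trans s0 _; lra.
  rewrite (@near_eq_derive _ _ _ gram_page (fun s => 4 * s / K ^+ 2)); last first.
    apply: filterS (near_lt s1) => y y1.
      by rewrite /gram_page /factor_page smooth_sqrt_eq0 // mulr0 addr0.
  have K0 : K != 0 by rewrite gt_eqF //; lra.
  have [_ ->] : is_derive s 1 (fun s : R^o => 4 * s / K ^+ 2 : R^o) (4 / K ^+ 2).
    by der_eq; ring.
  rewrite /height /factor_page height_drop_eq0 // smooth_sqrt_eq0 // mulr0 addr0 subr0.
  by field.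
have d := is_derive_smooth_sqrt s0.
have q0 : Num.sqrt s != 0 by rewrite gt_eqF // sqrtr_gt0.
have k0 : factor_page s != 0 by rewrite gt_eqF // factor_page_gt0.
have dk : is_derive s 1 factor_page (slope s / Num.sqrt s).
  by rewrite /factor_page; der_eq; field.
have [_ ->] : is_derive s 1 gram_page (4 / factor_page s ^+ 3 *
    (factor_page s - 2 * Num.sqrt s * slope s)).
  rewrite /gram_page; der_eq; first by rewrite expf_neq0.
  have e := sqr_sqrtr (ltW s0); rewrite /=.
  set q := Num.sqrt s in q0 e *; set k := factor_page s in k0 *; set a := slope s.
  by rewrite -e; field; rewrite k0.
rewrite /height {2}/factor_page /slope /height_drop /smooth_sqrt.
by field.
Qed.

Lemma gram_page_lt (s t : R) : s < t -> gram_page s < gram_page t.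
Proof.
move=> st; apply: derive_gt0_lt => // y; first by move=> _; exact: smooth_at_gram_page.
move=> _; rewrite derive_gram_page divr_gt0 ?exprn_gt0 ?factor_page_gt0 //.
by rewrite mulr_gt0 ?height_gt0.
Qed.

Lemma gram_page_le (s t : R) : s <= t -> gram_page s <= gram_page t.
Proof. by rewrite le_eqVlt => /orP[/eqP -> //|/gram_page_lt/ltW]. Qed.

Lemma gram_page_inj (s t : R) : gram_page s = gram_page t -> s = t.
Proof.
move=> e; have [h|h|//] := ltgtP s t; have := gram_page_lt h; by rewrite e ltxx.
Qed.

Lemma gram_page0 : gram_page 0 = 0. Proof. by rewrite /gram_page mulr0 mul0r. Qed.

Lemma gram_page_large (s : R) : 1 / 4 <= s ->
  gram_page s = (2 * Num.sqrt s / (K + 2 * Num.sqrt s)) ^+ 2.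
Proof.
move=> s0; rewrite /gram_page /factor_page smooth_sqrt_eq // expr_div_n exprMn sqr_sqrtr.
  by rewrite (_ : 2 ^+ 2 = 4) // expr2; ring.
lra.
Qed.

Lemma gram_page1_lt1 : gram_page 1 < 1.
Proof.
have k2 := K2; rewrite gram_page_large; last lra.
by rewrite sqrtr1 mulr1 expr_lt1 // ?divr_ge0 ?ltr_pdivrMr //; lra.
Qed.

Lemma gram_page_itv (s : R) : 0 <= s <= 1 -> 0 <= gram_page s < 1.
Proof.
move=> /andP[s0 s1]; rewrite -[X in X <= _]gram_page0 gram_page_le //=.
exact: le_lt_trans (gram_page_le s1) gram_page1_lt1.
Qed.

Lemma gram_page_surj (t : R) : 0 <= t <= gram_page 1 ->
  exists2 s : R, 0 <= s <= 1 & gram_page s = t.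
Proof.
move=> h; apply: smooth_IVT; [exact: ler01|by move=> s _; exact: smooth_at_gram_page|].
by rewrite gram_page0.
Qed.

(** Monotonicity on the whole line gives one global inverse; near each value it coincides with a
    local one from [smooth_at_inverse]. *)
Lemma gram_page_inverse : exists J : R^o -> R^o, forall s : R,
  J (gram_page s) = s /\ smooth_at (gram_page s : R^o) J.
Proof.
have h s : smooth_at s gram_page /\ 0 < 'D_1 gram_page s.
  split; first exact: smooth_at_gram_page.
  rewrite derive_gram_page divr_gt0 ?exprn_gt0 ?factor_page_gt0 //.
  by rewrite mulr_gt0 ?height_gt0.
pose J y : R^o := xget 0 [set s : R^o | gram_page s = y].
have JK s : J (gram_page s) = s.
  by rewrite /J; case: xgetP => [z _ /gram_page_inj|/(_ s)[]].
exists J => s; split=> //.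
have [|g hg] := @smooth_at_inverse R gram_page (s - 1) (s + 1) => [y _|]; first exact: h.
have [|gs ss] := hg s; first lra.
apply: smooth_at_ext ss.
have n1 := near_lt (gram_page_lt (_ : s < s + 1 / 2)).
have n2 := near_gt (gram_page_lt (_ : s - 1 / 2 < s)).
have a1 : s < s + 1 / 2 by lra.
have a2 : s - 1 / 2 < s by lra.
apply: filterS2 (n1 a1) (n2 a2) => y /ltW y1 /ltW y2.
have [|||y' y'1 <-] := @smooth_IVT R gram_page (s - 1 / 2) (s + 1 / 2) y.
- lra.
- by move=> z _; exact: smooth_at_gram_page.
- by rewrite y1 y2.
by rewrite JK; have [|-> _] := hg y'; lra.
Qed.

Variable J : R^o -> R^o.
Hypothesis hJ : forall s : R, J (gram_page s) = s /\ smooth_at (gram_page s : R^o) J.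

(** On the binding side t = 4 mu^2 with mu = 1 / (2 + K nu). Half the square root of t recovers mu,
    then nu, and the factor is the binding factor of nu divided by mu. *)
Definition factor_binding (t : R^o) : R^o :=
  binding_factor (((Num.sqrt t / 2)^-1 - 2) / K) / (Num.sqrt t / 2).

(** The two formulas agree for 1/4 <= s <= 1, where nu = 1/sqrt(s) >= 1. The switch at s = 1/2 lies
    inside this range, so smoothness is not affected. *)
Definition factor (t : R^o) : R^o :=
  if gram_page (1 / 2) < t then factor_binding t else factor_page (J t).

Lemma factor_bindingE (nu : R) : 0 <= nu ->
  factor_binding (4 * (2 + K * nu) ^- 2) = binding_factor nu * (2 + K * nu).
Proof.
have k2 := K2; move=> n0; rewrite /factor_binding.
have m1 : 0 <= K * nu by rewrite mulr_ge0 //; lra.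
have m0 : 0 < 2 + K * nu by lra.
have -> : Num.sqrt (4 * (2 + K * nu) ^- 2) = 2 / (2 + K * nu).
  have -> : 4 * (2 + K * nu) ^- 2 = (2 / (2 + K * nu)) ^+ 2 by field; rewrite gt_eqF.
  by rewrite sqrtr_sqr ger0_norm // divr_ge0 // ltW.
have -> : 2 / (2 + K * nu) / 2 = (2 + K * nu)^-1 by field; rewrite gt_eqF.
rewrite invrK; congr (binding_factor _ * _).
by field; rewrite gt_eqF //; lra.
Qed.

Lemma gram_pageE (s : R) : 1 / 4 <= s -> gram_page s = 4 * (2 + K * (Num.sqrt s)^-1) ^- 2.
Proof.
have k2 := K2; move=> s0; have q0 : 0 < Num.sqrt s by rewrite sqrtr_gt0; lra.
rewrite gram_page_large //; field.
rewrite (gt_eqF q0) /= !gt_eqF //; lra.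
Qed.

Lemma factor_agree (s : R) : 1 / 4 <= s <= 1 -> factor_binding (gram_page s) = factor_page s.
Proof.
have k2 := K2; move=> /andP[s0 s1]; have q0 : 0 < Num.sqrt s by rewrite sqrtr_gt0; lra.
have q1 : Num.sqrt s <= 1 by rewrite -sqrtr1 ler_wsqrtr.
rewrite gram_pageE // factor_bindingE ?invr_ge0 ?ltW // binding_factor_large; last first.
  by rewrite invf_ge1.
rewrite invrK /factor_page smooth_sqrt_eq //.
by field; rewrite gt_eqF.
Qed.

Lemma factor_lt (t : R) : t < gram_page 1 -> factor t = factor_page (J t).
Proof.
move=> t1; rewrite /factor; case: ifPn => // t2.
have t0 : 0 <= t by apply: le_trans (ltW t2); rewrite -gram_page0 gram_page_le //; lra.
have [|s /andP[s0 s1] e] := @gram_page_surj t; first by rewrite t0 ltW.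
rewrite -e (hJ s).1 factor_agree // s1 andbT ltW //.
rewrite ltNge; apply/negP => /gram_page_le; rewrite e leNgt => /negP; apply.
apply: le_lt_trans t2; apply: gram_page_le; lra.
Qed.

Lemma factor_pageE (s : R) : 0 <= s <= 1 -> factor (gram_page s) = factor_page s.
Proof.
move=> /andP[s0]; rewrite le_eqVlt => /orP[/eqP ->|s1]; last first.
  by rewrite factor_lt ?gram_page_lt // (hJ s).1.
by rewrite /factor gram_page_lt ?factor_agree //; lra.
Qed.

Lemma factor_large (t : R) : gram_page 1 <= t -> factor t = factor_binding t.
Proof.
move=> t1; rewrite /factor ifT //; apply: lt_le_trans t1; apply: gram_page_lt; lra.
Qed.

(** The disc is parametrised slightly beyond radius 1, so nu exceeds 1; the bound 4/3 is below sqrt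
    2, the value of nu at the switch s = 1/2. *)
Lemma factorE (nu : R) : 0 <= nu <= 4 / 3 ->
  factor (4 * (2 + K * nu) ^- 2) = binding_factor nu * (2 + K * nu).
Proof.
have k2 := K2; move=> /andP[n0 n1]; rewrite /factor ifT; first exact: factor_bindingE.
have q0 : 0 < Num.sqrt (1 / 2) :> R by rewrite sqrtr_gt0; lra.
rewrite gram_pageE ?ltr_pM2l; last 2 first.
- lra.
- lra.
have i0 : 0 < (Num.sqrt (1 / 2))^-1 :> R by rewrite invr_gt0.
have K0 : 0 < K by lra.
have a0 := mulr_ge0 (ltW K0) n0; have b0 := mulr_gt0 K0 i0.
rewrite ltf_pV2 ?posrE ?exprn_gt0 //; try lra.
rewrite ltr_pXn2r ?nnegrE //; try lra.
rewrite ltrD2l ltr_pM2l //; apply: le_lt_trans n1 _.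
rewrite -[X in _ < X]mul1r ltr_pdivlMr //.
suff : Num.sqrt (1 / 2) < 3 / 4 :> R by lra.
by rewrite -(@ltr_pXn2r _ 2) ?nnegrE ?ltW // ?sqr_sqrtr; lra.
Qed.

Lemma smooth_at_factor (t : R) : 0 <= t <= 1 -> smooth_at (t : R^o) factor.
Proof.
have k2 := K2; move=> /andP[t0 t1]; have [t2|t2] := ltP t (gram_page 1).
  have [|s _ e] := @gram_page_surj t; first by rewrite t0 ltW.
  apply: (@smooth_at_ext R R^o R^o t (fun t => factor_page (J t))).
    by apply: filterS (near_lt t2) => y /factor_lt.
  apply: (@smooth_at_comp1 _ _ _ J); first exact: smooth_at_factor_page.
  by rewrite -e; exact: (hJ s).2.
have t3 : gram_page (1 / 2) < t by apply: lt_le_trans t2; apply: gram_page_lt; lra.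
apply: (@smooth_at_ext R R^o R^o t factor_binding).
  by apply: filterS (near_gt t3) => y y1; rewrite /factor y1.
have p0 : 0 < gram_page (1 / 2) by rewrite -gram_page0 gram_page_lt //; lra.
have t4 : 0 < t by apply: lt_trans t3.
have q0 : 0 < Num.sqrt t by rewrite sqrtr_gt0.
have q1 : Num.sqrt t <= 1 by rewrite -sqrtr1 ler_wsqrtr.
have n0 : 0 <= ((Num.sqrt t / 2)^-1 - 2) / K.
  rewrite divr_ge0 //; last lra.
  by rewrite subr_ge0 invf_div ler_pdivlMr // ger_pMr.
rewrite /factor_binding; apply: smooth_atM; last first.
  by smooth; rewrite gt_eqF // divr_gt0.
apply: (@smooth_at_comp1 _ _ _ (fun t : R^o => ((Num.sqrt t / 2)^-1 - 2) / K : R^o)).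
  exact: smooth_at_binding_factor.
by smooth; rewrite gt_eqF // divr_gt0.
Qed.

Lemma factor_gt0 (t : R) : 0 <= t <= 1 -> 0 < factor t.
Proof.
have k2 := K2; move=> /andP[t0 t1]; have [t2|t2] := ltP t (gram_page 1).
  by rewrite factor_lt // factor_page_gt0.
rewrite factor_large //.
have p0 : 0 < gram_page 1 by rewrite -gram_page0 gram_page_lt.
have t4 : 0 < t by apply: lt_le_trans t2.
have q0 : 0 < Num.sqrt t by rewrite sqrtr_gt0.
have q1 : Num.sqrt t <= 1 by rewrite -sqrtr1 ler_wsqrtr.
rewrite /factor_binding divr_gt0 ?divr_gt0 // binding_factor_gt0 // divr_ge0 //; last lra.
by rewrite subr_ge0 invf_div ler_pdivlMr // ger_pMr.
Qed.

End PageHeight.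

(** * The mapping torus part of the Ustilovsky open book *)

Section UstilovskyPage.
Context {R : realType} {N : nat}.
Local Notation E := 'rV[R]_(N + N).
Local Notation l := lsubmx.
Local Notation r := rsubmx.
Local Notation DT := (@disc_cotangent R N).
Local Notation sq x := (dot (r x) (r x)).
Variable p : nat.
Hypothesis p_odd : odd p.
Variable K : R.
Hypothesis K2 : 2 < K.
Hypothesis hK : forall s : R, 0 <= s <= 1 -> height_drop s < K.
Variable g : R^o -> R^o.
Hypothesis hg : forall rho : R, -1 < rho < 1 ->
  g (gram p rho) = rho /\ smooth_at (gram p rho : R^o) g.

Local Notation height := (height K).
Local Notation factor_page := (factor_page K).
Local Notation gram_page := (gram_page K).

Lemma gram_root (t : R) : -1 < t <= 1 -> [/\ 0 <= g t < 1, gram p (g t) = t & smooth_at (t : R^o) g].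
Proof.
move=> /(gram_surj p_odd)[rho /andP[r0 r1] e]; have [|e2 s2] := hg (rho := rho); first lra.
by rewrite -e e2 r0 r1.
Qed.

Lemma gram_root_gt0 (t : R) : -1 < t < 1 -> 0 < g t.
Proof.
move=> /andP[t0 t1]; have [|/andP[g0 g1] e _] := @gram_root t; first by rewrite t0 ltW.
by apply: (gram_lt1 p_odd); rewrite ?e //; lra.
Qed.

Definition page_modulus (s : R^o) : R^o := Num.sqrt (g (gram_page s)).
(** If a and b scale xi and q, the sphere gives a^2 s + b^2 = 1 - rho and the Brieskorn equation b^2
    - a^2 s = rho^(p/2); this is the solution for b. *)
Definition page_im_scale (s : R^o) : R^o :=
  Num.sqrt ((1 - g (gram_page s) + page_modulus s ^+ p) / 2).
(** Solving for a^2 directly would divide by s. The product ab is prescribed instead, and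
    [page_re_scale_sqr] recovers the equation from the choice of rho. *)
Definition page_re_scale (s : R^o) : R^o := (factor_page s * page_im_scale s)^-1.

Section AtRadius.
Variable s : R.
Hypothesis s01 : 0 <= s <= 1.

Lemma page_gram_itv : -1 < gram_page s < 1.
Proof. by have := gram_page_itv K2 hK s01; lra. Qed.

Lemma page_rho_itv : 0 < g (gram_page s) < 1.
Proof.
have h := page_gram_itv; rewrite gram_root_gt0 //=.
by have [|/andP[_ ->] _ _] // := @gram_root (gram_page s); lra.
Qed.

Lemma page_modulus_gt0 : 0 < page_modulus s.
Proof. by rewrite sqrtr_gt0; have /andP[] := page_rho_itv. Qed.

Lemma page_modulus_sqr : page_modulus s ^+ 2 = g (gram_page s).
Proof. by rewrite sqr_sqrtr //; have /andP[/ltW] := page_rho_itv. Qed.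

Lemma page_im_arg_gt0 : 0 < (1 - g (gram_page s) + page_modulus s ^+ p) / 2.
Proof.
have m0 : 0 < page_modulus s ^+ p by rewrite exprn_gt0 // page_modulus_gt0.
by have /andP[] := page_rho_itv; lra.
Qed.

Lemma page_im_scale_gt0 : 0 < page_im_scale s.
Proof. by rewrite sqrtr_gt0 page_im_arg_gt0. Qed.

Lemma page_im_scale_sqr : page_im_scale s ^+ 2 = (1 - g (gram_page s) + page_modulus s ^+ p) / 2.
Proof. by rewrite sqr_sqrtr // ltW // page_im_arg_gt0. Qed.

Lemma page_re_scale_gt0 : 0 < page_re_scale s.
Proof. by rewrite invr_gt0 mulr_gt0 ?page_im_scale_gt0 // (factor_page_gt0 K2). Qed.

Lemma page_scale_mul : page_re_scale s * page_im_scale s = (factor_page s)^-1.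
Proof. by rewrite /page_re_scale invfM mulfVK // gt_eqF // page_im_scale_gt0. Qed.

Lemma page_re_scale_sqr :
  page_re_scale s ^+ 2 * s = (1 - g (gram_page s) - page_modulus s ^+ p) / 2.
Proof.
have y0 := page_im_scale_gt0; have y2 := page_im_scale_sqr; have k0 := factor_page_gt0 K2 s.
have [|_ e _] := @gram_root (gram_page s); first by have := page_gram_itv; lra.
have m2 : (page_modulus s ^+ p) ^+ 2 = g (gram_page s) ^+ p.
  by rewrite -exprM mulnC exprM page_modulus_sqr.
move: e; rewrite /gram -m2; set w := g _ in y2 * => e.
apply: (mulIf (lt0r_neq0 (exprn_gt0 2 y0))).
rewrite mulrAC -exprMn page_scale_mul y2.
apply: (mulfI (x := 4)); first by [].
rewrite (_ : 4 * ((factor_page s)^-1 ^+ 2 * s) = 4 * s / factor_page s ^+ 2); last first.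
  by rewrite exprVn; ring.
by rewrite -[LHS]/(gram_page s) -e; field.
Qed.

Lemma near_page_gram : \forall y \near (s : R^o), -1 < gram_page y < 1.
Proof.
have c := smooth_at_continuous (smooth_at_gram_page K2 s).
have /andP[g0 g1] := page_gram_itv.
near=> y; apply/andP; split; near: y.
  exact: (c _ (near_gt g0)).
exact: (c _ (near_lt g1)).
Unshelve. all: by end_near. Qed.

Lemma smooth_at_page_rho : smooth_at (s : R^o) (fun s => g (gram_page s)).
Proof.
apply: (@smooth_at_comp1 _ _ _ gram_page); last exact: smooth_at_gram_page.
by have [|_ _ //] := @gram_root (gram_page s); have := page_gram_itv; lra.
Qed.

Lemma smooth_at_page_modulus : smooth_at (s : R^o) page_modulus.
Proof.
by apply: smooth_at_sqrt; [have /andP[] := page_rho_itv|exact: smooth_at_page_rho].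
Qed.

Lemma smooth_at_page_im_scale : smooth_at (s : R^o) page_im_scale.
Proof.
have h1 := smooth_at_page_modulus; have h2 := smooth_at_page_rho.
apply: smooth_at_sqrt; first exact: page_im_arg_gt0.
by smooth.
Qed.

Lemma smooth_at_page_re_scale : smooth_at (s : R^o) page_re_scale.
Proof.
have h1 := smooth_at_page_im_scale; have h2 := @smooth_at_factor_page R K.
apply: smooth_atV; last by smooth.
by rewrite gt_eqF // mulr_gt0 ?page_im_scale_gt0 // (factor_page_gt0 K2).
Qed.

(** Were it 0, differentiating gram(rho) = [gram_page] would contradict the positive derivative of
    the right-hand side. *)
Lemma derive_page_modulus_neq0 : 'D_1 page_modulus (s : R^o) != 0.
Proof.
have d := smooth_at_is_derive (1 : R^o) smooth_at_page_modulus.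
apply/negP => /eqP e; rewrite e in d.
have dr : is_derive (s : R^o) 1 (fun y : R^o => gram p (page_modulus y ^+ 2) : R^o) 0.
  apply: (@is_derive_eq _ _ _ _ _ _ _ _ (is_derive_comp1 (is_derive_pow 2 d) (is_derive_gram _ _))).
  by rewrite !mulr0.
have : 'D_1 gram_page (s : R^o) = 0.
  have [_ <-] := dr; apply: near_eq_derive.
  apply: filterS near_page_gram => y y1; have y0 := gram_root_gt0 y1.
  rewrite /page_modulus sqr_sqrtr ?ltW //.
  by have [|_ -> _] // := @gram_root (gram_page y); lra.
apply/eqP; rewrite derive_gram_page // gt_eqF // divr_gt0 ?exprn_gt0 ?(factor_page_gt0 K2) //.
by rewrite mulr_gt0 // (height_gt0 K2).
Qed.

End AtRadius.

(** One return time changes this angle alpha by p pi, so z_0, of argument 2 alpha / p, turns exactly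
    once. *)
Definition page_angle (q : R^o * E) : R^o := 2 * q.1 / height (sq q.2).
(** The frame turns by the full alpha near the boundary and not at all near the zero section, where
    xi / |xi| is undefined; the monodromy supplies the missing p pi (1 - [slope]). *)
Definition page_turn (q : R^o * E) : R^o := slope (sq q.2) * page_angle q.
Definition turn_cos (q : R^o * E) : R^o := cos (page_turn q).
Definition turn_sinc (q : R^o * E) : R^o := sin (page_turn q) / Num.sqrt (sq q.2).

Lemma smooth_at_sq2 (f : R^o -> R^o) (q : R^o * E) : smooth_at (sq q.2 : R^o) f ->
  smooth_at q (fun q : R^o * E => f (sq q.2) : R^o).
Proof.
by move=> sf; apply: (@smooth_at_comp1 _ _ _ (fun q : R^o * E => sq q.2 : R^o)) => //; smooth.
Qed.

Lemma is_derive_sq2 (f : R^o -> R^o) (t : R) (x : E) (s : R) (u : E) : smooth_at (sq x : R^o) f ->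
  is_derive ((t, x) : R^o * E) (s, u) (fun q : R^o * E => f (sq q.2) : R^o)
    ('D_1 f (sq x : R^o) * (2 * dot (r x) (r u))).
Proof.
move=> sf; apply: (@is_derive_comp1 _ _ (fun q : R^o * E => sq q.2 : R^o) f);
  last exact: smooth_at_is_derive.
by der_eq; rewrite (dotC (r u)); ring.
Qed.

Lemma smooth_at_page_angle q : smooth_at q page_angle.
Proof.
have h := smooth_at_sq2 (smooth_at_height K (sq q.2)).
by rewrite /page_angle; smooth; rewrite gt_eqF // (height_gt0 K2).
Qed.

Lemma smooth_at_page_turn q : smooth_at q page_turn.
Proof.
have h := smooth_at_page_angle; have h2 := smooth_at_sq2 (@smooth_at_slope R (sq q.2)).
by apply: smooth_atM => //; exact: h.
Qed.

Lemma smooth_at_turn_cos q : smooth_at q turn_cos.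
Proof. by apply: smooth_at_cos; exact: smooth_at_page_turn. Qed.

Lemma near_core (q : R^o * E) : sq q.2 < 1 / 16 -> \forall y \near q, sq y.2 < 1 / 16.
Proof.
move=> q0; have s : smooth_at q (fun q : R^o * E => sq q.2 : R^o) by smooth.
exact: (smooth_at_continuous s (near_lt q0)).
Qed.

Lemma page_turn_core q : sq q.2 < 1 / 16 -> page_turn q = 0.
Proof. by move=> q0; rewrite /page_turn slope_eq0 // mul0r. Qed.

Lemma turn_sinc_core q : sq q.2 < 1 / 16 -> turn_sinc q = 0.
Proof. by move=> q0; rewrite /turn_sinc page_turn_core // sin0 mul0r. Qed.

Lemma smooth_at_turn_sinc q : smooth_at q turn_sinc.
Proof.
have [q0|q0] := ltP 0 (sq q.2).
  have h : smooth_at q (fun q : R^o * E => sq q.2 : R^o) by smooth.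
  apply: smooth_atM; first by apply: smooth_at_sin; exact: smooth_at_page_turn.
  apply: smooth_atV; first by rewrite gt_eqF // sqrtr_gt0.
  exact: smooth_at_sqrt.
apply: (@smooth_at_ext R _ R^o q (fun=> 0)); last exact: smooth_at_cst.
have q1 : sq q.2 < 1 / 16 by apply: le_lt_trans q0 _; lra.
by apply: filterS (near_core q1) => y /turn_sinc_core.
Qed.

Lemma turn_cos_sinc q : turn_cos q ^+ 2 + sq q.2 * turn_sinc q ^+ 2 = 1.
Proof.
rewrite -[RHS](cos2Dsin2 (page_turn q)); congr (_ + _).
have [q0|q0] := ltP 0 (sq q.2).
  by rewrite /turn_sinc expr_div_n sqr_sqrtr ?ltW // mulrC divfK // gt_eqF.
have q1 : sq q.2 < 1 / 16 by apply: le_lt_trans q0 _; lra.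
by rewrite turn_sinc_core // page_turn_core // sin0 expr0n mulr0.
Qed.

(** The third identity is what the contact form retains of the turning, namely -|xi| d(turn); the
    other two serve the immersion property. *)
Lemma derive_turn (t : R) (x : E) (s : R) (u : E) :
  let D (f : R^o * E -> R^o) : R := 'D_((s, u) : R^o * E) f ((t, x) : R^o * E) in
  let C : R := turn_cos (t, x) in let S : R := turn_sinc (t, x) in
  [/\ D turn_cos = - (sin (page_turn (t, x)) * D page_turn),
      D page_turn = 0 -> dot (r x) (r u) = 0 -> D turn_sinc = 0 &
      sq x * (S * D turn_cos - C * D turn_sinc) - C * S * dot (r x) (r u) =
      - (Num.sqrt (sq x) * D page_turn)].
Proof.
move=> D C S; have dt := smooth_at_is_derive ((s, u) : R^o * E) (smooth_at_page_turn (t, x)).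
have dC : D turn_cos = - (sin (page_turn (t, x)) * D page_turn).
  have [_ e] := is_derive_cos_comp dt; rewrite /D [LHS]e.
  by rewrite mulNr.
split=> //.
  have [x0|x0] := ltP 0 (sq x).
    move=> t0 c0; have q0 : Num.sqrt (sq x) != 0 by rewrite gt_eqF // sqrtr_gt0.
    rewrite -/(D page_turn) t0 in dt.
    have ds : is_derive ((t, x) : R^o * E) (s, u) (fun q : R^o * E => sq q.2 : R^o) 0.
      by der_eq; rewrite (dotC (r u)) c0 addr0.
    suff h : is_derive ((t, x) : R^o * E) (s, u) turn_sinc 0 by have [_] := h.
    by rewrite /turn_sinc; der_eq => //=; rewrite !(mulr0, addr0).
  move=> _ _; have x1 : sq x < 1 / 16 by apply: le_lt_trans x0 _; lra.
  rewrite /D (@near_eq_derive _ _ _ turn_sinc (cst 0)) ?derive_cst //.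
  by apply: filterS (@near_core (t, x) x1) => y /turn_sinc_core.
have [x0|x0] := ltP 0 (sq x); last first.
  have x1 : sq x = 0 by apply/eqP; rewrite eq_le x0 dot_ge0.
  by rewrite /S turn_sinc_core /= ?x1 ?sqrtr0 ?mul0r ?mulr0 ?mul0r ?subr0 ?oppr0 //; lra.
have q0 : Num.sqrt (sq x) != 0 by rewrite gt_eqF // sqrtr_gt0.
have q2 : Num.sqrt (sq x) ^+ 2 = sq x by rewrite sqr_sqrtr ?ltW.
rewrite dC; have ds : is_derive ((t, x) : R^o * E) (s, u) (fun q : R^o * E => sq q.2 : R^o)
    (2 * dot (r x) (r u)).
  by der_eq; rewrite (dotC (r u)); ring.
have [_ dS] : is_derive ((t, x) : R^o * E) (s, u) turn_sinc
    (C * D page_turn / Num.sqrt (sq x) - S * dot (r x) (r u) / sq x).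
  rewrite /turn_sinc; der_eq => //=.
  rewrite /S /turn_sinc /C /turn_cos /D /=; set a := Num.sqrt _ in q0 q2 *; rewrite -q2.
  by field; rewrite q0.
rewrite [D turn_sinc]dS; have cs := cos2Dsin2 (page_turn (t, x)).
rewrite /S /turn_sinc /C /turn_cos /=; set a := Num.sqrt _ in q0 q2 *; rewrite -q2.
set c := cos _ in cs *; set b := sin _ in cs *; set m := D _.
apply: (@eq_of_sub _ _ _ (- a * m * (c ^+ 2 + b ^+ 2 - 1))); first by rewrite cs subrr mulr0.
by field; rewrite q0.
Qed.

Lemma derive_page_angle (t : R) (x : E) (s : R) (u : E) :
  is_derive ((t, x) : R^o * E) (s, u) page_angle (2 * s / height (sq x) -
    2 * t * ('D_1 height (sq x : R^o) * (2 * dot (r x) (r u))) / height (sq x) ^+ 2).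
Proof.
have h0 : height (sq x) != 0 by rewrite gt_eqF // (height_gt0 K2).
have d := is_derive_sq2 t s u (smooth_at_height K (sq x)).
by rewrite /page_angle; der_eq => //=; field.
Qed.

Lemma derive_page_turn (t : R) (x : E) (s : R) (u : E) :
  is_derive ((t, x) : R^o * E) (s, u) page_turn
   (slope (sq x) * 'D_((s, u) : R^o * E) page_angle ((t, x) : R^o * E) +
    page_angle (t, x) * ('D_1 slope (sq x : R^o) * (2 * dot (r x) (r u)))).
Proof.
have d := is_derive_sq2 t s u (@smooth_at_slope R (sq x)).
have d2 := smooth_at_is_derive ((s, u) : R^o * E) (smooth_at_page_angle (t, x)).
by rewrite /page_turn; der_eq.
Qed.

(* The dt-component of the contact form; the height was chosen to make it 1. *)
Lemma page_time (t : R) (x : E) (s : R) (u : E) :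
  factor_page (sq x) / 2 * 'D_((s, u) : R^o * E) page_angle ((t, x) : R^o * E) -
  Num.sqrt (sq x) * 'D_((s, u) : R^o * E) page_turn ((t, x) : R^o * E) = s.
Proof.
have [_ ->] := derive_page_turn t x s u; have [_ ->] := derive_page_angle t x s u.
have h0 : height (sq x) != 0 by rewrite gt_eqF // (height_gt0 K2).
have kE : factor_page (sq x) / 2 = height (sq x) / 2 + Num.sqrt (sq x) * slope (sq x).
  rewrite /factor_page /height /height_drop /slope /smooth_sqrt; by field.
have dE : 'D_1 height (sq x : R^o) * dot (r x) (r u) =
    - (2 * Num.sqrt (sq x) * 'D_1 slope (sq x : R^o) * dot (r x) (r u)).
  have [x0|x0] := ltP 0 (sq x).
    have dd := is_derive_height_drop x0.
    suff h : is_derive (sq x : R^o) 1 height (- (2 * Num.sqrt (sq x) * 'D_1 slope (sq x : R^o))).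
      by have [_ ->] := h; rewrite mulNr.
    by rewrite /height; der_eq; ring.
  have : r x = 0 by apply/eqP; rewrite -dot_eq0 eq_le x0 dot_ge0.
  by move=> ->; rewrite !dot0l !mulr0 oppr0.
rewrite kE /page_angle /=; move: dE; set dh := 'D_1 height _; set ds := 'D_1 slope _.
set c := dot (r x) (r u); set a := Num.sqrt _; set h := height _ in h0 * => dE.
apply: (@eq_of_sub _ _ _ (- 2 * t / h * (dh * c - - (2 * a * ds * c)))).
  by rewrite dE subrr mulr0.
by field.
Qed.

Definition turn_q (q : R^o * E) : 'rV[R]_N := turn_cos q *: l q.2 + (- turn_sinc q) *: r q.2.
Definition turn_xi (q : R^o * E) : 'rV[R]_N :=
  turn_cos q *: r q.2 + (sq q.2 * turn_sinc q) *: l q.2.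

Lemma turn_dots q : DT q.2 -> [/\ dot (turn_q q) (turn_q q) = 1, dot (turn_xi q) (turn_q q) = 0 &
  dot (turn_xi q) (turn_xi q) = sq q.2].
Proof.
move=> [qq qx _]; have e := turn_cos_sinc q; rewrite /turn_q /turn_xi !dotE (dotC (r q.2) (l q.2)) qq qx.
set C := turn_cos q in e *; set S := turn_sinc q in e *; set s := sq q.2 in e *.
split.
- by apply: (@eq_of_sub _ _ _ (C ^+ 2 + s * S ^+ 2 - 1)); [rewrite e subrr|ring].
- by ring.
- by apply: (@eq_of_sub _ _ _ (s * (C ^+ 2 + s * S ^+ 2 - 1))); [rewrite e subrr mulr0|ring].
Qed.

Lemma smooth_at_turn_q q : smooth_at q turn_q.
Proof.
by have h1 := smooth_at_turn_cos q; have h2 := smooth_at_turn_sinc q; rewrite /turn_q; smooth.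
Qed.

Lemma smooth_at_turn_xi q : smooth_at q turn_xi.
Proof.
by have h1 := smooth_at_turn_cos q; have h2 := smooth_at_turn_sinc q; rewrite /turn_xi; smooth.
Qed.

Lemma turn_inj t x x' : sq x = sq x' -> turn_q (t, x) = turn_q (t, x') ->
  turn_xi (t, x) = turn_xi (t, x') -> x = x'.
Proof.
move=> es; have eC : turn_cos (t, x) = turn_cos (t, x').
  by rewrite /turn_cos /page_turn /page_angle /= es.
have eS : turn_sinc (t, x) = turn_sinc (t, x').
  by rewrite /turn_sinc /page_turn /page_angle /= es.
rewrite /turn_q /turn_xi /= -es -eC -eS => e1 e2; have e := turn_cos_sinc (t, x).
move: e1 e2 e; rewrite /=; set C := turn_cos _; set S := turn_sinc _; set s := sq x => e1 e2 e.
have key (a b : 'rV[R]_N) : a = C *: (C *: a + (- S) *: b) + S *: (C *: b + (s * S) *: a) /\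
    b = C *: (C *: b + (s * S) *: a) - (s * S) *: (C *: a + (- S) *: b).
  split; apply/rowP => i; rewrite !mxE; set u := a _ _; set v := b _ _.
    apply/esym; apply: (@eq_of_sub _ _ _ ((C ^+ 2 + s * S ^+ 2 - 1) * u)).
      by rewrite e subrr mul0r.
    by ring.
  apply/esym; apply: (@eq_of_sub _ _ _ ((C ^+ 2 + s * S ^+ 2 - 1) * v)).
    by rewrite e subrr mul0r.
  by ring.
have [k1 k2] := key (l x) (r x); have [k3 k4] := key (l x') (r x').
rewrite -[x]hsubmxK -[x']hsubmxK; congr row_mx.
  by rewrite [LHS]k1 e1 e2 -k3.
by rewrite [LHS]k2 e1 e2 -k4.
Qed.

Section TurnDerivative.
Variables (t : R) (x : E) (s : R) (u : E).
Local Notation D f := ('D_((s, u) : R^o * E) f ((t, x) : R^o * E)).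
Local Notation C := (turn_cos (t, x)).
Local Notation S := (turn_sinc (t, x)).

Lemma is_derive_turn_q : is_derive ((t, x) : R^o * E) (s, u) turn_q
  ((D turn_cos : R) *: l x + C *: l u + (- (D turn_sinc : R) *: r x + (- S) *: r u)).
Proof.
have h1 := smooth_at_is_derive ((s, u) : R^o * E) (smooth_at_turn_cos (t, x)).
have h2 := smooth_at_is_derive ((s, u) : R^o * E) (smooth_at_turn_sinc (t, x)).
by rewrite /turn_q; der_eq.
Qed.

Lemma is_derive_turn_xi : is_derive ((t, x) : R^o * E) (s, u) turn_xi
  ((D turn_cos : R) *: r x + C *: r u +
   ((sq x * (D turn_sinc : R) + S * (2 * dot (r x) (r u))) *: l x + (sq x * S) *: l u)).
Proof.
have h1 := smooth_at_is_derive ((s, u) : R^o * E) (smooth_at_turn_cos (t, x)).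
have h2 := smooth_at_is_derive ((s, u) : R^o * E) (smooth_at_turn_sinc (t, x)).
rewrite /turn_xi; der_eq; congr (_ + (_ *: _ + _)).
by rewrite (dotC (r u)) /=; ring.
Qed.

Context {d : nat} (en : (N + N = 1 + 1 + d.+1)%N).

Lemma turn_form : tangent d.+1 DT x u ->
  dot (turn_xi (t, x)) (D turn_q) = dot (r x) (l u) - Num.sqrt (sq x) * D page_turn /\
  dot (turn_q (t, x)) (D turn_xi) = - (dot (r x) (l u) - Num.sqrt (sq x) * D page_turn).
Proof.
move=> /(tangent_disc_cotangent en)[[qq qx _] u1 u2].
have [_ -> ] := is_derive_turn_q; have [_ ->] := is_derive_turn_xi.
have eu : dot (l x) (r u) = - dot (r x) (l u) by rewrite (dotC (r x)); lra.
have [_ _ e] := derive_turn t x s u; have e1 := turn_cos_sinc (t, x).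
have -> : Num.sqrt (sq x) * D page_turn = - (sq x * (S * D turn_cos - C * D turn_sinc) -
   C * S * dot (r x) (r u)) by rewrite e opprK.
rewrite /turn_q /turn_xi /= in e1 *; rewrite !dotE (dotC (r x) (l x)) qq qx u1 eu.
set c := C in e1 *; set b := S in e1 *; set z := sq x in e1 *.
set dc := D turn_cos; set db := D turn_sinc; set w := dot (r x) (l u).
split.
  by apply: (@eq_of_sub _ _ _ ((c ^+ 2 + z * b ^+ 2 - 1) * w)); [rewrite e1 subrr mul0r|ring].
by apply: (@eq_of_sub _ _ _ (- (c ^+ 2 + z * b ^+ 2 - 1) * w)); [rewrite e1 subrr oppr0 mul0r|ring].
Qed.

End TurnDerivative.

(** For z = e^(i alpha) (u + iv), the imaginary part of conj(z).dz is that of u + iv plus |u + iv|^2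
    dalpha. *)
Lemma rotated_form (n : nat) (c b da : R) (u v du dv : 'rV[R]_n) : c ^+ 2 + b ^+ 2 = 1 ->
  dot (c *: u + (- b) *: v) (b *: du + c *: dv + da *: (c *: u + (- b) *: v)) -
  dot (b *: u + c *: v) (c *: du + (- b) *: dv - da *: (b *: u + c *: v)) =
  da * (dot u u + dot v v) + (dot u dv - dot v du).
Proof.
move=> e; rewrite !dotE (dotC v u).
apply: (@eq_of_sub _ _ _ ((c ^+ 2 + b ^+ 2 - 1) *
  (da * (dot u u + dot v v) + (dot u dv - dot v du)))); first by rewrite e subrr mul0r.
by ring.
Qed.

Definition page_re (q : R^o * E) : 'rV[R]_N := page_re_scale (sq q.2) *: turn_xi q.
Definition page_im (q : R^o * E) : 'rV[R]_N := page_im_scale (sq q.2) *: turn_q q.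
Definition base_angle (q : R^o * E) : R^o := 2 / p%:R * page_angle q.

(* Its coordinates are e^(2 i alpha / p) rho^(1/2) and e^(i alpha) (page_re + i page_im),
   with alpha the page angle. *)
Definition ustilovsky_P (q : R^o * E) : Cspace R (1 + N) :=
  zpt (page_modulus (sq q.2) * cos (base_angle q)) (page_modulus (sq q.2) * sin (base_angle q))
    (cos (page_angle q) *: page_re q + (- sin (page_angle q)) *: page_im q)
    (sin (page_angle q) *: page_re q + cos (page_angle q) *: page_im q).

Lemma p_neq0 : p%:R != 0 :> R.
Proof. by rewrite pnatr_eq0 -lt0n odd_gt0. Qed.

Lemma page_dots q : DT q.2 -> [/\ dot (page_re q) (page_im q) = 0,
  dot (page_re q) (page_re q) = (1 - g (gram_page (sq q.2)) - page_modulus (sq q.2) ^+ p) / 2 &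
  dot (page_im q) (page_im q) = (1 - g (gram_page (sq q.2)) + page_modulus (sq q.2) ^+ p) / 2].
Proof.
move=> Vq; have [e1 e2 e3] := turn_dots Vq; have s01 := disc_sq01 Vq.
rewrite /page_re /page_im -page_re_scale_sqr // -page_im_scale_sqr //.
move: (turn_xi q) (turn_q q) e1 e2 e3 => a b e1 e2 e3; rewrite !dotE e1 e2 e3.
by split; ring.
Qed.

Lemma smooth_at_page_re q : DT q.2 -> smooth_at q page_re.
Proof.
move=> /disc_sq01 s01; have h1 := smooth_at_sq2 (smooth_at_page_re_scale s01).
by apply: smooth_atZ h1 (smooth_at_turn_xi q).
Qed.

Lemma smooth_at_page_im q : DT q.2 -> smooth_at q page_im.
Proof.
move=> /disc_sq01 s01; have h1 := smooth_at_sq2 (smooth_at_page_im_scale s01).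
by apply: smooth_atZ h1 (smooth_at_turn_q q).
Qed.

Lemma smooth_at_ustilovsky_P q : DT q.2 -> smooth_at q ustilovsky_P.
Proof.
move=> Vq; have h1 := smooth_at_page_re Vq; have h2 := smooth_at_page_im Vq.
have h3 := smooth_at_page_angle; have h4 := smooth_at_sq2 (smooth_at_page_modulus (disc_sq01 Vq)).
have h5 : smooth_at q base_angle by rewrite /base_angle; smooth; exact: h3.
have h6 := h3 q.
by apply: smooth_at_zpt; smooth.
Qed.

Lemma ustilovsky_P_modulus q : DT q.2 -> modulus0 (ustilovsky_P q) = g (gram_page (sq q.2)).
Proof.
by move=> Vq; rewrite modulus0_zpt !exprMn -mulrDr cos2Dsin2 mulr1 page_modulus_sqr // disc_sq01.
Qed.

Lemma ustilovsky_P_brieskorn q : DT q.2 -> brieskorn (brieskorn_exponent p) (ustilovsky_P q).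
Proof.
move=> Vq; have [e1 e2 e3] := page_dots Vq; have s01 := disc_sq01 Vq.
have pE : p%:R * base_angle q = page_angle q + page_angle q.
  by rewrite /base_angle; field; rewrite p_neq0.
apply/brieskorn_zpt; rewrite zpow_polar /= pE cosD sinD.
move: (page_re q) (page_im q) e1 e2 e3 => a a' e1 e2 e3; rewrite !dotE (dotC a' a) e1 e2 e3.
have cs := cos2Dsin2 (page_angle q); have mm := page_modulus_sqr s01.
set c := cos (page_angle q) in cs *; set b := sin (page_angle q) in cs *.
set m := page_modulus _ ^+ p; split; [by field|by field|].
rewrite !exprMn -mulrDr cos2Dsin2 mulr1 mm; set w := g _.
apply: (@eq_of_sub _ _ _ ((c ^+ 2 + b ^+ 2 - 1) * (1 - w))); first by rewrite cs subrr mul0r.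
by field.
Qed.

Lemma is_derive_ustilovsky_P (t : R) (x : E) (s : R) (u : E) : DT x ->
  let D (f : R^o * E -> R^o) : R := 'D_((s, u) : R^o * E) f ((t, x) : R^o * E) in
  let q : R^o * E := (t, x) in
  let dm : R := 'D_1 page_modulus (sq x : R^o) * (2 * dot (r x) (r u)) in
  is_derive ((t, x) : R^o * E) (s, u) ustilovsky_P (zpt
   (dm * cos (base_angle q) - page_modulus (sq x) * sin (base_angle q) * (2 / p%:R * D page_angle))
   (dm * sin (base_angle q) + page_modulus (sq x) * cos (base_angle q) * (2 / p%:R * D page_angle))
   (cos (page_angle q) *: 'D_((s, u) : R^o * E) page_re (t, x) +
      (- sin (page_angle q)) *: 'D_((s, u) : R^o * E) page_im (t, x) -
      D page_angle *: (sin (page_angle q) *: page_re q + cos (page_angle q) *: page_im q))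
   (sin (page_angle q) *: 'D_((s, u) : R^o * E) page_re (t, x) +
      cos (page_angle q) *: 'D_((s, u) : R^o * E) page_im (t, x) +
      D page_angle *: (cos (page_angle q) *: page_re q + (- sin (page_angle q)) *: page_im q))).
Proof.
move=> Vx D q dm.
have h1 := smooth_at_is_derive ((s, u) : R^o * E) (@smooth_at_page_re (t, x) Vx).
have h2 := smooth_at_is_derive ((s, u) : R^o * E) (@smooth_at_page_im (t, x) Vx).
have h3 := smooth_at_is_derive ((s, u) : R^o * E) (smooth_at_page_angle (t, x)).
have h4 := is_derive_sq2 t s u (smooth_at_page_modulus (disc_sq01 Vx)).
have h5 : is_derive ((t, x) : R^o * E) (s, u) base_angle (2 / p%:R * D page_angle).
  by rewrite /base_angle; der_eq; rewrite mulr0 addr0.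
rewrite -/dm in h4.
apply: is_derive_zpt.
- by der_eq; rewrite /q; ring.
- by der_eq; rewrite /q; ring.
- move: h1 h2; move: ('D_(_) page_re _) ('D_(_) page_im _) => d1 d2 h1 h2.
  der_vec; rewrite /q /D; move: (page_re _) (page_im _) => a b.
  by apply/rowP => i; rewrite !mxE; ring.
- move: h1 h2; move: ('D_(_) page_re _) ('D_(_) page_im _) => d1 d2 h1 h2.
  der_vec; rewrite /q /D; move: (page_re _) (page_im _) => a b.
  by apply/rowP => i; rewrite !mxE; ring.
Qed.

Lemma is_derive_page_re (t : R) (x : E) (s : R) (u : E) : DT x ->
  is_derive ((t, x) : R^o * E) (s, u) page_re
   (('D_1 page_re_scale (sq x : R^o) * (2 * dot (r x) (r u))) *: turn_xi (t, x) +
    page_re_scale (sq x) *: 'D_((s, u) : R^o * E) turn_xi (t, x)).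
Proof.
move=> Vx; have h1 := smooth_at_is_derive ((s, u) : R^o * E) (smooth_at_turn_xi (t, x)).
have h4 := is_derive_sq2 t s u (smooth_at_page_re_scale (disc_sq01 Vx)).
by rewrite /page_re; der_eq.
Qed.

Lemma is_derive_page_im (t : R) (x : E) (s : R) (u : E) : DT x ->
  is_derive ((t, x) : R^o * E) (s, u) page_im
   (('D_1 page_im_scale (sq x : R^o) * (2 * dot (r x) (r u))) *: turn_q (t, x) +
    page_im_scale (sq x) *: 'D_((s, u) : R^o * E) turn_q (t, x)).
Proof.
move=> Vx; have h1 := smooth_at_is_derive ((s, u) : R^o * E) (smooth_at_turn_q (t, x)).
have h4 := is_derive_sq2 t s u (smooth_at_page_im_scale (disc_sq01 Vx)).
by rewrite /page_im; der_eq.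
Qed.

Context {d : nat} (en : (N + N = 1 + 1 + d.+1)%N).

(** The first coordinate contributes (p/4) rho (2/p) dalpha = rho dalpha / 2, the others (1 - rho)
    dalpha / 2 and 1/F times the turned xi.dq. So rho drops out of the sum, and [page_time]
    finishes. *)
Lemma ustilovsky_P_form (t : R) (x : E) (s : R) (u : E) : tangent d.+1 DT x u ->
  factor_page (sq x) * brieskorn_form (brieskorn_exponent p) (ustilovsky_P (t, x))
    ('D_((s, u) : R^o * E) ustilovsky_P (t, x)) = s + canonical_form x u.
Proof.
move=> tu; have /(tangent_disc_cotangent en)[Vx _ _] := tu; have s01 := disc_sq01 Vx.
have [_ ->] := is_derive_ustilovsky_P t s u Vx.
rewrite /ustilovsky_P brieskorn_form_zpt /= rotated_form ?cos2Dsin2 //.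
have [e1 e2 e3] := @page_dots (t, x) Vx; rewrite e2 e3 /=.
have [_ ->] := is_derive_page_re t s u Vx; have [_ ->] := is_derive_page_im t s u Vx.
have [t1 t2] := turn_form t s en tu; have [d1 d2 d3] := @turn_dots (t, x) Vx.
have -> : page_re (t, x) = page_re_scale (sq x) *: turn_xi (t, x) by [].
have -> : page_im (t, x) = page_im_scale (sq x) *: turn_q (t, x) by [].
move: (turn_xi (t, x)) (turn_q (t, x)) ('D_(_) turn_q _) ('D_(_) turn_xi _) t1 t2 d1 d2 d3.
move=> f1 f2 f3 f4 t1 t2 d1 d2 d3; rewrite !dotE t1 t2 (dotC f2 f1) d2.
have sm := page_scale_mul s01; have k0 := factor_page_gt0 K2 (sq x).
have cs := cos2Dsin2 (base_angle (t, x)); have mm := page_modulus_sqr s01.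
have pt := page_time t x s u; rewrite -[X in _ = X + _]pt /canonical_form.
set dA := 'D_(s, u) page_angle _; set dT := 'D_(s, u) page_turn _.
set a := page_re_scale _ in sm *; set b := page_im_scale _ in sm *; set k := factor_page _ in sm k0 *.
set m := page_modulus _ in mm *; set w := g _ in mm *; set c := cos _ in cs *; set e := sin _ in cs *.
set y := Num.sqrt _; set z := dot (r x) (l u).
have p0 := p_neq0; have k1 : k != 0 by rewrite gt_eqF.
apply: (@eq_of_sub _ _ _ (k / 2 * dA * (m ^+ 2 * (c ^+ 2 + e ^+ 2) - w) +
   k * (a * b - k^-1) * (z - y * dT))).
  by rewrite cs mulr1 mm subrr mulr0 add0r sm subrr mulr0 mul0r.
by field; rewrite ?p0 ?k1.
Qed.

(** The modulus of z_0 controls |xi| and its argument controls alpha, so a kernel vector fixes |xi|,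
    alpha and then t. What remains is an invertible linear image of u. *)
Lemma ustilovsky_P_immersion (t : R) (x : E) (s : R) (u : E) : tangent d.+1 DT x u ->
  'D_((s, u) : R^o * E) ustilovsky_P (t, x) = 0 -> s = 0 /\ u = 0.
Proof.
move=> tu; have /(tangent_disc_cotangent en)[Vx _ _] := tu; have s01 := disc_sq01 Vx.
have [_ ->] := is_derive_ustilovsky_P t s u Vx; move=> /= /zpt_eq0[].
have m0 := page_modulus_gt0 s01; have dm0 := derive_page_modulus_neq0 s01.
have cs := cos2Dsin2 (base_angle (t, x)); have h0 := height_gt0 K2 hK (sq x).
set dm := _ * (2 * _); set dA := 'D_(s, u) page_angle _ => e1 e2 e3 e4.
have dm1 : dm = 0.
  apply: (@eq_of_sub _ _ _ (cos (base_angle (t, x)) * (dm * cos (base_angle (t, x)) -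
      page_modulus (sq x) * sin (base_angle (t, x)) * (2 / p%:R * dA)) +
    sin (base_angle (t, x)) * (dm * sin (base_angle (t, x)) +
      page_modulus (sq x) * cos (base_angle (t, x)) * (2 / p%:R * dA)) -
    dm * (cos (base_angle (t, x)) ^+ 2 + sin (base_angle (t, x)) ^+ 2 - 1))).
    by rewrite e1 e2 cs subrr !mulr0 addr0 subr0.
  by ring.
have dA0 : page_modulus (sq x) * (2 / p%:R * dA) = 0.
  apply: (@eq_of_sub _ _ _ (cos (base_angle (t, x)) * (dm * sin (base_angle (t, x)) +
      page_modulus (sq x) * cos (base_angle (t, x)) * (2 / p%:R * dA)) -
    sin (base_angle (t, x)) * (dm * cos (base_angle (t, x)) -
      page_modulus (sq x) * sin (base_angle (t, x)) * (2 / p%:R * dA)) -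
    page_modulus (sq x) * (2 / p%:R * dA) *
      (cos (base_angle (t, x)) ^+ 2 + sin (base_angle (t, x)) ^+ 2 - 1))).
    by rewrite e1 e2 cs subrr !mulr0 !subr0.
  by ring.
have c0 : dot (r x) (r u) = 0.
  move/eqP: dm1; rewrite /dm mulf_eq0 (negbTE dm0) /= mulf_eq0 pnatr_eq0 /=.
  by move/eqP.
have dA1 : dA = 0.
  have n0 : 0 < page_modulus (sq x) * (2 / p%:R) by rewrite mulr_gt0 // divr_gt0 // ltr0n odd_gt0.
  by move/eqP: dA0; rewrite mulrA mulf_eq0 (gt_eqF n0) => /eqP.
have s0 : s = 0.
  have := derive_page_angle t x s u => -[_]; rewrite -/dA dA1 c0 !mulr0 mul0r subr0.
  by move=> /esym/eqP; rewrite mulf_eq0 invr_eq0 (gt_eqF h0) orbF mulf_eq0 pnatr_eq0 => /eqP.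
split=> //.
have dT0 : 'D_((s, u) : R^o * E) page_turn (t, x) = 0.
  have [_ ->] := derive_page_turn t x s u; rewrite -/dA dA1 c0 !mulr0 addr0 //.
have [dC dS _] := derive_turn t x s u; have dS0 := dS dT0 c0.
rewrite dT0 mulr0 oppr0 in dC.
have [_ eq] := is_derive_turn_q t x s u; have [_ ex] := is_derive_turn_xi t x s u.
rewrite dC dS0 c0 !mulr0 addr0 oppr0 !scale0r !add0r in eq ex.
rewrite dA1 scale0r subr0 in e3; rewrite dA1 scale0r addr0 in e4.
have [_ er] := is_derive_page_re t s u Vx; have [_ ei] := is_derive_page_im t s u Vx.
rewrite c0 !mulr0 scale0r add0r ex in er; rewrite c0 !mulr0 scale0r add0r eq in ei.
rewrite er ei in e3 e4.
have cs2 := cos2Dsin2 (page_angle (t, x)).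
have a0 := page_re_scale_gt0 s01; have b0 := page_im_scale_gt0 s01.
set c := cos _ in e3 e4 cs2; set b := sin _ in e3 e4 cs2.
set X1 := _ + _ in ex e3 e4; set Q1 := _ + _ in eq e3 e4.
have key (a a' : 'rV[R]_N) : c *: a + (- b) *: a' = 0 -> b *: a + c *: a' = 0 -> a = 0 /\ a' = 0.
  move=> f1 f2; split; apply/rowP => i; have := congr1 (fun M : 'rV_N => M ord0 i) f1;
    have := congr1 (fun M : 'rV_N => M ord0 i) f2; rewrite !mxE => g2 g1.
    apply: (@eq_of_sub _ _ _ (c * (c * a ord0 i + - b * a' ord0 i) + b * (b * a ord0 i + c * a' ord0 i) -
      (c ^+ 2 + b ^+ 2 - 1) * a ord0 i)); first by rewrite g1 g2 cs2 subrr !mulr0 mul0r addr0 subr0.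
    by ring.
  apply: (@eq_of_sub _ _ _ (c * (b * a ord0 i + c * a' ord0 i) - b * (c * a ord0 i + - b * a' ord0 i) -
    (c ^+ 2 + b ^+ 2 - 1) * a' ord0 i)); first by rewrite g1 g2 cs2 subrr !mulr0 mul0r !subr0.
  by ring.
have [/eqP X0 /eqP Q0] := key _ _ e3 e4.
rewrite scaler_eq0 gt_eqF //= in X0; rewrite scaler_eq0 gt_eqF //= in Q0.
move/eqP: X0; move/eqP: Q0; rewrite /X1 /Q1 => Q0 X0; have e := turn_cos_sinc (t, x).
move: Q0 X0 e; rewrite /=; set C := turn_cos _; set S := turn_sinc _; set z := sq x => Q0 X0 e.
rewrite -[u]hsubmxK; apply/eqP; rewrite -(row_mx0 _ 1 N N); apply/eqP.
congr row_mx; apply/rowP => i; have := congr1 (fun M : 'rV_N => M ord0 i) Q0;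
  have := congr1 (fun M : 'rV_N => M ord0 i) X0; rewrite [LHS]mxE [RHS]mxE !mxE => g2 g1.
  set v := u _ (lshift _ _) in g1 g2 *; set v' := u _ (rshift _ _) in g1 g2 *.
  apply: (@eq_of_sub _ _ _ (C * (C * v + - S * v') + S * (C * v' + z * S * v) -
    (C ^+ 2 + z * S ^+ 2 - 1) * v)); first by rewrite g1 g2 e subrr !mulr0 mul0r addr0 subr0.
  by ring.
set v := u _ (lshift _ _) in g1 g2 *; set v' := u _ (rshift _ _) in g1 g2 *.
apply: (@eq_of_sub _ _ _ (C * (C * v' + z * S * v) - z * S * (C * v + - S * v') -
  (C ^+ 2 + z * S ^+ 2 - 1) * v')); first by rewrite g1 g2 e subrr !mulr0 mul0r !subr0.
by ring.
Qed.

Lemma rotate_inj (c b : R) (u v u' v' : 'rV[R]_N) : c ^+ 2 + b ^+ 2 = 1 ->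
  c *: u + (- b) *: v = c *: u' + (- b) *: v' -> b *: u + c *: v = b *: u' + c *: v' ->
  u = u' /\ v = v'.
Proof.
move=> e e1 e2.
have key (x y : 'rV[R]_N) : x = c *: (c *: x + (- b) *: y) + b *: (b *: x + c *: y) /\
    y = c *: (b *: x + c *: y) - b *: (c *: x + (- b) *: y).
  split; apply/rowP => i; rewrite !mxE; set w := x _ _; set z := y _ _; apply/esym.
    by apply: (@eq_of_sub _ _ _ ((c ^+ 2 + b ^+ 2 - 1) * w)); [rewrite e subrr mul0r|ring].
  by apply: (@eq_of_sub _ _ _ ((c ^+ 2 + b ^+ 2 - 1) * z)); [rewrite e subrr mul0r|ring].
have [k1 k2] := key u v; have [k3 k4] := key u' v'.
by split; [rewrite [LHS]k1 e1 e2 -k3|rewrite [LHS]k2 e1 e2 -k4].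
Qed.

Lemma le0_core (z : R) : z <= 0 -> z < 1 / 16.
Proof. lra. Qed.

Definition page_h (x : E) : R := p%:R * pi / 2 * height (sq x).

Lemma page_h_gt0 x : 0 < page_h x.
Proof.
by rewrite mulr_gt0 ?(height_gt0 K2) // divr_gt0 // mulr_gt0 ?pi_gt0 // ltr0n odd_gt0.
Qed.

Lemma page_angle_deck t x : DT x -> page_angle (deck (page_twist p) page_h (t, x)) =
  page_angle (t, x) - p%:R * pi.
Proof.
move=> Vx; rewrite /page_angle /deck /= twist_sq //; last exact: cos_sinc_angle.
by rewrite /page_h; field; rewrite gt_eqF // (height_gt0 K2).
Qed.

(** The monodromy advances the geodesic flow by p pi (1 - [slope]) and the time shift by p pi
    [slope]; the total p pi is the sign (-1)^p, to be cancelled by e^(i alpha). *)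
Lemma turn_deck t x : DT x ->
  turn_q (deck (page_twist p) page_h (t, x)) = (-1) ^+ p *: turn_q (t, x) /\
  turn_xi (deck (page_twist p) page_h (t, x)) = (-1) ^+ p *: turn_xi (t, x).
Proof.
move=> Vx; have es : sq (page_twist p x) = sq x by apply: twist_sq => //; exact: cos_sinc_angle.
have ea : page_turn (deck (page_twist p) page_h (t, x)) = page_turn (t, x) - slope (sq x) * (p%:R * pi).
  by rewrite /page_turn page_angle_deck //= es mulrBr.
rewrite /turn_q /turn_xi /turn_cos /turn_sinc ea /= es /page_twist /twist !lrE.
have [x0|x0] := ltP 0 (sq x); last first.
  have x1 := le0_core x0.
  rewrite sinc_angle_core // /cos_angle angle_core // cos_pin page_turn_core // slope_eq0 //.
  rewrite mul0r subr0 cos0 sin0 !mul0r !mulr0 oppr0 !scale0r !addr0 !scale1r oppr0 addr0.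
  by [].
have q0 : Num.sqrt (sq x) != 0 by rewrite gt_eqF // sqrtr_gt0.
have q2 : Num.sqrt (sq x) ^+ 2 = sq x by rewrite sqr_sqrtr ?ltW.
have tE : page_turn (t, x) = (page_turn (t, x) - slope (sq x) * (p%:R * pi)) - angle p (sq x) + p%:R * pi.
  by rewrite /angle; ring.
have cE : (-1) ^+ p * cos (page_turn (t, x)) =
    cos (page_turn (t, x) - slope (sq x) * (p%:R * pi)) * cos (angle p (sq x)) +
    sin (page_turn (t, x) - slope (sq x) * (p%:R * pi)) * sin (angle p (sq x)).
  by rewrite {1}tE cosDpin mulrA -exprMn mulrNN mul1r expr1n mul1r cosB.
have sE : (-1) ^+ p * sin (page_turn (t, x)) =
    sin (page_turn (t, x) - slope (sq x) * (p%:R * pi)) * cos (angle p (sq x)) -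
    cos (page_turn (t, x) - slope (sq x) * (p%:R * pi)) * sin (angle p (sq x)).
  by rewrite {1}tE sinDpin mulrA -exprMn mulrNN mul1r expr1n mul1r sinB.
rewrite !scalerDr !scalerA mulrN [(-1) ^+ p * (_ / _)]mulrA [(-1) ^+ p * (sq x * _)]mulrCA.
rewrite [(-1) ^+ p * (_ / _)]mulrA cE sE /sinc_angle /cos_angle.
move: q0 q2; set z := sq x; set a := Num.sqrt z => q0 q2; rewrite -!q2.
by split; apply/rowP => i; rewrite !mxE; field; rewrite q0.
Qed.

Definition frame_point (m cb sb ca sa A B : R) (f1 f2 : 'rV[R]_N) : Cspace R (1 + N) :=
  zpt (m * cb) (m * sb) (ca *: (A *: f2) + (- sa) *: (B *: f1)) (sa *: (A *: f2) + ca *: (B *: f1)).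

Lemma frame_point_sign (e m cb sb ca sa cb' sb' ca' sa' A B : R) (f1 f2 f1' f2' : 'rV[R]_N) :
  e * e = 1 -> cb = cb' -> sb = sb' -> ca = e * ca' -> sa = e * sa' ->
  f1 = e *: f1' -> f2 = e *: f2' ->
  frame_point m cb sb ca sa A B f1 f2 = frame_point m cb' sb' ca' sa' A B f1' f2'.
Proof.
move=> ee -> -> -> -> -> ->; rewrite /frame_point.
have key (z w : R) (f : 'rV[R]_N) : (e * z) *: (w *: (e *: f)) = z *: (w *: f).
  by rewrite !scalerA; congr (_ *: _); rewrite -[RHS]mul1r -ee; ring.
by rewrite -!mulrN !key.
Qed.

Lemma ustilovsky_P_deck q : DT q.2 ->
  ustilovsky_P (deck (page_twist p) page_h q) = ustilovsky_P q.
Proof.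
case: q => t x /= Vx.
have es : sq (page_twist p x) = sq x by apply: twist_sq => //; exact: cos_sinc_angle.
have [eq ex] := turn_deck t Vx; have ea := page_angle_deck t Vx.
have eps2 : (-1) ^+ p * (-1) ^+ p = 1 :> R by rewrite -exprMn mulrNN mul1r expr1n.
have ca : cos (page_angle (deck (page_twist p) page_h (t, x))) = (-1) ^+ p * cos (page_angle (t, x)).
  by rewrite -[in RHS](subrK (p%:R * pi) (page_angle (t, x))) cosDpin mulrA eps2 mul1r -ea.
have sa : sin (page_angle (deck (page_twist p) page_h (t, x))) = (-1) ^+ p * sin (page_angle (t, x)).
  by rewrite -[in RHS](subrK (p%:R * pi) (page_angle (t, x))) sinDpin mulrA eps2 mul1r -ea.
have eb : base_angle (t, x) = base_angle (deck (page_twist p) page_h (t, x)) + 1%:R * (2 * pi).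
  by rewrite /base_angle ea; field; rewrite p_neq0.
have cb : cos (base_angle (deck (page_twist p) page_h (t, x))) = cos (base_angle (t, x)).
  by rewrite eb cosDn2pi.
have sb : sin (base_angle (deck (page_twist p) page_h (t, x))) = sin (base_angle (t, x)).
  by rewrite eb sinDn2pi.
have es' : sq (deck (page_twist p) page_h (t, x)).2 = sq x by exact: es.
move: {es ea eb} es' ca sa cb sb eq ex; move: (deck _ _ _) => y es ca sa cb sb eq ex.
have PE q : ustilovsky_P q = frame_point (page_modulus (sq q.2)) (cos (base_angle q))
  (sin (base_angle q)) (cos (page_angle q)) (sin (page_angle q)) (page_re_scale (sq q.2))
  (page_im_scale (sq q.2)) (turn_q q) (turn_xi q) by [].
by rewrite PE es; exact: (frame_point_sign _ _ _ eps2 cb sb ca sa eq ex).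
Qed.

Lemma ustilovsky_P_sq q q' : DT q.2 -> DT q'.2 -> ustilovsky_P q = ustilovsky_P q' ->
  sq q.2 = sq q'.2.
Proof.
move=> Vq Vq' e; have := congr1 modulus0 e; rewrite (ustilovsky_P_modulus Vq) (ustilovsky_P_modulus Vq') => e1.
apply: (gram_page_inj K2 hK).
have [|_ <- _] := @gram_root (gram_page (sq q.2)); first by have := page_gram_itv (disc_sq01 Vq); lra.
have [|_ e2 _] := @gram_root (gram_page (sq q'.2)); first by have := page_gram_itv (disc_sq01 Vq'); lra.
by rewrite e1 e2.
Qed.

Lemma ustilovsky_P_fibres q q' : DT q.2 -> DT q'.2 -> (ustilovsky_P q = ustilovsky_P q' <->
  exists n, iter n (deck (page_twist p) page_h) q = q' \/ iter n (deck (page_twist p) page_h) q' = q).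
Proof.
apply: deck_fibres.
- by move=> x Vx; apply: twist_disc => //; exact: cos_sinc_angle.
- by move=> x Vx; rewrite /page_h twist_sq //; exact: cos_sinc_angle.
- exact: ustilovsky_P_deck.
- move=> [t x] [t' x'] Vx Vx' e; have es := ustilovsky_P_sq Vx Vx' e.
  rewrite /= in es; have m0 := page_modulus_gt0 (disc_sq01 Vx).
  split; first by rewrite /page_h /= es.
  move: e => /zpt_inj[/= + + _ _]; rewrite -es => /(mulfI (lt0r_neq0 m0)) ec /(mulfI (lt0r_neq0 m0)) e'.
  have [n hn] := cos_sin_eq ec e'; exists n.
  have h0 := height_gt0 K2 hK (sq x); have p0 := p_neq0.
  have key (y z : R) : base_angle (y, x) - base_angle (z, x) = n%:R * (2 * pi) ->
      y - z = n%:R * page_h x.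
    rewrite /base_angle /page_angle /page_h /= => ez.
    have -> : n%:R * (p%:R * pi / 2 * height (sq x)) = n%:R * (2 * pi) * (p%:R * height (sq x) / 4).
      by field.
    by rewrite -ez; field; rewrite p0 gt_eqF.
  have eb : base_angle (t', x') = base_angle (t', x).
    by rewrite /base_angle /page_angle /= es.
  by case: hn; rewrite eb => hn; [left|right]; exact: key.
- move=> t x x' Vx Vx' e; have es := ustilovsky_P_sq (q := (t, x)) (q' := (t, x')) Vx Vx' e.
  rewrite /= in es; have s01 := disc_sq01 Vx.
  have ea : page_angle (t, x') = page_angle (t, x) by rewrite /page_angle /= es.
  move: e => /zpt_inj[_ _]; rewrite ea => e1 e2.
  have [e3 e4] := rotate_inj (cos2Dsin2 _) e1 e2.
  have a0 := page_re_scale_gt0 s01; have b0 := page_im_scale_gt0 s01.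
  rewrite /page_re /= -es in e3; rewrite /page_im /= -es in e4.
  apply: (turn_inj es (t := t)).
    by move: e4; apply: scalerI; rewrite gt_eqF.
  by move: e3; apply: scalerI; rewrite gt_eqF.
Qed.

Lemma dot_cauchy_schwarz (X W : 'rV[R]_N) : dot X W ^+ 2 <= dot X X * dot W W.
Proof.
have [->|W0] := eqVneq W 0; first by rewrite !dot0r expr0n mulr0.
have w0 : 0 < dot W W by rewrite dot_gt0.
have := dot_ge0 (dot W W *: X - dot X W *: W); rewrite !dotE (dotC W X).
set a := dot X X; set b := dot X W; set c := dot W W in w0 * => h.
rewrite -subr_ge0 -(pmulr_rge0 _ w0).
by rewrite (_ : c * _ = c * (c * a - b * b) + (c * - (b * b) - b * - (b * c))) //; ring.
Qed.

(** On the Brieskorn manifold [gram] is 4 (|X|^2 |W|^2 - (X.W)^2), nonnegative by Cauchy-Schwarz;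
    since it is -1 at rho = 1, that value of rho cannot occur. *)
Lemma brieskorn_gram a b (X W : 'rV[R]_N) : brieskorn (brieskorn_exponent p) (zpt a b X W) ->
  let rho := a ^+ 2 + b ^+ 2 in 0 <= rho < 1 /\ 0 <= gram p rho <= 1.
Proof.
move=> /brieskorn_zpt[e1 e2 e3] rho; have r0 : 0 <= rho by rewrite addr_ge0 ?sqr_ge0.
have dX := dot_ge0 X; have dW := dot_ge0 W; have cs := dot_cauchy_schwarz X W.
have r1 : rho <= 1 by rewrite /rho; lra.
have nm := zpow_norm p a b; rewrite -/rho in nm e3.
have gE : gram p rho = 4 * (dot X X * dot W W - dot X W ^+ 2).
  rewrite /gram -nm (_ : (zpow p a b).1 = dot W W - dot X X); last lra.
  rewrite (_ : (zpow p a b).2 = - (2 * dot X W)); last lra.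
  by rewrite (_ : 1 - rho = dot X X + dot W W); [ring|lra].
have g0 : 0 <= gram p rho by rewrite gE; lra.
have rp : 0 <= rho ^+ p by rewrite exprn_ge0.
split; last first.
  have h : (1 - rho) ^+ 2 <= 1 by rewrite expr_le1 //; lra.
  by rewrite g0 /gram /=; lra.
rewrite r0 lt_neqAle r1 andbT /=; apply: contraTneq g0 => ->.
by rewrite gram1 -ltNge ltrN10.
Qed.

Lemma ustilovsky_P_surj a b (X W : 'rV[R]_N) : brieskorn (brieskorn_exponent p) (zpt a b X W) ->
  gram p (a ^+ 2 + b ^+ 2) <= gram_page 1 ->
  exists2 q : R^o * E, DT q.2 & zpt a b X W = ustilovsky_P q.
Proof.
move=> My g1; have [/andP[r0 r1] /andP[g0 _]] := brieskorn_gram My.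
move/brieskorn_zpt: My => [e1 e2 e3].
set rho := _ + b ^+ 2 in g1 r0 r1 g0 e3.
have [|s s01 es] := @gram_page_surj R K K2 (gram p rho); first by rewrite g0.
have gr : g (gram_page s) = rho by rewrite es; have [|-> _ //] := hg (rho := rho); lra.
have m0 := page_modulus_gt0 s01; have m2 := page_modulus_sqr s01.
have [|th [ct st]] := @exists_angle _ (a / page_modulus s) (b / page_modulus s).
  by rewrite !expr_div_n -mulrDl -/rho -gr -m2 divff // expf_neq0 // gt_eqF.
have h0 := height_gt0 K2 hK s; have p0 := p_neq0.
(* Half the argument of the p-th power of z_0. *)
pose al : R := p%:R * th / 2.
have aE : a = page_modulus s * cos th by rewrite -ct mulrC divfK // gt_eqF.
have bE : b = page_modulus s * sin th by rewrite -st mulrC divfK // gt_eqF.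
move: e1 e2; rewrite aE bE zpow_polar /=.
have -> : p%:R * th = al + al by rewrite /al; field.
rewrite cosD sinD; set m := page_modulus s ^+ p.
have cs := cos2Dsin2 al; move: cs; set c := cos al; set z := sin al => cs e1 e2.
(* U + iV is X + iW multiplied by e^(-i alpha), which makes its complex square real; hence U and V
   are orthogonal. *)
pose U := c *: X + z *: W; pose V := c *: W + (- z) *: X.
have UV : dot U V = 0.
  rewrite /U /V !dotE (dotC W X).
  apply: (@eq_of_sub _ _ _ ((c * c - z * z) / 2 * (m * (z * c + c * z) + 2 * dot X W) -
    c * z * (m * (c * c - z * z) + (dot X X - dot W W)))).
    by rewrite e1 e2 !mulr0 subrr.
  by field.
have UU : dot U U = (1 - rho - m) / 2.
  rewrite /U !dotE (dotC W X).
  apply: (@eq_of_sub _ _ _ ((c ^+ 2 + z ^+ 2 - 1) * (m * (c ^+ 2 + z ^+ 2 + 1) * (- 2^-1)) +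
     (c ^+ 2 + z ^+ 2 - 1) * (dot X X + dot W W) / 2 + (dot X X + dot W W - (1 - rho)) / 2 +
     (c * c - z * z) / 2 * (m * (c * c - z * z) + (dot X X - dot W W)) +
     c * z * (m * (z * c + c * z) + 2 * dot X W))).
    by rewrite e1 cs subrr !mul0r mulr0 (_ : _ - (1 - rho) = 0); [rewrite e2; lra|lra].
  by field.
have VV : dot V V = (1 - rho + m) / 2.
  have : dot U U + dot V V = dot X X + dot W W.
    rewrite /U /V !dotE (dotC W X).
    apply: (@eq_of_sub _ _ _ ((c ^+ 2 + z ^+ 2 - 1) * (dot X X + dot W W))); last by ring.
    by rewrite cs subrr mul0r.
  by rewrite UU; lra.
have y0 := page_im_scale_gt0 s01; have x0 := page_re_scale_gt0 s01.
have y2 := page_im_scale_sqr s01; have x2 := page_re_scale_sqr s01.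
rewrite gr -/m in y2 x2.
pose q1 := (page_im_scale s)^-1 *: V; pose xi1 := (page_re_scale s)^-1 *: U.
have qq : dot q1 q1 = 1.
  by rewrite /q1 dotZl dotZr VV -y2 mulrA -expr2 exprVn mulVf // expf_neq0 // gt_eqF.
have qx : dot q1 xi1 = 0 by rewrite /q1 /xi1 dotZl dotZr (dotC V) UV !mulr0.
have xx : dot xi1 xi1 = s.
  by rewrite /xi1 dotZl dotZr UU -x2 mulrA -expr2 exprVn mulrA mulVf ?mul1r // expf_neq0 // gt_eqF.
have V1 : page_im_scale s *: q1 = V by rewrite scalerA divff ?scale1r // gt_eqF.
have U1 : page_re_scale s *: xi1 = U by rewrite scalerA divff ?scale1r // gt_eqF.
clearbody q1 xi1.
pose t : R := al * height s / 2.
(* The turning coefficients depend only on t and |xi|. This stand-in with the right |xi| allows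
   evaluating them before x, the inverse turn of (q1, xi1), is defined. *)
pose x' : E := row_mx 0 xi1.
have sx' : sq x' = s by rewrite /x' row_mxKr.
have := turn_cos_sinc (t, x'); rewrite /= sx'.
have [C CE] : exists C : R, C = turn_cos (t, x') by eexists.
have [S SE] : exists S : R, S = turn_sinc (t, x') by eexists.
rewrite -CE -SE => CS.
have [x lx rx] : exists2 x : E, l x = C *: q1 + S *: xi1 & r x = C *: xi1 - (s * S) *: q1.
  by exists (row_mx (C *: q1 + S *: xi1) (C *: xi1 - (s * S) *: q1)); rewrite ?row_mxKl ?row_mxKr.
have sx : sq x = s.
  rewrite rx !dotE (dotC xi1) qq qx xx.
  by apply: (@eq_of_sub _ _ _ (s * (C ^+ 2 + s * S ^+ 2 - 1))); [rewrite CS subrr mulr0|ring].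
have Vx : DT x.
  split; last by rewrite sx; have /andP[] := s01.
    rewrite lx !dotE (dotC xi1) qq qx xx.
    by apply: (@eq_of_sub _ _ _ (C ^+ 2 + s * S ^+ 2 - 1)); [rewrite CS subrr|ring].
  by rewrite lx rx !dotE (dotC xi1) qq qx xx; ring.
have Cx : turn_cos (t, x) = C by rewrite CE /turn_cos /page_turn /page_angle /= sx sx'.
have Sx : turn_sinc (t, x) = S by rewrite SE /turn_sinc /page_turn /page_angle /= sx sx'.
have tq : turn_q (t, x) = q1.
  rewrite /turn_q Cx Sx /= lx rx; apply/rowP => i; rewrite !mxE.
  set v := q1 _ _; set w := xi1 _ _.
  by apply: (@eq_of_sub _ _ _ ((C ^+ 2 + s * S ^+ 2 - 1) * v)); [rewrite CS subrr mul0r|ring].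
have tx : turn_xi (t, x) = xi1.
  rewrite /turn_xi Cx Sx /= sx lx rx; apply/rowP => i; rewrite !mxE.
  set v := q1 _ _; set w := xi1 _ _.
  by apply: (@eq_of_sub _ _ _ ((C ^+ 2 + s * S ^+ 2 - 1) * w)); [rewrite CS subrr mul0r|ring].
exists (t, x); first exact: Vx.
have ea : page_angle (t, x) = al by rewrite /page_angle /= sx /t; field; rewrite gt_eqF.
have eb : base_angle (t, x) = th by rewrite /base_angle ea /al; field.
rewrite /ustilovsky_P /page_re /page_im tq tx ea eb /= sx V1 U1 -/c -/z /U /V; congr zpt; apply/rowP => i; rewrite !mxE;
  set v := X _ _; set w := W _ _; apply/esym.
  by apply: (@eq_of_sub _ _ _ ((c ^+ 2 + z ^+ 2 - 1) * v)); [rewrite cs subrr mul0r|ring].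
by apply: (@eq_of_sub _ _ _ ((c ^+ 2 + z ^+ 2 - 1) * w)); [rewrite cs subrr mul0r|ring].
Qed.

End UstilovskyPage.

(** * The neighbourhood of the Ustilovsky binding *)

Section UstilovskyBinding.
Context {R : realType} {N : nat}.
Local Notation E := 'rV[R]_(N + N).
Local Notation l := lsubmx.
Local Notation r := rsubmx.
Local Notation DT := (@disc_cotangent R N).
Local Notation sq x := (dot (r x) (r x)).
Local Notation vw w := (w.1 ^+ 2 + w.2 ^+ 2).
Variable p : nat.
Hypothesis p_odd : odd p.
Variable K : R.
Hypothesis K2 : 2 < K.
Hypothesis hK : forall s : R, 0 <= s <= 1 -> height_drop s < K.
Variable g : R^o -> R^o.
Hypothesis hg : forall rho : R, -1 < rho < 1 ->
  g (gram p rho) = rho /\ smooth_at (gram p rho : R^o) g.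

(** On the collar nu = 1/|xi|, and mu = |xi| / (K + 2 |xi|) is |xi| / [factor_page]; thus 4 mu^2
    continues [gram_page] over the disc, up to the value 1 at the centre. *)
Definition disc_mu (v : R^o) : R^o := (2 + K * disc_profile v)^-1.
Definition disc_rho (v : R^o) : R^o := g (4 * disc_mu v ^+ 2).
(** The square root of rho / v in a form smooth at v = 0: gram(rho) = 4 mu^2 reads rho (2 - rho +
    rho^(p-1)) = 1 - 4 mu^2, and the right-hand side is K nu (4 + K nu) mu^2 with nu divisible by
    v. *)
Definition disc_scale (v : R^o) : R^o := Num.sqrt (disc_ratio v * K * (4 + K * disc_profile v) *
  disc_mu v ^+ 2 / (2 - disc_rho v + disc_rho v ^+ p.-1)).
(** On the collar this is a |xi| + b, the sum of the lengths of the scaled frame vectors: their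
    squares add up to 1 - rho and their product is mu. *)
Definition disc_axis (v : R^o) : R^o := Num.sqrt (1 - disc_rho v + 2 * disc_mu v).

Section AtRadius.
Variable v : R.
Hypothesis v0 : 0 <= v.

Lemma disc_mu_arg : 2 <= 2 + K * disc_profile v.
Proof.
rewrite lerDl mulr_ge0 ?disc_profile_ge0 //; have := K2; lra.
Qed.

Lemma disc_mu_gt0 : 0 < disc_mu v.
Proof. by rewrite invr_gt0; have := disc_mu_arg; lra. Qed.

Lemma disc_mu_le : 2 * disc_mu v <= 1.
Proof. by rewrite ler_pdivrMr ?mul1r; have := disc_mu_arg; lra. Qed.

Lemma disc_mu_profile : K * disc_profile v * disc_mu v = 1 - 2 * disc_mu v.
Proof.
have a := disc_mu_arg; rewrite /disc_mu; field.
by rewrite gt_eqF //; lra.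
Qed.

Lemma disc_gram_itv : 0 < 4 * disc_mu v ^+ 2 <= 1.
Proof.
have m0 := disc_mu_gt0; have m1 := disc_mu_le.
by rewrite mulr_gt0 ?exprn_gt0 //= expr2; nra.
Qed.

Lemma disc_rho_root : [/\ 0 <= disc_rho v < 1, gram p (disc_rho v) = 4 * disc_mu v ^+ 2 &
  smooth_at (4 * disc_mu v ^+ 2 : R^o) g].
Proof. by apply: (gram_root p_odd hg); have := disc_gram_itv; lra. Qed.

Lemma disc_den_gt0 : 0 < 2 - disc_rho v + disc_rho v ^+ p.-1.
Proof.
have [/andP[r0 r1] _ _] := disc_rho_root.
have : 0 <= disc_rho v ^+ p.-1 by rewrite exprn_ge0.
by move=> ?; lra.
Qed.

Lemma disc_scale_arg_gt0 : 0 < disc_ratio v * K * (4 + K * disc_profile v) *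
  disc_mu v ^+ 2 / (2 - disc_rho v + disc_rho v ^+ p.-1).
Proof.
have a := disc_mu_arg; have k := K2.
by rewrite divr_gt0 ?disc_den_gt0 // !mulr_gt0 ?exprn_gt0 ?disc_mu_gt0 ?disc_ratio_gt0 //; lra.
Qed.

Lemma disc_scale_gt0 : 0 < disc_scale v.
Proof. by rewrite sqrtr_gt0 disc_scale_arg_gt0. Qed.

Lemma disc_scale_sqr : disc_scale v ^+ 2 * v = disc_rho v.
Proof.
have [_ e _] := disc_rho_root; have d0 := disc_den_gt0.
rewrite sqr_sqrtr ?(ltW disc_scale_arg_gt0) //.
have em := disc_mu_profile; rewrite /disc_profile in em *.
have pE : disc_rho v ^+ p = disc_rho v * disc_rho v ^+ p.-1 by rewrite -exprS prednK // odd_gt0.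
move: e d0; rewrite /gram pE; set w := disc_rho v; set z := w ^+ p.-1; set m := disc_mu v in em *.
set D := disc_ratio v in em * => e d0.
apply: (@eq_of_sub _ _ _ (((K * (v * D) * m - (1 - 2 * m)) * (K * (v * D) * m + 1 + 2 * m) +
  ((1 - w) ^+ 2 - w * z - 4 * m ^+ 2)) / (2 - w + z))).
  by rewrite em e !subrr mul0r addr0 mul0r.
by field; rewrite gt_eqF.
Qed.

Lemma disc_axis_arg_gt0 : 0 < 1 - disc_rho v + 2 * disc_mu v.
Proof. by have [/andP[r0 r1] _ _] := disc_rho_root; have := disc_mu_gt0; lra. Qed.

Lemma disc_axis_gt0 : 0 < disc_axis v.
Proof. by rewrite sqrtr_gt0 disc_axis_arg_gt0. Qed.

Lemma disc_axis_sqr : disc_axis v ^+ 2 = 1 - disc_rho v + 2 * disc_mu v.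
Proof. by rewrite sqr_sqrtr // ltW // disc_axis_arg_gt0. Qed.

Lemma smooth_at_disc_mu : smooth_at (v : R^o) disc_mu.
Proof.
have h := @smooth_at_disc_profile R; rewrite /disc_mu; smooth.
by rewrite gt_eqF //; have := disc_mu_arg; lra.
Qed.

Lemma smooth_at_disc_rho : smooth_at (v : R^o) disc_rho.
Proof.
have [_ _ sg] := disc_rho_root; have h := smooth_at_disc_mu.
by apply: (@smooth_at_comp1 _ _ _ (fun v => 4 * disc_mu v ^+ 2 : R^o)) => //; smooth.
Qed.

Lemma smooth_at_disc_scale : smooth_at (v : R^o) disc_scale.
Proof.
have h1 := smooth_at_disc_mu; have h2 := smooth_at_disc_rho.
have h3 := @smooth_at_disc_profile R; have h4 := @smooth_at_disc_ratio R.
apply: smooth_at_sqrt; first exact: disc_scale_arg_gt0.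
by smooth; rewrite gt_eqF // disc_den_gt0.
Qed.

Lemma smooth_at_disc_axis : smooth_at (v : R^o) disc_axis.
Proof.
have h1 := smooth_at_disc_mu; have h2 := smooth_at_disc_rho.
by apply: smooth_at_sqrt; [exact: disc_axis_arg_gt0|smooth].
Qed.

End AtRadius.

Lemma derive_disc_rho_neq0 (v : R) : 0 < v -> 'D_1 disc_rho (v : R^o) != 0.
Proof.
move=> v0; have d := smooth_at_is_derive (1 : R^o) (smooth_at_disc_rho (ltW v0)).
have dp := smooth_at_is_derive (1 : R^o) (@smooth_at_disc_profile R v).
apply/negP => /eqP e; rewrite e in d.
have dr : is_derive (v : R^o) 1 (fun y : R^o => gram p (disc_rho y) : R^o) 0.
  by apply: (@is_derive_eq _ _ _ _ _ _ _ _ (is_derive_comp1 d (is_derive_gram _ _))); rewrite mulr0.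
have a := disc_mu_arg (ltW v0); have a1 : 2 + K * disc_profile v != 0 by rewrite gt_eqF //; lra.
have dm : is_derive (v : R^o) 1 (fun y : R^o => 4 * disc_mu y ^+ 2 : R^o)
    (- (8 * K * 'D_1 disc_profile (v : R^o) / (2 + K * disc_profile v) ^+ 3)).
  by rewrite /disc_mu; der_eq => //; field.
have : 'D_1 (fun y : R^o => gram p (disc_rho y) : R^o) (v : R^o) =
    'D_1 (fun y : R^o => 4 * disc_mu y ^+ 2 : R^o) (v : R^o).
  apply: near_eq_derive; apply: filterS (near_gt v0) => y /ltW y0.
  by have [_ -> _] := disc_rho_root y0.
have [_ ->] := dr; have [_ ->] := dm; move=> /esym/eqP; rewrite oppr_eq0; apply/negP.
have k := K2; rewrite gt_eqF // divr_gt0 ?exprn_gt0 //; last lra.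
by rewrite !mulr_gt0 ?derive_disc_profile_gt0 //; lra.
Qed.

Lemma disc_rho_inj (v v' : R) : 0 <= v -> 0 <= v' -> disc_rho v = disc_rho v' -> v = v'.
Proof.
move=> v0 v0' e; have [_ e1 _] := disc_rho_root v0; have [_ e2 _] := disc_rho_root v0'.
have em : disc_mu v = disc_mu v'.
  have : disc_mu v ^+ 2 = disc_mu v' ^+ 2.
    by apply: (mulfI (x := 4)) => //; rewrite -e1 -e2 e.
  by move/eqP; rewrite eqrXn2 ?ltW ?disc_mu_gt0 // => /eqP.
have k0 : K != 0 by rewrite gt_eqF //; have := K2; lra.
by apply: disc_profile_inj => //; apply: (mulfI k0); apply: (addrI 2); exact: invr_inj.
Qed.

Local Notation Q3 := (E * (R^o * R^o))%type.

Definition disc_re (q : Q3) : R^o := q.2.1 * disc_scale (vw q.2).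
Definition disc_im (q : Q3) : R^o := q.2.2 * disc_scale (vw q.2).
Definition disc_pow_re (q : Q3) : R^o := (zpow p (disc_re q) (disc_im q)).1.
Definition disc_pow_im (q : Q3) : R^o := (zpow p (disc_re q) (disc_im q)).2.
Definition disc_axis2 (q : Q3) : R^o := disc_axis (vw q.2).
Definition coef1 (q : Q3) : R^o := disc_axis2 q / 2 - disc_pow_re q / (2 * disc_axis2 q).
Definition coef2 (q : Q3) : R^o := - (disc_pow_im q / (2 * disc_axis2 q)).
Definition coef3 (q : Q3) : R^o := disc_axis2 q / 2 + disc_pow_re q / (2 * disc_axis2 q).

(* With zeta = xi + iq and z_0 the first coordinate, the others form the vector
   (S/2) zeta - z_0^p / (2S) conj(zeta), where S is the disc axis. *)
Definition ustilovsky_Q (q : Q3) : Cspace R (1 + N) :=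
  zpt (disc_re q) (disc_im q) (coef1 q *: r q.1 + coef2 q *: l q.1)
    (coef2 q *: r q.1 + coef3 q *: l q.1).

Lemma disc_modulus q : disc_re q ^+ 2 + disc_im q ^+ 2 = disc_rho (vw q.2).
Proof. by rewrite !exprMn -mulrDl mulrC disc_scale_sqr // vw_ge0. Qed.

(** The coefficients form a symmetric 2 x 2 matrix of determinant (S^4 - rho^p) / (4 S^2), which is
    mu because rho^p = (1 - rho)^2 - 4 mu^2. The other relations encode the sphere and the Brieskorn
    equation. *)
Lemma coef_rel q : [/\ coef1 q * coef3 q - coef2 q ^+ 2 = disc_mu (vw q.2),
  coef1 q ^+ 2 + coef2 q ^+ 2 = (1 - disc_rho (vw q.2) - disc_pow_re q) / 2,
  coef2 q ^+ 2 + coef3 q ^+ 2 = (1 - disc_rho (vw q.2) + disc_pow_re q) / 2 &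
  coef2 q * (coef1 q + coef3 q) = - disc_pow_im q / 2].
Proof.
have v0 := vw_ge0 q.2; have [_ e _] := disc_rho_root v0.
have n := zpow_norm p (disc_re q) (disc_im q); rewrite disc_modulus in n.
have s2 := disc_axis_sqr v0; have s0 := disc_axis_gt0 v0.
rewrite /coef1 /coef2 /coef3 /disc_pow_re /disc_pow_im /disc_axis2.
move: n e; rewrite /gram => <-.
set m1 := (zpow _ _ _).1; set m2 := (zpow _ _ _).2; set S := disc_axis _ in s2 s0 *.
set w := disc_rho _ in s2 *; set m := disc_mu _ in s2 * => e.
have S0 : S != 0 by rewrite gt_eqF.
have e2 : S ^+ 2 * (S ^+ 2 - 4 * m) - (m1 ^+ 2 + m2 ^+ 2) = 0.
  by rewrite s2; apply: (@eq_of_sub _ _ _ ((1 - w) ^+ 2 - (m1 ^+ 2 + m2 ^+ 2) - 4 * m ^+ 2));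
    [rewrite e subrr|ring].
have e1 : S ^+ 2 - (1 - w + 2 * m) = 0 by rewrite s2 subrr.
split.
- apply: (@eq_of_sub _ _ _ ((S ^+ 2 * (S ^+ 2 - 4 * m) - (m1 ^+ 2 + m2 ^+ 2)) / (4 * S ^+ 2))).
    by rewrite e2 mul0r.
  by field.
- apply: (@eq_of_sub _ _ _ ((S ^+ 2 - (1 - w + 2 * m)) / 2 -
    (S ^+ 2 * (S ^+ 2 - 4 * m) - (m1 ^+ 2 + m2 ^+ 2)) / (4 * S ^+ 2))).
    by rewrite e1 e2 !mul0r subr0.
  by field.
- apply: (@eq_of_sub _ _ _ ((S ^+ 2 - (1 - w + 2 * m)) / 2 -
    (S ^+ 2 * (S ^+ 2 - 4 * m) - (m1 ^+ 2 + m2 ^+ 2)) / (4 * S ^+ 2))).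
    by rewrite e1 e2 !mul0r subr0.
  by field.
- by field.
Qed.

Lemma coef_solve q (X Y X' Y' : 'rV[R]_N) :
  coef1 q *: X + coef2 q *: Y = coef1 q *: X' + coef2 q *: Y' ->
  coef2 q *: X + coef3 q *: Y = coef2 q *: X' + coef3 q *: Y' -> X = X' /\ Y = Y'.
Proof.
have [e _ _ _] := coef_rel q; have m0 := disc_mu_gt0 (vw_ge0 q.2); move=> e1 e2.
have m1 : disc_mu (vw q.2) != 0 by rewrite gt_eqF.
move: e e1 e2; set a := coef1 q; set b := coef2 q; set c := coef3 q => e e1 e2.
have key (U V : 'rV[R]_N) : disc_mu (vw q.2) *: U = c *: (a *: U + b *: V) - b *: (b *: U + c *: V) /\
    disc_mu (vw q.2) *: V = a *: (b *: U + c *: V) - b *: (a *: U + b *: V).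
  by rewrite -e; split; apply/rowP => i; rewrite !mxE; ring.
have [k1 k2] := key X Y; have [k3 k4] := key X' Y'.
by split; apply: (scalerI m1); rewrite ?k1 ?k2 ?k3 ?k4 e1 e2.
Qed.

Lemma smooth_at_vw (f : R^o -> R^o) (q : Q3) : smooth_at (vw q.2 : R^o) f ->
  smooth_at q (fun q : Q3 => f (vw q.2) : R^o).
Proof.
by move=> sf; apply: (@smooth_at_comp1 _ _ _ (fun q : Q3 => vw q.2 : R^o)) => //; smooth.
Qed.

Lemma smooth_at_disc_re q : smooth_at q disc_re.
Proof.
by have h := smooth_at_vw (smooth_at_disc_scale (vw_ge0 q.2)); rewrite /disc_re; smooth.
Qed.

Lemma smooth_at_disc_im q : smooth_at q disc_im.
Proof.
by have h := smooth_at_vw (smooth_at_disc_scale (vw_ge0 q.2)); rewrite /disc_im; smooth.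
Qed.

Lemma smooth_at_disc_axis2 q : smooth_at q disc_axis2.
Proof. exact: smooth_at_vw (smooth_at_disc_axis (vw_ge0 q.2)). Qed.

Lemma disc_axis2_neq0 q : 2 * disc_axis2 q != 0.
Proof. by rewrite gt_eqF // mulr_gt0 // disc_axis_gt0 // vw_ge0. Qed.

Lemma smooth_at_coef q : [/\ smooth_at q coef1, smooth_at q coef2 & smooth_at q coef3].
Proof.
have h := smooth_at_disc_axis2 q; have s0 := disc_axis2_neq0 q.
have [h1 h2] := smooth_at_zpow p (smooth_at_disc_re q) (smooth_at_disc_im q).
have h3 : smooth_at q disc_pow_re by [].
have h4 : smooth_at q disc_pow_im by [].
by split; rewrite /coef1 /coef2 /coef3; smooth.
Qed.

Lemma smooth_at_ustilovsky_Q q : smooth_at q ustilovsky_Q.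
Proof.
have h1 := smooth_at_disc_re q; have h2 := smooth_at_disc_im q.
by have [h3 h4 h5] := smooth_at_coef q; apply: smooth_at_zpt; smooth.
Qed.

Lemma is_derive_ustilovsky_Q (q e : Q3) : is_derive q e ustilovsky_Q (zpt
  ('D_e disc_re q : R) ('D_e disc_im q : R)
  (('D_e coef1 q : R) *: r q.1 + coef1 q *: r e.1 + (('D_e coef2 q : R) *: l q.1 + coef2 q *: l e.1))
  (('D_e coef2 q : R) *: r q.1 + coef2 q *: r e.1 + (('D_e coef3 q : R) *: l q.1 + coef3 q *: l e.1))).
Proof.
have h1 := smooth_at_is_derive e (smooth_at_disc_re q).
have h2 := smooth_at_is_derive e (smooth_at_disc_im q).
have [s3 s4 s5] := smooth_at_coef q.
have h3 := smooth_at_is_derive e s3; have h4 := smooth_at_is_derive e s4.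
have h5 := smooth_at_is_derive e s5.
by apply: is_derive_zpt => //; der_vec.
Qed.

(* The derivatives of the coefficients enter the contact form only through this combination. *)
Lemma derive_coef (q e : Q3) :
  let D (f : Q3 -> R^o) : R := 'D_e f q in
  (coef1 q * D coef2 + coef2 q * D coef3 - coef2 q * D coef1 - coef3 q * D coef2) *
    disc_axis2 q ^+ 2 =
  p%:R / 2 * disc_rho (vw q.2) ^+ p.-1 * (disc_re q * D disc_im - disc_im q * D disc_re) /\
  (D disc_re = 0 -> D disc_im = 0 -> D disc_axis2 = 0 ->
   [/\ D coef1 = 0, D coef2 = 0 & D coef3 = 0]).
Proof.
move=> D; have h1 := smooth_at_is_derive e (smooth_at_disc_re q).
have h2 := smooth_at_is_derive e (smooth_at_disc_im q).
have h3 := smooth_at_is_derive e (smooth_at_disc_axis2 q).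
have s0 := disc_axis2_neq0 q; have s1 : disc_axis2 q != 0.
  by apply: contra s0 => /eqP ->; rewrite mulr0.
have [d1 d2] := is_derive_zpow p h1 h2.
rewrite -/(D disc_re) -/(D disc_im) in d1 d2; rewrite -/(D disc_axis2) in h3.
set r1 := (zpow p.-1 _ _).1 in d1 d2; set r2 := (zpow p.-1 _ _).2 in d1 d2.
have [f1 f2] : is_derive q e disc_pow_re (p%:R * (r1 * D disc_re - r2 * D disc_im)) /\
  is_derive q e disc_pow_im (p%:R * (r1 * D disc_im + r2 * D disc_re)) by split.
pose Dm1 : R := p%:R * (r1 * D disc_re - r2 * D disc_im).
pose Dm2 : R := p%:R * (r1 * D disc_im + r2 * D disc_re).
rewrite -/Dm1 in f1; rewrite -/Dm2 in f2.
pose S : R := disc_axis2 q; pose DS : R := D disc_axis2.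
have [_ c1] : is_derive q e coef1 (DS / 2 - Dm1 / (2 * S) + disc_pow_re q * DS / (2 * S ^+ 2)).
  by rewrite /coef1; der_eq => //; rewrite /DS /S; field.
have [_ c2] : is_derive q e coef2 (- (Dm2 / (2 * S)) + disc_pow_im q * DS / (2 * S ^+ 2)).
  by rewrite /coef2; der_eq => //; rewrite /DS /S; field.
have [_ c3] : is_derive q e coef3 (DS / 2 + Dm1 / (2 * S) - disc_pow_re q * DS / (2 * S ^+ 2)).
  by rewrite /coef3; der_eq => //; rewrite /DS /S; field.
rewrite [D coef1]c1 [D coef2]c2 [D coef3]c3; split; last first.
  by move=> e1 e2 e3; rewrite /Dm1 /Dm2 /DS e1 e2 e3 !mulr0 subr0 addr0 !mulr0 !mul0r subr0 oppr0 !addr0.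
have n := zpow_norm p.-1 (disc_re q) (disc_im q); rewrite disc_modulus -/r1 -/r2 in n.
have pE : p = p.-1.+1 by rewrite prednK // odd_gt0.
have m1E : disc_pow_re q = disc_re q * r1 - disc_im q * r2 by rewrite /disc_pow_re {1}pE.
have m2E : disc_pow_im q = disc_re q * r2 + disc_im q * r1 by rewrite /disc_pow_im {1}pE.
rewrite /coef1 /coef2 /coef3 -/S m1E m2E -n /Dm1 /Dm2.
have s2 : S != 0 by [].
move: s2; move: (S) (DS) (D disc_re) (D disc_im) (disc_re q) (disc_im q) (r1) (r2) (p%:R).
by move=> *; field.
Qed.

Lemma ustilovsky_Q_modulus x w : modulus0 (ustilovsky_Q (x, w)) = disc_rho (vw w).
Proof. by rewrite modulus0_zpt disc_modulus. Qed.

Context {d : nat} (en : (N + N = 1 + 1 + d.+1)%N).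

Definition binding_point (x : E) := [/\ dot (l x) (l x) = 1, dot (l x) (r x) = 0 & sq x = 1].

Lemma ustilovsky_Q_brieskorn x w : binding_point x ->
  brieskorn (brieskorn_exponent p) (ustilovsky_Q (x, w)).
Proof.
move=> [qq qx xx]; have [_ e1 e2 e3] := coef_rel (x, w).
have em := disc_modulus (x, w); move: e1 e2 e3 em.
rewrite /ustilovsky_Q /disc_pow_re /disc_pow_im /=.
move: (coef1 _) (coef2 _) (coef3 _) (disc_re _) (disc_im _) => c1 c2 c3 a b e1 e2 e3 em.
apply/brieskorn_zpt; rewrite !dotE (dotC (r x) (l x)) qq qx xx.
split.
- by lra.
- by lra.
- by lra.
Qed.

Lemma ustilovsky_Q_inj x x' w w' : ustilovsky_Q (x, w) = ustilovsky_Q (x', w') ->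
  x = x' /\ w = w'.
Proof.
move=> e; have := congr1 modulus0 e; rewrite (ustilovsky_Q_modulus x w) (ustilovsky_Q_modulus x' w').
move=> /(disc_rho_inj (vw_ge0 w) (vw_ge0 w')) ev.
have a0 := disc_scale_gt0 (vw_ge0 w).
have [e1 e2 _ _] := zpt_inj e.
have ww : w = w'.
  move: e1 e2; rewrite /disc_re /disc_im /= -ev => /(mulIf (lt0r_neq0 a0)) e1 /(mulIf (lt0r_neq0 a0)) e2.
  by rewrite [w]surjective_pairing [w']surjective_pairing e1 e2.
split=> //; rewrite -ww in e; have [_ _ e3 e4] := zpt_inj e.
have [e5 e6] := @coef_solve (x, w) _ _ _ _ e3 e4.
by rewrite -[x]hsubmxK -[x']hsubmxK e5 e6.
Qed.

Lemma derive_vw (f : R^o -> R^o) (x u : E) (w eta : R^o * R^o) : smooth_at (vw w : R^o) f ->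
  is_derive ((x, w) : Q3) (u, eta) (fun q : Q3 => f (vw q.2) : R^o)
   ('D_1 f (vw w : R^o) * (2 * (w.1 * eta.1 + w.2 * eta.2))).
Proof.
move=> sf; apply: (@is_derive_comp1 _ _ (fun q : Q3 => vw q.2 : R^o) f);
  last exact: smooth_at_is_derive.
by der_eq; ring.
Qed.

Lemma is_derive_disc_re (x u : E) (w eta : R^o * R^o) :
  is_derive ((x, w) : Q3) (u, eta) disc_re (w.1 * ('D_1 disc_scale (vw w : R^o) *
    (2 * (w.1 * eta.1 + w.2 * eta.2))) + disc_scale (vw w) * eta.1).
Proof.
have h := derive_vw x u eta (smooth_at_disc_scale (vw_ge0 w)).
by rewrite /disc_re; der_eq.
Qed.

Lemma is_derive_disc_im (x u : E) (w eta : R^o * R^o) :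
  is_derive ((x, w) : Q3) (u, eta) disc_im (w.2 * ('D_1 disc_scale (vw w : R^o) *
    (2 * (w.1 * eta.1 + w.2 * eta.2))) + disc_scale (vw w) * eta.2).
Proof.
have h := derive_vw x u eta (smooth_at_disc_scale (vw_ge0 w)).
by rewrite /disc_im; der_eq.
Qed.

Lemma ustilovsky_Q_immersion (x u : E) (w eta : R^o * R^o) :
  'D_((u, eta) : Q3) ustilovsky_Q ((x, w) : Q3) = 0 -> u = 0 /\ eta = 0.
Proof.
have [_ ->] := is_derive_ustilovsky_Q ((x, w) : Q3) (u, eta).
move=> /zpt_eq0[]; set e : Q3 := (u, eta); set q : Q3 := (x, w) => e1 e2 e3 e4.
have v0 := vw_ge0 w; have a0 := disc_scale_gt0 v0.
have [_ d1] := is_derive_disc_re x u w eta; have [_ d2] := is_derive_disc_im x u w eta.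
have c0 : 2 * (w.1 * eta.1 + w.2 * eta.2) = 0.
  have [v1|v1] := ltP 0 (vw w); last first.
    have : vw w = 0 by apply/eqP; rewrite eq_le v1.
    move/eqP; rewrite paddr_eq0 ?sqr_ge0 // !sqrf_eq0 => /andP[/eqP w1 /eqP w2].
    by rewrite w1 w2 !mul0r addr0 mulr0.
  have h1 := smooth_at_is_derive e (smooth_at_disc_re q).
  have h2 := smooth_at_is_derive e (smooth_at_disc_im q).
  rewrite e1 in h1; rewrite e2 in h2.
  have h3 : is_derive q e (fun q : Q3 => disc_re q ^+ 2 + disc_im q ^+ 2 : R^o) 0.
    by der_eq; ring.
  have := derive_vw x u eta (smooth_at_disc_rho v0) => -[_].
  under eq_fun => y do rewrite -disc_modulus.
  have [_ ->] := h3; move=> /esym/eqP; rewrite mulf_eq0 (negbTE (derive_disc_rho_neq0 v1)) /=.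
  by move/eqP.
rewrite c0 !mulr0 add0r in d1; rewrite c0 !mulr0 add0r in d2.
have eta0 : eta = 0.
  have := e1; rewrite d1 => /eqP; rewrite mulf_eq0 (gt_eqF a0) /= => /eqP t1.
  have := e2; rewrite d2 => /eqP; rewrite mulf_eq0 (gt_eqF a0) /= => /eqP t2.
  by rewrite [eta]surjective_pairing t1 t2.
split=> //; have [_ dz] := derive_coef q e.
have dS : 'D_e disc_axis2 q = 0.
  by have [_ ->] := derive_vw x u eta (smooth_at_disc_axis v0); rewrite c0 mulr0.
have [z1 z2 z3] := dz e1 e2 dS.
rewrite z1 z2 !scale0r !add0r in e3; rewrite z2 z3 !scale0r !add0r in e4.
have [||f1 f2] := @coef_solve q (r u) (l u) 0 0.
- by rewrite e3 !scaler0 addr0.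
- by rewrite e4 !scaler0 addr0.
by rewrite -[u]hsubmxK f1 f2 row_mx0.
Qed.

Lemma ustilovsky_Q_form (x u : E) (w eta : R^o * R^o) : bdtangent d.+1 DT x u ->
  (disc_mu (vw w))^-1 * brieskorn_form (brieskorn_exponent p) (ustilovsky_Q (x, w))
    ('D_((u, eta) : Q3) ustilovsky_Q ((x, w) : Q3)) =
  canonical_form x u + disc_profile (vw w) * polar_dt (p%:R * pi / 2 * K) w eta.
Proof.
move=> /(bdtangent_disc_cotangent en)[bx t1 t2 t3]; move: bx.
rewrite (boundary_disc_cotangent en) => -[qq qx xx].
have [_ ->] := is_derive_ustilovsky_Q ((x, w) : Q3) (u, eta).
rewrite /ustilovsky_Q brieskorn_form_zpt; set e : Q3 := (u, eta); set q : Q3 := (x, w).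
have [dz _] := derive_coef q e; move: dz => /=.
have [_ d1] := is_derive_disc_re x u w eta; have [_ d2] := is_derive_disc_im x u w eta.
have [ce _ _ _] := coef_rel q.
have cr : disc_re q * 'D_e disc_im q - disc_im q * 'D_e disc_re q =
    disc_scale (vw w) ^+ 2 * (w.1 * eta.2 - w.2 * eta.1).
  rewrite d1 d2 /disc_re /disc_im /=; ring.
rewrite cr; have v0 := vw_ge0 w.
have eu : dot (l x) (r u) = - dot (r x) (l u) by rewrite (dotC (r x)); lra.
have m0 := disc_mu_gt0 v0; have s0 := disc_axis_gt0 v0; have sc := disc_scale_sqr v0.
have [_ eg _] := disc_rho_root v0; have s2 := disc_axis_sqr v0; have mp := disc_mu_profile v0.
have pE : disc_rho (vw w) ^+ p = disc_rho (vw w) * disc_rho (vw w) ^+ p.-1.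
  by rewrite -exprS prednK // odd_gt0.
rewrite /gram pE in eg.
rewrite /= -[disc_axis2 q]/(disc_axis (vw w)) !dotE (dotC (r x) (l x)) qq qx xx t1 t3 eu.
rewrite /polar_dt radius_sqr /canonical_form.
move: ce; move: (coef1 q) (coef2 q) (coef3 q) ('D_e coef1 q) ('D_e coef2 q) ('D_e coef3 q).
move=> c1 c2 c3 dc1 dc2 dc3 ce dz.
rewrite -[q.2]/w in ce.
have pi0 : pi != 0 :> R by rewrite gt_eqF // pi_gt0.
have W0 : vw w = 0 -> w.1 * eta.2 - w.2 * eta.1 = 0.
  move/eqP; rewrite paddr_eq0 ?sqr_ge0 // !sqrf_eq0 => /andP[/eqP -> /eqP ->].
  by rewrite !mul0r subrr.
move: W0 ce dz m0 s0 sc eg s2 mp.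
set m := disc_mu _; set S := disc_axis _; set w0 := disc_rho _; set E2 := disc_scale _.
set nu := disc_profile _; set y := dot (r x) (l u); set z := w0 ^+ p.-1; set v := vw w.
set W := w.1 * eta.2 - _; clearbody m S w0 E2 nu y z W.
move=> W0 ce dz m0 s0 sc eg s2 mp.
have S0 : S != 0 by rewrite gt_eqF.
have M0 : m != 0 by rewrite gt_eqF.
have dz' : c1 * dc2 + c2 * dc3 - c2 * dc1 - c3 * dc2 = p%:R / 2 * z * (E2 ^+ 2 * W) / S ^+ 2.
  by rewrite -dz mulfK // expf_neq0.
transitivity (m^-1 * (p%:R / 4 * (E2 ^+ 2 * W) +
    ((c1 * dc2 + c2 * dc3 - c2 * dc1 - c3 * dc2) + 2 * (c1 * c3 - c2 ^+ 2) * y) / 2)).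
  by congr (_ * _); ring.
rewrite ce dz'.
have zS : w0 * z / S ^+ 2 = 1 - w0 - 2 * m.
  have S2 : S ^+ 2 != 0 by rewrite expf_neq0.
  apply: (mulIf S2); rewrite divfK // s2.
  by apply: (@eq_of_sub _ _ _ (- ((1 - w0) ^+ 2 - w0 * z - 4 * m ^+ 2))); [rewrite eg subrr oppr0|ring].
(* Since v times the squared scale is rho and rho^p / S^2 = 1 - rho - 2 mu, the sum is (p/4)(1 - 2
   mu), and 1 - 2 mu = K nu mu. *)
have key : v * (p%:R / 4 * E2 ^+ 2 + p%:R / 4 * z * E2 ^+ 2 / S ^+ 2) = p%:R / 4 * K * nu * m.
  transitivity (p%:R / 4 * (E2 ^+ 2 * v + (E2 ^+ 2 * v) * z / S ^+ 2)).
    by field.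
  rewrite sc zS; transitivity (p%:R / 4 * (K * nu * m)); last by ring.
  by rewrite mp; ring.
transitivity (y + m^-1 * (p%:R / 4 * E2 ^+ 2 + p%:R / 4 * z * E2 ^+ 2 / S ^+ 2) * W).
  by field; rewrite ?M0 ?S0.
congr (_ + _).
have [v1|v1] := eqVneq v 0.
  by rewrite (W0 v1) mul0r !mulr0.
transitivity (m^-1 * (v * (p%:R / 4 * E2 ^+ 2 + p%:R / 4 * z * E2 ^+ 2 / S ^+ 2)) * W / v).
  by field; rewrite ?M0 ?S0 ?v1.
rewrite key.
have aux (P q' k n mm WW vv : R) : q' != 0 -> mm != 0 -> vv != 0 ->
  mm^-1 * (P / 4 * k * n * mm) * WW / vv = n * (P * q' / 2 * k / (2 * q') * (WW / vv)).
  by move=> q0 n0 w1; field; rewrite ?q0 ?n0 ?w1.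
exact: aux.
Qed.

(** The page has [gram] at most (2 / (K + 2))^2, whereas nu < 1 inside the disc makes 4 mu^2
    strictly larger. *)
Lemma ustilovsky_disjoint (s : R) (w : R^o * R^o) : 0 <= s <= 1 -> radius w < 1 ->
  g (gram_page K s) <> disc_rho (vw w).
Proof.
move=> s01 w1 e; have v0 := vw_ge0 w.
have v1 : vw w < 1 by rewrite -radius_sqr -(expr1n R 2) ltr_pXn2r ?nnegrE ?radius_ge0.
have := disc_profile_lt v0 v1; rewrite disc_profile1 => n1.
have [|_ e1 _] := gram_root p_odd hg (t := gram_page K s).
  by have := page_gram_itv K2 hK s01; lra.
have [_ e2 _] := disc_rho_root v0.
have : gram_page K s < 4 * disc_mu (vw w) ^+ 2.
  apply: le_lt_trans (gram_page_le K2 hK (proj2 (andP s01))) _.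
  have k := K2; have k0 : 0 < K by lra.
  rewrite gram_page_large; last lra.
  rewrite sqrtr1 mulr1 expr_div_n (_ : 2 ^+ 2 = 4); last by rewrite expr2; ring.
  rewrite ltr_pM2l // /disc_mu exprVn ltf_pV2 ?posrE ?exprn_gt0 //; try by (have := disc_mu_arg v0; lra).
  rewrite ltr_pXn2r ?nnegrE //; try by (have := disc_mu_arg v0; lra).
  by rewrite addrC ltrD2r gtr_pMr.
by rewrite -e1 -e2 e ltxx.
Qed.

Lemma ustilovsky_Q_surj a b (X W : 'rV[R]_N) : brieskorn (brieskorn_exponent p) (zpt a b X W) ->
  gram_page K 1 < gram p (a ^+ 2 + b ^+ 2) ->
  exists x w, [/\ binding_point x, radius w < 1 & zpt a b X W = ustilovsky_Q (x, w)].
Proof.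
move=> My g1; have [/andP[r0 r1] /andP[g0 g2]] := brieskorn_gram My.
move/brieskorn_zpt: My => [e1 e2 e3].
have k := K2; have k0 : 0 < K by lra.
set rho := a ^+ 2 + b ^+ 2 in g1 r0 r1 g0 g2 e3.
pose t := Num.sqrt (gram p rho).
have t2 : t ^+ 2 = gram p rho by rewrite sqr_sqrtr.
have gp : gram_page K 1 = (2 / (K + 2)) ^+ 2.
  by rewrite gram_page_large ?sqrtr1 ?mulr1 //; lra.
have tl : 2 / (K + 2) < t.
  rewrite -(@ltr_pXn2r _ 2) ?nnegrE ?sqrtr_ge0 ?divr_ge0 //; last lra.
  by rewrite -gp t2.
have tu : t <= 1 by rewrite -(@ler_pXn2r _ 2) ?nnegrE ?sqrtr_ge0 // t2 expr1n.
have t0 : 0 < t by apply: lt_trans tl; rewrite divr_gt0 //; lra.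
(* Solves 2 / (2 + K nu) = t, that is 2 mu = t; the strict lower bound on t gives nu < 1. *)
pose nu := (2 / t - 2) / K.
have nu01 : 0 <= nu < 1.
  rewrite divr_ge0 ?(ltW k0) ?subr_ge0 ?ler_pdivlMr //=; last lra.
  rewrite ltr_pdivrMr // mul1r ltrBlDr ltr_pdivrMr //.
  by move: tl; rewrite ltr_pdivrMr; lra.
have [v /andP[v0 v1] ev] := disc_profile_surj nu01.
have mE : 2 * disc_mu v = t.
  have tn : t != 0 by rewrite gt_eqF.
  have kn : K != 0 by rewrite gt_eqF.
  rewrite /disc_mu ev /nu [K * _]mulrC divfK // addrC subrK invf_div.
  by rewrite mulrC divfK.
have rE : disc_rho v = rho.
  rewrite /disc_rho (_ : 4 * _ = gram p rho); first by have [|-> _ //] := hg (rho := rho); lra.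
  by rewrite -t2 -mE; ring.
have a0 := disc_scale_gt0 v0; have sc := disc_scale_sqr v0; rewrite rE in sc.
pose w : R^o * R^o := (a / disc_scale v, b / disc_scale v).
have vE : vw w = v.
  by rewrite /w /= !expr_div_n -mulrDl -/rho -sc [_ * v]mulrC mulfK // expf_neq0 // gt_eqF.
have wa : w.1 * disc_scale v = a by rewrite /w /= divfK // gt_eqF.
have wb : w.2 * disc_scale v = b by rewrite /w /= divfK // gt_eqF.
have w1 : radius w < 1.
  by rewrite -(@ltr_pXn2r _ 2) ?nnegrE ?radius_ge0 // radius_sqr vE expr1n.
clearbody w.
(* The coefficients depend on w alone, so they are evaluated at (0, w) before x is known. *)
have [ce f1 f2 f3] := coef_rel ((0, w) : Q3).
have ra : disc_re ((0, w) : Q3) = a by rewrite /disc_re /= vE.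
have rb : disc_im ((0, w) : Q3) = b by rewrite /disc_im /= vE.
have c1E (y : E) : coef1 ((y, w) : Q3) = coef1 ((0, w) : Q3) by [].
have c2E (y : E) : coef2 ((y, w) : Q3) = coef2 ((0, w) : Q3) by [].
have c3E (y : E) : coef3 ((y, w) : Q3) = coef3 ((0, w) : Q3) by [].
have QE (y : E) : ustilovsky_Q (y, w) = zpt a b
    (coef1 ((0, w) : Q3) *: r y + coef2 ((0, w) : Q3) *: l y)
    (coef2 ((0, w) : Q3) *: r y + coef3 ((0, w) : Q3) *: l y).
  by rewrite -ra -rb.
move: f1 f2 f3; rewrite /disc_pow_re /disc_pow_im ra rb /= vE rE => f1 f2 f3.
rewrite /= vE in ce; have m0 := disc_mu_gt0 v0.
move: ce f1 f2 f3 QE {c1E c2E c3E}.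
move: (coef1 _) (coef2 _) (coef3 _) => c1 c2 c3 ce f1 f2 f3 QE.
have XX : dot X X = c1 ^+ 2 + c2 ^+ 2 by rewrite f1; lra.
have WW : dot W W = c2 ^+ 2 + c3 ^+ 2 by rewrite f2; lra.
have XW : dot X W = c2 * (c1 + c3) by rewrite f3; lra.
set m := disc_mu v in ce m0 *; have m1 : m != 0 by rewrite gt_eqF.
have mi : m^-1 * m^-1 * (c1 * c3 - c2 ^+ 2) ^+ 2 = 1 by rewrite ce; field.
(* The inverse of the coefficient matrix, of determinant m, applied to (X, W). *)
have [x lx rx] : exists2 x : E, l x = m^-1 *: (c1 *: W + (- c2) *: X) &
    r x = m^-1 *: (c3 *: X + (- c2) *: W).
  by exists (row_mx (m^-1 *: (c1 *: W + (- c2) *: X)) (m^-1 *: (c3 *: X + (- c2) *: W)));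
    rewrite ?row_mxKl ?row_mxKr.
exists x, w; split=> //; last first.
  rewrite QE lx rx -ce; congr zpt; apply/rowP => i; rewrite !mxE; field;
    by rewrite ce.
split.
- rewrite lx !dotE (dotC W X) XX WW XW -[RHS]mi; ring.
- rewrite lx rx !dotE (dotC W X) XX WW XW; ring.
- rewrite rx !dotE (dotC W X) XX WW XW -[RHS]mi; ring.
Qed.

(** On the collar the frame turns by the full alpha. With zeta = xi + iq of the binding point and e
    = |xi| on the collar, the scaled real and imaginary parts of e^(-i alpha) zeta, multiplied by
    e^(i alpha), become (ae + b)/2 zeta + (ae - b)/2 e^(2 i alpha) conj(zeta). The second
    coefficient is -z_0^p / (2S), an expression that extends over z_0 = 0. *)
Lemma ustilovsky_glue (x : E) (y : R) (t : R) : binding_point x -> 1 <= y < 5 / 4 ->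
  ustilovsky_Q (x, polar (page_h p K x) y t) =
  ustilovsky_P p K g (t, disc_cotangent_collar (1 - y, x)).
Proof.
move=> [qq qx xx] /andP[y1 y2]; have k := K2; have k0 : 0 < K by lra.
have hx : page_h p K x = p%:R * pi / 2 * K.
  by rewrite /page_h xx /height height_drop_eq0r ?subr0 //; lra.
have E0 := expR_gt0 (1 - y); have E1 := expR_gt0 (y - 1).
have ee : expR (y - 1) * expR (1 - y) = 1 :> R by rewrite -expRD addrC subrKA subrr expR0.
set e := expR (1 - y) in E0 ee *.
have e1 : e <= 1 by rewrite /e -[X in _ <= X](@expR0 R) ler_expR; lra.
(* The overlap of width 1/4 keeps |xi| above 1/2, where all cutoffs equal 1. *)
have e34 : 3 / 4 < e by have := expR_ge1Dx (1 - y); rewrite -/e; lra.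
have einv : e^-1 = expR (y - 1) by apply: (mulIf (lt0r_neq0 E0)); rewrite mulVf ?gt_eqF.
pose z : E := disc_cotangent_collar (1 - y, x).
have lz : l z = l x by rewrite /z row_mxKl.
have rz : r z = e *: r x by rewrite /z row_mxKr.
have sz : sq z = e ^+ 2 by rewrite rz dotZl dotZr xx mulr1 -expr2.
have Vz : DT z.
  by split; rewrite ?sz ?lz ?rz ?dotZr ?qx ?mulr0 // expr_le1 // ltW.
rewrite -/z; clearbody z.
have s01 := disc_sq01 Vz; rewrite sz in s01.
have s14 : 1 / 4 < e ^+ 2 by rewrite expr2; nra.
have sqE : Num.sqrt (e ^+ 2) = e by rewrite sqrtr_sqr ger0_norm // ltW.
have hz : height K (e ^+ 2) = K by rewrite /height height_drop_eq0r ?subr0.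
have kz : factor_page K (e ^+ 2) = K + 2 * e by rewrite /factor_page smooth_sqrt_eq ?sqE // ltW.
have slz : slope (e ^+ 2) = 1 by rewrite slope_eq1.
have y0 : 0 <= y by lra.
set w := polar _ y t; have vE : vw w = y ^+ 2 by rewrite -radius_sqr radius_polar.
have nE := disc_profile_end y1.
have p0 : p%:R != 0 :> R by exact: p_neq0.
have mE : disc_mu (y ^+ 2) = e / (K + 2 * e).
  rewrite /disc_mu nE -einv; field; rewrite !gt_eqF //; lra.
have gE : gram_page K (e ^+ 2) = 4 * disc_mu (y ^+ 2) ^+ 2.
  rewrite gram_page_large ?sqE //; last exact: ltW.
  by rewrite mE; field; rewrite gt_eqF //; lra.
have rE : disc_rho (y ^+ 2) = g (gram_page K (e ^+ 2)) by rewrite gE.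
have v0 : 0 <= y ^+ 2 by rewrite sqr_ge0.
have sgE : y * disc_scale (y ^+ 2) = page_modulus K g (e ^+ 2).
  have a0 := disc_scale_gt0 v0; have b0 := page_modulus_gt0 p_odd K2 hK hg s01.
  apply/eqP; rewrite -(@eqrXn2 _ 2) ?mulr_ge0 ?(ltW a0) ?(ltW b0) //; apply/eqP.
  by rewrite exprMn mulrC disc_scale_sqr // (page_modulus_sqr p_odd K2 hK hg s01).
pose al : R := 2 * t / K.
have aE : page_angle K (t, z) = al by rewrite /page_angle /= sz hz.
have bE : base_angle p K (t, z) = 2 / p%:R * al by rewrite /base_angle aE.
have tE : page_turn K (t, z) = al by rewrite /page_turn /= sz slz mul1r aE.
have pi0 : pi != 0 :> R by rewrite gt_eqF // pi_gt0.
have angE : 2 * pi * t / page_h p K x = 2 / p%:R * al.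
  have aux (q P k0' t' : R) : q != 0 -> P != 0 -> k0' != 0 ->
      2 * q * t' / (P * q / 2 * k0') = 2 / P * (2 * t' / k0').
    by move=> n1 n2 n3; field; rewrite ?n1 ?n2 ?n3.
  by rewrite hx; apply: aux => //; rewrite gt_eqF.
have w1E : w.1 = y * cos (2 / p%:R * al) by rewrite /w /polar /= angE.
have w2E : w.2 = y * sin (2 / p%:R * al) by rewrite /w /polar /= angE.
clearbody w.
have reE : disc_re ((x, w) : Q3) = page_modulus K g (e ^+ 2) * cos (2 / p%:R * al).
  by rewrite /disc_re /= vE w1E -sgE; ring.
have imE : disc_im ((x, w) : Q3) = page_modulus K g (e ^+ 2) * sin (2 / p%:R * al).
  by rewrite /disc_im /= vE w2E -sgE; ring.
have pal : p%:R * (2 / p%:R * al) = al + al by field.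
have zp : zpow p (disc_re ((x, w) : Q3)) (disc_im ((x, w) : Q3)) =
   (page_modulus K g (e ^+ 2) ^+ p * cos (al + al), page_modulus K g (e ^+ 2) ^+ p * sin (al + al)).
  by rewrite reE imE zpow_polar pal.
have a0 := page_re_scale_gt0 p_odd K2 hK hg s01.
have b0 := page_im_scale_gt0 p_odd K2 hK hg s01.
have a2 := page_re_scale_sqr p_odd K2 hK hg s01.
have b2 := page_im_scale_sqr p_odd K2 hK hg s01.
have ab := page_scale_mul p_odd K2 hK hg s01.
have axE : disc_axis2 ((x, w) : Q3) = page_re_scale p K g (e ^+ 2) * e + page_im_scale p K g (e ^+ 2).
  have s0 := disc_axis_gt0 v0; have s2 := disc_axis_sqr v0.
  rewrite /disc_axis2 /= vE.
  apply/eqP; rewrite -(@eqrXn2 _ 2) ?(ltW s0) ?addr_ge0 ?mulr_ge0 ?(ltW a0) ?(ltW b0) ?(ltW E0) //.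
  apply/eqP; rewrite s2 rE mE sqrrD exprMn a2 b2 -mulr_natl.
  rewrite (_ : page_re_scale p K g (e ^+ 2) * e * _ = (factor_page K (e ^+ 2))^-1 * e).
    by rewrite kz; field; rewrite gt_eqF //; lra.
  by rewrite -ab; ring.
have cs := cos2Dsin2 al.
rewrite /ustilovsky_Q /ustilovsky_P /page_re /page_im /= bE aE reE imE.
have tqE : turn_q K (t, z) = cos al *: l x + (- sin al) *: r x.
  rewrite /turn_q /turn_cos /turn_sinc tE /= sz sqE lz rz scalerA mulNr divfK //.
  by rewrite gt_eqF.
have txE : turn_xi K (t, z) = (e * cos al) *: r x + (e * sin al) *: l x.
  rewrite /turn_xi /turn_cos /turn_sinc tE /= sz sqE lz rz scalerA [cos al * e]mulrC.
  by congr (_ + _ *: _); field; rewrite gt_eqF.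
rewrite tqE txE sz.
rewrite /coef1 /coef2 /coef3 /disc_pow_re /disc_pow_im zp /= axE cosD sinD.
move: a0 b0 a2 b2; set A := page_re_scale _ _ _ _; set Y := page_im_scale _ _ _ _ => a0 b0 a2 b2.
set M := page_modulus _ _ _ ^+ p in a2 b2 *.
have ME : M = (Y - A * e) * (Y + A * e).
  by rewrite -subr_sqr exprMn a2 b2; field.
have nz : A * e + Y != 0 by rewrite gt_eqF // addr_gt0 // mulr_gt0.
rewrite ME; move: cs; set c := cos al; set b := sin al => cs.
congr zpt; apply/rowP => i; rewrite !mxE; set X1 := x _ _; set X2 := x _ _.
  apply: (@eq_of_sub _ _ _ (- (c ^+ 2 + b ^+ 2 - 1) * ((A * e + Y) / 2) * X1)).
    by rewrite cs subrr oppr0 !mul0r.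
  by field; rewrite nz.
apply: (@eq_of_sub _ _ _ (- (c ^+ 2 + b ^+ 2 - 1) * ((A * e + Y) / 2) * X2)).
  by rewrite cs subrr oppr0 !mul0r.
by field; rewrite nz.
Qed.

End UstilovskyBinding.

(** * Assembling the Ustilovsky open book *)

Section UstilovskyOpenBook.
Context {R : realType} {N : nat}.
Local Notation E := 'rV[R]_(N + N).
Local Notation l := lsubmx.
Local Notation r := rsubmx.
Local Notation DT := (@disc_cotangent R N).
Local Notation sq x := (dot (r x) (r x)).
Local Notation vw w := (w.1 ^+ 2 + w.2 ^+ 2).
Variable p : nat.
Hypothesis p_odd : odd p.
Variable K : R.
Hypothesis K2 : 2 < K.
Hypothesis hK : forall s : R, 0 <= s <= 1 -> height_drop s < K.
Variable g : R^o -> R^o.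
Hypothesis hg : forall rho : R, -1 < rho < 1 ->
  g (gram p rho) = rho /\ smooth_at (gram p rho : R^o) g.
Variable J : R^o -> R^o.
Hypothesis hJ : forall s : R, J (gram_page K s) = s /\ smooth_at (gram_page K s : R^o) J.
Context {d : nat} (en : (N + N = 1 + 1 + d.+1)%N).

Lemma page_twist_exact : exact_monodromy d.+1 DT canonical_form (page_twist p) (page_h p K).
Proof.
split.
  apply: smooth_near_at => x _; apply: smooth_atM; first exact: smooth_at_cst.
  apply: (@smooth_at_comp1 _ _ _ (fun x : E => sq x : R^o) (height K)); last by smooth.
  exact: smooth_at_height.
move=> x v tv; have /(tangent_disc_cotangent en)[Vx _ _] := tv.
rewrite (twist_primitive _ _ _ en tv); last first.
- exact: cos_sinc_angle.
- exact: smooth_at_sinc_angle.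
- exact: smooth_at_cos_angle.
have hd : is_derive x v (fun x : E => height K (sq x) : R^o)
    ('D_1 (height K) (sq x : R^o) * (2 * dot (r x) (r v))).
  apply: (@is_derive_comp1 _ _ (fun x : E => sq x : R^o) (height K)).
    by der_eq; rewrite (dotC (r v)); ring.
  exact: smooth_at_is_derive (smooth_at_height K (sq x)).
have [_ ->] : is_derive x v (page_h p K : E -> R^o)
    (p%:R * pi / 2 * ('D_1 (height K) (sq x : R^o) * (2 * dot (r x) (r v)))).
  by rewrite /page_h; der_eq; rewrite mulr0 addr0.
have [s0|s0] := ltP 0 (sq x); last first.
  have /eqP : sq x = 0 by apply/eqP; rewrite eq_le s0 dot_ge0.
  by rewrite dot_eq0 => /eqP ->; rewrite !dot0l !mulr0.
rewrite cos_sinc_primitive //; have [_ ->] := @is_derive_angle R p (sq x).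
have dh := is_derive_height_drop s0.
have [_ ->] : is_derive (sq x : R^o) 1 (height K) (- (2 * Num.sqrt (sq x) * 'D_1 slope (sq x : R^o))).
  by rewrite /height; der_eq; ring.
by field.
Qed.

Definition ustilovsky_factor (y : Cspace R (1 + N)) : R := factor K J (gram p (modulus0 y)).

Lemma ustilovsky_factor_itv (y : Cspace R (1 + N)) : brieskorn (brieskorn_exponent p) y ->
  0 <= gram p (modulus0 y) <= 1.
Proof. by rewrite (zpt_surj y) modulus0_zpt => /brieskorn_gram[]. Qed.

Lemma ustilovsky_factor_P q : DT q.2 ->
  ustilovsky_factor (ustilovsky_P p K g q) = factor_page K (sq q.2).
Proof.
move=> Vq; have s01 := disc_sq01 Vq.
rewrite /ustilovsky_factor (ustilovsky_P_modulus p_odd K2 hK hg Vq).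
have gi := page_gram_itv K2 hK s01.
have [|_ -> _] := gram_root p_odd hg (t := gram_page K (sq q.2)); first lra.
exact: (factor_pageE K2 hK hJ).
Qed.

(** The profile at radius 5/4 is exp(1/4), and exp(-1/4) >= 3/4. *)
Lemma disc_profile_le (w : R^o * R^o) : Defs.radius w < 1 + 1 / 4 -> disc_profile (vw w) <= 4 / 3.
Proof.
move=> w1; have v1 : vw w < (5 / 4) ^+ 2.
  rewrite -radius_sqr ltr_pXn2r ?nnegrE ?radius_ge0 //; lra.
have /ltW := disc_profile_lt (vw_ge0 w) v1; move=> /le_trans; apply.
rewrite disc_profile_end; last lra.
have e := expR_ge1Dx (1 - 5 / 4 : R).
have ee : expR (5 / 4 - 1) * expR (1 - 5 / 4) = 1 :> R by rewrite -expRD addrC subrKA subrr expR0.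
have E1 := expR_gt0 (5 / 4 - 1 : R); nra.
Qed.

Lemma ustilovsky_factor_Q x w : Defs.radius w < 1 + 1 / 4 ->
  ustilovsky_factor (ustilovsky_Q p K g (x, w)) =
  binding_factor (disc_profile (vw w)) * (disc_mu K (vw w))^-1.
Proof.
move=> w1; have v0 := vw_ge0 w.
rewrite /ustilovsky_factor (ustilovsky_Q_modulus p_odd K2 hg).
have [_ -> _] := disc_rho_root p_odd K2 hg v0.
rewrite /disc_mu invrK exprVn factorE //.
by rewrite disc_profile_ge0 // disc_profile_le.
Qed.

Lemma page_h_boundary (x : E) : sq x = 1 -> page_h p K x = p%:R * pi / 2 * K.
Proof. by move=> xx; rewrite /page_h xx /height height_drop_eq0r ?subr0 //; lra. Qed.

Lemma ustilovsky_open_book : open_book_form d.+1 (brieskorn (brieskorn_exponent p))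
  (fun y v => ustilovsky_factor y * brieskorn_form (brieskorn_exponent p) y v)
  DT canonical_form (page_twist p) (page_h p K) (@disc_cotangent_collar R N)
  (ustilovsky_P p K g) (ustilovsky_Q p K g) (1 / 4) binding_h1 binding_h2.
Proof.
have bE := boundary_disc_cotangent en.
split.
- by lra.
- by move=> x _; exact: page_h_gt0.
- by apply: smooth_near_at => q Vq; exact: smooth_at_ustilovsky_P.
- by move=> t x s u; exact: (ustilovsky_P_immersion p_odd K2 hK hg en).
- by move=> q q'; exact: (ustilovsky_P_fibres p_odd K2 hK hg).
- move=> t x s u tu; have /(tangent_disc_cotangent en)[Vx _ _] := tu.
  by rewrite ustilovsky_factor_P //; exact: (ustilovsky_P_form p_odd K2 hK hg en).
- by apply: smooth_near_at => q _; exact: smooth_at_ustilovsky_Q.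
- by move=> x w u eta _ _; exact: (ustilovsky_Q_immersion p_odd K2 hg).
- by move=> x x' w w' _ _ _ _; exact: (ustilovsky_Q_inj p_odd K2 hg).
- move=> x w u eta w1 tu; have /(bdtangent_disc_cotangent en)[bx _ _ _] := tu.
  rewrite bE in bx; have [_ _ xx] := bx.
  rewrite ustilovsky_factor_Q // -mulrA (ustilovsky_Q_form p_odd K2 hg en) //.
  by rewrite (page_h_boundary xx) /binding_h2 /binding_h1 radius_sqr; ring.
- exact: binding_h_smooth.
- exact: binding_h_near0.
- by move=> s /andP[s1 _]; exact: binding_h_match.
- move=> x s t; rewrite bE => bx s1; apply: (ustilovsky_glue p_odd K2 hK hg) => //.
  by lra.
- move=> q x w Vq _ w1 e; have := congr1 modulus0 e.
  rewrite (ustilovsky_P_modulus p_odd K2 hK hg Vq) (ustilovsky_Q_modulus p_odd K2 hg).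
  exact: (ustilovsky_disjoint p_odd K2 hK hg (disc_sq01 Vq) w1).
- move=> y; split; last first.
    case=> [[q Vq ->]|[x [w [bx _ ->]]]]; first exact: (ustilovsky_P_brieskorn p_odd K2 hK hg).
    by apply: (ustilovsky_Q_brieskorn p_odd K2 hg); rewrite bE in bx.
  rewrite (zpt_surj y) => My.
  have [h|h] := leP (gram p (l y.1 ord0 ord0 ^+ 2 + l y.2 ord0 ord0 ^+ 2)) (gram_page K 1).
    by left; exact: (ustilovsky_P_surj p_odd K2 hK hg My h).
  right; have [x [w [bx w1 e]]] := ustilovsky_Q_surj p_odd K2 hg My h.
  by exists x, w; rewrite bE.
Qed.

Lemma ustilovsky_factor_smooth :
  smooth_near (brieskorn (brieskorn_exponent p)) (ustilovsky_factor : Cspace R (1 + N) -> R^o).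
Proof.
apply: smooth_near_at => y /ustilovsky_factor_itv t01.
apply: (@smooth_at_comp1 _ _ _ (fun y => gram p (modulus0 y) : R^o) (factor K J)).
  exact: (smooth_at_factor K2 hK hJ).
apply: (@smooth_at_comp1 _ _ _ modulus0 (gram p)); first exact: smooth_at_gram.
exact: smooth_at_modulus0.
Qed.

End UstilovskyOpenBook.

(** * The supporting open books and the embedding *)

Section SupportingOpenBooks.
Context {R : realType} {N d : nat}.
Variable p : nat.

Lemma ustilovsky_supporting_open_book : odd p -> (N + N = 1 + 1 + d.+1)%N ->
  supporting_open_book d.+1 (brieskorn (@brieskorn_exponent N p))
    (@brieskorn_form R (1 + N) (brieskorn_exponent p)) (@disc_cotangent R N) canonical_form
    (page_twist p).
Proof.
move=> p_odd en; have sp := @page_twist_symplectomorphism R N p d en.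
have idb := @page_twist_id_near_boundary R N p d en.
split; [exact: disc_cotangent_exact|exact: sp|exact: idb|].
have [K K2 hK] := @height_drop_bounded R; have [g hg] := @gram_inverse R p p_odd.
have [J hJ] := gram_page_inverse K2 hK.
exists (page_twist p), (page_h p K), (@disc_cotangent_collar R N); split.
- by split=> //; exact: constant_isotopy.
- exact: page_twist_exact.
- exact: disc_cotangent_is_collar.
exists (ustilovsky_factor p K J); split.
- exact: ustilovsky_factor_smooth.
- by move=> y My; apply: (factor_gt0 K2 hK hJ); exact: ustilovsky_factor_itv.
exists (ustilovsky_P p K g), (ustilovsky_Q p K g), (1 / 4), binding_h1, binding_h2.
exact: ustilovsky_open_book.
Qed.

Lemma sphere_supporting_open_book : (N + N = 0 + d.+2)%N ->
  supporting_open_book d.+2 (@unit_sphere R (1 + N)) (@std_form R (1 + N))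
    (@ball2 R N) radial_form (ball_twist p).
Proof.
move=> en; have sp := @ball_twist_symplectomorphism R N p d en 1.
split; [exact: ball2_exact|exact: sp|exact: ball_twist_id_near_boundary|].
by apply: sphere_supports => //; exact: ball_twist_isotopy.
Qed.

End SupportingOpenBooks.

Theorem mainTheorem5 (R : realType) (m p : nat)
    (hm : (2 <= m)%N) (hp : (0 < p)%N)
    (hp8 : (p = 1 %[mod 8])%N \/ (p = 7 %[mod 8])%N) :
  contact_open_book_embeds
    (4 * m)%N (@ustilovsky_sphere R m p) (@ustilovsky_form R m p)
    (4 * m + 2)%N (@unit_sphere R (2 * m + 2)) (@std_form R (2 * m + 2)).
Proof.
have p_odd : odd p by rewrite (divn_eq p 8) oddD oddM andbF; case: hp8 => ->.
have eN : (2 * m + 2 = 1 + (2 * m + 1))%N by rewrite addnCA.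
have [d ed] : exists d, (4 * m = d.+1)%N.
  by exists (4 * m).-1; rewrite prednK // muln_gt0 (ltn_trans _ hm).
have e1 : ((2 * m + 1) + (2 * m + 1) = 1 + 1 + d.+1)%N by rewrite -ed; ring.
rewrite /ustilovsky_sphere /ustilovsky_form /ustilovsky_exponent.
(* The number of complex coordinates is generalised before it is rewritten, since the types of the
   manifolds and forms depend on it. *)
rewrite [(4 * m + 2)%N]addn2 ed; move: (2 * m + 2)%N eN => k ->.
have e2 : ((2 * m + 1) + (2 * m + 1) = 0 + d.+3)%N by rewrite e1.
exists (2 * m + 1 + (2 * m + 1))%N, (2 * m + 1 + (2 * m + 1))%N,
  (@disc_cotangent R (2 * m + 1)), canonical_form, (page_twist p),
  (@ball2 R (2 * m + 1)), radial_form, (ball_twist p), (page_embedding quarter_root).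
split.
- exact: ustilovsky_supporting_open_book.
- exact: sphere_supporting_open_book.
- exact: page_embedding_proper.
- by move=> x; exact: page_embedding_twist.
Qed.
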